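(* Let $\Delta\subseteq\mathbb{R}^2$ be a two-dimensional lattice polygon and assume that $N_\Delta\ge4$, or equivalently that $\Delta\not\cong\Sigma$. Then $$ b_{N_\Delta-4}=(N_\Delta-4)\cdot B_\Delta\quad\text{where}\quad B_\Delta=\begin{cases}0&\text{if }\dim\Delta^{(1)}=2\text{ and }\Delta\not\cong\Upsilon_2,\\1&\text{if }\dim\Delta^{(1)}=1\text{ or }\Delta\cong\Upsilon_2,\\(N_\Delta-1)/2&\text{if }\dim\Delta^{(1)}=0,\\N_\Delta-2&\text{if }\Delta^{(1)}=\emptyset,\end{cases}$$ and $$ c_3=(N_\Delta-4)\left((N_\Delta-3)\,\mathrm{vol}(\Delta)-\frac{(N_\Delta-1)(N_\Delta-2)}{2}+B_\Delta\right).$$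
   Context: Let $k$ be a field of characteristic $0$. A lattice polygon is the convex hull in $\mathbb{R}^2$ of finitely many points of $\mathbb{Z}^2$; $\mathrm{vol}(\Delta)$ is its Euclidean area, $\Delta^{(1)}$ the convex hull of the lattice points in the interior of $\Delta$, and $N_\Delta=|\Delta\cap\mathbb{Z}^2|$. $\Delta\cong\Delta'$ means that one polygon is the image of the other under a map $(x,y)\mapsto(x,y)A+(a,b)$ with $A\in\mathrm{GL}_2(\mathbb{Z})$, $a,b\in\mathbb{Z}$. Set $\Sigma=\mathrm{conv}\{(0,0),(1,0),(0,1)\}$ and $\Upsilon_2=\mathrm{conv}\{(-1,-1),(2,0),(0,2)\}$. Let $S_\Delta=k[X_{i,j}\mid (i,j)\in\Delta\cap\mathbb{Z}^2]$, so that $\mathbb{P}^{N_\Delta-1}=\mathrm{Proj}\, S_\Delta$. The toric surface $X_\Delta\subseteq\mathbb{P}^{N_\Delta-1}$ is the Zariski closure of the image of $(k^* )^2\to\mathbb{P}^{N_\Delta-1}:(a,b)\mapsto(a^ib^j)_{(i,j)\in\Delta\cap\mathbb{Z}^2}$, and $I_\Delta\subseteq S_\Delta$ is its homogeneous ideal. The graded Betti numbers $\beta_{p,q}$ are the exponents in a minimal graded free resolution $\cdots\to\bigoplus_{q}S_\Delta(-q)^{\beta_{1,q}}\to\bigoplus_q S_\Delta(-q)^{\beta_{0,q}}\to S_\Delta/I_\Delta\to0$ of $S_\Delta/I_\Delta$ as a graded $S_\Delta$-module. For $1\le\ell\le N_\Delta-3$ one writes $b_\ell=\beta_{\ell,\ell+1}$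 and $c_\ell=\beta_{N_\Delta-2-\ell,\,N_\Delta-\ell}$; $b_\ell$ and $c_\ell$ are understood to be $0$ for $\ell$ outside this range. *)

(* Defs.v *)
From HB Require Import structures.
From mathcomp Require Export all_boot all_order all_algebra finmap.
From mathcomp Require Export all_classical all_reals all_analysis.
(* The notations of mpoly clash with those of mathcomp-analysis. *)
From mathcomp Require Export -(notations) mpoly.
Export numFieldNormedType.Exports.

Set Implicit Arguments.
Unset Strict Implicit.
Unset Printing Implicit Defensive.

Import Order.TTheory GRing.Theory Num.Theory.

Local Open Scope classical_set_scope.
Local Open Scope ring_scope.

Section Polygons.
Variable R : realType.
Implicit Types (A D : set (R * R)) (p : int * int) (V : seq (int * int)).

Definition convex_hull A : set (R * R) :=
  smallest (@convex_set R (R^o * R^o)%type) A.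

(* [affine_dim A d] : the affine hull of the nonempty set [A] is [x + U], with
   [U] a linear subspace of dimension [d].  It never holds for [set0]. *)
Definition affine_dim A (d : nat) : Prop :=
  exists (x : R^o * R^o) (U : {vspace R^o * R^o}),
    [/\ A x, forall y, A y -> (y : R^o * R^o) - x \in U,
        forall W : {vspace R^o * R^o},
          (forall y, A y -> (y : R^o * R^o) - x \in W) -> (U <= W)%VS
      & \dim U = d].

Definition real_pt p : R * R := (p.1%:~R, p.2%:~R).

Definition lattice_hull V : set (R * R) := convex_hull (real_pt @` [set` V]).

Definition lattice_polygon D : Prop := exists V, D = lattice_hull V.

Definition lattice_points D : set (int * int) := [set p | D (real_pt p)].

(* The lattice points of a (bounded) polygon, in an arbitrary fixed order. *)
Definition lattice_seq D : seq (int * int) :=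
  enum_fset (fset_set (lattice_points D)).

Definition nb_points D : nat := size (lattice_seq D).

Definition area D : R :=
  fine ((@lebesgue_measure R \x @lebesgue_measure R)%E D).

Definition interior_hull D : set (R * R) :=
  convex_hull (real_pt @` lattice_points D^°).

(* The map (x, y) |-> (x, y) A + (a, b), on row vectors. *)
Definition affine_map (A : 'M[int]_2) (t : int * int) (z : R * R) : R * R :=
  (z.1 * (A 0 0)%:~R + z.2 * (A 1 0)%:~R + t.1%:~R,
   z.1 * (A 0 1)%:~R + z.2 * (A 1 1)%:~R + t.2%:~R).

Definition polygon_equiv D D' : Prop :=
  exists (A : 'M[int]_2) (t : int * int),
    A \in unitmx /\ D' = affine_map A t @` D.

Definition Sigma : set (R * R) := lattice_hull [:: (0, 0); (1, 0); (0, 1)].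

Definition Upsilon2 : set (R * R) :=
  lattice_hull [:: (-1, -1); (2, 0); (0, 2)].

(* The last case is that of an empty [interior_hull D]. *)
Definition Bconst D : R :=
  let N : R := (nb_points D)%:R in
  if `[< affine_dim (interior_hull D) 2 /\ ~ polygon_equiv D Upsilon2 >] then 0
  else if `[< affine_dim (interior_hull D) 1 \/ polygon_equiv D Upsilon2 >]
  then 1
  else if `[< affine_dim (interior_hull D) 0 >] then (N - 1) / 2
  else N - 2.

End Polygons.

Arguments Sigma R : clear implicits.
Arguments Upsilon2 R : clear implicits.

Section ProjectiveSets.
Variables (k : fieldType) (n : nat).

(* Subsets of the projective space P^(n-1)(k) are given by the set of the
   homogeneous coordinate vectors of their points. *)
Implicit Type Y : set ('I_n -> k).

Definition zariski_closure Y : set ('I_n -> k) :=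
  [set v | (exists i, v i != 0) /\
     forall (d : nat) (f : mpoly n k), f \is ishomog1 d mdeg ->
       (forall y, Y y -> meval y f = 0) -> meval v f = 0].

(* The ideal generated by the homogeneous polynomials vanishing on [Y]: it
   consists of the polynomials all of whose homogeneous components do. *)
Definition homog_ideal Y : set (mpoly n k) :=
  [set f | forall (d : nat) y, Y y -> meval y (pihomog mdeg d f) = 0].

End ProjectiveSets.

Section Toric.
Variables (k : fieldType) (R : realType) (D : set (R * R)).

Definition lattice_pt (i : 'I_(nb_points D)) : int * int :=
  tnth (in_tuple (lattice_seq D)) i.

Definition torus_image : set ('I_(nb_points D) -> k) :=
  [set v | exists a b c : k, [/\ a != 0, b != 0, c != 0 &
     forall i, v i = c * (a ^ (lattice_pt i).1 * b ^ (lattice_pt i).2)]].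

Definition toric_surface : set ('I_(nb_points D) -> k) :=
  zariski_closure torus_image.

Definition toric_ideal : set (mpoly (nb_points D) k) :=
  homog_ideal toric_surface.

End Toric.

Arguments toric_ideal k {R} D.

(* Minimal graded free resolutions of S/I, for an ideal I of the polynomial ring
   S in [n] variables.  The p-th module is the direct sum of the modules
   S(-[res_deg p a]), for a < [res_rank p]; its elements are row vectors, and
   [res_diff p] acts on them by right multiplication, from the module of index
   p.+1 to that of index p.  The augmentation sends the row vector v of the
   module of index 0 to the class of [v *m res_aug] modulo I. *)
Record min_graded_free_resolution (k : fieldType) (n : nat)
    (I : set (mpoly n k)) := MinGradedFreeResolution {
  res_rank : nat -> nat;
  res_deg : forall p, 'I_(res_rank p) -> int;
  res_diff : forall p, 'M[mpoly n k]_(res_rank p.+1, res_rank p);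
  res_aug : 'cV[mpoly n k]_(res_rank 0);
  res_diff_homog : forall p a b, {in msupp (res_diff p a b), forall m,
    res_deg a = res_deg b + (mdeg m)%:Z};
  res_aug_homog : forall b, {in msupp (res_aug b 0), forall m,
    res_deg b = (mdeg m)%:Z};
  res_aug_surj : forall f : mpoly n k,
    exists v : 'rV_(res_rank 0), I (f - (v *m res_aug) 0 0);
  res_aug_exact : forall v : 'rV_(res_rank 0),
    I ((v *m res_aug) 0 0) <-> exists w, v = w *m res_diff 0;
  res_exact : forall p (v : 'rV_(res_rank p.+1)),
    v *m res_diff p = 0 <-> exists w, v = w *m res_diff p.+1;
  (* the differentials vanish modulo the ideal generated by the variables *)
  res_minimal : forall p a b, mcoeff mnm0 (res_diff p a b) = 0
}.

Section Betti.
Variables (k : fieldType) (n : nat) (I : set (mpoly n k)).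
Variable F : min_graded_free_resolution I.

Definition betti (p q : nat) : nat :=
  #|[pred a : 'I_(res_rank F p) | res_deg a == q%:Z]|.

Definition betti_b (l : nat) : nat :=
  if (1 <= l <= n - 3)%N then betti l l.+1 else 0%N.

Definition betti_c (l : nat) : nat :=
  if (1 <= l <= n - 3)%N then betti (n - 2 - l) (n - l) else 0%N.

End Betti.

(* Main.v *)
(**
  Since the torus is Zariski dense, the toric ideal consists of the polynomials
  all of whose sums of coefficients over the monomials of a given degree d and
  a given weight z (a lattice point of d times the polygon) vanish.  Tensoring
  a minimal resolution with k and computing Tor from the Koszul complex instead,
  the Betti number of index (p, q) is the total dimension, over the weights z,
  of a homology group of cells (T, j), with T a set of p lattice points and j a
  lattice point of (q - p) times the polygon.  The same cells for the points
  interior to the cone give the dual groups, so that c_3 and b_(N-4) occur in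
  one strand of two interior terms; its Euler characteristic, with the Ehrhart
  counts of the polygon and of its interior, expresses c_3 in terms of
  b_(N-4).  By duality b_(N-4) is then the dimension of a space of Koszul
  relations on the interior points: the shape of the interior (plane, segment,
  point, empty) determines it, a polygon with two-dimensional interior having
  none except for the triangle Upsilon_2.
*)
From HB Require Import structures.
Require Import Defs.
From mathcomp Require Import fintype finset ring lra zify.

Set Implicit Arguments.
Unset Strict Implicit.
Unset Printing Implicit Defensive.

Import Order.TTheory GRing.Theory Num.Theory.

Local Open Scope ring_scope.

(** Both numbers live in internal degree N - 3: b_(N-4) is the entry (N-4, N-3) and c_3 the entry
    (N-5, N-3). In that degree the interior side consists of sets of N, N - 1 and N - 2 points over
    interior points of heights 3, 2 and 1, and of nothing below, which is why exactly these two
    Betti numbers are tied together. The duality is elementary: the edges whose half-plane contains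
    a given cell form one arc of the boundary cycle, so the cells in all, in two consecutive, in
    one, in some and in no half-planes are linked by three short exact sequences with acyclic middle
    terms. The same arcs give the Ehrhart polynomial together with reciprocity. Characteristic 0
    enters through the Euler homotopy, which divides by degrees, and through the density of the
    torus. The obstacle is a two-dimensional interior: the induction removes a vertex, but the
    smaller point set may lose its two-dimensional interior. Then two interior points become
    boundary points at once, and counting the points that can still occur in a syzygy decides,
    except for Upsilon_2, whose extensions by one point need an argument of their own. *)

Section LinearMaps.
Variables (k : fieldType) (U V : vectType k).
Definition lin_fun (f : U -> V) (hf : linear f) := f.
HB.instance Definition _ (f : U -> V) (hf : linear f) :=
  GRing.isLinear.Build k U V _ (lin_fun hf) hf.
Definition lin (f : U -> V) (hf : linear f) : 'Hom(U, V) := linfun (lin_fun hf).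
Lemma linE f (hf : linear f) x : lin hf x = f x.
Proof. by rewrite /lin lfunE. Qed.
End LinearMaps.

(** * Homology dimensions of complexes of subspaces *)

Section Homology.
Variable k : fieldType.

(** The complex is a sequence of subspaces of one ambient space with a single endomorphism, so that
    maps of complexes are linear maps of ambient spaces. The truncated subtraction is the dimension
    of homology whenever the boundaries lie among the cycles. *)
Definition hdim (L : vectType k) (d : 'End(L)) (X : nat -> {vspace L}) (p : nat) : nat :=
  (\dim (X p :&: lker d)%VS - \dim (d @: X p.+1)%VS)%N.

Variables (L1 L2 : vectType k) (d1 : 'End(L1)) (d2 : 'End(L2)) (f : 'Hom(L1, L2)).
Variable X : nat -> {vspace L1}.
Hypothesis fd : forall x, f (d1 x) = d2 (f x).

(** This is the connecting isomorphism of the short exact sequence formed by the kernel of [f], the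
    exact complex [X] and its image, turned into a comparison of dimensions. *)
Lemma hdim_limg_acyclic p :
  (forall p, X p :&: lker d1 = d1 @: X p.+1)%VS ->
  hdim d2 (fun q => f @: X q)%VS p.+1 = hdim d1 (fun q => X q :&: lker f)%VS p.
Proof.
move=> acX; rewrite /hdim.
(* [P] is the preimage in [X p.+1] of the cycles of the image complex; it is measured once through
   [f] and once through [d1]. *)
have [P PE] : exists P : {vspace L1},
    forall x, (x \in P) = (x \in X p.+1) && (f (d1 x) == 0).
  by exists (X p.+1 :&: lker (f \o d1))%VS => x; rewrite memv_cap memv_ker lfunE.
have fP : (f @: P = f @: X p.+1 :&: lker d2)%VS.
  apply/vspaceP => y; apply/memv_imgP/idP => [[x Px ->]|].
    move: Px; rewrite PE memv_cap memv_ker => /andP[xX /eqP fx].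
    by rewrite memv_img //= -fd fx.
  rewrite memv_cap memv_ker => /andP[/memv_imgP[x xX ->]]; rewrite -fd => fx.
  by exists x => //; rewrite PE xX.
have kP : (P :&: lker f = X p.+1 :&: lker f)%VS.
  apply/vspaceP => x; rewrite !memv_cap PE !memv_ker.
  by case: (boolP (x \in _)) => //= _; case: (f x =P 0) => [fx|]; rewrite ?andbF // fd fx linear0 eqxx.
have dP : (d1 @: P = X p :&: lker f :&: lker d1)%VS.
  apply/vspaceP => y; apply/memv_imgP/idP => [[x Px ->]|].
    move: Px; rewrite PE => /andP[xX /eqP fx].
    have: d1 x \in (X p :&: lker d1)%VS by rewrite acX memv_img.
    by rewrite !memv_cap !memv_ker fx eqxx => /andP[-> ->].
  rewrite !memv_cap !memv_ker => /andP[/andP[yX /eqP fy] dy].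
  have: y \in (X p :&: lker d1)%VS by rewrite memv_cap yX memv_ker.
  rewrite acX => /memv_imgP[x xX yE].
  by exists x => //; rewrite PE xX -yE fy eqxx.
have kdP : (P :&: lker d1 = X p.+1 :&: lker d1)%VS.
  apply/vspaceP => x; rewrite !memv_cap PE !memv_ker.
  by case: (boolP (x \in _)) => //= _; case: (d1 x =P 0) => [->|]; rewrite ?andbF // linear0 eqxx.
have dfY : (d2 @: (f @: X p.+2) = f @: (X p.+1 :&: lker d1))%VS.
  rewrite acX -!limg_comp; congr (_ @: _)%VS.
  by apply/lfunP => x; rewrite !lfunE /= fd.
rewrite dfY -fP.
have e1 := limg_ker_dim f P; rewrite kP in e1.
have e2 := limg_ker_dim d1 P; rewrite dP kdP in e2.
have e3 := limg_ker_dim f (X p.+1 :&: lker d1)%VS.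
have e4 := limg_ker_dim d1 (X p.+1 :&: lker f)%VS.
have e5 : (X p.+1 :&: lker d1 :&: lker f = X p.+1 :&: lker f :&: lker d1)%VS.
  by rewrite -!capvA [(lker d1 :&: _)%VS]capvC.
rewrite e5 in e3.
move: e1 e2 e3 e4; lia.
Qed.

Lemma hdim_limg_inj p : (forall q, X q :&: lker f = 0)%VS ->
  (forall q, d1 @: X q <= X q.-1)%VS ->
  hdim d2 (fun q => f @: X q)%VS p = hdim d1 X p.
Proof.
move=> fI dX; rewrite /hdim.
have inj_dim q Y : (Y <= X q)%VS -> \dim (f @: Y)%VS = \dim Y.
  move=> YX; apply: limg_dim_eq; apply/eqP; rewrite -subv0 -(fI q).
  by apply: capvS.
have -> : (f @: X p :&: lker d2 = f @: (X p :&: lker d1))%VS.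
  apply/vspaceP => y; apply/idP/memv_imgP.
    rewrite memv_cap memv_ker => /andP[/memv_imgP[x xX ->]]; rewrite -fd => fx.
    exists x => //; rewrite memv_cap xX memv_ker /=.
    have : d1 x \in (X p.-1 :&: lker f)%VS.
      by rewrite memv_cap memv_ker fx andbT (subvP (dX p)) ?memv_img.
    by rewrite fI memv0.
  move=> [x]; rewrite memv_cap memv_ker => /andP[xX /eqP dx] ->.
  by rewrite memv_cap memv_img // memv_ker -fd dx linear0 eqxx.
have -> : (d2 @: (f @: X p.+1) = f @: (d1 @: X p.+1))%VS.
  by rewrite -!limg_comp; congr (_ @: _)%VS; apply/lfunP => x; rewrite !lfunE /= fd.
by rewrite (inj_dim p) ?capvSl // (inj_dim p) // (dX p.+1).
Qed.
End Homology.

(** * Koszul signs *)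

Section Signs.
Variables (k : fieldType) (n : nat).
Implicit Types (s t : 'I_n) (T : {set 'I_n}).

Definition sgn t T : k := (-1) ^+ #|[set s in T | (s < t)%N]|.

Lemma sgnU t s T : s \notin T -> sgn t (s |: T) = sgn t T * (-1) ^+ (s < t)%N.
Proof.
move=> sT; rewrite /sgn; case: ltnP => st; last first.
  rewrite mulr1; congr (_ ^+ #|pred_of_set _|); apply/finset.setP => i; rewrite !inE.
  by case: eqP => [->|] //=; rewrite ltnNge st andbF.
have -> : [set i in s |: T | (i < t)%N] = s |: [set i in T | (i < t)%N].
  by apply/finset.setP => i; rewrite !inE; case: eqP => [->|] //=; rewrite st.
by rewrite cardsU1 inE (negPf sT) /= exprD mulrC.
Qed.

Lemma sgn_sqr t T : sgn t T * sgn t T = 1.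
Proof. by rewrite /sgn -expr2 sqrr_sign. Qed.

Lemma sgn_swap s t T : s != t -> s \notin T -> t \notin T ->
  sgn t T * sgn s (t |: T) = - (sgn s T * sgn t (s |: T)).
Proof.
move=> st sT tT; rewrite !sgnU //.
by have [lt_st|lt_ts|/val_inj e] := ltngtP s t; last (by rewrite e eqxx in st);
  rewrite ?mulr1 ?expr1; ring.
Qed.

(** Used wherever an insertion meets a removal, so that the mixed terms of a contracting homotopy
    cancel. *)
Lemma sgn_swap_mix s t T : s != t -> s \notin T -> t \notin T ->
  sgn t (s |: T) * sgn s (t |: T) = - (sgn s T * sgn t T).
Proof.
move=> st sT tT; rewrite -[LHS]mul1r -(sgn_sqr t T).
have -> : sgn t T * sgn t T * (sgn t (s |: T) * sgn s (t |: T)) =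
  sgn t T * sgn t (s |: T) * (sgn t T * sgn s (t |: T)) by ring.
rewrite sgn_swap // mulrN; congr (- _).
by rewrite -[RHS]mulr1 -(sgn_sqr t (s |: T)); ring.
Qed.

(** Pairs are matched with their transposes after splitting by order, which works in any abelian
    group, even with 2-torsion. *)
Lemma sum_antisym (E : zmodType) (Q : pred 'I_n) (F : 'I_n -> 'I_n -> E) :
  (forall s t, s != t -> Q s -> Q t -> F s t = - F t s) ->
  \sum_(t | Q t) \sum_(s | Q s && (s != t)) F s t = 0.
Proof.
move=> FN; rewrite pair_big_dep /= (bigID (fun p : 'I_n * 'I_n => (p.1 < p.2)%N)) /=.
rewrite [X in _ + X](reindex_inj (h := fun p : 'I_n * 'I_n => (p.2, p.1))) /=; last first.
  by move=> [a b] [c e] [-> ->].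
rewrite [X in X + _](eq_bigl (fun p : 'I_n * 'I_n => [&& Q p.1, Q p.2 & (p.1 < p.2)%N])).
  rewrite [X in _ + X](eq_bigl (fun p : 'I_n * 'I_n => [&& Q p.1, Q p.2 & (p.1 < p.2)%N])).
    rewrite -big_split big1 //= => -[a b] /= /and3P[Qa Qb ab].
    by rewrite (FN a b) ?subrr // ?addNr //; apply: contraTneq ab => ->; rewrite ltnn.
  move=> [a b] /=; case: (Q a); case: (Q b) => //=.
  rewrite -(inj_eq val_inj) /=; lia.
move=> [a b] /=; case: (Q a); case: (Q b) => //=.
by case: (ltngtP a b) => [ab|ab|e]; rewrite ?andbT ?andbF //; apply: contraTneq ab => ->; rewrite ltnn.
Qed.

End Signs.

(** * Chains of cells and acyclicity of cones *)

Section Chains.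
Variables (k : fieldType) (J : finType) (n : nat).
Local Notation cell := (J * {set 'I_n})%type.
Local Notation L := {ffun cell -> k^o}.
Implicit Types (f g : L) (X : pred cell).

(** A function stands for the chain with these coefficients: removing an element from a set becomes,
    on coefficients, a sum over the sets with one more element. *)
Definition bd_fun f : L :=
  [ffun x : cell => \sum_(t | t \notin x.2) sgn k t x.2 * f (x.1, t |: x.2)].
Lemma bd_linear : linear bd_fun.
Proof.
move=> a f g; apply/ffunP => x; rewrite !ffunE scaler_sumr -big_split /=.
by apply: eq_bigr => t _; rewrite !ffunE /GRing.scale /=; ring.
Qed.
Definition bd : 'End(L) := lin bd_linear.
Lemma bdE f x : bd f x = \sum_(t | t \notin x.2) sgn k t x.2 * f (x.1, t |: x.2).
Proof. by rewrite linE ffunE. Qed.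

Lemma bd_bd f : bd (bd f) = 0.
Proof.
apply/ffunP => -[j T]; rewrite bdE ffunE /=.
under eq_bigr => t tT do rewrite bdE /= mulr_sumr.
rewrite (eq_bigr (fun t => \sum_(s | (s \notin T) && (s != t))
  sgn k t T * (sgn k s (t |: T) * f (j, s |: (t |: T))))).
  apply: sum_antisym => s t st sT tT.
  by rewrite !mulrA (sgn_swap k st) // mulNr !finset.setUA [[set s; t]]finset.setUC.
by move=> t tT; apply: eq_bigl => s; rewrite !inE negb_or andbC.
Qed.

Definition restr_fun X f : L := [ffun x : cell => if X x then f x else 0].
Lemma restr_linear X : linear (restr_fun X).
Proof.
move=> a f g; apply/ffunP => x; rewrite !ffunE; case: ifP => // _.
by rewrite scaler0 addr0.
Qed.
Definition restr X : 'End(L) := lin (restr_linear X).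
Lemma restrE X f x : restr X f x = if X x then f x else 0.
Proof. by rewrite linE ffunE. Qed.

Definition chains X p : {vspace L} :=
  limg (restr (fun x : cell => X x && (#|x.2| == p))).
Lemma chainsP X p f :
  reflect (forall x, f x != 0 -> X x /\ #|x.2| = p) (f \in chains X p).
Proof.
apply: (iffP (memv_imgP)) => [[g _ ->] x|Xf].
  by rewrite restrE; case: ifP => [/andP[-> /eqP]|]; rewrite ?eqxx.
exists f; rewrite ?memvf //; apply/ffunP => x; rewrite restrE.
by case: ifP => // /negbT; case: (eqVneq (f x) 0) => // /Xf[-> ->]; rewrite eqxx.
Qed.

Definition down_closed X := forall j (t : 'I_n) T, X (j, t |: T) -> X (j, T).

Lemma bd_neq0 f x : bd f x != 0 ->
  exists2 t, t \notin x.2 & f (x.1, t |: x.2) != 0.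
Proof.
rewrite bdE => nz.
case: (pickP (fun t => (t \notin x.2) && (f (x.1, t |: x.2) != 0))) => [t /andP[]|no].
  by exists t.
case/eqP: nz; rewrite big1 // => t tT.
by have := no t; rewrite tT /= => /negbFE/eqP ->; rewrite mulr0.
Qed.

Lemma bd_chains X p f : down_closed X -> f \in chains X p -> bd f \in chains X p.-1.
Proof.
move=> dX /chainsP Xf; apply/chainsP => -[j T] /bd_neq0[t /= tT] /Xf[/dX XT].
by rewrite /= cardsU1 tT /= => <-.
Qed.

Lemma bd_chains0 X f : f \in chains X 0 -> bd f = 0.
Proof.
move=> /chainsP Xf; apply/ffunP => x; rewrite ffunE; apply/eqP; apply/negPn.
by apply/negP => /bd_neq0[t tT] /Xf[_]; rewrite /= cardsU1 tT.
Qed.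

(** Coning with apex [a j] is a contracting homotopy; the apex may depend on the first component,
    which the boundary leaves fixed. *)
Lemma chains_acyclic X (a : J -> 'I_n) p : down_closed X ->
  (forall j T, X (j, T) -> X (j, a j |: T)) ->
  (chains X p :&: lker bd = bd @: chains X p.+1)%VS.
Proof.
move=> dX coneX; apply/vspaceP => f; rewrite memv_cap memv_ker.
apply/andP/memv_imgP => [[/chainsP Xf /eqP df]|[g Xg ->]]; last first.
  by rewrite (bd_chains dX Xg) bd_bd eqxx.
exists [ffun x : cell => if a x.1 \in x.2 then
    sgn k (a x.1) (x.2 :\ a x.1) * f (x.1, x.2 :\ a x.1) else 0].
  apply/chainsP => -[j T]; rewrite ffunE /=; case: ifP => aT; rewrite ?eqxx //.
  rewrite mulf_eq0 negb_or => /andP[_ /Xf[/= XT <-]].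
  by split; [rewrite -(finset.setD1K aT); apply: coneX | rewrite [in LHS](cardsD1 (a j)) aT].
apply/ffunP => -[j T]; rewrite bdE /=.
have [aT|aT] := boolP (a j \in T); last first.
  rewrite (bigD1 (a j)) //= ffunE /= finset.setU11 big1 ?addr0 => [|t /andP[tT ta]].
    by rewrite finset.setU1K // mulrA sgn_sqr mul1r.
  by rewrite ffunE /= !inE eq_sym (negPf ta) (negPf aT) mulr0.
set R := T :\ a j.
have aR : a j \notin R by rewrite !inE eqxx.
have TR : T = a j |: R by rewrite finset.setD1K.
clearbody R.
(* The cycle condition at [R] expresses the coefficient at [T] through sets that avoid the apex. *)
have := congr1 (fun h : L => h (j, R)) df; rewrite bdE ffunE /=.
rewrite (bigD1 (a j)) //= -TR => /eqP; rewrite addr_eq0 => /eqP E.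
have notT t : (t \notin T) = (t \notin R) && (t != a j).
  by rewrite TR !inE negb_or andbC.
have -> : f (j, T) = sgn k (a j) R * (sgn k (a j) R * f (j, T)).
  by rewrite mulrA sgn_sqr mul1r.
rewrite E mulrN mulr_sumr -sumrN; apply: eq_big => [t|t /andP[tR ta]]; first by rewrite notT.
 have ta' : a j != t by rewrite eq_sym.
rewrite ffunE /= TR !inE eqxx orbT finset.setUCA finset.setU1K; last first.
  by rewrite !inE negb_or ta' aR.
by rewrite mulrA sgn_swap_mix // mulNr mulrA.
Qed.
End Chains.

(** * Arcs of a cyclic set *)

Section Arcs.
Variables (m : nat).
Implicit Types (Q : pred 'I_m) (i s : 'I_m).

Definition is_start Q i := Q i && ~~ Q (ord_pred i).

Lemma iter_ordS_val l s : iter l (@ordS m) s = ((s + l) %% m)%N :> nat.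
Proof.
elim: l => [|l IH]; first by rewrite addn0 modn_small.
by rewrite iterS /= IH -addn1 modnDml addn1 addnS.
Qed.

Lemma iter_ordS_reach s i : iter ((i + m - s) %% m)%N (@ordS m) s = i.
Proof.
apply/val_inj; rewrite /= iter_ordS_val modnDmr.
have -> : (s + (i + m - s) = i + m)%N by have := ltn_ord s; lia.
by rewrite modnDr modn_small.
Qed.

Lemma exists_start Q s l : ~~ Q s -> Q (iter l (@ordS m) s) ->
  exists2 l', (0 < l' <= l)%N & is_start Q (iter l' (@ordS m) s).
Proof.
move=> nQs; elim: l => [|l IH] Ql; first by rewrite Ql in nQs.
have [/IH[l' /andP[l0 ll'] st]|nQl] := boolP (Q (iter l (@ordS m) s)).
  by exists l' => //; rewrite l0 ltnW.
by exists l.+1; rewrite ?leqnn // /is_start Ql iterS ordSK nQl.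
Qed.

(** The sum is the only obstruction to being a difference: the partial sums from the start of the
    arc vanish past its end, because there they have exhausted the total. *)
Lemma cyclic_difference (k : fieldType) Q (h : 'I_m -> k) :
  (forall i i', is_start Q i -> is_start Q i' -> i = i') ->
  (forall i, h i != 0 -> Q i) -> \sum_i h i = 0 ->
  exists g : 'I_m -> k, (forall i, g i != 0 -> Q i && Q (ord_pred i)) /\
    forall i, h i = g i - g (ordS i).
Proof.
move=> uQ hQ sumh; case: (pickP (fun i : 'I_m => true)) => [i0 _|no]; last first.
  by exists (fun=> 0); split=> i; have := no i.
have m0 : (0 < m)%N by apply: leq_ltn_trans (ltn_ord i0).
(* Without a start, [Q] is empty or the whole cycle, and any base point will do. *)
have [s sP] : exists s : 'I_m, forall i, is_start Q i -> i = s.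
  case: (pickP (is_start Q)) => [s ss|no].
    by exists s => i si; apply: uQ.
  by exists i0 => i; rewrite no.
pose K (i : 'I_m) := ((i + m - s) %% m)%N.
have KE i : iter (K i) (@ordS m) s = i by apply: iter_ordS_reach.
have Km i : (K i < m)%N by rewrite ltn_mod.
have sumE : \sum_(0 <= l < m) h (iter l (@ordS m) s) = 0.
  rewrite big_mkord -[RHS]sumh [RHS](reindex (fun l : 'I_m => iter l (@ordS m) s)) //=.
  exists (fun i => Ordinal (Km i)) => i _ /=; last exact: KE.
  apply/val_inj; rewrite /= /K iter_ordS_val.
  have si : (s + i < m + m)%N by rewrite -addSn leq_add // ltnW // ltn_ord.
  case: (ltnP (s + i) m) => sim.
    rewrite [X in (X + m - s)%N]modn_small // (_ : (s + i + m - s = i + m)%N); last by lia.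
    by rewrite modnDr modn_small.
  rewrite -(subnK sim) modnDr [X in (X + m - s)%N]modn_small; last by lia.
  rewrite (_ : (s + i - m + m - s = i)%N); last by lia.
  by rewrite modn_small.
have KS i : K (ordS i) = if (K i).+1 == m then 0%N else (K i).+1.
  have := KE (ordS i); rewrite -[in RHS](KE i) -iterS => /(congr1 val).
  rewrite /= !iter_ordS_val -(addn1 (_ %% _)) modnDml -addnA addn1 => /eqP.
  rewrite eqn_modDl.
  rewrite (modn_small (Km _)); case: ifP => [/eqP ->|ne]; first by rewrite modnn => /eqP.
  by rewrite modn_small => [/eqP|]; rewrite // ltn_neqAle ne Km.
pose g i := - \sum_(0 <= l < K i) h (iter l (@ordS m) s).
exists g; split; last first.
  move=> i; rewrite /g KS; case: ifP => [/eqP e|_].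
    rewrite [X in _ - - X]big_geq // oppr0 subr0.
    have : \sum_(0 <= l < (K i).+1) h (iter l (@ordS m) s) = 0 by rewrite e.
    by rewrite big_nat_recr //= KE => /eqP; rewrite addrC addr_eq0 => /eqP.
  by rewrite big_nat_recr //= KE; ring.
(* Past the end of the arc the partial sum is minus the sum of the remaining terms; a nonzero one
   among them would force a second start. *)
have nQ_tail i : ~~ Q i -> (0 < K i)%N -> g i = 0.
  move=> nQi K0; rewrite /g.
  have -> : \sum_(0 <= l < K i) h (iter l (@ordS m) s) =
     - \sum_(K i <= l < m) h (iter l (@ordS m) s).
    by apply/eqP; rewrite -addr_eq0 -big_cat_nat //= ?sumE // ltnW.
  rewrite opprK big_nat big1 // => l /andP[Kl lm]; apply/eqP/negPn/negP => /hQ Ql.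
  have : Q (iter (l - K i) (@ordS m) i) by rewrite -[X in iter _ _ X](KE i) -iterD subnK.
  case/(exists_start nQi) => l' /andP[l0 ll'] /sP; rewrite -[X in iter _ _ X](KE i) -iterD.
  move/(congr1 val); rewrite /= iter_ordS_val => /eqP.
  rewrite -[X in _ == X](modn_small (ltn_ord s)) -[X in _ == X %[mod _]]addn0 eqn_modDl mod0n.
  by rewrite modn_small; lia.
move=> i; have [K0|K0] := posnP (K i); first by rewrite /g K0 big_geq // oppr0 eqxx.
have [Qi|nQi] := boolP (Q i); last by rewrite nQ_tail ?eqxx.
apply: contraNT => nQp.
by have := sP i; rewrite /is_start Qi nQp => /(_ isT) e; move: K0; rewrite e /K addKn modnn.
Qed.
End Arcs.

Lemma eq_hdim (k : fieldType) (L : vectType k) (d : 'End(L)) X Y p :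
  (forall q, X q = Y q) -> hdim d X p = hdim d Y p.
Proof. by move=> e; rewrite /hdim !e. Qed.

(** * Duality between the cells of a cone and of its interior *)

Section Duality.
Variables (k : fieldType) (J : finType) (n m : nat) (B : {set 'I_n}).
Local Notation cell := (J * {set 'I_n})%type.
Local Notation L := {ffun cell -> k^o}.
Local Notation Lm := {ffun (J * 'I_m) * {set 'I_n} -> k^o}.
Variables (P : 'I_m -> pred cell) (v : 'I_m -> 'I_n).
Hypothesis m_gt0 : (0 < m)%N.
Hypothesis P_down : forall i, down_closed (P i).
Hypothesis P_B : forall i x, P i x -> x.2 \subset B.
Hypothesis vB : forall i, v i \in B.
Hypothesis P_cone : forall i j T, P i (j, T) -> P i (j, v i |: T).
Hypothesis P_cone_pred : forall i j T,
  P (ord_pred i) (j, T) -> P (ord_pred i) (j, v i |: T).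
Hypothesis P_arc : forall x i i',
  is_start (P^~ x) i -> is_start (P^~ x) i' -> i = i'.

Let call : pred cell := fun x => [forall i, P i x].
Let cnone : pred cell := fun x => [forall i, ~~ P i x].
(** In [X1] the index [i] stands for a vertex, lying on the edges [i] and [ord_pred i]; in [X2] it
    stands for an edge. *)
Let X1 : pred ((J * 'I_m) * {set 'I_n}) :=
  fun x => P x.1.2 (x.1.1, x.2) && P (ord_pred x.1.2) (x.1.1, x.2).
Let X2 : pred ((J * 'I_m) * {set 'I_n}) := fun x => P x.1.2 (x.1.1, x.2).

Definition cst_fun (f : L) : Lm := [ffun x : (J * 'I_m) * {set 'I_n} => f (x.1.1, x.2)].
Lemma cst_linear : linear cst_fun.
Proof. by move=> a f g; apply/ffunP => x; rewrite !ffunE. Qed.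
Let cst := lin cst_linear.

Definition dif_fun (g : Lm) : Lm :=
  [ffun x : (J * 'I_m) * {set 'I_n} => g x - g ((x.1.1, ordS x.1.2), x.2)].
Lemma dif_linear : linear dif_fun.
Proof.
by move=> a f g; apply/ffunP => x; rewrite !ffunE scalerBr opprD addrACA.
Qed.
Let dif := lin dif_linear.

Definition tot_fun (g : Lm) : L := [ffun x : cell => \sum_i g ((x.1, i), x.2)].
Lemma tot_linear : linear tot_fun.
Proof.
move=> a f g; apply/ffunP => x; rewrite !ffunE scaler_sumr -big_split.
by apply: eq_bigr => i _; rewrite !ffunE.
Qed.
Let tot := lin tot_linear.

(** The boundary of the quotient complex in which the cells of at least one half-plane are set to
    zero. *)
Definition bd_rel : 'End(L) := (restr k cnone \o bd k J n)%VF.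

Lemma cst_bd f : cst (bd k J n f) = bd k _ n (cst f).
Proof.
apply/ffunP => x; rewrite linE ffunE !bdE /=.
by apply: eq_bigr => t _; rewrite linE ffunE.
Qed.
Lemma dif_bd f : dif (bd k _ n f) = bd k _ n (dif f).
Proof.
apply/ffunP => x; rewrite linE ffunE !bdE /= -sumrB.
by apply: eq_bigr => t _; rewrite linE ffunE mulrBr.
Qed.
Lemma tot_bd f : tot (bd k _ n f) = bd k _ n (tot f).
Proof.
apply/ffunP => x; rewrite linE ffunE bdE /=.
under eq_bigr => i _ do rewrite bdE /=.
rewrite exchange_big /=; apply: eq_bigr => t _; rewrite linE ffunE mulr_sumr.
by [].
Qed.
Lemma restr_bd f : restr k cnone (bd k J n f) = bd_rel (restr k cnone f).
Proof.
apply/ffunP => -[j T]; rewrite /bd_rel comp_lfunE !restrE; case: ifP => // /forallP no.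
rewrite !bdE; apply: eq_bigr => t _; rewrite restrE ifT //=.
by apply/forallP => i; apply: contra (no i); apply: P_down.
Qed.

Lemma X1_down : down_closed X1.
Proof. by move=> [j i] t T; rewrite /X1 /= => /andP[/P_down-> /P_down->]. Qed.
Lemma X2_down : down_closed X2.
Proof. by move=> [j i] t T; rewrite /X2 /= => /P_down->. Qed.
Lemma call_down : down_closed call.
Proof. by move=> j t T /forallP H; apply/forallP => i; apply: P_down (H i). Qed.

Lemma cst_img p : (chains k X1 p :&: lker dif = cst @: chains k call p)%VS.
Proof.
apply/vspaceP => f; rewrite memv_cap memv_ker.
apply/andP/memv_imgP => [[/chainsP fX /eqP df]|[g /chainsP gX ->]]; last first.
  split; first apply/chainsP => -[[j i] T].
    by rewrite linE ffunE /= /X1 /= => /gX[/forallP H /= ->]; rewrite !H.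
  by apply/eqP/ffunP => x; rewrite linE !ffunE /= !linE !ffunE subrr.
pose i0 := Ordinal m_gt0.
have fS j i T : f ((j, i), T) = f ((j, ordS i), T).
  have := congr1 (fun h : Lm => h ((j, i), T)) df; rewrite linE !ffunE /= => /eqP.
  by rewrite subr_eq0 => /eqP.
have fE j i T : f ((j, i), T) = f ((j, i0), T).
  rewrite -(iter_ordS_reach i0 i); elim: (X in iter X) => //= l <-.
  by rewrite -fS.
exists [ffun x => f ((x.1, i0), x.2)]; last by apply/ffunP => -[[j i] T]; rewrite linE !ffunE /= fE.
apply/chainsP => -[j T]; rewrite ffunE /= => nz; split; last by have [] := fX _ nz.
apply/forallP => i; rewrite -(fE _ i) in nz; have [] := fX _ nz.
by rewrite /X1 => /andP[].
Qed.

(** Cell by cell this is [cyclic_difference]: the half-planes containing a given cell form an arc by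
    [P_arc]. *)
Lemma dif_img p : (chains k X2 p :&: lker tot = dif @: chains k X1 p)%VS.
Proof.
apply/vspaceP => f; rewrite memv_cap memv_ker.
apply/andP/memv_imgP => [[/chainsP fX /eqP tf]|[g /chainsP gX ->]]; last first.
  split; first apply/chainsP => -[[j i] T].
    rewrite linE ffunE /= /X2 /= => nz.
    have [g0|/gX[]] := eqVneq (g ((j, i), T)) 0; last by rewrite /X1 /= => /andP[].
    by move: nz; rewrite g0 sub0r oppr_eq0 => /gX[]; rewrite /X1 /= ordSK => /andP[].
  apply/eqP/ffunP => x; rewrite linE !ffunE.
  under eq_bigr => i _ do rewrite linE ffunE /=.
  by rewrite sumrB (reindex_inj (@ordS_inj m)) /= subrr.
have /choice[g gP] : forall x : cell, exists g : 'I_m -> k,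
    (forall i, g i != 0 -> [&& P i x, P (ord_pred i) x & #|x.2| == p]) /\
    forall i, f ((x.1, i), x.2) = g i - g (ordS i).
  move=> x; have [xp|xp] := eqVneq #|x.2| p; last first.
    exists (fun=> 0); split=> i; rewrite ?eqxx // subr0.
    by apply/eqP; apply: contraNT xp => /fX[] /= _ ->.
  have [||g [gQ gE]] := @cyclic_difference m k (P^~ x) (fun i => f ((x.1, i), x.2)) (@P_arc x).
  - by move=> i /fX[]; rewrite /X2 -surjective_pairing.
  - by have := congr1 (fun h : L => h x) tf; rewrite linE !ffunE.
  by exists g; split=> // i /gQ; rewrite andbT.
exists [ffun x : (J * 'I_m) * {set 'I_n} => g (x.1.1, x.2) x.1.2]; last first.
  by apply/ffunP => -[[j i] T]; rewrite linE !ffunE /= -(gP (j, T)).2.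
apply/chainsP => -[[j i] T]; rewrite ffunE /= => /(gP (j, T)).1 /and3P[Pi Pi' /eqP].
by rewrite /X1 /= Pi Pi'.
Qed.

Let some : pred cell := fun x => [exists i, P i x].
Lemma tot_img p : (tot @: chains k X2 p = chains k some p)%VS.
Proof.
apply/vspaceP => f; apply/memv_imgP/chainsP => [[g /chainsP gX ->] x|fX].
  rewrite linE ffunE => nz.
  case: (pickP (fun i => g ((x.1, i), x.2) != 0)) => [i /gX[Pi xp]|no].
    by split=> //; apply/existsP; exists i; rewrite /X2 /= -surjective_pairing in Pi.
  by case/eqP: nz; rewrite big1 // => i _; apply/eqP/negbFE/no.
(* A section of [tot]: the whole coefficient is put on one half-plane that contains the cell. *)
pose c x := odflt (Ordinal m_gt0) [pick i | P i x].
exists [ffun x : (J * 'I_m) * {set 'I_n} =>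
  if x.1.2 == c (x.1.1, x.2) then f (x.1.1, x.2) else 0].
  apply/chainsP => -[[j i] T]; rewrite ffunE /=; case: (i =P c (j, T)) => [->|]; rewrite ?eqxx //.
  move=> /fX[/existsP[i' Pi'] ?]; split=> //; rewrite /X2 /= /c.
  by case: pickP => [//|/(_ i')]; rewrite Pi'.
apply/ffunP => -[j T]; rewrite linE ffunE (bigD1 (c (j, T))) //= ffunE /= eqxx.
by rewrite big1 ?addr0 // => i ne; rewrite ffunE /= (negPf ne).
Qed.

Lemma restr_img p :
  (restr k cnone @: chains k (fun x : cell => x.2 \subset B) p =
   chains k (fun x : cell => (x.2 \subset B) && cnone x) p)%VS.
Proof.
apply/vspaceP => f; apply/memv_imgP/chainsP => [[g /chainsP gX ->] x|fX].
  by rewrite restrE; case: ifP; rewrite ?eqxx // => _ /gX[-> ->].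
exists f; first by apply/chainsP => x /fX[/andP[-> _] ->].
apply/ffunP => x; rewrite restrE; case: ifP => // /negbT; apply: contraNeq.
by move=> /fX[/andP[]].
Qed.

Lemma restr_ker p :
  (chains k (fun x : cell => x.2 \subset B) p :&: lker (restr k cnone) = chains k some p)%VS.
Proof.
apply/vspaceP => f; rewrite memv_cap memv_ker.
apply/andP/chainsP => [[/chainsP fX /eqP rf] x nz|fX].
  have [xB xp] := fX _ nz; split=> //.
  have := congr1 (fun h : L => h x) rf; rewrite restrE ffunE.
  case: ifP => [_ /eqP|/negbT]; first by rewrite (negPf nz).
  by rewrite negb_forall => /existsP[i]; rewrite negbK => Pi _; apply/existsP; exists i.
split; first by apply/chainsP => x /fX[/existsP[i /P_B]].
apply/eqP/ffunP => x; rewrite restrE ffunE; case: ifP => // /forallP no.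
by apply/eqP/negPn/negP => /fX[/existsP[i Pi]]; have := no i; rewrite Pi.
Qed.

(** The complex of all subsets of [B] and the complexes of [X2] and [X1] are cones with a vertex as
    apex, hence acyclic, so [restr], [tot] and [dif] shift the degree by one each; [cst] then
    identifies the last kernel with the cells common to all half-planes. *)
Theorem cone_duality p :
  hdim bd_rel (chains k (fun x : cell => (x.2 \subset B) && cnone x)) p.+3 =
  hdim (bd k J n) (chains k call) p.
Proof.
pose i0 := Ordinal m_gt0.
rewrite -(@eq_hdim _ _ _ (fun q => restr k cnone @: chains k (fun x : cell => x.2 \subset B) q)%VS);
  last by move=> q; rewrite restr_img.
rewrite (hdim_limg_acyclic restr_bd); last first.
  move=> q; apply: (@chains_acyclic _ _ _ _ (fun=> v i0)) => [j t T|j T] /=.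
    by move=> H; apply: fintype.subset_trans (finset.subsetUr _ _) H.
  by move=> TB; rewrite finset.subUset finset.sub1set vB.
rewrite (@eq_hdim _ _ _ _ (fun q => tot @: chains k X2 q)%VS); last first.
  by move=> q; rewrite restr_ker tot_img.
rewrite (hdim_limg_acyclic tot_bd); last first.
  move=> q; apply: (@chains_acyclic _ _ _ _ (fun x => v x.2)); first exact: X2_down.
  by move=> [j i] T; apply: P_cone.
rewrite (@eq_hdim _ _ _ _ (fun q => dif @: chains k X1 q)%VS); last first.
  by move=> q; rewrite dif_img.
rewrite (hdim_limg_acyclic dif_bd); last first.
  move=> q; apply: (@chains_acyclic _ _ _ _ (fun x => v x.2)); first exact: X1_down.
  by move=> [j i] T /andP[/P_cone H1 /P_cone_pred H2]; apply/andP; split.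
rewrite (@eq_hdim _ _ _ _ (fun q => cst @: chains k call q)%VS); last first.
  by move=> q; rewrite cst_img.
apply: (@hdim_limg_inj _ _ _ _ _ _ (chains k call) cst_bd) => q; last first.
  by apply/subvP => y /memv_imgP[f fX ->]; apply: (bd_chains call_down fX).
apply/eqP; rewrite -subv0; apply/subvP => f; rewrite memv_cap memv_ker => /andP[_ /eqP cf].
rewrite memv0; apply/eqP/ffunP => x.
by have := congr1 (fun h : Lm => h ((x.1, i0), x.2)) cf; rewrite linE !ffunE -surjective_pairing.
Qed.
End Duality.

(** * Dimensions of quotients under linear correspondences *)

Section QuotientDimension.
Variable k : fieldType.

(* [L] may be infinite-dimensional: only the quotient of [Z] by [Bd] need be of
   finite dimension. *)
Definition quot_dim (L : lmodType k) (Z Bd : L -> Prop) (d : nat) : Prop :=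
  exists c : 'I_d -> L, [/\ forall j, Z (c j),
    forall z, Z z -> exists a : 'I_d -> k, Bd (z - \sum_j a j *: c j)
  & forall a : 'I_d -> k, Bd (\sum_j a j *: c j) -> forall j, a j = 0].

Definition submodule (L : lmodType k) (P : L -> Prop) :=
  P 0 /\ forall (a : k) x y, P x -> P y -> P (a *: x + y).

Lemma submodule_sum (L : lmodType k) (P : L -> Prop) d (a : 'I_d -> k) (c : 'I_d -> L) :
  submodule P -> (forall j, P (c j)) -> P (\sum_j a j *: c j).
Proof.
move=> [P0 PD] Pc; elim/big_ind: _ => // [x y|j _].
  by move=> Px Py; rewrite -[x]scale1r; apply: PD.
by rewrite -[_ *: _]addr0; apply: PD.
Qed.

(** A relation replaces a map because connecting homomorphisms are given by lifts that are not
    unique; linearity and the two lifting conditions carry a basis of one quotient to a basis of the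
    other. *)
Lemma quot_dim_transport (L L' : lmodType k) (Z Bd : L -> Prop) (Z' Bd' : L' -> Prop)
    (R : L -> L' -> Prop) d :
  submodule Z -> submodule Z' ->
  R 0 0 -> (forall (a : k) x y x' y', R x x' -> R y y' -> R (a *: x + y) (a *: x' + y')) ->
  (forall z, Z z -> exists2 z', Z' z' & R z z') ->
  (forall z', Z' z' -> exists2 z, Z z & R z z') ->
  (forall z z', Z z -> Z' z' -> R z z' -> (Bd z <-> Bd' z')) ->
  quot_dim Z Bd d -> quot_dim Z' Bd' d.
Proof.
move=> sZ sZ' R0 RD RZ RZ' RB [c [Zc gen free]].
have [c' c'P] := choice (fun j => let: ex_intro2 z' Zz' Rz' := RZ _ (Zc j) in
  ex_intro (fun z' => Z' z' /\ R (c j) z') z' (conj Zz' Rz')).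
have RS (a : 'I_d -> k) : R (\sum_j a j *: c j) (\sum_j a j *: c' j).
  elim/big_ind2: _ => // [x x' y y' Rx Ry|j _].
    by rewrite -[x]scale1r -[x']scale1r; apply: RD.
  by rewrite -[_ *: c j]addr0 -[_ *: c' j]addr0; apply: RD => //; have [] := c'P j.
have subZ (M : lmodType k) (P : M -> Prop) x y : submodule P -> P x -> P y -> P (x - y).
  by move=> [_ PD] Px Py; rewrite -scaleN1r addrC; apply: PD.
exists c'; split=> [j|z' Zz'|a]; first by have [] := c'P j.
  have [z Zz Rz] := RZ' _ Zz'; have [a Ba] := gen _ Zz; exists a.
  have Zs : Z (z - \sum_j a j *: c j) by apply: subZ => //; apply: submodule_sum.
  have Z's : Z' (z' - \sum_j a j *: c' j).
    by apply: subZ => //; apply: submodule_sum => // j; have [] := c'P j.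
  have Rs : R (z - \sum_j a j *: c j) (z' - \sum_j a j *: c' j).
    by rewrite -!scaleN1r addrC [z' + _]addrC; apply: RD.
  exact/(RB _ _ Zs Z's Rs).
have Zs : Z (\sum_j a j *: c j) by apply: submodule_sum.
have Z's : Z' (\sum_j a j *: c' j) by apply: submodule_sum => // j; have [] := c'P j.
by move=> Ba; apply: free; apply/(RB _ _ Zs Z's (RS a)).
Qed.

Lemma quot_dim_vspace (L : vectType k) (Z Bd : {vspace L}) d : (Bd <= Z)%VS ->
  quot_dim (fun x => x \in Z) (fun x => x \in Bd) d -> d = (\dim Z - \dim Bd)%N.
Proof.
move=> BZ [c [Zc gen free]].
pose X := [tuple c j | j < d].
have XE j : X`_(val j) = c j by rewrite -tnth_nth tnth_mktuple.
have XZ : (<<X>> <= Z)%VS.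
  by apply/span_subvP => x /tnthP[j ->]; rewrite tnth_mktuple; apply: Zc.
have sumX (a : 'I_d -> k) : \sum_j a j *: c j \in <<X>>%VS.
  apply: memv_suml => j _; apply/memvZ/memv_span.
  by rewrite -XE; apply: mem_nth; rewrite size_tuple; apply: ltn_ord.
have spanX x : x \in <<X>>%VS -> exists a : 'I_d -> k, x = \sum_j a j *: c j.
  move=> xX; exists (fun j => coord X j x); rewrite [LHS](coord_span xX).
  by apply: eq_bigr => j _; rewrite XE.
have freeX : \dim <<X>> = d.
  rewrite -[RHS](size_tuple X); apply/eqP/freeP => a sa j.
  apply: (free a _ j).
  have -> : \sum_j a j *: c j = 0; last exact: mem0v.
  by rewrite -[RHS]sa; apply: eq_bigr => i _; rewrite XE.
have dir : (<<X>> :&: Bd = 0)%VS.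
  apply/eqP; rewrite -subv0; apply/subvP => x; rewrite memv_cap => /andP[/spanX[a ->] Ba].
  by rewrite memv0; apply/eqP; rewrite big1 // => j _; rewrite (free a) // scale0r.
have ZE : (<<X>> + Bd = Z)%VS.
  apply/eqP; rewrite eqEsubv subv_add XZ BZ /=; apply/subvP => z Zz.
  have [a Ba] := gen _ Zz; rewrite -[z](subrKC (\sum_j a j *: c j)).
  exact: memv_add (sumX a) Ba.
by rewrite -ZE dimv_disjoint_sum // freeX addnK.
Qed.
End QuotientDimension.

(** * Exactness of the Koszul complex in characteristic 0 *)

Section KoszulPolynomials.
Variables (k : fieldType) (n : nat).
Local Notation S := (mpoly n k).
Local Notation var t := (mpolyX k (mnm1 t)).
Hypothesis char0 : [pchar k]%R =i pred0.

Lemma mpoly_euler (f : S) e : {in msupp f, forall m, mdeg m = e} ->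
  \sum_(t < n) var t * mderiv t f = e%:R *: f.
Proof.
move=> fe; rewrite [in RHS](mpolyE f) scaler_sumr.
under eq_bigr => t _.
  rewrite [X in mderiv t X](mpolyE f) raddf_sum mulr_sumr /=.
  under eq_bigr => m _ do rewrite mderivZ mderivX -!scalerAr -mpolyXD.
  over.
rewrite exchange_big /= big_seq [RHS]big_seq; apply: eq_bigr => m mf.
rewrite -(fe m mf) mdegE scalerA natr_sum mulr_suml scaler_suml.
apply: eq_bigr => t _; rewrite scalerA mulrC.
have [->|mt] := posnP (m t); first by rewrite !mul0r !scale0r.
by rewrite addmC submK //; apply/mnm_lepP => i; rewrite mnm1E; case: eqP => // <-.
Qed.

Variable r : nat.
Local Notation E := {ffun {set 'I_n} * 'I_r -> S}.
Implicit Types f g : E.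

Definition koszul f : E := [ffun x : {set 'I_n} * 'I_r =>
  \sum_(t | t \notin x.1) sgn k t x.1 *: (var t * f (t |: x.1, x.2))].

Lemma koszulD f g : koszul (f + g) = koszul f + koszul g.
Proof.
apply/ffunP => x; rewrite !ffunE -big_split; apply: eq_bigr => t _.
by rewrite ffunE mulrDr scalerDr.
Qed.
Lemma koszulZ (a : k) f : koszul (a *: f) = a *: koszul f.
Proof.
apply/ffunP => x; rewrite !ffunE scaler_sumr; apply: eq_bigr => t _.
by rewrite ffunE -scalerAr !scalerA mulrC.
Qed.
Lemma koszul0 : koszul 0 = 0.
Proof. by have := koszulZ 0 0; rewrite !scale0r. Qed.
Lemma koszulN f : koszul (- f) = - koszul f.
Proof. by rewrite -scaleN1r koszulZ scaleN1r. Qed.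
Lemma koszulB f g : koszul (f - g) = koszul f - koszul g.
Proof. by rewrite koszulD koszulN. Qed.

Lemma koszul_koszul f : koszul (koszul f) = 0.
Proof.
apply/ffunP => -[T j]; rewrite !ffunE /=.
under eq_bigr => t tT do rewrite ffunE /= mulr_sumr scaler_sumr.
rewrite (eq_bigr (fun t => \sum_(s | (s \notin T) && (s != t))
  sgn k t T *: (var t * (sgn k s (t |: T) *: (var s * f (s |: (t |: T), j)))))).
  apply: sum_antisym => s t st sT tT.
  rewrite -!scalerAr !scalerA (sgn_swap k st) // !scaleNr; congr (- (_ *: _)).
  by rewrite mulrCA !setUA [[set s; t]]setUC.
by move=> t tT; apply: eq_bigl => s; rewrite !inE negb_or andbC.
Qed.

(* The element [f (T, j)] is homogeneous of degree [q - p - deg j], and zero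
   unless [T] has [p] elements. *)
Definition homog (deg : 'I_r -> int) (p : nat) (q : int) f :=
  forall T j m, m \in msupp (f (T, j)) -> #|T| = p /\ deg j + (mdeg m)%:Z + p%:Z = q.

(** The exterior derivative, with the exterior generators as differentials of the variables;
    [koszul] is then contraction with the Euler vector field. *)
Definition euler_homotopy f : E := [ffun x : {set 'I_n} * 'I_r =>
  \sum_(s in x.1) sgn k s (x.1 :\ s) *: mderiv s (f (x.1 :\ s, x.2))].

Lemma mderiv_sum s (I : finType) (P : pred I) (F : I -> S) :
  mderiv s (\sum_(i | P i) F i) = \sum_(i | P i) mderiv s (F i).
Proof. exact: (big_morph _ (mderivD s) (mderiv0 _ s)). Qed.

Lemma mderiv_varM s t (f : S) :
  mderiv s (var t * f) = (s == t)%:R *: f + var t * mderiv s f.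
Proof.
rewrite mderivM mderivX mnm1E eq_sym; congr (_ + _).
case: eqP => [->|]; last by rewrite !scale0r mul0r.
by rewrite !scale1r (_ : mnm_sub _ _ = mnm0) ?mpolyX0 ?mul1r //; apply/mnmP => i; rewrite mnmBE subnn mnm0E.
Qed.

(** Cartan's formula: the diagonal terms contribute Euler's identity and the size of [T], and the
    mixed terms cancel by [sgn_swap_mix]. *)
Lemma euler_homotopyE f T j e : {in msupp (f (T, j)), forall m, mdeg m = e} ->
  koszul (euler_homotopy f) (T, j) + euler_homotopy (koszul f) (T, j) =
  (e + #|T|)%:R *: f (T, j).
Proof.
move=> fe; rewrite !ffunE /=.
have -> : \sum_(t | t \notin T) sgn k t T *: (var t * euler_homotopy f (t |: T, j)) =
  \sum_(t | t \notin T) var t * mderiv t (f (T, j)) +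
  \sum_(t | t \notin T) \sum_(s in T)
     (sgn k t T * sgn k s ((t |: T) :\ s)) *: (var t * mderiv s (f ((t |: T) :\ s, j))).
  rewrite -big_split; apply: eq_bigr => t tT; rewrite ffunE /=.
  rewrite (big_setU1 t) //= setU1K // mulrDr scalerDr; congr (_ + _).
    by rewrite -scalerAr scalerA sgn_sqr scale1r.
  by rewrite mulr_sumr scaler_sumr; apply: eq_bigr => s _; rewrite -scalerAr scalerA.
have -> : \sum_(s in T) sgn k s (T :\ s) *: mderiv s (koszul f (T :\ s, j)) =
  \sum_(s in T) (f (T, j) + var s * mderiv s (f (T, j))) +
  \sum_(s in T) \sum_(t | t \notin T)
     (sgn k s (T :\ s) * sgn k t (T :\ s)) *: (var t * mderiv s (f (t |: (T :\ s), j))).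
  rewrite -big_split; apply: eq_bigr => s sT; rewrite ffunE /= mderiv_sum.
  rewrite (bigD1 s) /=; last by rewrite !inE eqxx.
  rewrite mderivZ mderiv_varM eqxx scale1r setD1K // scalerDr; congr (_ + _).
    by rewrite scalerA sgn_sqr scale1r.
  rewrite scaler_sumr; apply: eq_big => [t|t /andP[tT ts]].
    by rewrite !inE negb_and negbK; case: eqP => [->|]; rewrite ?sT ?andbF ?andbT.
  by rewrite mderivZ mderiv_varM eq_sym (negPf ts) scale0r add0r scalerA.
rewrite addrACA [X in _ + X](_ : _ = 0) ?addr0; last first.
  rewrite exchange_big /= -big_split big1 //= => s sT; rewrite -big_split big1 //= => t tT.
  have ts : t != s by apply: contraNneq tT => ->.
  have -> : (t |: T) :\ s = t |: (T :\ s).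
    apply/setP => i; rewrite !inE; case: (i =P s) => //= ->.
    by rewrite eq_sym (negPf ts).
  rewrite -scalerDl -{1}(setD1K sT) sgn_swap_mix ?addNr ?scale0r //.
  - by rewrite eq_sym.
  - by rewrite !inE eqxx.
  - by rewrite !inE negb_and tT orbT.
rewrite natrD scalerDl -(mpoly_euler fe) [in RHS](bigID (mem T)) /= big_split /= sumr_const scaler_nat.
by rewrite [RHS]addrC addrCA; congr (_ + _); rewrite addrC.
Qed.

Definition row_at (f : E) T : 'rV[S]_r := \row_j f (T, j).

Lemma homog_cons deg p q f T j : homog deg p q f -> f (T, j) != 0 -> #|T| = p.
Proof.
move=> hf nz; have [m mf] : exists m, m \in msupp (f (T, j)).
  case e : (msupp (f (T, j))) => [|m s]; last by exists m; rewrite inE eqxx.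
  by case/eqP: nz; rewrite [LHS]mpolyE e big_nil.
by have [] := hf _ _ _ mf.
Qed.

Lemma homog_submodule deg p q : submodule (L := E) (homog deg p q).
Proof.
split=> [T j m|a f g hf hg T j m]; first by rewrite ffunE msupp0.
rewrite !ffunE => /msuppD_le; rewrite mem_cat => /orP[/msuppZ_le|]; [exact: hf|exact: hg].
Qed.

Lemma homog_koszul deg p q f : homog deg p.+1 q f -> homog deg p q (koszul f).
Proof.
move=> hf T j m; rewrite ffunE => /msupp_sum_le/flatten_mapP[t].
rewrite mem_filter /= => /andP[tT _] /msuppZ_le; rewrite mulrC (perm_mem (msuppMX _ _)).
case/mapP => m' /hf[]; rewrite cardsU1 tT /= add1n => -[cT e] ->.
by rewrite mdegD mdeg1; split=> //; lia.
Qed.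

(** On cycles the Euler homotopy is a homotopy to multiplication by the polynomial degree plus [p],
    which on the generator [j] is the constant [q - deg j]. In characteristic 0 this is invertible
    as soon as it is nonzero, which positivity ensures. *)
Lemma koszul_exact deg p q f : homog deg p q f -> koszul f = 0 ->
  (forall T j m, m \in msupp (f (T, j)) -> (0 < mdeg m + p)%N) ->
  exists2 g, homog deg p.+1 q g & f = koszul g.
Proof.
move=> hf kf pos.
pose c j : k := ((absz (q - deg j))%:R)^-1.
exists [ffun x : {set 'I_n} * 'I_r => c x.2 *: euler_homotopy f x].
  move=> T j m; rewrite ffunE => /msuppZ_le; rewrite ffunE.
  move/msupp_sum_le/flatten_mapP => [s]; rewrite mem_filter /= => /andP[sT _] /msuppZ_le.
  rewrite mcoeff_msupp mcoeff_mderiv => nz.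
  have mf : mnm_add m (mnm1 s) \in msupp (f (T :\ s, j)).
    by rewrite mcoeff_msupp; apply: contraNneq nz => ->; rewrite mul0rn.
  have [cT] := hf _ _ _ mf; rewrite mdegD mdeg1 (cardsD1 s T) sT cT => e.
  by split=> //; lia.
apply/ffunP => -[T j].
have -> : koszul [ffun x : {set 'I_n} * 'I_r => c x.2 *: euler_homotopy f x] (T, j) =
   c j *: koszul (euler_homotopy f) (T, j).
  rewrite !ffunE /= scaler_sumr; apply: eq_bigr => t _.
  by rewrite ffunE /= -scalerAr !scalerA mulrC.
have [f0|nz] := eqVneq (f (T, j)) 0.
  have := @euler_homotopyE f T j 0; rewrite f0 msupp0 scaler0 kf.
  by rewrite [X in _ + X]ffunE big1 ?addr0 => [-> //|s _]; rewrite ?scaler0 // ffunE mderiv0 scaler0.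
have cT := homog_cons hf nz.
have fe : {in msupp (f (T, j)), forall m, mdeg m = (absz (q - deg j - p%:Z)%R)}.
  by move=> m /hf[_]; lia.
have [m mf] : exists m, m \in msupp (f (T, j)).
  case e : (msupp (f (T, j))) => [|m s]; last by exists m; rewrite inE eqxx.
  by case/eqP: nz; rewrite [LHS]mpolyE e big_nil.
have := euler_homotopyE fe; rewrite kf.
rewrite [X in _ + X]ffunE big1 ?addr0 => [->|s _]; last by rewrite ffunE mderiv0 scaler0.
have [_ em] := hf _ _ _ mf; have pm := pos _ _ _ mf.
rewrite scalerA cT (_ : _ + p = absz (q - deg j)%R)%N; last by lia.
rewrite mulVf ?scale1r // (pcharf0P _).1 // -lt0n; lia.
Qed.
End KoszulPolynomials.

(** * Homogeneous components *)

Section Components.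
Variables (k : fieldType) (n : nat).
Local Notation S := (mpoly n k).
Implicit Types x y : S.

(** The degree is an integer because twists can make [q - p - deg j] negative; such components are
    zero. *)
Definition component (e : int) x : S :=
  if 0 <= e then pihomog mdeg (absz e) x else 0.

Lemma component_linear e : linear (component e).
Proof.
move=> a x y; rewrite /component; case: ifP => _; last by rewrite scaler0 addr0.
exact: (linearP (pihomog mdeg (absz e))).
Qed.
HB.instance Definition _ e := GRing.isLinear.Build k S S _ (component e) (component_linear e).

Lemma component_sum e (I : Type) (s : seq I) (P : pred I) (G : I -> S) :
  component e (\sum_(i <- s | P i) G i) = \sum_(i <- s | P i) component e (G i).
Proof. exact: (big_morph _ (raddfD (component e)) (raddf0 (component e))). Qed.

Lemma componentZ e c x : component e (c *: x) = c *: component e x.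
Proof. exact: (linearZ_LR (component e)). Qed.

Lemma componentX e m : component e (mpolyX k m) = if (mdeg m)%:Z == e then mpolyX k m else 0.
Proof.
by case: e => e; rewrite /component //= pihomogX.
Qed.

Lemma component_id e x : {in msupp x, forall m, (mdeg m)%:Z = e} -> component e x = x.
Proof.
move=> xe; rewrite [in LHS](mpolyE x) component_sum [RHS]mpolyE big_seq [RHS]big_seq.
by apply: eq_bigr => m mx; rewrite componentZ componentX xe // eqxx.
Qed.

Lemma component_msupp e x m : m \in msupp (component e x) -> (mdeg m)%:Z = e.
Proof.
rewrite /component; case: ifP => e0; last by rewrite msupp0.
by have /dhomogP := pihomogP mdeg (absz e) x; move=> /[apply] /= ->; lia.
Qed.

Lemma component_mul e d x y : {in msupp y, forall m, (mdeg m)%:Z = d} ->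
  component (e + d) (x * y) = component e x * y.
Proof.
move=> yd; rewrite [in LHS](mpolyE x) [in RHS](mpolyE x) mulr_suml !component_sum mulr_suml.
apply: eq_bigr => m _; rewrite [in LHS](mpolyE y) [in RHS](mpolyE y) !mulr_sumr component_sum.
rewrite big_seq [RHS]big_seq; apply: eq_bigr => m' m'y.
rewrite -scalerAl -scalerAr -mpolyXD !componentZ !componentX mdegD PoszD (yd _ m'y).
have -> : ((mdeg m)%:Z + d == e + d) = ((mdeg m)%:Z == e) by apply/eqP/eqP; lia.
case: ifP => _; last by rewrite !scaler0 mul0r.
by rewrite -scalerAl -scalerAr -mpolyXD.
Qed.

Variable r : nat.
Local Notation E := {ffun {set 'I_n} * 'I_r -> S}.
Implicit Types f g : E.
Variables (deg : 'I_r -> int).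

Definition proj (p : nat) (q : int) f : E := [ffun x : {set 'I_n} * 'I_r =>
  if #|x.1| == p then component (q - p%:Z - deg x.2) (f x) else 0].

Lemma proj_homog p q f : homog deg p q (proj p q f).
Proof.
move=> T j m; rewrite ffunE /=; case: eqP => [cT|_]; last by rewrite msupp0.
by move/component_msupp => ->; split=> //; lia.
Qed.

Lemma proj_id p q f : homog deg p q f -> proj p q f = f.
Proof.
move=> hf; apply/ffunP => -[T j]; rewrite ffunE /=; case: eqP => [cT|ne].
  by apply: component_id => m /hf[_]; lia.
by have [->|/(homog_cons hf)] := eqVneq (f (T, j)) 0.
Qed.

Lemma projD p q f g : proj p q (f + g) = proj p q f + proj p q g.
Proof.
by apply/ffunP => x; rewrite !ffunE; case: ifP => _; rewrite ?addr0 // raddfD.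
Qed.

(** Together with [proj_mact] this allows arbitrary witnesses of a boundary to be replaced by
    homogeneous ones. *)
Lemma proj_koszul p q f : proj p q (koszul f) = koszul (proj p.+1 q f).
Proof.
apply/ffunP => -[T j]; rewrite !ffunE /=; case: eqP => cT; last first.
  rewrite big1 // => t tT; rewrite ffunE /= cardsU1 tT add1n ifN ?mulr0 ?scaler0 //.
  by apply/eqP => -[].
rewrite component_sum; apply: eq_bigr => t tT; rewrite componentZ ffunE /= cardsU1 tT add1n cT eqxx.
congr (_ *: _); rewrite mulrC [RHS]mulrC -(@component_mul _ 1).
  by congr (component _ _); lia.
by move=> m; rewrite msuppX inE => /eqP ->; rewrite mdeg1.
Qed.
End Components.

(** * Matrices acting on Koszul chains *)

Section MatrixAction.
Variables (k : fieldType) (n r s : nat).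
Local Notation S := (mpoly n k).
Implicit Types (f g : {ffun {set 'I_n} * 'I_r -> S}) (D : 'M[S]_(r, s)).

Definition mact f D : {ffun {set 'I_n} * 'I_s -> S} :=
  [ffun x : {set 'I_n} * 'I_s => \sum_a f (x.1, a) * D a x.2].

Lemma mactD f g D : mact (f + g) D = mact f D + mact g D.
Proof.
apply/ffunP => x; rewrite !ffunE -big_split; apply: eq_bigr => a _.
by rewrite ffunE mulrDl.
Qed.
Lemma mactZ (c : k) f D : mact (c *: f) D = c *: mact f D.
Proof.
apply/ffunP => x; rewrite !ffunE scaler_sumr; apply: eq_bigr => a _.
by rewrite ffunE -scalerAl.
Qed.
Lemma mact0 D : mact 0 D = 0.
Proof. by have := mactZ 0 0 D; rewrite !scale0r. Qed.
Lemma mactB f g D : mact (f - g) D = mact f D - mact g D.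
Proof. by rewrite mactD -scaleN1r mactZ scaleN1r. Qed.

Lemma row_mact f D T : row_at (mact f D) T = row_at f T *m D.
Proof.
by apply/rowP => j; rewrite !mxE ffunE; apply: eq_bigr => a _; rewrite mxE.
Qed.

Lemma koszul_mact f D : koszul (mact f D) = mact (koszul f) D.
Proof.
apply/ffunP => -[T j]; rewrite !ffunE /=.
under eq_bigr => t _ do rewrite ffunE mulr_sumr scaler_sumr /=.
rewrite exchange_big; apply: eq_bigr => a _; rewrite ffunE mulr_suml.
by apply: eq_bigr => t _; rewrite /= -scalerAl mulrA.
Qed.

Lemma row_at_inj f g : (forall T, row_at f T = row_at g T) -> f = g.
Proof.
move=> e; apply/ffunP => -[T j].
by have /rowP/(_ j) := e T; rewrite !mxE.
Qed.

Lemma proj_mact degr degs p q f D :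
  (forall a b, {in msupp (D a b), forall m, degr a = degs b + (mdeg m)%:Z}) ->
  proj degs p q (mact f D) = mact (proj degr p q f) D.
Proof.
move=> hD; apply/ffunP => -[T j]; rewrite !ffunE /=.
case: eqP => cT; last by rewrite big1 // => a _; rewrite ffunE /= (introF eqP cT) mul0r.
rewrite component_sum; apply: eq_bigr => a _; rewrite ffunE /= cT eqxx.
rewrite -(@component_mul _ _ _ (degr a - degs j)); first by congr component; lia.
by move=> m /hD ->; lia.
Qed.
End MatrixAction.

(** * Betti numbers as Koszul homology *)

Section BettiKoszul.
Variables (k : fieldType) (n : nat) (I : set (mpoly n k)).
Hypothesis char0 : [pchar k]%R =i pred0.
Variable F : min_graded_free_resolution I.
Local Notation S := (mpoly n k).
Local Notation rk j := (res_rank F j).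
Local Notation deg j := (@res_deg _ _ _ F j).
Local Notation dif j := (@res_diff _ _ _ F j).

(** Let M be the cokernel of [dif j], which is S/I for j = 0 and the j-th syzygy module otherwise.
    These are representatives of Koszul cycles with values in M, and the next definition gives the
    boundaries; the quotient is Tor_p(M, k) in degree q. *)
Definition syz_cycle j p q (f : {ffun {set 'I_n} * 'I_(rk j) -> S}) :=
  homog (deg j) p q f /\ exists h, koszul f = mact h (dif j).
Definition syz_boundary j p q (f : {ffun {set 'I_n} * 'I_(rk j) -> S}) :=
  homog (deg j) p q f /\ exists g h, f = koszul g + mact h (dif j).

Lemma mact_dif0 j (h : {ffun {set 'I_n} * 'I_(rk j.+1) -> S}) :
  mact h (dif j) = 0 -> exists e, h = mact e (dif j.+1).
Proof.
move=> h0.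
have /choice[e eP] : forall T, exists w, row_at h T = w *m dif j.+1.
  move=> T; apply/(res_exact (m := F)).
  by rewrite -row_mact h0; apply/rowP => b; rewrite !mxE ffunE.
exists [ffun x : {set 'I_n} * 'I_(rk j.+2) => e x.1 0 x.2]; apply: row_at_inj => T.
by rewrite row_mact eP; congr (_ *m _); apply/rowP => b; rewrite mxE ffunE.
Qed.

Lemma dif_dif j (e : {ffun {set 'I_n} * 'I_(rk j.+2) -> S}) :
  mact (mact e (dif j.+1)) (dif j) = 0.
Proof.
apply: row_at_inj => T; rewrite row_mact.
have -> : row_at (mact e (dif j.+1)) T *m dif j = 0.
  by apply/(res_exact (m := F)); exists (row_at e T); rewrite row_mact.
by apply/rowP => b; rewrite !mxE ffunE.
Qed.

Lemma syz_cycle_submodule j p q : submodule (@syz_cycle j p q).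
Proof.
have [h0 hD] := homog_submodule k n (deg j) p q.
split; first by split=> //; exists 0; rewrite koszul0 mact0.
move=> a x y [hx [ex Kx]] [hy [ey Ky]]; split; first exact: hD.
by exists (a *: ex + ey); rewrite koszulD koszulZ mactD mactZ Kx Ky.
Qed.

Lemma homog_mact j p q (h : {ffun {set 'I_n} * 'I_(rk j.+1) -> S}) :
  homog (deg j.+1) p q h -> homog (deg j) p q (mact h (dif j)).
Proof.
by move=> hh; rewrite -(proj_id hh) -(proj_mact _ _ _ (@res_diff_homog _ _ _ F j)); apply: proj_homog.
Qed.

Lemma koszul_homog0 r (dg : 'I_r -> int) q (f : {ffun {set 'I_n} * 'I_r -> S}) :
  homog dg 0 q f -> koszul f = 0.
Proof.
move=> hf; apply/ffunP => -[T j]; rewrite !ffunE /= big1 // => t tT.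
have [->|/(homog_cons hf)] := eqVneq (f (t |: T, j)) 0; first by rewrite mulr0 scaler0.
by rewrite cardsU1 tT.
Qed.

(** By minimality, elements coming from the next module have no constant term, so [koszul_exact]
    applies to them even in exterior degree 0. *)
Lemma mact_dif_pos j (h : {ffun {set 'I_n} * 'I_(rk j.+1) -> S}) T b m :
  m \in msupp (mact h (dif j) (T, b)) -> (0 < mdeg m)%N.
Proof.
rewrite lt0n mdeg_eq0 mcoeff_msupp; apply: contraNneq => ->.
rewrite ffunE raddf_sum big1 // => a _ /=.
by rewrite (rmorphM (mcoeff mnm0)) /= res_minimal mulr0.
Qed.

(** Dimension shifting along the exact sequence from the (j+1)-st syzygy module through the free
    module of index j to the j-th syzygy module. The relation [koszul f = mact e (dif j)] is the
    connecting map, and the free module contributes nothing by [koszul_exact]. *)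
Lemma syz_shift j p q d :
  quot_dim (@syz_cycle j.+1 p q) (@syz_boundary j.+1 p q) d ->
  quot_dim (@syz_cycle j p.+1 q) (@syz_boundary j p.+1 q) d.
Proof.
apply: (@quot_dim_transport _ _ _ _ _ _ _ (fun e f => koszul f = mact e (dif j))).
- exact: syz_cycle_submodule.
- exact: syz_cycle_submodule.
- by rewrite koszul0 mact0.
- by move=> a e e' f f' H H'; rewrite koszulD koszulZ mactD mactZ H H'.
- move=> e [he [h Ke]]; have hy := homog_mact he.
  have [||f hf fE] := koszul_exact char0 hy.
  + by rewrite koszul_mact Ke dif_dif.
  + by move=> T b m /mact_dif_pos; lia.
  by exists f => //; split=> //; exists e.
- move=> f [hf [h Kf]].
  have Kf' : koszul f = mact (proj (deg j.+1) p q h) (dif j).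
    rewrite -(proj_mact _ _ _ (@res_diff_homog _ _ _ F j)) -Kf.
    by rewrite proj_id //; apply: homog_koszul.
  exists (proj (deg j.+1) p q h) => //; split; first exact: proj_homog.
  by apply: mact_dif0; rewrite -koszul_mact -Kf' koszul_koszul.
move=> e f [he _] [hf _] Kf; split=> -[_].
  move=> [g [h eE]]; split=> //; pose g' := proj (deg j.+1) p.+1 q g.
  have hg' : homog (deg j.+1) p.+1 q g' by apply: proj_homog.
  have eE' : e = koszul g' + mact (proj (deg j.+2) p q h) (dif j.+1).
    by rewrite -(proj_id he) eE projD proj_koszul (proj_mact _ _ _ (@res_diff_homog _ _ _ F j.+1)).
  have [||//|g'' _ fE] := @koszul_exact _ _ char0 _ (deg j) p.+1 q (f - mact g' (dif j)).
  + have [_ hD] := homog_submodule k n (deg j) p.+1 q.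
    rewrite -scaleN1r addrC; apply: hD => //; exact: homog_mact.
  + by rewrite koszulB koszul_mact Kf eE' mactD dif_dif addr0 subrr.
  + by move=> *; rewrite addnS.
  by exists g'', g'; rewrite -fE subrK.
move=> [g0 [h0 fE]]; split=> //.
have [|e' eE] := @mact_dif0 j (e - koszul h0).
  by rewrite mactB -Kf fE koszulD koszul_koszul add0r koszul_mact subrr.
by exists h0, e'; rewrite -eE addrC subrK.
Qed.

Lemma mcoeff0_koszul r (g : {ffun {set 'I_n} * 'I_r -> S}) x : mcoeff mnm0 (koszul g x) = 0.
Proof.
rewrite ffunE raddf_sum big1 // => t _ /=.
by rewrite mcoeffZ (rmorphM (mcoeff mnm0)) /= mcoeffX mnm1_eq0 mul0r mulr0.
Qed.

Lemma mcoeff0_mact j (h : {ffun {set 'I_n} * 'I_(rk j.+1) -> S}) x :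
  mcoeff mnm0 (mact h (dif j) x) = 0.
Proof.
rewrite ffunE raddf_sum big1 // => a _ /=.
by rewrite (rmorphM (mcoeff mnm0)) /= res_minimal mulr0.
Qed.

(** The generators of degree q form a basis of Tor_0: constant terms read off the coordinates, since
    neither Koszul boundaries nor the image of a minimal differential have any. *)
Lemma syz_base j (q : nat) :
  quot_dim (@syz_cycle j 0 q%:Z) (@syz_boundary j 0 q%:Z) (betti F j q).
Proof.
set A := [pred a : 'I_(rk j) | deg j a == q%:Z].
pose c (i : 'I_#|A|) : {ffun {set 'I_n} * 'I_(rk j) -> S} :=
  [ffun x : {set 'I_n} * 'I_(rk j) => if x == (set0, enum_val i) then 1 else 0].
have c_homog i : homog (deg j) 0 q%:Z (c i).
  move=> T b m; rewrite ffunE; case: eqP => [[-> ->]|_]; last by rewrite msupp0.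
  rewrite msupp1 inE => /eqP ->; rewrite cards0 mdeg0; split=> //.
  have : enum_val i \in A by apply: enum_valP.
  by rewrite inE => /eqP ->; lia.
have cycle_homog (f : {ffun {set 'I_n} * 'I_(rk j) -> S}) :
    homog (deg j) 0 q%:Z f -> syz_cycle 0 q%:Z f.
  by move=> hf; split=> //; exists 0; rewrite mact0; apply: koszul_homog0 hf.
have coefS (a : 'I_#|A| -> k) i :
    mcoeff mnm0 ((\sum_l a l *: c l) (set0, enum_val i)) = a i.
  rewrite sum_ffunE raddf_sum (bigD1 i) //= big1 ?addr0 => [|l li].
    by rewrite !ffunE eqxx mcoeffZ mcoeff1 eqxx mulr1.
  rewrite !ffunE ifF ?scaler0 ?mcoeff0 //; apply/negP => /eqP[/enum_val_inj e].
  by rewrite e eqxx in li.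
have hom_sum (a : 'I_#|A| -> k) : homog (deg j) 0 q%:Z (\sum_l a l *: c l).
  exact: (submodule_sum a (homog_submodule _ _ _ _ _) c_homog).
exists c; split=> [i|z [hz _]|a].
- exact: cycle_homog.
- pose a (i : 'I_#|A|) := mcoeff mnm0 (z (set0, enum_val i)); exists a.
  have [_ hD] := homog_submodule k n (deg j) 0 q%:Z.
  have hy : homog (deg j) 0 q%:Z (z - \sum_l a l *: c l).
    by rewrite -scaleN1r addrC; apply: hD.
  split=> //; have [||g _ ->] := koszul_exact char0 hy.
  + exact: koszul_homog0 hy.
  + move=> T b m mf; rewrite addn0 lt0n mdeg_eq0; apply: contraTneq (mf) => m0.
    have [cT] := hy _ _ _ mf; rewrite m0 mdeg0 => e.
    move/eqP: cT; rewrite cards_eq0 => /eqP ->.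
    have bA : b \in A by rewrite inE; apply/eqP; lia.
    rewrite -(enum_rankK_in bA bA) mcoeff_msupp negbK.
    by rewrite ffunE raddfD /= [(- _ : {ffun _ -> _}) _]ffunE raddfN /= coefS subrr.
  by exists g, 0; rewrite mact0 addr0.
move=> [_ [g [h e]]] i; rewrite -(coefS a i) e ffunE raddfD /=.
by rewrite mcoeff0_koszul mcoeff0_mact addr0.
Qed.

Lemma betti_syz p j (q : nat) :
  quot_dim (@syz_cycle j p q%:Z) (@syz_boundary j p q%:Z) (betti F (p + j) q).
Proof.
elim: p j => [|p IH] j; first exact: syz_base.
by apply: syz_shift; rewrite addSnnS; apply: IH.
Qed.
End BettiKoszul.

(** * Fibres of the weight map *)

Section Fibres.
Variables (k : fieldType) (n : nat) (pi : 'I_n -> int * int).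
Local Notation S := (mpoly n k).
Implicit Types (x y : S) (m : multinom n) (z : int * int).

Definition weight m : int * int := \sum_i pi i *+ m i.

Lemma weightD m m' : weight (mnm_add m m') = weight m + weight m'.
Proof. by rewrite -big_split; apply: eq_bigr => i _; rewrite mnmDE mulrnDr. Qed.

Lemma weight1 t : weight (mnm1 t) = pi t.
Proof.
rewrite /weight (bigD1 t) //= mnm1E eqxx big1 ?addr0 // => i it.
by rewrite mnm1E eq_sym (negPf it).
Qed.

(* The coefficient of the point [z] in the image of the degree [d] part of [x]
   in the semigroup algebra of the points [pi i]. *)
Definition fibre (d : nat) z x : k :=
  \sum_(m <- msupp x | (mdeg m == d) && (weight m == z)) mcoeff m x.

Lemma fibreE d z x (s : seq (multinom n)) : uniq s -> {subset msupp x <= s} ->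
  fibre d z x = \sum_(m <- s | (mdeg m == d) && (weight m == z)) mcoeff m x.
Proof.
move=> us sub; rewrite /fibre [RHS](bigID (mem (msupp x))) /= [X in _ + X]big1 ?addr0; last first.
  by move=> m /andP[_ mx]; apply: memN_msupp_eq0.
rewrite -big_filter -[RHS]big_filter; apply: perm_big; apply: uniq_perm.
- exact/filter_uniq/msupp_uniq.
- exact: filter_uniq.
move=> m; rewrite !mem_filter.
by have [mx|mx] := boolP (m \in msupp x); rewrite ?andbF ?andbT //= (sub m) // andbT.
Qed.

Lemma fibre_linear d z : linear_for *%R (fibre d z).
Proof.
move=> a x y; pose s := undup (msupp x ++ msupp y ++ msupp (a *: x + y)).
have us : uniq s by apply: undup_uniq.
rewrite !(@fibreE d z _ s) //.
- by rewrite mulr_sumr -big_split; apply: eq_bigr => m _; rewrite /= mcoeffD mcoeffZ.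
- by move=> m my; rewrite mem_undup !mem_cat my !orbT.
- by move=> m my; rewrite mem_undup !mem_cat my.
- by move=> m my; rewrite mem_undup !mem_cat my !orbT.
Qed.
HB.instance Definition _ d z := GRing.isLinear.Build k S k _ (fibre d z) (fibre_linear d z).

Lemma fibre_sum d z (I : Type) (s : seq I) (P : pred I) (G : I -> S) :
  fibre d z (\sum_(i <- s | P i) G i) = \sum_(i <- s | P i) fibre d z (G i).
Proof. exact: (big_morph _ (raddfD (fibre d z)) (raddf0 (fibre d z))). Qed.

Lemma fibreZ d z a x : fibre d z (a *: x) = a * fibre d z x.
Proof. exact: (linearZ_LR (fibre d z)). Qed.

Lemma fibreX d z m : fibre d z (mpolyX k m) = ((mdeg m == d) && (weight m == z))%:R.
Proof.
rewrite /fibre msuppX big_cons big_nil addr0 mcoeffX eqxx.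
by case: (_ && _).
Qed.

(** Multiplication by a variable translates the fibres; this is what turns the Koszul differential
    into the boundary of cells. *)
Lemma fibre_var d z t x : fibre d.+1 z (mpolyX k (mnm1 t) * x) = fibre d (z - pi t) x.
Proof.
rewrite [in LHS](mpolyE x) [in RHS](mpolyE x) mulr_sumr !fibre_sum.
apply: eq_bigr => m _; rewrite -scalerAr -mpolyXD !fibreZ !fibreX mdegD mdeg1 add1n eqSS.
have -> : (weight m == z - pi t) = (pi t + weight m == z).
  by apply/eqP/eqP => [->|<-]; [rewrite subrKC|rewrite addrC addKr].
by rewrite weightD weight1.
Qed.

Lemma fibre_neq0 d z x : fibre d z x != 0 ->
  exists2 m, m \in msupp x & mdeg m = d /\ weight m = z.
Proof.
move=> nz; case: (boolP (has (fun m => (mdeg m == d) && (weight m == z)) (msupp x))).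
  by case/hasP => m mx /andP[/eqP ? /eqP ?]; exists m.
move/hasPn => no; case/eqP: nz; rewrite /fibre big_seq_cond big1 // => m /andP[/no].
by case: (_ && _).
Qed.
End Fibres.

(** * Koszul homology of the toric ring in terms of cells *)

Section ToricChains.
Variables (k : fieldType) (n : nat) (I : set (mpoly n k)) (pi : 'I_n -> int * int).
Hypothesis char0 : [pchar k]%R =i pred0.
Variable F : min_graded_free_resolution I.
Local Notation S := (mpoly n k).
Local Notation aug := (res_aug F).
Local Notation fib := (@fibre k n pi).
Hypothesis I_fibre : forall x, I x <-> forall d z, fib d z x = 0.
Variables (q : nat) (J : finType) (w : J -> int * int).
Hypothesis w_inj : injective w.
Hypothesis w_full : forall m : multinom n, mdeg m = q -> exists j, w j = weight pi m.
Local Notation sg T := (\sum_(t in T) pi t).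
Variable X : pred (J * {set 'I_n}).
Hypothesis XP : forall j T, X (j, T) <->
  exists m : multinom n, (mdeg m + #|T| = q)%N /\ weight pi m = w j - sg T.
Local Notation C0 := {ffun {set 'I_n} * 'I_(res_rank F 0) -> S}.
Local Notation deg0 := (@res_deg _ _ _ F 0).

Lemma X_down : down_closed X.
Proof.
move=> j t T; case: (boolP (t \in T)) => [tT|tT]; first by rewrite (setUidPr _) // sub1set.
case/XP => m [e em]; apply/XP; exists (mnm_add (mnm1 t) m).
rewrite mdegD mdeg1 weightD weight1 em (big_setU1 t) //=.
by split; [move: e; rewrite cardsU1 tT /=; lia | rewrite opprD addrCA addNKr].
Qed.

Definition augm (f : C0) T : S := \sum_a f (T, a) * aug a 0.

Lemma augmE f T : augm f T = (row_at f T *m aug) 0 0.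
Proof. by rewrite mxE; apply: eq_bigr => a _; rewrite mxE. Qed.

(** The quotient by the ideal is at most one-dimensional in each degree and weight, spanned by any
    monomial there, so a Koszul chain with values in it is a function on cells; [w j] is the total
    weight, including that of the exterior part [T]. *)
Definition to_cells (f : C0) : {ffun J * {set 'I_n} -> k^o} :=
  [ffun x : J * {set 'I_n} => fib (q - #|x.2|)%N (w x.1 - sg x.2) (augm f x.2)].

Lemma to_cellsD a f g : to_cells (a *: f + g) = a *: to_cells f + to_cells g.
Proof.
apply/ffunP => -[j T]; rewrite !ffunE /= -(linearP (fib _ _)); congr (fib _ _ _).
by rewrite scaler_sumr -big_split; apply: eq_bigr => b _; rewrite /= !ffunE mulrDl scalerAl.
Qed.

Lemma augm_msupp p f (T : {set 'I_n}) m : homog deg0 p q%:Z f -> m \in msupp (augm f T) ->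
  #|T| = p /\ (mdeg m + p = q)%N.
Proof.
move=> hf /msupp_sum_le/flatten_mapP[b _ /msuppM_le/allpairsP[[m1 m2] /= [m1f m2a ->]]].
have [cT e] := hf _ _ _ m1f; split=> //.
by rewrite (res_aug_homog m2a) in e; rewrite mdegD; lia.
Qed.

Lemma to_cells_chains p f : homog deg0 p q%:Z f -> to_cells f \in chains k X p.
Proof.
move=> hf; apply/chainsP => -[j T]; rewrite ffunE /= => /fibre_neq0[m mf [_ wm]].
have [cT e] := augm_msupp hf mf; split=> //; apply/XP; exists m; split=> //.
by rewrite cT.
Qed.

Lemma augm_koszul f T :
  augm (koszul f) T = \sum_(t | t \notin T) sgn k t T *: (mpolyX k (mnm1 t) * augm f (t |: T)).
Proof.
rewrite /augm; under eq_bigr => a _ do rewrite ffunE mulr_suml /=.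
rewrite exchange_big; apply: eq_bigr => t _ /=; rewrite mulr_sumr scaler_sumr.
by apply: eq_bigr => a _; rewrite -scalerAl mulrA.
Qed.

Lemma sg_setU1 t (T : {set 'I_n}) : t \notin T -> sg (t |: T) = pi t + sg T.
Proof. by move=> tT; rewrite (big_setU1 t). Qed.

Lemma fib_koszul p f (T : {set 'I_n}) z : homog deg0 p.+1 q%:Z f ->
  fib (q - #|T|)%N z (augm (koszul f) T) =
  \sum_(t | t \notin T) sgn k t T * fib (q - #|T|.+1)%N (z - pi t) (augm f (t |: T)).
Proof.
move=> hf; rewrite augm_koszul fibre_sum; apply: eq_bigr => t tT; rewrite fibreZ.
congr (_ * _); have [->|nz] := eqVneq (augm f (t |: T)) 0; first by rewrite mulr0 !raddf0.
have [m mf] : exists m, m \in msupp (augm f (t |: T)).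
  case e : (msupp (augm f (t |: T))) => [|m s]; last by exists m; rewrite inE eqxx.
  by case/eqP: nz; rewrite [LHS]mpolyE e big_nil.
have [cT e] := augm_msupp hf mf; rewrite cardsU1 tT in cT.
by rewrite -fibre_var; congr (fib _ _ _); lia.
Qed.

Lemma to_cells_koszul p f : homog deg0 p.+1 q%:Z f -> to_cells (koszul f) = bd k J n (to_cells f).
Proof.
move=> hf; apply/ffunP => -[j T]; rewrite ffunE /= (fib_koszul _ _ hf) bdE.
apply: eq_bigr => t tT; rewrite ffunE /= cardsU1 tT sg_setU1 //.
by rewrite opprD addrA addrAC.
Qed.

Lemma rows_in_image f : (forall T, I (augm f T)) -> exists h, f = mact h (res_diff F 0).
Proof.
move=> If.
have /choice[h hP] : forall T, exists v, row_at f T = v *m res_diff F 0.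
  by move=> T; apply/(res_aug_exact (m := F)); rewrite -augmE.
exists [ffun x : {set 'I_n} * 'I_(res_rank F 1) => h x.1 0 x.2]; apply: row_at_inj => T.
by rewrite row_mact hP; congr (_ *m _); apply/rowP => b; rewrite mxE ffunE.
Qed.

Lemma augm_mact h T : I (augm (mact h (res_diff F 0)) T).
Proof.
by rewrite augmE row_mact; apply/(res_aug_exact (m := F)); exists (row_at h T).
Qed.

Lemma to_cells_mact h : to_cells (mact h (res_diff F 0)) = 0.
Proof. by apply/ffunP => -[j T]; rewrite !ffunE; apply: (I_fibre _).1 (augm_mact h T) _ _. Qed.

Lemma to_cells_eq0 p f : homog deg0 p q%:Z f -> to_cells f = 0 ->
  exists h, f = mact h (res_diff F 0).
Proof.
move=> hf f0; apply: rows_in_image => T; apply/I_fibre => d z.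
apply/eqP/negPn/negP => /[dup] nz /fibre_neq0[m mf [md wm]].
have [cT e] := augm_msupp hf mf.
have [j wj] : exists j, w j = weight pi m + sg T.
  (* The indicator of [T] as an exponent vector: it completes [m] to a monomial of degree [q], whose
     weight is indexed by [J]. *)
  pose m1 : multinom n := Multinom [tuple (i \in T : nat) | i < n].
  have [|j wj] := @w_full (mnm_add m m1).
    rewrite mdegD -e -cT; congr addn; rewrite mdegE -sum1_card [RHS]big_mkcond.
    by apply: eq_bigr => i _; rewrite mnmE; case: (i \in T).
  exists j; rewrite wj weightD; congr (_ + _); rewrite [RHS]big_mkcond.
  by apply: eq_bigr => i _; rewrite mnmE; case: (i \in T).
move/eqP: nz; apply; have := congr1 (fun h : {ffun _ -> _} => h (j, T)) f0.
by rewrite !ffunE /= wj addrK wm -md cT -e addnK.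
Qed.

Lemma to_cells_lift p G : G \in chains k X p ->
  exists2 f, homog deg0 p q%:Z f & to_cells f = G.
Proof.
move=> /chainsP GX.
have /choice[m mP] : forall x : J * {set 'I_n}, exists m : multinom n,
    X x -> (mdeg m + #|x.2| = q)%N /\ weight pi m = w x.1 - sg x.2.
  move=> [j T]; case: (boolP (X (j, T))) => [/XP[m mP]|_]; first by exists m.
  by exists mnm0.
(* The prescribed coefficients are carried by one chosen monomial per cell; distinct [j] have
   distinct weights, so the fibres do not mix. *)
pose y T : S := \sum_j G (j, T) *: mpolyX k (m (j, T)).
have /choice[v vP] : forall T : {set 'I_n}, exists v : 'rV_(res_rank F 0), I (y T - (v *m aug) 0 0).
  by move=> T; apply: res_aug_surj.
pose f0 : C0 := [ffun x : {set 'I_n} * 'I_(res_rank F 0) => v x.1 0 x.2].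
exists (proj deg0 p q%:Z f0); first exact: proj_homog.
apply/ffunP => -[j T]; rewrite ffunE /=.
have [cT|ne] := eqVneq #|T| p; last first.
  have -> : augm (proj deg0 p q%:Z f0) T = 0.
    by rewrite /augm big1 // => a _; rewrite ffunE /= (negPf ne) mul0r.
  by rewrite raddf0; apply/esym/eqP; apply: contraNT ne => /GX[_ /= ->].
have augp : augm (proj deg0 p q%:Z f0) T = component (q%:Z - p%:Z) (augm f0 T).
  rewrite component_sum; apply: eq_bigr => a _; rewrite ffunE /= cT eqxx.
  rewrite -(@component_mul _ _ _ (deg0 a)); first by congr component; lia.
  by move=> u /res_aug_homog.
have augf0 : augm f0 T = (v T *m aug) 0 0.
  by rewrite augmE; congr ((_ *m _) 0 0); apply/rowP => a; rewrite mxE ffunE.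
have fib_comp z x : (p <= q)%N -> fib (q - p)%N z (component (q%:Z - p%:Z) x) = fib (q - p)%N z x.
  move=> pq; rewrite [in LHS](mpolyE x) [in RHS](mpolyE x) component_sum !fibre_sum.
  apply: eq_bigr => u _; rewrite componentZ componentX !fibreZ; congr (_ * _).
  case: ifP => // ne; rewrite raddf0 fibreX; case: eqP => //= e.
  by move/eqP: ne; case; lia.
have [pq|qp] := leqP p q; last first.
  have -> : G (j, T) = 0.
    apply/eqP/negPn/negP => /GX[/XP[u [e _]] _]; lia.
  by rewrite augp /component ifF ?raddf0 //; lia.
rewrite cT augp fib_comp // augf0.
have /eqP := (I_fibre _).1 (vP T) (q - p)%N (w j - sg T).
rewrite raddfB /= subr_eq0 => /eqP <-; rewrite /y fibre_sum (bigD1 j) //=.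
rewrite [X in _ + X]big1 ?addr0 => [|i ij].
  rewrite fibreZ fibreX; have [->|/GX[/mP/= [e ->] _]] := eqVneq (G (j, T)) 0.
    by rewrite mul0r.
  have -> : mdeg (m (j, T)) = (q - p)%N by rewrite -cT -e addnK.
  by rewrite !eqxx mulr1.
rewrite fibreZ fibreX; have [->|/GX[/mP/= [e ->] _]] := eqVneq (G (i, T)) 0.
  by rewrite mul0r.
by rewrite (inj_eq (addIr _)) (inj_eq w_inj) (negPf ij) andbF mulr0.
Qed.

(** The case j = 0 of [betti_syz], with [to_cells] as correspondence: it is onto by [to_cells_lift],
    and by [to_cells_eq0] its kernel consists of the chains with values in the ideal. *)
Theorem betti_hdim p : betti F p q = hdim (bd k J n) (chains k X) p.
Proof.
have bX : (bd k J n @: chains k X p.+1 <= chains k X p :&: lker (bd k J n))%VS.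
  apply/subvP => y /memv_imgP[g gX ->]; rewrite memv_cap memv_ker bd_bd eqxx andbT.
  exact: bd_chains X_down gX.
rewrite /hdim; apply: (quot_dim_vspace bX).
have := betti_syz char0 F p 0 q; rewrite addn0.
have kz0 f : homog deg0 p q%:Z f -> p = 0%N -> koszul f = 0.
  by move=> hf p0; rewrite p0 in hf; apply: koszul_homog0 hf.
apply: (@quot_dim_transport _ _ _ _ _ _ _ (fun f G => to_cells f = G)).
- exact: syz_cycle_submodule.
- split=> [|a x y]; first exact: mem0v.
  by move=> xZ yZ; rewrite memvD // memvZ.
- by have := to_cellsD (-1) 0 0; rewrite scaler0 addr0 scaleN1r addNr.
- by move=> a x y x' y' <- <-; rewrite to_cellsD.
- move=> f [hf [h Kf]]; exists (to_cells f) => //; rewrite memv_cap memv_ker to_cells_chains //=.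
  case: (p) hf => [|p'] hf; first by rewrite (bd_chains0 (to_cells_chains hf)).
  by rewrite -(to_cells_koszul hf) Kf to_cells_mact.
- move=> G; rewrite memv_cap memv_ker => /andP[GX /eqP dG].
  have [f hf fG] := to_cells_lift GX; exists f => //; split=> //.
  move: hf fG; case: (p) => [|p'] hf fG.
    by exists 0; rewrite mact0; apply: koszul_homog0 hf.
  by apply: (to_cells_eq0 (homog_koszul hf)); rewrite (to_cells_koszul hf) fG.
move=> f G [hf _] _ <-; split.
  move=> [_ [g [h fE]]]; have fE' : f = koszul (proj deg0 p.+1 q%:Z g) +
      mact (proj (@res_deg _ _ _ F 1) p q%:Z h) (res_diff F 0).
    by rewrite -(proj_id hf) fE projD proj_koszul (proj_mact _ _ _ (@res_diff_homog _ _ _ F 0)).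
  have hg : homog deg0 p.+1 q%:Z (proj deg0 p.+1 q%:Z g) by apply: proj_homog.
  rewrite fE' -[koszul _]scale1r to_cellsD scale1r to_cells_mact addr0 (to_cells_koszul hg).
  by apply: memv_img; apply: to_cells_chains.
case/memv_imgP => G' /to_cells_lift[g hg <-] e; split=> //.
have [_ hD] := homog_submodule k n deg0 p q%:Z.
have [||h fh] := @to_cells_eq0 p (f - koszul g).
- by rewrite -scaleN1r addrC; apply: hD => //; apply: homog_koszul.
- by rewrite -scaleN1r addrC to_cellsD scaleN1r e (to_cells_koszul hg) addNr.
by exists g, h; rewrite -fh addrC subrK.
Qed.
End ToricChains.

(** * Convex hulls of finite sets of lattice points *)

Definition det2 (R : pzRingType) (u v : R * R) : R := u.1 * v.2 - u.2 * v.1.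
Definition orient (R : pzRingType) (a b c : R * R) : R := det2 (b - a) (c - a).
Definition dot (R : pzRingType) (u v : R * R) : R := u.1 * v.1 + u.2 * v.2.

Lemma seq_argmin (T : eqType) d (V : orderType d) (F : T -> V) (s : seq T) x0 : x0 \in s ->
  exists2 a, a \in s & forall c, c \in s -> (F a <= F c)%O.
Proof.
elim: s x0 => // x s IH x0 _; case: s IH => [_|y s IH].
  by exists x; rewrite ?inE // => c; rewrite inE => /eqP ->.
have [a sa aP] := IH y (mem_head _ _).
have [le|lt] := Order.TotalTheory.leP (F x) (F a).
  exists x; rewrite ?mem_head // => c; rewrite inE => /orP[/eqP -> //|/aP].
  exact: Order.POrderTheory.le_trans.
exists a; first by rewrite inE sa orbT.
by move=> c; rewrite inE => /orP[/eqP ->|/aP //]; apply: Order.POrderTheory.ltW.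
Qed.

Lemma seq_bounded (T : eqType) (F : T -> int) (s : seq T) :
  exists2 K, 0 < K & forall c, c \in s -> `|F c| < K.
Proof.
elim: s => [|x s [K K0 KP]]; first by exists 1.
exists (K + `|F x|); first by lia.
by move=> c; rewrite inE => /orP[/eqP ->|/KP]; lia.
Qed.

Section GiftWrapping.
Variable s : seq (int * int).
Implicit Types a b c p : int * int.

Definition strict_vertex a := a \in s /\
  exists p, forall c, c \in s -> c != a -> 0 < dot p (c - a).

(** The last condition makes [a] and [b] the two extreme points on the supporting line, so that
    either end of an edge leaves no choice for the other. *)
Definition hull_edge a b := [/\ a \in s, b \in s, a != b,
  forall c, c \in s -> 0 <= orient a b c
  & forall c, c \in s -> orient a b c = 0 -> 0 <= dot (b - a) (c - a) <= dot (b - a) (b - a)].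

Lemma strict_vertex_exists x0 : x0 \in s -> exists a, strict_vertex a.
Proof.
move=> sx0; have [K K0 KP] := seq_bounded (fun c : int * int => c.2) s.
(* [2 * K] exceeds every difference of second coordinates, so this functional orders the points
   lexicographically. *)
pose p : int * int := (2 * K, 1).
have [a sa aP] := seq_argmin (dot p) sx0; exists a; split=> //; exists p => c sc ca.
have := aP _ sc; have := KP _ sc; have := KP _ sa.
move: ca; case: c sc => c1 c2 sc; case: a sa aP => a1 a2 sa aP.
rewrite /dot /= xpair_eqE negb_and => /orP ca a2K c2K le; move: le ca a2K c2K.
by have [lt|gt|->] := ltgtP a1 c1 => le [/eqP|/eqP]; nia.
Qed.

Lemma hull_edge_strict a b : hull_edge a b -> strict_vertex b.
Proof.
move=> [sa sb ab pos seg]; split=> //.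
have [K K0 KP] := seq_bounded (fun c => dot (b - a) (c - b)) s.
(* A large multiple of the inward normal, tilted against the direction of the edge: off the edge the
   normal wins, on it the tilt makes [b] the strict minimum. *)
exists (- K * (b - a).2 - (b - a).1, K * (b - a).1 - (b - a).2) => c sc cb.
have := KP _ sc; have := pos _ sc; have := seg _ sc; move: cb ab.
case: a {sa pos seg KP} => a1 a2; case: b {sb} => b1 b2; case: c {sc} => c1 c2.
rewrite /orient /det2 /dot /= !xpair_eqE.
set u1 := b1 - a1; set u2 := b2 - a2 => cb ab seg pos KP.
have -> : c1 - b1 = (c1 - a1) - u1 by rewrite /u1; ring.
have -> : c2 - b2 = (c2 - a2) - u2 by rewrite /u2; ring.
have cb' : ~~ ((c1 - a1 == u1) && (c2 - a2 == u2)) by move: cb; rewrite /u1 /u2; lia.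
have ab' : ~~ ((u1 == 0) && (u2 == 0)) by move: ab; rewrite /u1 /u2; lia.
have e1 : c1 - b1 = (c1 - a1) - u1 by rewrite /u1; ring.
have e2 : c2 - b2 = (c2 - a2) - u2 by rewrite /u2; ring.
rewrite e1 e2 in KP; move: seg pos KP cb' ab'.
move: (c1 - a1) (c2 - a2) u1 u2 {e1 e2 cb ab} => v1 v2 u1 u2 seg pos KP cb ab.
pose D := u1 * v2 - u2 * v1; pose N := u1 * (v1 - u1) + u2 * (v2 - u2).
have -> : (- K * u2 - u1) * (v1 - u1) + (K * u1 - u2) * (v2 - u2) = K * D - N.
  by rewrite /D /N; ring.
have [D0|D0|D0] := ltgtP D 0; [by move: pos; rewrite -/D; lia| |].
  have : K * 1 <= K * D by apply: ler_wpM2l; lia.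
  by move: KP; rewrite -/N; lia.
have := seg D0 => /andP[_ le]; rewrite D0 mulr0 sub0r oppr_gt0 lt_neqAle.
apply/andP; split; last by rewrite /N; lia.
apply/eqP => N0; have : (u1 * u1 + u2 * u2) * (v1 - u1) = 0.
  rewrite (_ : _ * _ = u1 * N - u2 * D); first by rewrite N0 D0; ring.
  by rewrite /N /D; ring.
have : (u1 * u1 + u2 * u2) * (v2 - u2) = 0.
  rewrite (_ : _ * _ = u2 * N + u1 * D); first by rewrite N0 D0; ring.
  by rewrite /N /D; ring.
have nz : u1 * u1 + u2 * u2 != 0 by nia.
by move=> /eqP; rewrite mulf_eq0 (negPf nz) /= => ? /eqP; rewrite mulf_eq0 (negPf nz) /=; lia.
Qed.

(** Gift wrapping: among the points of smallest slope seen from [a], measured with the functional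
    [p] that isolates [a], take the farthest. *)
Lemma next_vertex a : strict_vertex a -> (exists2 c, c \in s & c != a) ->
  exists b, hull_edge a b.
Proof.
move=> [sa [p pP]] [c0 sc0 c0a].
pose slope c : rat := (det2 p (c - a))%:~R / (dot p (c - a))%:~R.
have posp c : c \in s -> c != a -> 0 < (dot p (c - a))%:~R :> rat.
  by move=> sc ca; rewrite ltr0z pP.
have [b0] : exists2 b0, b0 \in [seq c <- s | c != a] &
    forall c, c \in [seq c <- s | c != a] -> slope b0 <= slope c.
  by apply: (@seq_argmin _ _ _ _ _ c0); rewrite mem_filter c0a.
rewrite mem_filter => /andP[b0a sb0] b0P.
have [b] : exists2 b, b \in [seq c <- s | (c != a) && (slope c == slope b0)] &
    forall c, c \in [seq c <- s | (c != a) && (slope c == slope b0)] ->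
    - dot p (b - a) <= - dot p (c - a).
  by apply: (@seq_argmin _ _ _ _ _ b0); rewrite mem_filter b0a eqxx.
rewrite mem_filter => /andP[/andP[ba /eqP slb] sb] bP.
have slE c : c \in s -> c != a -> (slope b <= slope c) =
    (det2 p (b - a) * dot p (c - a) <= det2 p (c - a) * dot p (b - a)).
  move=> sc ca; rewrite /slope ler_pdivrMr ?posp // mulrAC ler_pdivlMr ?posp //.
  by rewrite -!intrM ler_int.
have ortE c : orient a b c * dot p p =
    det2 p (c - a) * dot p (b - a) - det2 p (b - a) * dot p (c - a).
  by rewrite /orient /det2 /dot /=; ring.
have pp : 0 < dot p p.
  have := pP _ sb ba; rewrite /dot; case: (p) => p1 p2 /=.
  by have [->|n1] := eqVneq p1 0; have [->|n2] := eqVneq p2 0; nia.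
have ort c : c \in s -> 0 <= orient a b c.
  move=> sc; have [->|ca] := eqVneq c a; first by rewrite /orient subrr /det2 /=; lia.
  rewrite -(pmulr_lge0 _ pp) ortE subr_ge0 -slE // slb b0P // mem_filter ca.
  by [].
exists b; split=> //; first by rewrite eq_sym.
have bb : 0 <= dot (b - a) (b - a).
  by rewrite /dot -!expr2 addr_ge0 ?sqr_ge0.
move=> c sc o0; have [->|ca] := eqVneq c a.
  by rewrite subrr [dot _ 0](_ : _ = 0) ?lexx // /dot /= !mulr0 addr0.
have le : dot p (c - a) <= dot p (b - a).
  rewrite -lerN2; apply: bP; rewrite mem_filter ca sc andbT /=.
  rewrite -slb eq_le; apply/andP; split; last first.
    by rewrite slE // -subr_ge0 -ortE o0 mul0r.
  rewrite /slope ler_pdivrMr ?posp // mulrAC ler_pdivlMr ?posp //.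
  by rewrite -!intrM ler_int -subr_ge0 -opprB -ortE o0 mul0r oppr0.
have e : dot (b - a) (c - a) * dot p (b - a) = dot p (c - a) * dot (b - a) (b - a).
  have : dot (b - a) (c - a) * dot p (b - a) - dot p (c - a) * dot (b - a) (b - a)
     = orient a b c * det2 p (b - a) by rewrite /orient /det2 /dot /=; ring.
  by rewrite o0 mul0r => /eqP; rewrite subr_eq0 => /eqP.
have pb := pP _ sb ba; have pc := pP _ sc ca.
apply/andP; split; first by rewrite -(pmulr_lge0 _ pb) e mulr_ge0 // ltW.
by rewrite -(ler_pM2r pb) e mulrC ler_wpM2l.
Qed.

Lemma hull_edge_inj a a' b : hull_edge a b -> hull_edge a' b -> a = a'.
Proof.
move=> [sa sb ab pos seg] [sa' _ a'b pos' seg'].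
have := pos _ sa'; have := pos' _ sa; have := seg _ sa'; have := seg' _ sa.
move: ab a'b; clear sa sb pos seg sa' pos' seg'.
case: a => a1 a2; case: b => b1 b2; case: a' => c1 c2; rewrite /orient /det2 /dot !xpair_eqE /=.
set u1 := b1 - a1; set u2 := b2 - a2; set v1 := b1 - c1; set v2 := b2 - c2.
have -> : c1 - a1 = u1 - v1 by rewrite /u1 /v1; ring.
have -> : c2 - a2 = u2 - v2 by rewrite /u2 /v2; ring.
have -> : a1 - c1 = v1 - u1 by rewrite /u1 /v1; ring.
have -> : a2 - c2 = v2 - u2 by rewrite /u2 /v2; ring.
move=> ab cb H1 H2 P1 P2.
have u0 : ~~ ((u1 == 0) && (u2 == 0)) by move: ab; rewrite /u1 /u2; lia.
have v0 : ~~ ((v1 == 0) && (v2 == 0)) by move: cb; rewrite /v1 /v2; lia.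
have D0 : u1 * v2 - u2 * v1 = 0 by lia.
have /andP[uw uw'] := H2 ltac:(lia); have /andP[vw _] := H1 ltac:(lia).
suff [f1 f2] : u1 - v1 = 0 /\ u2 - v2 = 0.
  by congr pair; move: f1 f2; rewrite /u1 /v1 /u2 /v2; lia.
clearbody u1 u2 v1 v2; clear H1 H2 P1 P2 ab cb.
have uv : 0 <= u1 * v1 + u2 * v2 by lia.
have vw' : v1 * (u1 - v1) + v2 * (u2 - v2) <= 0 by lia.
have e : (u1 * v1 + u2 * v2) * ((u1 - v1) ^+ 2 + (u2 - v2) ^+ 2) <= 0.
  rewrite (_ : _ * _ = (u1 * (u1 - v1) + u2 * (u2 - v2)) * (v1 * (u1 - v1) + v2 * (u2 - v2))
     + (u1 * v2 - u2 * v1) * (u1 * v2 - u2 * v1)); last by ring.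
  by rewrite D0 mul0r addr0; apply: mulr_ge0_le0.
have uv0 : 0 < u1 * v1 + u2 * v2.
  rewrite lt_neqAle uv andbT eq_sym; apply/eqP => uv0.
  have : (u1 ^+ 2 + u2 ^+ 2) * (v1 ^+ 2 + v2 ^+ 2) = 0.
    have -> : (u1 ^+ 2 + u2 ^+ 2) * (v1 ^+ 2 + v2 ^+ 2) =
      (u1 * v1 + u2 * v2) ^+ 2 + (u1 * v2 - u2 * v1) ^+ 2 by ring.
    by rewrite uv0 D0 expr0n addr0.
  by move/eqP; rewrite mulf_eq0 !paddr_eq0 ?sqr_ge0 // !sqrf_eq0 (negPf u0) (negPf v0).
have : (u1 - v1) ^+ 2 + (u2 - v2) ^+ 2 <= 0 by rewrite -(pmulr_rle0 _ uv0).
have s1 := sqr_ge0 (u1 - v1); have s2 := sqr_ge0 (u2 - v2) => s3.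
have q1 : (u1 - v1) ^+ 2 = 0 by lia.
have q2 : (u2 - v2) ^+ 2 = 0 by lia.
by split; apply/eqP; rewrite -sqrf_eq0 ?q1 ?q2.
Qed.
End GiftWrapping.

(** * Convex polygons and the cones over them *)

Section Polygon.
Variables (R : realDomainType) (m : nat) (V : 'I_m -> R * R).
Implicit Types (i j : 'I_m) (h : R) (z : R * R).

(* The linear form on the cone over the polygon, at height [h], that cuts out
   the edge from [V i] to the next vertex. *)
Definition edge i h z : R :=
  det2 (V (ordS i) - V i) (z.1 - h * (V i).1, z.2 - h * (V i).2).

Definition convex_cycle := (2 < m)%N /\
  forall i j, j != i -> j != ordS i -> 0 < edge i 1 (V j).

Lemma edgeD i h h' z z' : edge i (h + h') (z + z') = edge i h z + edge i h' z'.
Proof. by rewrite /edge /det2 /=; ring. Qed.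
Lemma edgeN i h z : edge i (- h) (- z) = - edge i h z.
Proof. by rewrite /edge /det2 /=; ring. Qed.
Lemma edgeM i h a z : edge i (a * h) (a * z.1, a * z.2) = a * edge i h z.
Proof. by rewrite /edge /det2 /=; ring. Qed.
Lemma edge0 i : edge i 0 0 = 0.
Proof. by rewrite /edge /det2 /=; ring. Qed.
Lemma edge_start i : edge i 1 (V i) = 0.
Proof. by rewrite /edge /det2 /=; ring. Qed.
Lemma edge_end i : edge i 1 (V (ordS i)) = 0.
Proof. by rewrite /edge /det2 /=; ring. Qed.
Lemma edge_pred_end i : edge (ord_pred i) 1 (V i) = 0.
Proof. by have := edge_end (ord_pred i); rewrite ord_predK. Qed.

Hypothesis cvx : convex_cycle.

Lemma ordS_neq i : ordS i != i.
Proof.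
have [m2 _] := cvx; apply/eqP => /(congr1 val) /= /eqP.
rewrite -[X in _ == X](modn_small (ltn_ord i)) -addn1 -[X in _ == X %[mod _]]addn0 eqn_modDl.
by rewrite mod0n modn_small //; lia.
Qed.

Lemma ordSS_neq i : ordS (ordS i) != i.
Proof.
have [m2 _] := cvx; apply/eqP => /(congr1 val) /=.
have [e|lt] : (i.+1 = m :> nat) \/ (i.+1 < m)%N by have := ltn_ord i; lia.
  by rewrite {1}e modnn modn_small; lia.
rewrite (modn_small lt); have [e|lt'] : (i.+2 = m :> nat) \/ (i.+2 < m)%N by lia.
  by rewrite {1}e modnn; lia.
by rewrite modn_small; lia.
Qed.

Lemma edge_vertex i j : 0 <= edge i 1 (V j).
Proof.
have [->|ji] := eqVneq j i; first by rewrite edge_start.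
have [->|jS] := eqVneq j (ordS i); first by rewrite edge_end.
by apply/ltW; apply cvx.2.
Qed.

Lemma edge_vertex_eq0 i j : edge i 1 (V j) = 0 -> j = i \/ j = ordS i.
Proof.
move=> e; have [->|ji] := eqVneq j i; first by left.
have [->|jS] := eqVneq j (ordS i); first by right.
by have := cvx.2 _ _ ji jS; rewrite e ltxx.
Qed.

Lemma vertex_inj : injective V.
Proof.
move=> i j e; have := edge_start i; rewrite e => /edge_vertex_eq0[//|ji].
have := edge_start j; rewrite -e => /edge_vertex_eq0[//|ij].
by have := ordSS_neq i; rewrite -ji -ij eqxx.
Qed.

Lemma pred_neq i : ord_pred i != i /\ ord_pred i != ordS i.
Proof.
split; apply/eqP => e; [have := ordS_neq i|have := ordSS_neq i].
  by rewrite -{1}e ord_predK eqxx.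
by rewrite -e ord_predK eqxx.
Qed.

(** The point lies beyond the incoming edge at [V i] and on the inner side of the outgoing one, so
    all other vertices lie on one side of the line from [V i] to it; the identity expresses this in
    the frame of the two edges. *)
Lemma start_half h z i i' : 0 <= edge i h z -> edge (ord_pred i) h z < 0 ->
  0 <= det2 (V i' - V i) (z.1 - h * (V i).1, z.2 - h * (V i).2) /\
  (det2 (V i' - V i) (z.1 - h * (V i).1, z.2 - h * (V i).2) = 0 -> i' = i \/ i' = ordS i).
Proof.
set T := det2 _ _ => A0 B0.
have [p1 p2] := pred_neq i.
have N0 : 0 < edge i 1 (V (ord_pred i)) by apply: cvx.2.
have X0 := edge_vertex (ord_pred i) i'; have Y0 := edge_vertex i i'.
have e : edge i 1 (V (ord_pred i)) * T =
  edge (ord_pred i) 1 (V i') * edge i h z + edge i 1 (V i') * - edge (ord_pred i) h z.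
  by rewrite /T /edge ord_predK /det2 /=; ring.
have t1 : 0 <= edge (ord_pred i) 1 (V i') * edge i h z by apply: mulr_ge0.
have t2 : 0 <= edge i 1 (V i') * - edge (ord_pred i) h z by apply: mulr_ge0; rewrite ?oppr_ge0 // ltW.
split; first by rewrite -(pmulr_rge0 _ N0) e addr_ge0.
move=> T0; apply: edge_vertex_eq0; move/eqP: e; rewrite T0 mulr0 eq_sym paddr_eq0 //.
by move=> /andP[_]; rewrite mulf_eq0 oppr_eq0 (lt_eqF B0) orbF => /eqP.
Qed.

(** Two starts would see each other on opposite sides, so both determinants vanish and each vertex
    would be the successor of the other, impossible in a cycle of length at least 3. *)
Lemma unique_start h z i i' : 0 <= edge i h z -> edge (ord_pred i) h z < 0 ->
  0 <= edge i' h z -> edge (ord_pred i') h z < 0 -> i = i'.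
Proof.
move=> a b a' b'; have [t1 t2] := start_half i' a b; have [t1' t2'] := start_half i a' b'.
have e : det2 (V i - V i') (z.1 - h * (V i').1, z.2 - h * (V i').2) =
  - det2 (V i' - V i) (z.1 - h * (V i).1, z.2 - h * (V i).2) by rewrite /det2 /=; ring.
rewrite e in t1' t2'.
have T0 : det2 (V i' - V i) (z.1 - h * (V i).1, z.2 - h * (V i).2) = 0.
  by apply/eqP; rewrite eq_le t1 andbT -oppr_ge0.
case: (t2 T0) => // iS; case: (t2' _) => [|//|i'S]; first by rewrite T0 oppr0.
by have := ordSS_neq i; rewrite -iS -i'S eqxx.
Qed.

(** Triangulate by the diagonals from a fixed vertex: the first sign change of [G] selects the
    triangle. The coefficients are barycentric coordinates cleared of the denominator [D], so that
    the statement makes sense over the integers. *)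
Lemma fan h z : (forall i, 0 <= edge i h z) ->
  exists i0 j (b c d : R), let D := edge j 1 (V i0) in
  [/\ 0 < D, [/\ 0 <= b, 0 <= c & 0 <= d], D * h = b + c + d,
      D * z.1 = b * (V i0).1 + c * (V j).1 + d * (V (ordS j)).1 &
      D * z.2 = b * (V i0).2 + c * (V j).2 + d * (V (ordS j)).2].
Proof.
move=> pos; have [m2 _] := cvx; pose i0 := Ordinal (ltnW (ltnW m2)).
pose W k := V (insubd i0 k).
pose G k := det2 (W k - V i0) (z.1 - h * (V i0).1, z.2 - h * (V i0).2).
have ordSE k : (k.+1 < m)%N -> ordS (insubd i0 k) = insubd i0 k.+1.
  by move=> km; apply/val_inj; rewrite /= !val_insubd km ltnW // modn_small.
have Gend : G m.-1 <= 0.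
  have e : ordS (insubd i0 m.-1) = i0.
    apply/val_inj; rewrite /= val_insubd (_ : (m.-1 < m)%N = true); last by lia.
    by rewrite prednK ?modnn //; lia.
  have := pos (insubd i0 m.-1); rewrite /edge e /G /W -oppr_ge0.
  by congr (0 <= _); rewrite /det2 /=; ring.
have G1 : 0 <= G 1%N.
  have e : ordS i0 = insubd i0 1%N.
    by apply/val_inj; rewrite /= val_insubd (ltnW m2) modn_small // ltnW.
  by have := pos i0; rewrite /edge e.
have ex : exists k, (0 < k)%N && (G k.+1 <= 0).
  by exists m.-2; rewrite (_ : m.-2.+1 = m.-1) ?Gend ?andbT; lia.
case: (ex_minnP ex) => k /andP[k0 Gk] kmin.
have km : (k.+1 < m)%N.
  have : (k <= m.-2)%N by apply: kmin; rewrite (_ : m.-2.+1 = m.-1) ?Gend ?andbT; lia.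
  by lia.
have Gk0 : 0 <= G k.
  case: (k) k0 Gk kmin km => // -[_ _ _ _|k' _ _ kmin _]; first exact: G1.
  rewrite leNgt; apply/negP => /ltW Gk; have := kmin k'.+1; rewrite Gk => /(_ isT).
  by rewrite ltnn.
exists i0, (insubd i0 k), (edge (insubd i0 k) h z), (- G k.+1), (G k).
split=> /=.
- apply: cvx.2; apply/eqP => /(congr1 val) /=; rewrite val_insubd (ltnW km); first by lia.
  by rewrite modn_small //; lia.
- by rewrite oppr_ge0; split.
- by rewrite /edge /G /W -ordSE // /det2 /=; ring.
- by rewrite /edge /G /W -ordSE // /det2 /=; ring.
- by rewrite /edge /G /W -ordSE // /det2 /=; ring.
Qed.
End Polygon.

(** The successor map of gift wrapping is injective on the finite set of strict vertices, so the
    orbit of one vertex is a cycle. *)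
Lemma convex_cycle_exists (s : seq (int * int)) :
  (exists a b c, [/\ a \in s, b \in s, c \in s & orient a b c != 0]) ->
  exists m (V : 'I_m -> int * int), [/\ convex_cycle V, forall i, V i \in s &
    forall i z, z \in s -> 0 <= edge V i 1 z].
Proof.
move=> [a0 [b0 [c0 [sa0 sb0 sc0 nc]]]].
have [v0 v0P] := strict_vertex_exists sa0.
pose VT := {x : seq_sub s | `[< strict_vertex s (val x) >]}.
have nextE (x : VT) : exists y : VT, hull_edge s (val (val x)) (val (val y)).
  have /asboolP xP := valP x.
  have [|b eb] := next_vertex xP.
    have [e|ne] := eqVneq a0 (val (val x)); last by exists a0.
    exists b0 => //; apply: contra nc => /eqP ->; rewrite -e.
    by rewrite /orient subrr /det2 /= !mul0r subr0.
  have /asboolP bP := hull_edge_strict eb.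
  have sb : b \in s by case: eb.
  by exists (exist _ (SeqSub sb) bP).
have [nx nxP] := choice nextE.
have nx_inj : injective nx.
  move=> x y e; apply/val_inj/val_inj; apply: (@hull_edge_inj s _ _ (val (val (nx x)))).
    exact: nxP.
  by rewrite e; apply: nxP.
have /asboolP v0P' := v0P; have sv0 : v0 \in s by case: v0P.
pose x0 : VT := exist _ (SeqSub sv0) v0P'.
pose m := fingraph.order nx x0.
pose V (i : 'I_m) := val (val (iter i nx x0)).
have VS i : V (ordS i) = val (val (nx (iter i nx x0))).
  rewrite /V -[nx (iter i nx x0)]/(iter i.+1 nx x0).
  have -> : nat_of_ord (ordS i) = (i.+1 %% m)%N by [].
  have := ltn_ord i; rewrite leq_eqVlt => /orP[/eqP e|lt].
    by rewrite e modnn iter_order.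
  by rewrite modn_small.
have VP i : hull_edge s (V i) (V (ordS i)) by rewrite VS; apply: nxP.
have Vs i : V i \in s by case: (VP i).
have edgeE i z : edge V i 1 z = orient (V i) (V (ordS i)) z.
  by rewrite /edge /orient /det2 /=; ring.
have V_inj : injective V.
  move=> i j /val_inj/val_inj e; apply/val_inj => /=.
  have := orbit_uniq nx x0; rewrite /fingraph.orbit => /uniqP => /(_ x0) u.
  by apply: u; rewrite ?inE ?size_traject ?ltn_ord // !nth_traject ?ltn_ord.
(* A vertex on the supporting line of an edge lies between its ends, so it cannot be the strict
   minimum of a functional. *)
have strict i j : j != i -> j != ordS i -> 0 < edge V i 1 (V j).
  move=> ji jS; have [_ _ _ pos seg] := VP i; rewrite edgeE lt_neqAle pos // andbT.
  rewrite eq_sym; apply/eqP => o0; have /andP[d0 d1] := seg _ (Vs j) o0.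
  have /asboolP[_ [p pP]] := valP (iter j nx x0).
  have pi := pP _ (Vs i); have pS := pP _ (Vs (ordS i)).
  rewrite -/(V j) in pi pS.
  have {}pi := pi _; have {}pS := pS _.
  have {}pi : 0 < dot p (V i - V j) by apply: pi; apply: contraNneq ji => /V_inj ->.
  have {}pS : 0 < dot p (V (ordS i) - V j) by apply: pS; apply: contraNneq jS => /V_inj ->.
  pose u := V (ordS i) - V i; pose w := V j - V i.
  have uu : 0 < dot u u.
    rewrite lt_neqAle (le_trans d0 d1) andbT eq_sym; apply/eqP => u0.
    have : V (ordS i) - V i = 0.
      move: u0; rewrite -/u /dot; case: (u) => u1 u2 /= u0.
      by congr pair; nia.
    by move/eqP; rewrite subr_eq0 => /eqP e; have [_ _] := VP i; rewrite e eqxx.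
  have e : dot u u * dot p (V i - V j) = - (dot u w * dot p u) + orient (V i) (V (ordS i)) (V j) * det2 p u.
    by rewrite /u /w /dot /orient /det2 /=; ring.
  have e' : dot u u * dot p (V (ordS i) - V j) = (dot u u - dot u w) * dot p u + orient (V i) (V (ordS i)) (V j) * det2 p u.
    by rewrite /u /w /dot /orient /det2 /=; ring.
  rewrite o0 mul0r addr0 in e; rewrite o0 mul0r addr0 in e'.
  have f1 : 0 < dot u u * dot p (V i - V j) by apply: mulr_gt0.
  have f2 : 0 < dot u u * dot p (V (ordS i) - V j) by apply: mulr_gt0.
  rewrite e in f1; rewrite e' in f2; rewrite -/u -/w in d0 d1.
  have [t0|t0] := leP 0 (dot p u).
    by have := mulr_ge0 d0 t0; lia.
  by rewrite -subr_ge0 in d1; have := mulr_ge0_le0 d1 (ltW t0); lia.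
have m2 : (2 < m)%N.
  have [x|y] := ltnP 2 m; first by [].
  pose i : 'I_m := Ordinal (order_gt0 nx x0).
  have [_ _ ne pos _] := VP i; have [_ _ _ pos' _] := VP (ordS i).
  have SS : ordS (ordS i) = i.
    by apply/val_inj; rewrite /=; have := order_gt0 nx x0; rewrite -/m; case: (m) y => [|[|[|]]].
  rewrite SS in pos'.
  have col z : z \in s -> orient (V i) (V (ordS i)) z = 0.
    move=> sz; apply/eqP; rewrite eq_le pos // andbT -oppr_ge0.
    by have := pos' _ sz; congr (0 <= _); rewrite /orient /det2 /=; ring.
  have ca := col _ sa0; have cb := col _ sb0; have cc := col _ sc0.
  have e (t : int * int) : t = (orient (V i) (V (ordS i)) b0 - orient (V i) (V (ordS i)) a0, 0) -> True by [].
  case/eqP: nc; move: ne ca cb cc; rewrite /orient /det2 /=.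
  case: (V i) => v1 v2; case: (V (ordS i)) => w1 w2; case: (a0) => a1 a2; case: (b0) => b1 b2.
  case: (c0) => c1 c2 /=; rewrite xpair_eqE => ne ca cb cc.
  set T := _ - _.
  have t1 : T * (w1 - v1) = 0.
    rewrite /T (_ : _ * _ = (b1 - a1) * (((w1 - v1) * (c2 - v2) - (w2 - v2) * (c1 - v1)) -
       ((w1 - v1) * (a2 - v2) - (w2 - v2) * (a1 - v1)))
     - (c1 - a1) * (((w1 - v1) * (b2 - v2) - (w2 - v2) * (b1 - v1)) -
       ((w1 - v1) * (a2 - v2) - (w2 - v2) * (a1 - v1)))); last by ring.
    by rewrite ca cb cc; ring.
  have t2 : T * (w2 - v2) = 0.
    rewrite /T (_ : _ * _ = (b2 - a2) * (((w1 - v1) * (c2 - v2) - (w2 - v2) * (c1 - v1)) -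
       ((w1 - v1) * (a2 - v2) - (w2 - v2) * (a1 - v1)))
     - (c2 - a2) * (((w1 - v1) * (b2 - v2) - (w2 - v2) * (b1 - v1)) -
       ((w1 - v1) * (a2 - v2) - (w2 - v2) * (a1 - v1)))); last by ring.
    by rewrite ca cb cc; ring.
  apply/eqP; move/eqP: t1; rewrite mulf_eq0 => /orP[//|w1v1].
  by move/eqP: t2; rewrite mulf_eq0 => /orP[//|w2v2]; lia.
exists m, V; split=> // i z sz; rewrite edgeE.
by have [_ _ _ pos _] := VP i; apply: pos.
Qed.

Definition in_cone (R : realDomainType) m (V : 'I_m -> R * R) h z :=
  [forall i, 0 <= edge V i h z].
Definition in_icone (R : realDomainType) m (V : 'I_m -> R * R) h z :=
  [forall i, 0 < edge V i h z].

Section Functional.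
Variables (R : realDomainType) (m : nat) (V : 'I_m -> R * R).
Hypothesis cvx : convex_cycle V.

Lemma icone_cone h z : in_icone V h z -> in_cone V h z.
Proof. by move=> /forallP zP; apply/forallP => i; apply: ltW. Qed.

Lemma functional_ge0 p c h z : (forall j, 0 <= dot p (V j) + c) ->
  in_cone V h z -> 0 <= dot p z + c * h.
Proof.
move=> pos /forallP /(fan cvx) [i0 [j [b [c' [d [D0 [b0 c0 d0] eh e1 e2]]]]]].
rewrite -(pmulr_rge0 _ D0); set D := edge _ _ _ _ in D0 eh e1 e2 *.
have -> : D * (dot p z + c * h) = p.1 * (D * z.1) + p.2 * (D * z.2) + c * (D * h).
  by rewrite /dot; ring.
rewrite eh e1 e2.
have -> : forall x y t : R * R, p.1 * (b * x.1 + c' * y.1 + d * t.1)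
  + p.2 * (b * x.2 + c' * y.2 + d * t.2) + c * (b + c' + d) =
  b * (dot p x + c) + c' * (dot p y + c) + d * (dot p t + c).
  by move=> x y t; rewrite /dot; ring.
by rewrite !addr_ge0 // mulr_ge0.
Qed.

Lemma cone_height h z : in_cone V h z -> 0 <= h /\ (h = 0 -> z = 0).
Proof.
move=> zP; split.
  have := @functional_ge0 0 1 h z _ zP; rewrite /dot /= !mul0r !add0r mul1r; apply.
  by move=> j; rewrite !mul0r !add0r ler01.
move: zP => /forallP /(fan cvx) [i0 [j [b [c' [d [D0 [b0 c0 d0] eh e1 e2]]]]]] h0.
move/esym/eqP: eh; rewrite h0 mulr0 !paddr_eq0 ?addr_ge0 // => /andP[/andP[]].
move=> /eqP b1 /eqP c1 /eqP d1; move/eqP: e1; move/eqP: e2; rewrite b1 c1 d1 !mul0r !addr0.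
by rewrite !mulf_eq0 (gt_eqF D0) /=; case: (z) => x y /= /eqP -> /eqP ->.
Qed.
End Functional.

Section LatticePolygon.
Variables (m : nat) (V : 'I_m -> int * int).
Hypothesis cvx : convex_cycle V.
Implicit Types (q h : int) (z a p u : int * int).

Lemma functional_gt0 p c h z : p != 0 -> (forall j, 0 <= dot p (V j) + c) ->
  in_icone V h z -> 0 < dot p z + c * h.
Proof.
move=> p0 pos /forallP zP; rewrite ltNge; apply/negP => le.
(* [K] is so large that moving [K z] by [- p] does not leave the cone; there the functional would be
   negative. *)
pose K : int := 1 + \sum_i `|edge V i 0 (- p)|.
have K1 i : `|edge V i 0 (- p)| <= K.
  by rewrite /K (bigD1 i) //= addrCA lerDl addr_ge0 // sumr_ge0.
have : in_cone V (K * h) (K * z.1 - p.1, K * z.2 - p.2).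
  apply/forallP => i.
  have -> : edge V i (K * h) (K * z.1 - p.1, K * z.2 - p.2) = K * edge V i h z + edge V i 0 (- p).
    by rewrite -edgeM -edgeD addr0.
  have : K * 1 <= K * edge V i h z.
    by apply: ler_wpM2l; rewrite ?(le_trans _ (K1 i)) //; have := zP i; lia.
  by have := K1 i; lia.
move/(functional_ge0 cvx pos).
have -> : dot p (K * z.1 - p.1, K * z.2 - p.2) + c * (K * h) =
  K * (dot p z + c * h) - dot p p by rewrite /dot /=; ring.
have K0 : 0 <= K by rewrite addr_ge0 // sumr_ge0.
have := mulr_ge0_le0 K0 le.
have : 0 < dot p p.
  by move: p0; rewrite /dot; case: (p) => p1 p2 /=; rewrite xpair_eqE; nia.
by lia.
Qed.

Definition det3 (h0 : int) z0 (h1 : int) z1 (h2 : int) z2 : int :=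
  h0 * det2 z1 z2 - h1 * det2 z0 z2 + h2 * det2 z0 z1.

Lemma edge_det3 i h z : edge V i h z = det3 h z 1 (V i) 1 (V (ordS i)).
Proof. by rewrite /edge /det3 /det2 /=; ring. Qed.

Lemma det3_rot h0 z0 h1 z1 h2 z2 : det3 h0 z0 h1 z1 h2 z2 = det3 h1 z1 h2 z2 h0 z0.
Proof. by rewrite /det3 /det2; ring. Qed.

Lemma cramer (l : int -> int * int -> int) (c : int) p a0 a1 a2 h z :
  (forall h z, l h z = dot p z + c * h) ->
  det3 1 a0 1 a1 1 a2 * l h z = det3 h z 1 a1 1 a2 * l 1 a0 +
    det3 1 a0 h z 1 a2 * l 1 a1 + det3 1 a0 1 a1 h z * l 1 a2.
Proof. by move=> lE; rewrite !lE /det3 /det2 /dot; ring. Qed.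

Lemma edge_functional i : exists p (c : int), forall h z, edge V i h z = dot p z + c * h.
Proof.
exists (- (V (ordS i) - V i).2, (V (ordS i) - V i).1), (- det2 (V (ordS i) - V i) (V i)).
by move=> h z; rewrite /edge /det2 /dot /=; ring.
Qed.

Lemma edge_cramer i a0 a1 a2 h z :
  det3 1 a0 1 a1 1 a2 * edge V i h z = det3 h z 1 a1 1 a2 * edge V i 1 a0 +
    det3 1 a0 h z 1 a2 * edge V i 1 a1 + det3 1 a0 1 a1 h z * edge V i 1 a2.
Proof. by have [p [c lE]] := edge_functional i; apply: cramer. Qed.

Lemma height_cramer a0 a1 a2 h z :
  det3 1 a0 1 a1 1 a2 * h = det3 h z 1 a1 1 a2 +
    det3 1 a0 h z 1 a2 + det3 1 a0 1 a1 h z.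
Proof. by rewrite /det3 /det2; ring. Qed.

Lemma det3B0 a0 a1 a2 h z : det3 (h - 1) (z - a0) 1 a1 1 a2 = det3 h z 1 a1 1 a2 - det3 1 a0 1 a1 1 a2.
Proof. by rewrite /det3 /det2 /=; ring. Qed.
Lemma det3B1 a0 a2 h z : det3 1 a0 (h - 1) (z - a0) 1 a2 = det3 1 a0 h z 1 a2.
Proof. by rewrite /det3 /det2 /=; ring. Qed.
Lemma det3B2 a0 a1 h z : det3 1 a0 1 a1 (h - 1) (z - a0) = det3 1 a0 1 a1 h z.
Proof. by rewrite /det3 /det2 /=; ring. Qed.

(** For [z] at height 2 this is a lattice point at height 1 whose barycentric coordinates are 1
    minus those of [z]. *)
Definition mirror a0 a1 a2 z := a0 + a1 + a2 - z.
Lemma det3r0 a0 a1 a2 z : det3 1 (mirror a0 a1 a2 z) 1 a1 1 a2 =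
  det3 1 a0 1 a1 1 a2 - det3 2 z 1 a1 1 a2.
Proof. by rewrite /det3 /det2 /=; ring. Qed.
Lemma det3r1 a0 a1 a2 z : det3 1 a0 1 (mirror a0 a1 a2 z) 1 a2 =
  det3 1 a0 1 a1 1 a2 - det3 1 a0 2 z 1 a2.
Proof. by rewrite /det3 /det2 /=; ring. Qed.
Lemma det3r2 a0 a1 a2 z : det3 1 a0 1 a1 1 (mirror a0 a1 a2 z) =
  det3 1 a0 1 a1 1 a2 - det3 1 a0 1 a1 2 z.
Proof. by rewrite /det3 /det2 /=; ring. Qed.

Lemma det3s1 a0 a1 a2 z : det3 1 a0 1 a1 1 a2 * det3 1 (mirror a0 a1 a2 z) 2 z 1 a2 =
  (det3 1 a0 1 a1 1 a2 - det3 2 z 1 a1 1 a2) * det3 1 a0 2 z 1 a2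
  - det3 2 z 1 a1 1 a2 * (det3 1 a0 1 a1 1 a2 - det3 1 a0 2 z 1 a2).
Proof. by rewrite /det3 /det2 /=; ring. Qed.
Lemma det3s2 a0 a1 a2 z : det3 1 a0 1 a1 1 a2 * det3 1 (mirror a0 a1 a2 z) 1 a1 2 z =
  (det3 1 a0 1 a1 1 a2 - det3 2 z 1 a1 1 a2) * det3 1 a0 1 a1 2 z
  - det3 2 z 1 a1 1 a2 * (det3 1 a0 1 a1 1 a2 - det3 1 a0 1 a1 2 z).
Proof. by rewrite /det3 /det2 /=; ring. Qed.

(* [z], at height [h], has nonnegative barycentric coordinates in the triangle. *)
Definition triangle a0 a1 a2 h z := [/\ 0 < det3 1 a0 1 a1 1 a2,
  0 <= det3 h z 1 a1 1 a2, 0 <= det3 1 a0 h z 1 a2 & 0 <= det3 1 a0 1 a1 h z].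

Lemma triangle_rot a0 a1 a2 h z : triangle a0 a1 a2 h z -> triangle a1 a2 a0 h z.
Proof.
move=> [? ? ? ?]; split; first by rewrite -det3_rot.
- by rewrite -det3_rot.
- by rewrite -det3_rot.
- by rewrite -det3_rot.
Qed.

Lemma triangle_sub a0 a1 a2 h z : in_cone V 1 a0 -> in_cone V 1 a1 -> in_cone V 1 a2 ->
  triangle a0 a1 a2 h z -> det3 1 a0 1 a1 1 a2 <= det3 h z 1 a1 1 a2 ->
  in_cone V (h - 1) (z - a0).
Proof.
move=> /forallP A0 /forallP A1 /forallP A2 [D0 b0 c0 d0] le; apply/forallP => i.
rewrite -(pmulr_rge0 _ D0) edge_cramer det3B0 det3B1 det3B2.
by rewrite !addr_ge0 ?mulr_ge0 // subr_ge0.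
Qed.

Lemma triangle_split a0 a1 a2 z :
  triangle a0 a1 a2 2 z -> det3 2 z 1 a1 1 a2 < det3 1 a0 1 a1 1 a2 ->
  det3 2 z 1 a1 1 a2 <= det3 1 a0 2 z 1 a2 -> det3 2 z 1 a1 1 a2 <= det3 1 a0 1 a1 2 z ->
  triangle (mirror a0 a1 a2 z) a1 a2 2 z.
Proof.
move=> [D0 b0 c0 d0] lt le1 le2; split; rewrite ?det3r0 ?subr_gt0 //.
  rewrite -(pmulr_rge0 _ D0) det3s1 (_ : _ - _ = det3 1 a0 1 a1 1 a2 *
    (det3 1 a0 2 z 1 a2 - det3 2 z 1 a1 1 a2)); last by ring.
  by rewrite mulr_ge0 ?subr_ge0 // ltW.
rewrite -(pmulr_rge0 _ D0) det3s2 (_ : _ - _ = det3 1 a0 1 a1 1 a2 *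
  (det3 1 a0 1 a1 2 z - det3 2 z 1 a1 1 a2)); last by ring.
by rewrite mulr_ge0 ?subr_ge0 // ltW.
Qed.

Lemma min3 (b c d : int) :
  [\/ b <= c /\ b <= d, c <= d /\ c <= b | d <= b /\ d <= c].
Proof.
have [bc|bc] := leP b c; have [bd|bd] := leP b d; have [cd|cd] := leP c d.
all: by [apply: Or31|apply: Or32; split; lia|apply: Or33; split; lia].
Qed.

Lemma mirrorE a0 a1 a2 z : mirror a1 a2 a0 z = mirror a0 a1 a2 z.
Proof. by rewrite /mirror; congr (_ - _); rewrite addrC addrA. Qed.

Lemma mirror_cone a0 a1 a2 z : in_cone V 1 a0 -> in_cone V 1 a1 -> in_cone V 1 a2 ->
  0 < det3 1 a0 1 a1 1 a2 ->
  det3 2 z 1 a1 1 a2 < det3 1 a0 1 a1 1 a2 -> det3 1 a0 2 z 1 a2 < det3 1 a0 1 a1 1 a2 ->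
  det3 1 a0 1 a1 2 z < det3 1 a0 1 a1 1 a2 ->
  in_cone V 1 (mirror a0 a1 a2 z).
Proof.
move=> /forallP A0 /forallP A1 /forallP A2 D0 lt0 lt1 lt2; apply/forallP => i.
rewrite -(pmulr_rge0 _ D0) edge_cramer det3r0 det3r1 det3r2.
by rewrite !addr_ge0 ?mulr_ge0 // subr_ge0 ltW.
Qed.

(** Lattice polygons are normal. Take a lattice triangle over which [z] lies. If a barycentric
    coordinate is at least 1, subtract that vertex. Otherwise [h] is at most 2, and for [h = 2] the
    mirror point lies in the triangle; put in place of the vertex with the smallest coordinate, it
    gives a triangle of smaller area that still lies under [z]. *)
Lemma cone_sub_point h z : 0 < h -> in_cone V h z ->
  exists2 a, in_cone V 1 a & in_cone V (h - 1) (z - a).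
Proof.
move=> h0 zP; have Vc j : in_cone V 1 (V j) by apply/forallP => i; apply: edge_vertex.
have [i0 [j [b [c [d [D0 [b0 c0 d0] eh e1 e2]]]]]] := fan cvx (forallP zP).
have tr : triangle (V i0) (V j) (V (ordS j)) h z.
  have eD : edge V j 1 (V i0) = det3 1 (V i0) 1 (V j) 1 (V (ordS j)) by exact: edge_det3.
  rewrite eD in D0 eh e1 e2; split=> //; rewrite -(pmulr_rge0 _ D0).
  - have -> : forall D x y, D * det3 h z 1 x 1 y = det3 (D * h) (D * z.1, D * z.2) 1 x 1 y.
      by move=> D x y; rewrite /det3 /det2 /=; ring.
    rewrite eh e1 e2 [X in 0 <= X](_ : _ = b * det3 1 (V i0) 1 (V j) 1 (V (ordS j))).
      by rewrite mulr_ge0 // ltW.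
    by rewrite /det3 /det2 /=; ring.
  - have -> : forall D x y, D * det3 1 x h z 1 y = det3 1 x (D * h) (D * z.1, D * z.2) 1 y.
      by move=> D x y; rewrite /det3 /det2 /=; ring.
    rewrite eh e1 e2 [X in 0 <= X](_ : _ = c * det3 1 (V i0) 1 (V j) 1 (V (ordS j))).
      by rewrite mulr_ge0 // ltW.
    by rewrite /det3 /det2 /=; ring.
  - have -> : forall D x y, D * det3 1 x 1 y h z = det3 1 x 1 y (D * h) (D * z.1, D * z.2).
      by move=> D x y; rewrite /det3 /det2 /=; ring.
    rewrite eh e1 e2 [X in 0 <= X](_ : _ = d * det3 1 (V i0) 1 (V j) 1 (V (ordS j))).
      by rewrite mulr_ge0 // ltW.
    by rewrite /det3 /det2 /=; ring.
have A0 := Vc i0; have A1 := Vc j; have A2 := Vc (ordS j).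
move: (V i0) (V j) (V (ordS j)) A0 A1 A2 tr => {i0 j b c d b0 c0 d0 D0 eh e1 e2} a0 a1 a2 A0 A1 A2 tr.
have [n le] : exists n : nat, det3 1 a0 1 a1 1 a2 <= n%:Z.
  by exists `|det3 1 a0 1 a1 1 a2|%N; lia.
elim: n a0 a1 a2 A0 A1 A2 tr le => [|n IH] a0 a1 a2 A0 A1 A2 tr le.
  by case: tr => D0 *; lia.
have [le0|lt0] := leP (det3 1 a0 1 a1 1 a2) (det3 h z 1 a1 1 a2).
  by exists a0 => //; apply: triangle_sub tr le0.
have tr1 := triangle_rot tr; have tr2 := triangle_rot tr1.
have [le1|lt1] := leP (det3 1 a0 1 a1 1 a2) (det3 1 a0 h z 1 a2).
  by exists a1 => //; apply: triangle_sub tr1 _ => //; rewrite -!(det3_rot _ a0).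
have [le2|lt2] := leP (det3 1 a0 1 a1 1 a2) (det3 1 a0 1 a1 h z).
  by exists a2 => //; apply: triangle_sub tr2 _ => //; rewrite det3_rot [X in _ <= X]det3_rot.
have [h1|h1] := eqVneq h 1.
  exists z; first by rewrite -h1.
  by rewrite h1 !subrr; apply/forallP => i; rewrite edge0.
have hE := height_cramer a0 a1 a2 h z; have [D0 b0 c0 d0] := tr.
(* Three coordinates below the determinant add up to [h] times it, so [h] is below 3. *)
have h2 : h = 2 by nia.
subst h; have pA := mirror_cone A0 A1 A2 D0 lt0 lt1 lt2.
have [[]|[]|[]] := min3 (det3 2 z 1 a1 1 a2) (det3 1 a0 2 z 1 a2) (det3 1 a0 1 a1 2 z).
- move=> r1 r2; have tr' := triangle_split tr lt0 r1 r2.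
  have nz : det3 2 z 1 a1 1 a2 != 0 by lia.
  by apply: (IH _ _ _ pA A1 A2 tr'); rewrite det3r0; lia.
- move=> r1 r2; have tr' : triangle (mirror a1 a2 a0 z) a2 a0 2 z.
    by apply: (triangle_split tr1); rewrite -!(det3_rot _ a0) -?(det3_rot 2 z 1 a1).
  rewrite mirrorE in tr'; apply: (IH _ _ _ pA A2 A0 tr').
  have nz : det3 1 a0 2 z 1 a2 != 0 by lia.
  by rewrite -(det3_rot _ a0) det3r1; lia.
- move=> r1 r2; have tr' : triangle (mirror a2 a0 a1 z) a0 a1 2 z.
    by apply: (triangle_split tr2); rewrite !(det3_rot _ a2) ?(det3_rot 2 z 1 a0).
  rewrite 2!mirrorE in tr'; apply: (IH _ _ _ pA A0 A1 tr').
  have nz : det3 1 a0 1 a1 2 z != 0 by lia.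
  by rewrite det3_rot det3r2; lia.
Qed.

Lemma mirror_icone a0 a1 a2 z : in_icone V 1 a0 -> in_cone V 1 a1 -> in_cone V 1 a2 ->
  0 < det3 1 a0 1 a1 1 a2 ->
  det3 2 z 1 a1 1 a2 < det3 1 a0 1 a1 1 a2 -> det3 1 a0 2 z 1 a2 < det3 1 a0 1 a1 1 a2 ->
  det3 1 a0 1 a1 2 z < det3 1 a0 1 a1 1 a2 ->
  in_icone V 1 (mirror a0 a1 a2 z).
Proof.
move=> /forallP A0 /forallP A1 /forallP A2 D0 lt0 lt1 lt2; apply/forallP => i.
rewrite -(pmulr_rgt0 _ D0) edge_cramer det3r0 det3r1 det3r2.
apply/ltr_wpDr; first by apply: mulr_ge0; [rewrite subr_ge0 ltW|].
apply/ltr_wpDr; first by apply: mulr_ge0; [rewrite subr_ge0 ltW|].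
by apply: mulr_gt0 => //; rewrite subr_gt0.
Qed.

Lemma triangle_isub a0 a1 a2 h z : in_icone V 1 a0 -> in_cone V 1 a1 -> in_cone V 1 a2 ->
  triangle a0 a1 a2 h z -> 0 < det3 h z 1 a1 1 a2 ->
  det3 1 a0 1 a1 1 a2 <= det3 1 a0 h z 1 a2 -> in_icone V (h - 1) (z - a1).
Proof.
move=> /forallP A0 /forallP A1 /forallP A2 tr b0 le; apply/forallP => i.
have [D0 _ c0 d0] := tr; rewrite -(pmulr_rgt0 _ D0) edge_cramer.
have -> : det3 (h - 1) (z - a1) 1 a1 1 a2 = det3 h z 1 a1 1 a2.
  by rewrite /det3 /det2 /=; ring.
have -> : det3 1 a0 (h - 1) (z - a1) 1 a2 = det3 1 a0 h z 1 a2 - det3 1 a0 1 a1 1 a2.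
  by rewrite /det3 /det2 /=; ring.
have -> : det3 1 a0 1 a1 (h - 1) (z - a1) = det3 1 a0 1 a1 h z.
  by rewrite /det3 /det2 /=; ring.
apply/ltr_wpDr; first by apply: mulr_ge0.
apply/ltr_wpDr; first by apply: mulr_ge0 => //; rewrite subr_ge0.
by apply: mulr_gt0.
Qed.

(** The ray from [i] towards half of [u] leaves through an edge where [G] changes sign. Both signs
    occur, since otherwise a functional of constant sign on the vertices would vanish at the
    interior point [i]. *)
Lemma fan_from_interior i u : in_icone V 1 i -> in_icone V 2 u -> u != i + i ->
  exists j, triangle i (V j) (V (ordS j)) 2 u.
Proof.
move=> iP uP ui; pose G j := det3 1 i 1 (V j) 2 u.
have v0 : u - (i + i) != 0 by rewrite subr_eq0.
pose p : int * int := ((u - (i + i)).2, - (u - (i + i)).1).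
have p0 : p != 0.
  move: v0; rewrite /p; case: (u - (i + i)) => x y /=; rewrite !xpair_eqE oppr_eq0.
  by rewrite andbC.
have GE j : G j = dot p (V j) - dot p i.
  by rewrite /G /det3 /det2 /dot /=; ring.
have ex (s : int) : s = 1 \/ s = -1 -> exists j, s * G j < 0.
  move=> s1; case: (pickP (fun j => s * G j < 0)) => [j jP|no]; first by exists j.
  have := @functional_gt0 (s * p.1, s * p.2) (- (s * dot p i)) 1 i _ _ iP.
  have -> : dot (s * p.1, s * p.2) i + - (s * dot p i) * 1 = 0 by rewrite /dot /=; ring.
  rewrite ltxx => F; suff: false by []; apply: F.
    by move: p0; case: (p) => x y; rewrite !xpair_eqE /=; case: s1 => ->; rewrite ?mul1r ?mulN1r ?oppr_eq0.
  move=> j; have := no j; rewrite GE; have -> : dot (s * p.1, s * p.2) (V j) = s * dot p (V j).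
    by rewrite /dot /=; ring.
  by lia.
have [j1 j1P] := ex 1 (or_introl erefl); have [j2 j2P] := ex (-1) (or_intror erefl).
have [j /andP[jn jp]] : exists j, is_start (fun j => G j < 0) j.
  have j2n : ~~ (G j2 < 0) by lia.
  have := @exists_start _ (fun j => G j < 0) j2 ((j1 + m - j2) %% m)%N j2n.
  rewrite iter_ordS_reach; case; first by lia.
  by move=> l _ st; exists (iter l (@ordS m) j2).
exists (ord_pred j); split.
- by rewrite -edge_det3; move/forallP: iP; apply.
- by rewrite -edge_det3; apply/ltW; move/forallP: uP; apply.
- rewrite ord_predK; have -> : det3 1 i 2 u 1 (V j) = - G j.
    by rewrite /G /det3 /det2 /=; ring.
  by lia.
- by rewrite -/(G _); lia.
Qed.

(** The descent of [cone_sub_point], run on triangles with one interior vertex: the mirror point is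
    again interior, so interiority survives in one of the two summands. *)
Lemma icone2_sub i u : in_icone V 1 i -> in_icone V 2 u ->
  exists2 a, in_cone V 1 a & in_icone V 1 (u - a).
Proof.
move=> iP uP; have [->|ui] := eqVneq u (i + i).
  by exists i; rewrite ?addrK //; apply: icone_cone.
have [j tr] := fan_from_interior iP uP ui.
have Vc j' : in_cone V 1 (V j') by apply/forallP => i'; apply: edge_vertex.
have b0 : 0 < det3 2 u 1 (V j) 1 (V (ordS j)) by rewrite -edge_det3; move/forallP: uP; apply.
have A1 := Vc j; have A2 := Vc (ordS j).
move: i (V j) (V (ordS j)) iP {ui} A1 A2 tr b0 => {j} a0 a1 a2 A0 A1 A2 tr b0.
have [n le] : exists n : nat, det3 1 a0 1 a1 1 a2 <= n%:Z.
  by exists `|det3 1 a0 1 a1 1 a2|%N; lia.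
elim: n a0 a1 a2 A0 A1 A2 tr b0 le => [|n IH] a0 a1 a2 A0 A1 A2 tr b0 le.
  by case: tr => D0 *; lia.
have A0' := icone_cone A0.
have [le0|lt0] := leP (det3 1 a0 1 a1 1 a2) (det3 2 u 1 a1 1 a2).
  by exists (u - a0); rewrite ?subKr //; exact: (triangle_sub A0' A1 A2 tr le0).
have tr1 := triangle_rot tr; have tr2 := triangle_rot tr1.
have [le1|lt1] := leP (det3 1 a0 1 a1 1 a2) (det3 1 a0 2 u 1 a2).
  by exists a1 => //; exact: (triangle_isub A0 A1 A2 tr b0 le1).
have [le2|lt2] := leP (det3 1 a0 1 a1 1 a2) (det3 1 a0 1 a1 2 u).
  exists a2 => //.
  move/forallP: A0 => A0; move/forallP: A1 => A1; move/forallP: A2 => A2; apply/forallP => i.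
  have [D0 _ c0 d0] := tr; rewrite -(pmulr_rgt0 _ D0) edge_cramer.
  have -> : det3 1 (u - a2) 1 a1 1 a2 = det3 2 u 1 a1 1 a2.
    by rewrite /det3 /det2 /=; ring.
  have -> : det3 1 a0 1 (u - a2) 1 a2 = det3 1 a0 2 u 1 a2.
    by rewrite /det3 /det2 /=; ring.
  have -> : det3 1 a0 1 a1 1 (u - a2) = det3 1 a0 1 a1 2 u - det3 1 a0 1 a1 1 a2.
    by rewrite /det3 /det2 /=; ring.
  apply/ltr_wpDr; first by apply: mulr_ge0 => //; rewrite subr_ge0.
  apply/ltr_wpDr; first by apply: mulr_ge0.
  by apply: mulr_gt0.
have hE := height_cramer a0 a1 a2 2 u; have [D0 _ c0 d0] := tr.
have pA := mirror_icone A0 A1 A2 D0 lt0 lt1 lt2; have pA' := icone_cone pA.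
have [[]|[]|[]] := min3 (det3 2 u 1 a1 1 a2) (det3 1 a0 2 u 1 a2) (det3 1 a0 1 a1 2 u).
- move=> r1 r2; have tr' := triangle_split tr lt0 r1 r2.
  by apply: (IH _ _ _ pA A1 A2 tr') => //; rewrite det3r0; lia.
- move=> r1 r2; have tr' : triangle (mirror a1 a2 a0 u) a2 a0 2 u.
    by apply: (triangle_split tr1); rewrite -!(det3_rot _ a0) -?(det3_rot 2 u 1 a1).
  rewrite mirrorE in tr'.
  have nz : 0 < det3 1 a0 2 u 1 a2 by lia.
  by apply: (IH _ _ _ pA A2 A0' tr'); rewrite -(det3_rot _ a0) ?det3r1 //; lia.
- move=> r1 r2; have tr' : triangle (mirror a2 a0 a1 u) a0 a1 2 u.
    by apply: (triangle_split tr2); rewrite !(det3_rot _ a2) ?(det3_rot 2 u 1 a0).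
  rewrite 2!mirrorE in tr'.
  have nz : 0 < det3 1 a0 1 a1 2 u by lia.
  apply: (IH _ _ _ pA A0' A1 tr'); first by rewrite det3_rot.
  by rewrite det3_rot det3r2; lia.
Qed.
End LatticePolygon.

(** * Counting lattice points *)

Section Counting.
Implicit Types (P Q : pred (int * int)) (s : seq (int * int)) (z : int * int) (K : int).

Definition in_box K z := (`|z.1| <= K) && (`|z.2| <= K).

Definition int_range K : seq int := [seq i%:Z - K | i <- iota 0 (absz K).*2.+1].
Definition box K := [seq (x, y) | x <- int_range K, y <- int_range K].

Lemma mem_int_range K (x : int) : `|x| <= K -> x \in int_range K.
Proof.
move=> xK; apply/mapP; exists (absz (x + K)); last by lia.
by rewrite mem_iota; lia.
Qed.

Lemma mem_box K z : in_box K z -> z \in box K.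
Proof.
by case: z => x y /andP[? ?]; apply/allpairsP; exists (x, y); split; rewrite ?mem_int_range.
Qed.

Lemma box_uniq K : uniq (box K).
Proof.
have u : uniq (int_range K) by rewrite map_inj_uniq ?iota_uniq // => i j; lia.
by apply: allpairs_uniq => // -[? ?] [? ?].
Qed.

Definition npts P : nat := size (enum_fset (fset_set [set z | P z]%classic)).

Lemma npts_count P s : uniq s -> (forall z, P z -> z \in s) -> npts P = count P s.
Proof.
move=> us sP; rewrite -size_filter; apply/perm_size/uniq_perm; rewrite ?filter_uniq //.
have fin : finite_set [set z | P z]%classic.
  by apply: (@sub_finite_set _ _ [set` s]%classic) => // z; apply: sP.
move=> z; rewrite in_fset_set // mem_filter; apply/idP/andP.
  by rewrite classical_sets.in_setE => /= Pz; rewrite Pz sP.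
by case=> Pz _; rewrite classical_sets.in_setE.
Qed.

Lemma npts_bij P Q s (t : seq (int * int)) f g :
  (forall z, P z -> z \in s) -> (forall z, Q z -> z \in t) ->
  (forall z, P z -> Q (f z) /\ g (f z) = z) -> (forall z, Q z -> P (g z) /\ f (g z) = z) ->
  npts P = npts Q.
Proof.
move=> sP tQ fP gP.
rewrite (@npts_count P (undup s)) ?undup_uniq //; last by move=> z /sP; rewrite mem_undup.
rewrite (@npts_count Q (undup t)) ?undup_uniq //; last by move=> z /tQ; rewrite mem_undup.
rewrite -!size_filter -(size_map f); apply/perm_size/uniq_perm.
- rewrite map_inj_in_uniq ?filter_uniq ?undup_uniq // => x y.
  by rewrite !mem_filter => /andP[/fP[_ e] _] /andP[/fP[_ e'] _] eq; rewrite -e -e' eq.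
- by rewrite filter_uniq ?undup_uniq.
move=> z; rewrite mem_filter mem_undup; apply/mapP/andP.
  by move=> [x]; rewrite mem_filter => /andP[/fP[Qx _] _] ->; rewrite Qx tQ.
by move=> [/gP[Pz e] _]; exists (g z); rewrite ?mem_filter ?Pz ?mem_undup ?sP.
Qed.

Lemma npts0 P : P =1 xpred0 -> npts P = 0%N.
Proof. by move=> P0; rewrite (@npts_count P [::]) // => z; rewrite P0. Qed.
End Counting.

(** * Difference operators on lattice functions *)

Section Differences.
Implicit Types (Phi : int -> int * int -> int) (F : int -> int).

(** A sum over the whole lattice, encoded as the common value over all finite sets that contain a
    large box. *)
Definition sums Phi F := forall h, exists K, forall s, uniq s ->
  (forall z, in_box K z -> z \in s) -> \sum_(z <- s) Phi h z = F h.

Definition nabla F h := F h - F (h - 1).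

Definition shift_diff a Phi h z := Phi h z - Phi (h - 1) (z - a).

Lemma sums_shift a Phi F : sums Phi F -> sums (shift_diff a Phi) (nabla F).
Proof.
move=> S h; have [K KP] := S h; have [K' KP'] := S (h - 1).
exists (`|K| + `|K'| + `|a.1| + `|a.2|) => s us sP; rewrite sumrB /nabla KP //; last first.
  by move=> z /andP[? ?]; apply: sP; apply/andP; split; lia.
congr (_ - _); rewrite -(big_map (fun z => z - a) xpredT (Phi (h - 1))) KP' //.
  by rewrite map_inj_uniq // => x y /addIr.
move=> z /andP[? ?]; apply/mapP; exists (z + a); last by rewrite addrK.
by apply: sP; apply/andP; rewrite /=; split; lia.
Qed.

Definition diffs s Phi := foldr shift_diff Phi s.

Lemma sums_diffs s Phi F : sums Phi F -> sums (diffs s Phi) (iter (size s) nabla F).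
Proof. by move=> S; elim: s => //= a s; apply: sums_shift. Qed.

Lemma diffs_invariant a s Phi : (forall h z, Phi (h - 1) (z - a) = Phi h z) ->
  forall h z, diffs s Phi (h - 1) (z - a) = diffs s Phi h z.
Proof.
move=> inv; elim: s => //= b s IH h z; rewrite /shift_diff IH.
by rewrite [z - a - b]addrAC IH.
Qed.

(** Differences in other directions preserve invariance under the translation by [a] at height 1,
    and the difference in its own direction then gives zero. *)
Lemma diffs_eq0 a s Phi : a \in s -> (forall h z, Phi (h - 1) (z - a) = Phi h z) ->
  forall h z, diffs s Phi h z = 0.
Proof.
move=> + inv; elim: s => //= b s IH; rewrite inE => /orP[/eqP <- h z|/IH {}IH h z].
  by rewrite /shift_diff diffs_invariant ?subrr.
by rewrite /shift_diff !IH subrr.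
Qed.

Lemma diffs_sum I (r : seq I) (e : I -> int) (Phi : I -> int -> int * int -> int) s h z :
  diffs s (fun h z => \sum_(i <- r) e i * Phi i h z) h z =
  \sum_(i <- r) e i * diffs s (Phi i) h z.
Proof.
elim: s h z => //= a s IH h z; rewrite /shift_diff !IH -sumrB.
by apply: eq_bigr => i _; rewrite mulrBr.
Qed.

Lemma eq_diffs s Phi Psi : (forall h z, Phi h z = Psi h z) ->
  forall h z, diffs s Phi h z = diffs s Psi h z.
Proof. by move=> e; elim: s => //= a s IH h z; rewrite /shift_diff !IH. Qed.
End Differences.

(** * Integer sequences with vanishing iterated differences *)

Section PolynomialSequences.
Variable R : realFieldType.

(** The difference of the power of exponent n + 1 starts with n + 1 times the power of exponent n,
    so the leading term can be removed and the degree drops. *)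
Lemma antidifference (p : {poly R}) : exists q : {poly R}, q - (q \Po ('X - 1)) = p.
Proof.
have expand n : exists2 r : {poly R}, (size r <= n)%N &
    ('X - 1) ^+ n.+1 = ('X^(n.+1) : {poly R}) - (n.+1%:R : R) *: ('X^n : {poly R}) + r.
  elim: n => [|n [r sr e]]; first by exists 0; rewrite ?size_poly0 // !expr1 expr0 scale1r addr0.
  exists ((n.+1%:R : R) *: ('X^n : {poly R}) + r * 'X - r); last first.
    rewrite exprSr e -!mul_polyC !rmorph_nat -(natr1 n.+1) !exprSr; ring.
  rewrite (leq_trans (size_polyD _ _)) // geq_max size_polyN (leq_trans sr) // andbT.
  rewrite (leq_trans (size_polyD _ _)) // geq_max (leq_trans (size_scale_leq _ _)) ?size_polyXn //=.
  by have [->|r0] := eqVneq r 0; rewrite ?mul0r ?size_poly0 // size_mulX.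
have [n] := ubnP (size p); elim: n p => // n IH p; rewrite ltnS leq_eqVlt => /orP[/eqP sp|]; last exact: IH.
case: n sp IH => [/eqP|n sp IH].
  by rewrite size_poly_eq0 => /eqP -> _; exists 0%:P; rewrite comp_polyC subrr.
have [r sr e] := expand n; pose c := lead_coef p / n.+1%:R.
have [q qP] : exists q : {poly R}, q - (q \Po ('X - 1)) = (p - lead_coef p *: ('X^n : {poly R})) + c *: r.
  apply: IH; rewrite ltnS; apply: (leq_trans (size_polyD _ _)); rewrite geq_max.
  rewrite (leq_trans (size_scale_leq _ _)) // andbT; apply/leq_sizeP => j nj.
  rewrite coefB coefZ coefXn lead_coefE sp /=.
  have [->|jn] := eqVneq j n; first by rewrite mulr1 subrr.
  by rewrite mulr0 subr0 nth_default // sp ltn_neqAle eq_sym jn.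
exists (c *: ('X^(n.+1) : {poly R}) + q); rewrite comp_polyD comp_polyZ comp_Xn_poly e.
have c0 : c *: ((n.+1%:R : R) *: ('X^n : {poly R})) = lead_coef p *: ('X^n : {poly R}).
  by rewrite scalerA divfK // pnatr_eq0.
rewrite !scalerDr scalerN c0.
have -> : forall a b d f g : {poly R}, a + q - (a - b + d + f) = (q - f) + b - d by move=> *; ring.
  by rewrite qP; ring.
exact: 0.
Qed.

Lemma nabla_polynomial (F : int -> int) n : (forall h, iter n nabla F h = 0) ->
  exists p : {poly R}, forall h, (F h)%:~R = p.[h%:~R].
Proof.
elim: n F => [|n IH] F F0; first by exists 0 => h; have /= -> := F0 h; rewrite horner0.
have [|p pP] := IH (nabla F); first by move=> h; rewrite -iterSr F0.
have [q qP] := antidifference p; pose G h : R := (F h)%:~R - q.[h%:~R].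
have G1 h : G h = G (h - 1).
  apply/eqP; rewrite -subr_eq0 /G; have := pP h; rewrite -qP /nabla !hornerE horner_comp !hornerE.
  by rewrite !rmorphB /= => /eqP; rewrite -subr_eq0; congr (_ == 0); ring.
have G0 h : G h = G 0.
  have Gn (n' : nat) : G n'%:Z = G 0 by elim: n' => // n' <-; rewrite G1; congr G; lia.
  have GN (n' : nat) : G (- n'%:Z) = G 0.
    by elim: n' => [|n' <-]; rewrite ?oppr0 // [RHS]G1; congr G; lia.
  by case: h => n'; [apply: Gn|rewrite NegzE; apply: GN].
exists (q + (G 0)%:P) => h; by rewrite hornerD hornerC -(G0 h) /G addrC subrK.
Qed.
End PolynomialSequences.

(** * The Ehrhart polynomial and reciprocity *)

Section Ehrhart.
Variables (m : nat) (V : 'I_m -> int * int).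
Hypothesis cvx : convex_cycle V.
Implicit Types (h : int) (z : int * int).

Definition Vbound : int := \sum_i (`|(V i).1| + `|(V i).2|).

Lemma cone_in_box h z : in_cone V h z -> in_box (Vbound * `|h|) z.
Proof.
move=> zP; have [h0 _] := cone_height cvx zP; rewrite ger0_norm //.
have VB j : `|(V j).1| + `|(V j).2| <= Vbound.
  by rewrite /Vbound (bigD1 j) //= lerDl sumr_ge0 // => *; apply: addr_ge0.
have f p : (forall j, 0 <= dot p (V j) + Vbound) -> 0 <= dot p z + Vbound * h.
  by move=> H; apply: (functional_ge0 cvx).
have := f (1, 0); have := f (-1, 0); have := f (0, 1); have := f (0, -1).
rewrite /dot /= => f1 f2 f3 f4; rewrite /in_box.
have {}f1 := f1 (fun j => ltac:(have := VB j; lia)).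
have {}f2 := f2 (fun j => ltac:(have := VB j; lia)).
have {}f3 := f3 (fun j => ltac:(have := VB j; lia)).
have {}f4 := f4 (fun j => ltac:(have := VB j; lia)).
by lia.
Qed.

Lemma npts_cone0 : npts (in_cone V 0) = 1%N.
Proof.
rewrite (@npts_count _ [:: 0]) //=.
  by rewrite (_ : in_cone V 0 0) //; apply/forallP => i; rewrite edge0.
by move=> z /(cone_height cvx)[_ ->]; rewrite ?inE.
Qed.

Lemma cone_neg h : h < 0 -> in_cone V h =1 xpred0.
Proof. by move=> h0 z; apply/negP => /(cone_height cvx)[]; lia. Qed.

Lemma icone_le0 h : h <= 0 -> in_icone V h =1 xpred0.
Proof.
move=> h0 z; apply/negP => zP; have [h1 e] := cone_height cvx (icone_cone zP).
have {}h0 : h = 0 by lia.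
have [m2 _] := cvx; move/forallP: zP => /(_ (Ordinal (ltnW (ltnW m2)))).
by rewrite e // h0 edge0.
Qed.

(** Positive heights count the points of the dilated polygon, negative heights the interior points,
    and height 0 the origin alone; polynomiality of this one function contains reciprocity. *)
Definition ehrhart h : int := (npts (in_cone V h))%:Z + (npts (in_icone V (- h)))%:Z.

Definition weight_fun h z : int := (in_cone V h z)%:Z + (in_icone V (- h) (- z))%:Z.

Lemma sums_weight : sums weight_fun ehrhart.
Proof.
move=> h; exists (Vbound * `|h|) => s us sP; rewrite big_split /=.
have sumE (P : pred (int * int)) : \sum_(z <- s) (P z)%:Z = (count P s)%:Z.
  by elim: (s) => [|x t IH]; rewrite ?big_nil // big_cons IH /= PoszD.
rewrite !sumE; congr (_%:Z + _%:Z).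
  by rewrite (@npts_count _ s) // => z /cone_in_box/sP.
have sub z : in_icone V (- h) (- z) -> z \in s.
  move=> /icone_cone/cone_in_box; rewrite normrN => zb; apply: sP.
  by move: zb; rewrite /in_box /= !normrN.
rewrite -(npts_count us (P := fun z => in_icone V (- h) (- z))) //.
apply: (@npts_bij _ _ s (map (fun z => - z) s) (fun z => - z) (fun z => - z)) => //.
- move=> z zP; apply/mapP; exists (- z); rewrite ?opprK //.
  by apply: sub; rewrite opprK.
- by move=> z zP; rewrite opprK.
- by move=> z zP; rewrite opprK.
Qed.

(** Among the half-planes containing a point, the number of consecutive pairs minus the number of
    half-planes is 0 for the whole cycle and for the empty set, and -1 for a proper arc. *)
Lemma arc_count h z : weight_fun h z =
  \sum_i (((0 <= edge V i h z)%R && (0 <= edge V (ord_pred i) h z)%R)%:Z - ((0 <= edge V i h z)%R)%:Z) + 1.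
Proof.
pose Q i := 0 <= edge V i h z.
have -> : \sum_i (((0 <= edge V i h z)%R && (0 <= edge V (ord_pred i) h z)%R)%:Z - ((0 <= edge V i h z)%R)%:Z)
    = - \sum_i (is_start Q i)%:Z.
  rewrite -sumrN; apply: eq_bigr => i _; rewrite /is_start /Q.
  by case: (0 <= edge V i h z); case: (0 <= _).
have [m2 _] := cvx; pose i0 : 'I_m := Ordinal (ltnW (ltnW m2)).
have iconeE : in_icone V (- h) (- z) = [forall i, ~~ Q i].
  by apply: eq_forallb => i; rewrite edgeN oppr_gt0 -ltNge.
rewrite /weight_fun iconeE; have [allQ|nall] := boolP (in_cone V h z).
  have Q1 i : Q i by move/forallP: allQ; apply.
  rewrite big1 ?oppr0 => [|i _]; last by rewrite /is_start !Q1.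
  by rewrite (_ : [forall i, _] = false) //; apply/negP => /forallP/(_ i0); rewrite Q1.
have [noQ|some] := boolP [forall i, ~~ Q i].
  rewrite big1 ?oppr0 // => i _; move/forallP: noQ => /(_ i).
  by rewrite /is_start => /negPf ->.
move: nall some; rewrite !negb_forall => /existsP[j /= jn] /existsP[l /=]; rewrite negbK => lQ.
have [s ss] : exists s, is_start Q s.
  have := @exists_start _ Q j ((l + m - j) %% m)%N jn.
  rewrite iter_ordS_reach => /(_ lQ)[l' _ st].
  by exists (iter l' (@ordS m) j).
rewrite (bigD1 s) //= ss big1 // => i /negPf nis; apply/eqP; rewrite eqz_nat eqb0.
apply: contraFN nis => /andP[a b]; have /andP[a' b'] := ss; apply/eqP.
by apply: (unique_start cvx a _ a'); rewrite ltNge.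
Qed.

Lemma edge_invariant i j h z : edge V i 1 (V j) = 0 -> edge V i (h - 1) (z - V j) = edge V i h z.
Proof. by move=> e; rewrite edgeD edgeN e subr0. Qed.

(** By [arc_count] the weight is a constant plus functions that depend on one or two edges through a
    vertex. Translation by that vertex at height 1 preserves each of them, so one difference per
    vertex gives zero. *)
Theorem ehrhart_polynomial (R : realFieldType) :
  exists p : {poly R}, forall h, (ehrhart h)%:~R = p.[h%:~R].
Proof.
pose s := [seq V i | i <- enum 'I_m].
apply: (@nabla_polynomial _ _ (size s)) => h; have [K KP] := sums_diffs s sums_weight h.
rewrite -(KP (box K)) ?box_uniq //; last exact: mem_box.
apply: big1 => z _.
have Vs i : V i \in s by apply/map_f; rewrite mem_enum.
pose Phi1 i h z : int := ((0 <= edge V i h z)%R && (0 <= edge V (ord_pred i) h z)%R)%:Z.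
pose Phi2 i h z : int := ((0 <= edge V i h z)%R)%:Z.
pose Phi3 (b : unit) h z : int := 1.
have e h' z' : weight_fun h' z' = \sum_(b <- [:: tt]) 1 * (\sum_(i <- enum 'I_m) 1 * Phi1 i h' z'
   + \sum_(i <- enum 'I_m) (-1) * Phi2 i h' z' + \sum_(b <- [:: tt]) 1 * Phi3 b h' z').
  rewrite arc_count !big_seq1 !mul1r; congr (_ + _); rewrite big_enum big_enum -big_split /=.
  by apply: eq_bigr => i _; rewrite mul1r mulN1r.
have split3 (A B C : int -> int * int -> int) : forall h z,
    diffs s (fun h z => A h z + B h z + C h z) h z = diffs s A h z + diffs s B h z + diffs s C h z.
  elim: (s) => // a t IH h' z'; rewrite /= /shift_diff !IH; ring.
rewrite (eq_diffs s e) diffs_sum big_seq1 mul1r split3 !diffs_sum.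
have z1 i h' z' : diffs s (Phi1 i) h' z' = 0.
  by apply: (diffs_eq0 (Vs i)) => h2 z2; rewrite /Phi1 !edge_invariant ?edge_start ?edge_pred_end.
have z2 i h' z' : diffs s (Phi2 i) h' z' = 0.
  by apply: (diffs_eq0 (Vs i)) => h2 z2; rewrite /Phi2 edge_invariant ?edge_start.
have z3 b h' z' : diffs s (Phi3 b) h' z' = 0.
  by apply: (diffs_eq0 (Vs (Ordinal (ltnW (ltnW cvx.1))))).
rewrite !big1 ?addr0 // => i _; first by rewrite z3 mulr0.
  by rewrite z2 mulr0.
by rewrite z1 mulr0.
Qed.
End Ehrhart.

Local Open Scope classical_set_scope.
Local Open Scope ring_scope.

(** * Real hulls and affine dimension *)

Section RealPolygons.
Variable R : realType.
Implicit Types (A D : set (R * R)) (x y z : R * R) (p : int * int) (P : seq (int * int)).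

Lemma convex_setP A : @convex_set R (R^o * R^o)%type A <->
  forall x y t, A x -> A y -> 0 <= t -> t <= 1 ->
    A (t * x.1 + (1 - t) * y.1, t * x.2 + (1 - t) * y.2).
Proof.
split=> H x y t.
  move=> Ax Ay t0 t1; have := H x y (Itv01 t0 t1).
  by rewrite !classical_sets.in_setE => /(_ Ax Ay); rewrite /conv /=.
rewrite !classical_sets.in_setE => Ax Ay; have := H x y t%:num Ax Ay.
by rewrite /conv /=; apply; [apply: ge0|apply: le1].
Qed.

Lemma hull_sub A B : A `<=` B -> @convex_set R (R^o * R^o)%type B -> convex_hull A `<=` B.
Proof. by move=> AB cB; apply: smallest_sub. Qed.

Lemma sub_hull A : A `<=` convex_hull A.
Proof. exact: sub_gen_smallest. Qed.

Lemma hull_convex A x y t : convex_hull A x -> convex_hull A y -> 0 <= t -> t <= 1 ->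
  convex_hull A (t * x.1 + (1 - t) * y.1, t * x.2 + (1 - t) * y.2).
Proof.
move=> hx hy t0 t1 C [cC AC]; have /convex_setP := cC; apply=> //; first exact: hx.
exact: hy.
Qed.

Lemma halfplane_convex (p : R * R) c : @convex_set R (R^o * R^o)%type [set z | 0 <= dot p z + c].
Proof.
apply/convex_setP => x y t /= hx hy t0 t1.
have -> : dot p (t * x.1 + (1 - t) * y.1, t * x.2 + (1 - t) * y.2) + c =
  t * (dot p x + c) + (1 - t) * (dot p y + c) by rewrite /dot /=; ring.
by rewrite addr_ge0 ?mulr_ge0 ?subr_ge0.
Qed.

Lemma line_convex (p : R * R) c : @convex_set R (R^o * R^o)%type [set z | dot p z = c].
Proof.
apply/convex_setP => x y t /= hx hy t0 t1.
have -> : dot p (t * x.1 + (1 - t) * y.1, t * x.2 + (1 - t) * y.2) =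
  t * dot p x + (1 - t) * dot p y by rewrite /dot /=; ring.
by rewrite hx hy; ring.
Qed.

Lemma hull3 A a0 a1 a2 (b c d : R) z : convex_hull A a0 -> convex_hull A a1 -> convex_hull A a2 ->
  0 <= b -> 0 <= c -> 0 <= d -> 0 < b + c + d ->
  (b + c + d) * z.1 = b * a0.1 + c * a1.1 + d * a2.1 ->
  (b + c + d) * z.2 = b * a0.2 + c * a1.2 + d * a2.2 -> convex_hull A z.
Proof.
move=> h0 h1 h2 b0 c0 d0 s0 e1 e2; case: z e1 e2 => z1 z2 /= e1 e2.
have nz : b + c + d != 0 by rewrite gt_eqF.
have [cd|cd] := eqVneq (c + d) 0.
  have [c1 d1] : c = 0 /\ d = 0 by lra.
  suff -> : (z1, z2) = a0 by [].
  rewrite c1 d1 !addr0 !mul0r !addr0 in nz e1 e2.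
  by case: a0 h0 e1 e2 => a b' /= _ /(mulfI nz) -> /(mulfI nz) ->.
have cd0 : 0 < c + d by rewrite lt_neqAle eq_sym cd addr_ge0.
pose t := b / (b + c + d); pose s := c / (c + d).
have := hull_convex h1 h2 (_ : 0 <= s) (_ : s <= 1).
move=> /(_ (divr_ge0 c0 (ltW cd0))); rewrite ler_pdivrMr // mul1r lerDl => /(_ d0) h.
have := hull_convex h0 h (_ : 0 <= t) (_ : t <= 1).
move=> /(_ (divr_ge0 b0 (ltW s0))); rewrite ler_pdivrMr // mul1r -addrA lerDl => /(_ (ltW cd0)).
congr (convex_hull A _); rewrite /=; congr pair; apply: (mulfI nz); rewrite ?e1 ?e2 /t /s; field.
  by rewrite cd nz.
by rewrite cd nz.
Qed.

Lemma real_pt_det (u v : int * int) : det2 (real_pt R u) (real_pt R v) = (det2 u v)%:~R.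
Proof. by rewrite /det2 /= rmorphB !rmorphM. Qed.
Lemma real_pt_dot (u v : int * int) : dot (real_pt R u) (real_pt R v) = (dot u v)%:~R.
Proof. by rewrite /dot /= rmorphD !rmorphM. Qed.

Definition noncollinear P := exists a b c, [/\ a \in P, b \in P, c \in P & orient a b c != 0].

(** [d] is a normal of the line; for a single point any nonzero vector serves. *)
Lemma collinear_line P : ~ noncollinear P -> P != [::] ->
  exists a, exists d : int * int, [/\ a \in P, d != 0, forall c, c \in P -> dot d c = dot d a &
  (forall c, c \in P -> c = a) \/ exists2 b, b \in P & b != a].
Proof.
case: P => // a P nc _; exists a.
have [/hasP[b Pb /eqP ba]|/hasPn no] := boolP (has (fun b => b != a) (a :: P)).
  exists (- (b - a).2, (b - a).1); split; rewrite ?mem_head //; last by right; exists b => //; apply/eqP.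
    apply/negP; rewrite xpair_eqE /= oppr_eq0 => /andP[/eqP f /eqP e].
    by apply: ba; case: (b) (a) e f => b1 b2 [a1 a2] /=; rewrite -[b1 - a1]/(b1 + _); move=> *; congr pair; lia.
  move=> c Pc; have [e|e] := eqVneq (orient a b c) 0; last by case: nc; exists a, b, c; rewrite mem_head.
  by move: e; rewrite /orient /det2 /dot /=; lia.
have all c : c \in a :: P -> c = a by move=> /no; rewrite negbK => /eqP.
exists (1, 0); split; rewrite ?mem_head //; last by left.
by move=> c /all ->.
Qed.

Lemma affine_dim_unique A d d' : affine_dim A d -> affine_dim A d' -> d = d'.
Proof.
move=> [x [U [Ax yU minU dU]]] [x' [U' [Ax' yU' minU' dU']]]; rewrite -dU -dU'.
congr (\dim _); apply/eqP; rewrite eqEsubv minU ?minU' // => y Ay.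
  have -> : (y : R^o * R^o) - x' = (y - x) - ((x' : R^o * R^o) - x) by rewrite opprB addrA subrK.
  by rewrite rpredB ?yU.
have -> : (y : R^o * R^o) - x = (y - x') - ((x : R^o * R^o) - x') by rewrite opprB addrA subrK.
by rewrite rpredB ?yU'.
Qed.

Lemma affine_dim_empty d : ~ affine_dim (@lattice_hull R [::]) d.
Proof.
move=> [x [U [h _ _ _]]]; suff: (classical_sets.set0 : set (R * R)) x by [].
move: x h {U}; apply: hull_sub => [z [? //]|]; exact/convex_setP.
Qed.

Lemma affine_dim_point P a : a \in P -> (forall c, c \in P -> c = a) ->
  affine_dim (@lattice_hull R P) 0.
Proof.
move=> Pa all; have hE z : @lattice_hull R P z -> z = real_pt R a.
  move: z; apply: (@hull_sub _ [set real_pt R a]); first by move=> _ [c /= /all -> <-].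
  apply/convex_setP => x y t /= -> -> _ _; rewrite /real_pt /=; congr pair; ring.
exists (real_pt R a), 0%VS; split; rewrite ?dimv0 //.
- by apply: sub_hull; exists a.
- by move=> y /hE ->; rewrite subrr mem0v.
- by move=> W _; apply: sub0v.
Qed.

Lemma scale_pair (t a b : R) : t *: ((a, b) : R^o * R^o) = (t * a, t * b).
Proof. by []. Qed.

Lemma dim_plane : \dim (fullv : {vspace R^o * R^o}) = 2%N.
Proof. by rewrite dimvf. Qed.

Lemma affine_dim_line P a b (d : int * int) : a \in P -> b \in P -> b != a -> d != 0 ->
  (forall c, c \in P -> dot d c = dot d a) -> affine_dim (@lattice_hull R P) 1.
Proof.
move=> Pa Pb ba d0 all; pose v : R^o * R^o := real_pt R b - real_pt R a.
have v0 : v != 0.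
  apply: contra ba; rewrite subr_eq0 => /eqP[/eqP + /eqP]; rewrite !eqr_int => /eqP e /eqP f.
  by case: (b) (a) e f => ? ? [? ?] /= -> ->.
have hE (z : R * R) : @lattice_hull R P z -> dot (real_pt R d) z = dot (real_pt R d) (real_pt R a).
  move: z; apply: (@hull_sub _ [set z | dot (real_pt R d) z = dot (real_pt R d) (real_pt R a)]).
    by move=> _ [c /= /all e <-]; rewrite !real_pt_dot e.
  exact: line_convex.
exists (real_pt R a), <[v]>%VS; split; last by rewrite dim_vline v0.
- by apply: sub_hull; exists a.
- move=> y /hE e; apply/vlineP.
  have e' : dot (real_pt R d) (real_pt R b) = dot (real_pt R d) (real_pt R a).
    by rewrite !real_pt_dot (all _ Pb).
  pose y0 : R * R := (y.1 - (real_pt R a).1, y.2 - (real_pt R a).2).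
  have ey : (y : R^o * R^o) - real_pt R a = y0 by [].
  pose v1 := (real_pt R b).1 - (real_pt R a).1; pose v2 := (real_pt R b).2 - (real_pt R a).2.
  have ev : v = (v1, v2) by [].
  have nz : v1 * v1 + v2 * v2 != 0.
    rewrite paddr_eq0 -?expr2 ?sqr_ge0 // !sqrf_eq0; apply: contra v0 => /andP[/eqP f1 /eqP f2].
    by rewrite ev f1 f2.
  exists ((y0.1 * v1 + y0.2 * v2) / (v1 * v1 + v2 * v2)); rewrite ey ev.
  have dz : (real_pt R d).1 * v1 + (real_pt R d).2 * v2 = 0.
    by move: e'; rewrite /dot /v1 /v2; lra.
  have dy : (real_pt R d).1 * y0.1 + (real_pt R d).2 * y0.2 = 0.
    by move: e; rewrite /dot /y0 /=; lra.
  have par : y0.1 * v2 = y0.2 * v1.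
    have [d1|d1] := eqVneq (real_pt R d).1 0.
      have d2 : (real_pt R d).2 != 0.
        apply: contra d0 => d2; move: d1 d2; case: (d) => ? ? /= /eqP; rewrite !intr_eq0.
        by move=> /eqP -> /eqP ->.
      have e2 : v2 = 0 by move: dz; rewrite d1 mul0r add0r => /eqP; rewrite mulf_eq0 (negPf d2) => /eqP.
      have e3 : y0.2 = 0 by move: dy; rewrite d1 mul0r add0r => /eqP; rewrite mulf_eq0 (negPf d2) => /eqP.
      by rewrite e2 e3 mulr0 mul0r.
    apply: (mulfI d1); apply/eqP; rewrite -subr_eq0; apply/eqP.
    have -> : (real_pt R d).1 * (y0.1 * v2) - (real_pt R d).1 * (y0.2 * v1) =
       ((real_pt R d).1 * y0.1 + (real_pt R d).2 * y0.2) * v2 -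
       y0.2 * ((real_pt R d).1 * v1 + (real_pt R d).2 * v2) by ring.
    by rewrite dz dy mul0r mulr0 subrr.
  rewrite scale_pair /y0; congr pair; rewrite -/y0 mulrAC; apply: (canRL (mulfK nz)).
    have p1 : y0.1 * v2 * v2 = y0.2 * v1 * v2 by rewrite par.
    by rewrite -[y.1 - _]/(y0.1) mulrDr [y0.1 * (v2 * v2)]mulrA p1; ring.
    have p1 : y0.1 * v2 * v1 = y0.2 * v1 * v1 by rewrite par.
    by rewrite -[y.2 - _]/(y0.2) mulrDr [y0.2 * (v1 * v1)]mulrA -p1; ring.
- move=> W WP; rewrite -memvE; apply: (WP (real_pt R b)).
  by apply: sub_hull; exists b.
Qed.

Lemma affine_dim_plane P : noncollinear P -> affine_dim (@lattice_hull R P) 2.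
Proof.
move=> [a [b [c [Pa Pb Pc nz]]]].
have mem q : q \in P -> @lattice_hull R P (real_pt R q) by move=> Pq; apply: sub_hull; exists q.
exists (real_pt R a), fullv; split; [exact: mem|by move=> y _; apply: memvf| |exact: dim_plane].
move=> W WP; apply/subvP => w _; have Wb := WP _ (mem _ Pb); have Wc := WP _ (mem _ Pc).
pose u := real_pt R (b - a); pose v := real_pt R (c - a); pose D := det2 u v.
have D0 : D != 0 by rewrite /D real_pt_det intr_eq0.
have -> : w = ((w.1 * v.2 - w.2 * v.1) / D) *: ((real_pt R b : R^o * R^o) - real_pt R a) +
   ((u.1 * w.2 - u.2 * w.1) / D) *: ((real_pt R c : R^o * R^o) - real_pt R a).
  have -> : (real_pt R b : R^o * R^o) - real_pt R a = u by rewrite /u /real_pt /= !rmorphB.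
  have -> : (real_pt R c : R^o * R^o) - real_pt R a = v by rewrite /v /real_pt /= !rmorphB.
  rewrite {}/D in D0 *; case: u v D0 w => u1 u2 [v1 v2] D0 [w1 w2].
  rewrite !scale_pair; congr pair; rewrite /det2 /= in D0 *.
    by field.
  by field.
by rewrite memvD ?memvZ.
Qed.

Lemma affine_dim2_noncollinear P : affine_dim (@lattice_hull R P) 2 -> noncollinear P.
Proof.
move=> d2; apply: contrapT => nc; have [P0|P0] := eqVneq P [::].
  by rewrite P0 in d2; apply: affine_dim_empty d2.
have [a [d [Pa d0 all [all1|[b Pb ba]]]]] := collinear_line nc P0.
  by have := affine_dim_unique d2 (affine_dim_point Pa all1).
by have := affine_dim_unique d2 (affine_dim_line Pa Pb ba d0 all).
Qed.
End RealPolygons.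

Local Close Scope classical_set_scope.

Local Open Scope classical_set_scope.
Local Open Scope ring_scope.

(** * A real polygon from its cycle of lattice vertices *)

Section PolygonData.
Variable R : realType.
Implicit Types (D : set (R * R)) (z : R * R).

Section Cycle.
Variables (m : nat) (V : 'I_m -> int * int).
Hypothesis cvx : convex_cycle V.

Definition real_cycle i : R * R := real_pt R (V i).
Definition edge_normal i : int * int := (- (V (ordS i) - V i).2, (V (ordS i) - V i).1).
Definition edge_const i : int := - det2 (V (ordS i) - V i) (V i).

Lemma edgeE i (h : int) (p : int * int) : edge V i h p = dot (edge_normal i) p + edge_const i * h.
Proof. by rewrite /edge /edge_normal /edge_const /det2 /dot /=; ring. Qed.

Lemma real_edgeE i h z :
  edge real_cycle i h z = dot (real_pt R (edge_normal i)) z + (edge_const i)%:~R * h.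
Proof.
rewrite /edge /edge_normal /edge_const /det2 /dot /real_cycle /=.
by rewrite !rmorphN /= !rmorphB /= !rmorphM /= !rmorphB /=; ring.
Qed.

Lemma edge_real_pt i (h : int) (p : int * int) :
  edge real_cycle i h%:~R (real_pt R p) = (edge V i h p)%:~R.
Proof. by rewrite real_edgeE edgeE real_pt_dot [RHS]intrD intrM. Qed.

Lemma real_convex_cycle : convex_cycle real_cycle.
Proof.
have [m2 pos] := cvx; split=> // i j ji jS.
by rewrite -[1]/(1%:~R) edge_real_pt ltr0z pos.
Qed.

Lemma cone_pt (h : int) (p : int * int) :
  (forall i, 0 <= edge real_cycle i h%:~R (real_pt R p)) <-> in_cone V h p.
Proof.
split=> [H|/forallP H i]; last by rewrite edge_real_pt ler0z.
by apply/forallP => i; have := H i; rewrite edge_real_pt ler0z.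
Qed.

Definition polygon_set : set (R * R) := [set z | forall i, 0 <= edge real_cycle i 1 z].

Definition normal_size : int := \sum_i (`|(edge_normal i).1| + `|(edge_normal i).2|).

Lemma normal_size_ge i : `|(edge_normal i).1| + `|(edge_normal i).2| <= normal_size.
Proof. by rewrite /normal_size (bigD1 i) //= lerDl sumr_ge0 // => *; apply: addr_ge0. Qed.

(** Integrality gives a strictly positive edge functional the margin 1 at a lattice point, which
    leaves room for a ball; conversely a point on an edge line is pushed out of the polygon along
    the normal. *)
Lemma interior_pt (p : int * int) : polygon_set^° (real_pt R p) <-> in_icone V 1 p.
Proof.
split.
  rewrite /interior => /nbhs_ballP[e /= e0 eP]; apply/forallP => i; rewrite ltNge; apply/negP => le.
  pose n := edge_normal i.
  have n0 : 0 < dot n n.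
    have [_ pos] := cvx; have := pos i (ord_pred i) (pred_neq cvx i).1 (pred_neq cvx i).2.
    have := edge_start V i; rewrite !edgeE -/n => e1 e2.
    have {e1 e2} : dot n (V i) < dot n (V (ord_pred i)) by lia.
    rewrite /dot; case: (n) => n1 n2 /=.
    have [-> |] := eqVneq n1 0; first by have [->|] := eqVneq n2 0; nia.
    nia.
  pose t := e / (2 * (`|n.1%:~R| + `|n.2%:~R| + 1)).
  have d0 : 0 < 2 * (`|n.1%:~R| + `|n.2%:~R| + 1) :> R.
    by rewrite mulr_gt0 // ltr_wpDl ?addr_ge0.
  have t0 : 0 < t by rewrite divr_gt0.
  have tE : 2 * (`|n.1%:~R| + `|n.2%:~R| + 1) * t = e by rewrite mulrC divfK ?gt_eqF.
  have small (a : R) : `|a| <= `|n.1%:~R| + `|n.2%:~R| -> `|t * a| < e.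
    move=> aP; rewrite normrM (gtr0_norm t0) -tE mulrC ltr_pM2r //.
    by have := normr_ge0 (n.1%:~R : R); have := normr_ge0 (n.2%:~R : R); lra.
  have /eP/(_ i) : ball (real_pt R p) e (p.1%:~R - t * n.1%:~R, p.2%:~R - t * n.2%:~R).
    by split; rewrite /ball /= opprB addrCA subrr addr0; apply: small; rewrite ?lerDl ?lerDr.
  rewrite real_edgeE; have := edge_real_pt i 1 p; rewrite real_edgeE /=.
  have : (edge V i 1 p)%:~R <= 0 :> R by rewrite lerz0.
  have -> : dot (real_pt R n) (p.1%:~R - t * n.1%:~R, p.2%:~R - t * n.2%:~R) =
     dot (real_pt R n) (real_pt R p) - t * (dot n n)%:~R.
    by rewrite -real_pt_dot /dot /=; ring.
  have : 0 < t * (dot n n)%:~R by rewrite mulr_gt0 // ltr0z.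
  by rewrite -/n mulr1z !mulr1; move: (t * _) => T; lra.
move=> /forallP pP; rewrite /interior; apply/nbhs_ballP.
(* Over this radius no edge functional changes by more than 1. *)
exists ((normal_size + 1)%:~R)^-1.
  have : 0 <= normal_size by rewrite sumr_ge0 // => *; apply: addr_ge0.
  by move=> ?; rewrite /= invr_gt0 ltr0z; lia.
set e := _^-1 => -[y1 y2] [/= b1 b2] i.
have e0 : 0 <= e.
  rewrite invr_ge0 ler0z addr_ge0 // sumr_ge0 // => *; exact: addr_ge0.
have eE : (normal_size + 1)%:~R * e = 1.
  rewrite mulfV // intr_eq0; have : 0 <= normal_size by rewrite sumr_ge0 // => *; apply: addr_ge0.
  by move=> ?; lia.
have p1 : 1 <= (edge V i 1 p)%:~R :> R by rewrite ler1z; have := pP i; lia.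
rewrite -edge_real_pt real_edgeE in p1; rewrite real_edgeE.
have nb : (`|(edge_normal i).1| + `|(edge_normal i).2|)%:~R * e <= 1 :> R.
  rewrite -[leRHS]eE; apply: ler_wpM2r => //; rewrite ler_int; have := normal_size_ge i; lia.
rewrite intrD !intr_norm in nb.
move: p1 nb b1 b2; rewrite /ball /= /dot /=.
move: (edge_normal i).1%:~R (edge_normal i).2%:~R (edge_const i)%:~R => a b c.
move: p.1%:~R p.2%:~R => x1 x2 p1 nb b1 b2.
have h1 : `|a * (x1 - y1)| <= `|a| * e by rewrite normrM ler_wpM2l // ltW.
have h2 : `|b * (x2 - y2)| <= `|b| * e by rewrite normrM ler_wpM2l // ltW.
have := ler_norm (a * (x1 - y1)); have := ler_norm (b * (x2 - y2)).
by move: h1 h2 nb; rewrite mulrDl; move: (`|a| * e) (`|b| * e) => A B; lra.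
Qed.
End Cycle.

Lemma polygon_data D : lattice_polygon D -> affine_dim D 2 ->
  exists m (V : 'I_m -> int * int), convex_cycle V /\ D = polygon_set V.
Proof.
move=> [s ->] /affine_dim2_noncollinear /convex_cycle_exists [m [V [cvx Vs Vpos]]].
exists m, V; split=> //; apply/seteqP; split.
  move=> z hz i; move: z hz; apply: (@hull_sub _ _ [set z | 0 <= edge (real_cycle V) i 1 z]).
    by move=> _ [p /= sp <-]; rewrite -[1]/(1%:~R) edge_real_pt ler0z Vpos.
  have -> : [set z | 0 <= edge (real_cycle V) i 1 z] =
    [set z | 0 <= dot (real_pt R (edge_normal V i)) z + (edge_const V i)%:~R].
    by apply/seteqP; split=> z /=; rewrite real_edgeE mulr1.
  exact: halfplane_convex.
move=> z /(fan (real_convex_cycle cvx)) [i0 [j [b [c [d [D0 [b0 c0 d0] eh e1 e2]]]]]].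
rewrite mulr1 in eh; rewrite eh in D0 e1 e2.
have hV i : lattice_hull s (real_cycle V i) by apply: sub_hull; exists (V i) => //=.
exact: (hull3 (hV i0) (hV j) (hV (ordS j)) b0 c0 d0).
Qed.
End PolygonData.

Local Close Scope classical_set_scope.

Local Open Scope classical_set_scope.
Local Open Scope ring_scope.

(** * The area as leading coefficient of the Ehrhart polynomial *)

Lemma linear_growth (R : realType) (r : {poly R}) (C : R) (n0 : nat) :
  (forall n, (n0 <= n)%N -> `|r.[n%:R]| <= C * n.+1%:R) -> (size r <= 2)%N.
Proof.
move=> rC; rewrite leqNgt; apply/negP => sr.
have [d sd] : exists d, size r = d.+3 by exists (size r - 3)%N; lia.
pose M : R := \sum_(i < d.+2) `|r`_i|.
have C0 : 0 <= C.
  by have := le_trans (normr_ge0 _) (rC _ (leqnn n0)); rewrite pmulr_lge0.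
have M0 : 0 <= M by rewrite sumr_ge0.
have bound n : (n0 <= n)%N -> (0 < n)%N -> `|lead_coef r| * n%:R <= 2 * C + M.
  move=> n0n ngt0; have n1 : 1 <= n%:R :> R by rewrite ler1n.
  have np : 0 < n%:R ^+ d.+1 :> R by rewrite exprn_gt0 // ltr0n.
  rewrite -(ler_pM2r np) -mulrA -exprS.
  have -> : `|lead_coef r| * n%:R ^+ d.+2 = `|r.[n%:R] - \sum_(i < d.+2) r`_i * n%:R ^+ i|.
    rewrite horner_coef sd big_ord_recr /= addrC addrK normrM lead_coefE sd /=.
    by congr (_ * _); rewrite ger0_norm // exprn_ge0.
  rewrite (le_trans (ler_normB _ _)) // mulrDl lerD //.
    rewrite (le_trans (rC _ n0n)) // [2 * C]mulrC -mulrA ler_wpM2l // -natr1.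
    have : n%:R <= n%:R ^+ d.+1 :> R by rewrite -[leLHS]expr1 ler_weXn2l.
    by move=> h1; lra.
  rewrite (le_trans (ler_norm_sum _ _ _)) // mulr_suml ler_sum // => i _.
  rewrite normrM ler_wpM2l // ger0_norm ?exprn_ge0 // ler_weXn2l //.
  by rewrite -ltnS.
have l0 : 0 < `|lead_coef r| by rewrite normr_gt0 lead_coef_eq0 -size_poly_gt0 sd.
pose B := (2 * C + M) / `|lead_coef r|.
have B0 : 0 <= B by rewrite divr_ge0 // addr_ge0 // mulr_ge0.
have := bound (maxn n0 (Num.bound B)).+1; rewrite leqW ?leq_maxl // => /(_ isT isT).
rewrite mulrC -ler_pdivlMr // -/B leNgt => /negP; apply.
by rewrite (lt_le_trans (archi_boundP B0)) // ler_nat leqW // leq_maxr.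
Qed.

Section Area.
Variables (R : realType) (m : nat) (V : 'I_m -> int * int).
Hypothesis cvx : convex_cycle V.
Implicit Types (q : nat) (w : int * int) (z : R * R) (s : seq (int * int)).

Notation mu := (@lebesgue_measure R \x @lebesgue_measure R)%E.

(** Half-open, so that the squares of the grid of mesh 1/q tile the plane without overlap. *)
Definition strip q (a : int) : set R := [set` `[a%:~R / q%:R, (a + 1)%:~R / q%:R[ ].
Definition square q w := strip q w.1 `*` strip q w.2.
Definition squares q s : set (R * R) := [set z | exists2 w, w \in s & square q w z].

Lemma stripE q a x : (0 < q)%N -> strip q a x <-> a%:~R <= q%:R * x < a%:~R + 1.
Proof.
move=> q0; have q1 : 0 < q%:R :> R by rewrite ltr0n.
by rewrite /strip /= in_itv /= ler_pdivrMr // ltr_pdivlMr // mulrC intrD.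
Qed.

Lemma strip_inj q a b x : (0 < q)%N -> strip q a x -> strip q b x -> a = b.
Proof.
move=> q0 /(stripE _ _ q0) /andP[a1 a2] /(stripE _ _ q0) /andP[b1 b2].
have := le_lt_trans a1 b2; have := le_lt_trans b1 a2.
by rewrite -[1]/(1%:~R) -!intrD !ltr_int; lia.
Qed.

Lemma measurable_strip q a : measurable (strip q a).
Proof. exact: measurable_itv. Qed.

Lemma strip_measure q a : (0 < q)%N -> lebesgue_measure (strip q a) = (q%:R^-1)%:E.
Proof.
move=> q0; have q1 : 0 < q%:R :> R by rewrite ltr0n.
rewrite /strip lebesgue_measure_itv /= lte_fin ltr_pM2r ?invr_gt0 // ltr_int.
by rewrite ltrDl ltr01 -EFinB -mulrBl -intrB addrC addKr mul1r.
Qed.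

Lemma squares_measure q s : (0 < q)%N -> uniq s ->
  measurable (squares q s) /\ mu (squares q s) = ((size s)%:R / q%:R ^+ 2)%:E.
Proof.
move=> q0; elim: s => [_|w s IH /= /andP[ws /IH [ms es]]].
  have -> : squares q [::] = classical_sets.set0 by apply/seteqP; split=> // z [].
  by split=> //; rewrite measure0 mul0r.
have mw : measurable (square q w) by apply: measurableX; apply: measurable_strip.
have -> : squares q (w :: s) = square q w `|` squares q s.
  apply/seteqP; split=> z.
    by move=> [v]; rewrite inE => /orP[/eqP -> ?|vs ?]; [left|right; exists v].
  by move=> [?|[v vs ?]]; [exists w; rewrite ?mem_head|exists v; rewrite // inE vs orbT].
have disj : square q w `&` squares q s = classical_sets.set0.
  apply/seteqP; split=> // z [[/= a b] [v vs [/= c d]]].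
  case/negP: ws; rewrite (_ : w = v) //; case: (w) (v) a b c d => ? ? [? ?] /= a b c d.
  by rewrite (strip_inj q0 a c) (strip_inj q0 b d).
split; first exact: measurableU.
have -> : mu (square q w `|` squares q s) = (mu (square q w) + mu (squares q s))%E by exact: measureU.
have -> : mu (square q w) = (lebesgue_measure (strip q w.1) * lebesgue_measure (strip q w.2))%E.
  by apply: product_measure1E; apply: measurable_strip.
rewrite es !strip_measure // -EFinM -EFinD; congr (_%:E).
by rewrite -natr1 mulrDl addrC mul1r expr2 invfM.
Qed.

Lemma measurable_polygon : measurable (@polygon_set R m V).
Proof.
have -> : @polygon_set R m V = \bigcap_(i in [set: 'I_m]%classic)
    ((fun z => edge (real_cycle R V) i 1 z) @^-1` `[0, +oo[%classic).
  apply/seteqP; split=> z zP i; first by move=> _; rewrite /= in_itv /= zP.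
  by have := zP i Logic.I; rewrite /= in_itv /= andbT.
apply: fin_bigcap_measurable => [|i _]; first exact: finite_finset.
suff mf : measurable_fun [set: R * R]%classic (fun z : measurableTypeR R * measurableTypeR R =>
    edge (real_cycle R V) i 1 z).
  by have := mf measurableT _ (measurable_itv `[0, +oo[); rewrite classical_sets.setTI.
have -> : (fun z : R * R => edge (real_cycle R V) i 1 z) =
  (fun z => (real_pt R (edge_normal V i)).1 * z.1 + (real_pt R (edge_normal V i)).2 * z.2
     + (edge_const V i)%:~R).
  by apply/funext => z; rewrite real_edgeE mulr1.
apply: measurable_realfun.measurable_funD => //; apply: measurable_realfun.measurable_funD; apply: measurable_realfun.measurable_funM => //.
Qed.

(** The sum of the vertices has value at least 1 on each edge, thanks to the vertex preceding that
    edge; scaling by [c] gives the depth. *)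
Lemma deep_point (c : int) : 0 <= c -> exists (K : int) w, 0 <= K /\ forall i, c <= edge V i K w.
Proof.
move=> c0; exists (c * m%:Z), (c * (\sum_j V j).1, c * (\sum_j V j).2).
split=> [|i]; first by rewrite mulr_ge0.
rewrite edgeM; have -> : edge V i m%:Z (\sum_j V j) = \sum_j edge V i 1 (V j).
  have e : forall (P : seq 'I_m), edge V i (size P)%:Z (\sum_(j <- P) V j) = \sum_(j <- P) edge V i 1 (V j).
    elim=> [|j P IH]; first by rewrite !big_nil edge0.
    by rewrite !big_cons -IH -edgeD; congr edge; rewrite /=; lia.
    by have := e (enum 'I_m); rewrite size_enum_ord !big_enum.
have : 1 <= \sum_j edge V i 1 (V j).
  rewrite (bigD1 (ord_pred i)) //= -[X in X <= _]addr0 lerD ?sumr_ge0 // => [|j _].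
    by have := cvx.2 i (ord_pred i) (pred_neq cvx i).1 (pred_neq cvx i).2; lia.
  exact: edge_vertex.
by move=> ?; rewrite -[X in X <= _]mulr1 ler_wpM2l.
Qed.

(** On a grid square an edge functional varies by at most [normal_size]. Translation by a point of
    that depth at height [K] absorbs this error into a change of the dilation factor. *)
Lemma area_sandwich : exists2 K : int, 0 <= K & forall q, (0 < q)%N ->
  ((npts (in_cone V (q%:Z - K)))%:R : R) <= area (@polygon_set R m V) * q%:R ^+ 2 <=
  ((npts (in_cone V (q%:Z + K)))%:R : R).
Proof.
have ns0 : 0 <= normal_size V by rewrite sumr_ge0 // => *; apply: addr_ge0.
have [K [w0 [K0 deep]]] := deep_point ns0; exists K => // q q0.
have q1 : 0 < q%:R :> R by rewrite ltr0n.
have q2 : 0 < q%:R ^+ 2 :> R by rewrite exprn_gt0.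
have edge_scale i (z : R * R) :
    q%:R * edge (real_cycle R V) i 1 z = edge (real_cycle R V) i q%:R (q%:R * z.1, q%:R * z.2).
  by rewrite -edgeM mulr1.
have near i w z : square q w z ->
    `|edge (real_cycle R V) i q%:R (q%:R * z.1, q%:R * z.2) - (edge V i q%:Z w)%:~R| <= (normal_size V)%:~R.
  move=> [/(stripE _ _ q0) /andP[a1 a2] /(stripE _ _ q0) /andP[b1 b2]].
  rewrite -(edge_real_pt R) !real_edgeE opprD addrACA subrr addr0.
  have := normal_size_ge V i; rewrite -(ler_int R) intrD !intr_norm.
  rewrite /dot /=; move: (edge_normal V i).1%:~R (edge_normal V i).2%:~R => x y le.
  apply: le_trans le; rewrite opprD addrACA -!mulrBr (le_trans (ler_normD _ _)) // !normrM.
  apply: lerD; rewrite -[leRHS]mulr1 ler_wpM2l // ler_norml; move: a1 a2 b1 b2.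
    by move: (q%:R * z.1) w.1%:~R => u v; lra.
  by move: (q%:R * z.2) w.2%:~R => u v; lra.
have memS (h : int) : exists s, [/\ uniq s, size s = npts (in_cone V h) & forall w, (w \in s) = in_cone V h w].
  exists (enum_fset (fset_set [set w | in_cone V h w])); split; rewrite ?fset_uniq // => w.
  have fin : finite_set [set w | in_cone V h w].
    by apply: (@sub_finite_set _ _ [set` box (Vbound V * `|h|)]) => // v /(cone_in_box cvx)/mem_box.
  by rewrite in_fset_set //; apply/idP/idP; rewrite classical_sets.in_setE.
have [s1 [us1 ss1 ms1]] := memS (q%:Z - K); have [s2 [us2 ss2 ms2]] := memS (q%:Z + K).
pose t1 := [seq w + w0 | w <- s1]; pose t2 := [seq w - w0 | w <- s2].
have ut1 : uniq t1 by rewrite map_inj_uniq // => ? ? /addIr.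
have ut2 : uniq t2 by rewrite map_inj_uniq // => ? ? /addIr.
have [m1 e1] := squares_measure q0 ut1; have [m2 e2] := squares_measure q0 ut2.
have sub1 : squares q t1 `<=` @polygon_set R m V.
  move=> z [_ /mapP[w sw ->] wz] i; rewrite -(pmulr_rge0 _ q1) edge_scale.
  have := near i _ _ wz; rewrite ler_norml => /andP[le _]; move: le; rewrite lerBrDr.
  apply: le_trans; rewrite addrC subr_ge0 ler_int.
  have -> : q%:Z = (q%:Z - K) + K by rewrite subrK.
  rewrite edgeD (le_trans (deep i)) // lerDr.
  by move: sw; rewrite ms1 => /forallP; apply.
have sub2 : @polygon_set R m V `<=` squares q t2.
  move=> z zP; pose w := (Num.floor (q%:R * z.1), Num.floor (q%:R * z.2)).
  have wz : square q w z.
    by split; apply/stripE => //; rewrite ?floor_le_tmp /= -[1]/(1%:~R) -intrD floorD1_gt.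
  exists w => //; apply/mapP; exists (w + w0); rewrite ?addrK // ms2; apply/forallP => i.
  rewrite edgeD; have := near i _ _ wz; rewrite ler_norml => /andP[_ le].
  have := zP i; rewrite -(pmulr_rge0 _ q1) edge_scale => ge0.
  have : - (normal_size V)%:~R <= (edge V i q%:Z w)%:~R :> R by lra.
  by rewrite -intrN ler_int; have := deep i; lia.
have le1 : (mu (squares q t1) <= mu (@polygon_set R m V))%E.
  by apply: le_measure => //; rewrite classical_sets.in_setE //; apply: measurable_polygon.
have le2 : (mu (@polygon_set R m V) <= mu (squares q t2))%E.
  by apply: le_measure => //; rewrite classical_sets.in_setE //; apply: measurable_polygon.
have fin : mu (@polygon_set R m V) \is a fin_num.
  by rewrite ge0_fin_numE // (le_lt_trans le2) // e2 ltry.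
move: le1 le2; rewrite e1 e2 !size_map ss1 ss2 -(fineK fin) !lee_fin -/(area _).
by rewrite ler_pdivrMr // ler_pdivlMr // => -> ->.
Qed.

(** The sandwich at [q + K] and [q - K] bounds the gap between the Ehrhart polynomial and the area
    times [q ^+ 2] by a linear function, which settles degree and leading coefficient; the constant
    term is the value at 0. *)
Theorem ehrhart_quadratic : exists b : R, forall h : int,
  (ehrhart V h)%:~R = area (@polygon_set R m V) * h%:~R ^+ 2 + b * h%:~R + 1.
Proof.
have [p pE] := ehrhart_polynomial cvx R; have [K K0 sand] := area_sandwich.
set a := area _ in sand *.
have pn q : (0 < q)%N -> p.[q%:R] = (npts (in_cone V q%:Z))%:R.
  by move=> q0; have := pE q%:Z; rewrite /ehrhart (npts0 (icone_le0 cvx _)) ?addr0 => [<- //|]; lia.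
have a0 : 0 <= a by rewrite fine_ge0.
have K0R : 0 <= K%:~R :> R by rewrite ler0z.
pose r := p - a *: 'X^2.
have sr : (size r <= 2)%N.
  apply: (@linear_growth R r (a * (2 * K%:~R + K%:~R ^+ 2)) (absz K).+1) => q qK.
  have -> : r.[q%:R] = p.[q%:R] - a * q%:R ^+ 2 by rewrite /r !hornerE.
  rewrite pn; last by lia.
  have /andP[lo _] := sand (absz (q%:Z + K)) ltac:(lia).
  have /andP[_ hi] := sand (absz (q%:Z - K)) ltac:(lia).
  rewrite !gez0_abs ?addrK ?subrK in lo hi; try lia.
  have e1 : (absz (q%:Z + K))%:R = q%:R + K%:~R :> R.
    by rewrite -[LHS]/((absz (q%:Z + K))%:Z%:~R) gez0_abs ?intrD //; lia.
  have e2 : (absz (q%:Z - K))%:R = q%:R - K%:~R :> R.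
    by rewrite -[LHS]/((absz (q%:Z - K))%:Z%:~R) gez0_abs ?intrB //; lia.
  rewrite e1 in lo; rewrite e2 in hi; rewrite -[q.+1%:R]natr1.
  set L := (npts _)%:R in lo hi *.
  have x0 : 0 <= q%:R :> R by [].
  move: (q%:R) (K%:~R) K0R x0 lo hi => x k k0 x0 lo hi.
  have t1 : 0 <= a * (k * x) by rewrite !mulr_ge0.
  have t2 : 0 <= a * k ^+ 2 by rewrite mulr_ge0 ?exprn_ge0.
  have t3 : 0 <= a * (k ^+ 2 * x) by rewrite !mulr_ge0 ?exprn_ge0.
  have t4 : 0 <= a * k by rewrite !mulr_ge0.
  have -> : a * (2 * k + k ^+ 2) * (x + 1) =
    2 * (a * (k * x)) + a * (k ^+ 2 * x) + 2 * (a * k) + a * k ^+ 2 by ring.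
  have f1 : a * (x + k) ^+ 2 = a * x ^+ 2 + 2 * (a * (k * x)) + a * k ^+ 2 by ring.
  have f2 : a * (x - k) ^+ 2 = a * x ^+ 2 - 2 * (a * (k * x)) + a * k ^+ 2 by ring.
  rewrite {}f1 in lo; rewrite {}f2 in hi; rewrite ler_norml; move: t1 t2 t3 t4 lo hi.
  move: (a * (k * x)) (a * k ^+ 2) (a * (k ^+ 2 * x)) (a * k) (a * x ^+ 2) => u1 u2 u3 u4 u5.
  by move=> *; apply/andP; split; lra.
have rp : p = r + a *: 'X^2 by rewrite subrK.
clearbody r.
have rE : r = r`_1 *: 'X + (r`_0)%:P.
  apply/polyP => -[|[|j]]; rewrite coefD coefZ coefX coefC /= ?mulr0 ?mulr1 ?add0r ?addr0 //.
  by rewrite nth_default // (leq_trans sr).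
have pE' h : p.[h] = a * h ^+ 2 + r`_1 * h + r`_0.
  by rewrite rp {1}rE !hornerE; ring.
exists r`_1 => h; rewrite pE pE'; congr (_ + _).
have := pE 0; rewrite pE' /ehrhart npts_cone0 // (npts0 (icone_le0 cvx _)) //.
by rewrite expr0n /= !mulr0 !add0r addr0.
Qed.
End Area.

Local Close Scope classical_set_scope.

(** * Density of the torus and the toric ideal *)

Section InfiniteField.
Variable k : fieldType.
Hypothesis char0 : [pchar k]%R =i pred0.

Lemma natr_inj0 : injective (fun n : nat => n%:R : k).
Proof.
have nz n : n.+1%:R != 0 :> k by rewrite ((pcharf0P k).1 char0).
move=> i j; wlog lt : i j / (i <= j)%N => [H|] /= e.
  by have [/H|/ltnW/H] := leqP i j; [apply|move=> /(_ (esym e))].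
apply/eqP; rewrite eqn_leq lt /= leqNgt; apply/negP => ij.
have /eqP := e; rewrite -(subnK lt) natrD -subr_eq0 opprD addrCA subrr addr0 oppr_eq0.
by rewrite -(prednK (_ : 0 < j - i)%N) ?subn_gt0 // (negPf (nz _)).
Qed.

Lemma poly_eq0_on_nat (P : {poly k}) : (forall n : nat, P.[n.+1%:R] = 0) -> P = 0.
Proof.
move=> P0; apply/eqP/negPn/negP => nz.
have := @max_poly_roots k P [seq (n.+1%:R : k) | n <- iota 0 (size P)] nz.
rewrite size_map size_iota ltnn; suff -> : all (root P) [seq (n.+1%:R : k) | n <- iota 0 (size P)].
  rewrite map_inj_uniq ?iota_uniq => [/(_ isT isT) //|i j /natr_inj0 []] //.
by apply/allP => _ /mapP[n _ ->]; apply/rootP.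
Qed.

(** Kronecker substitution: on the curve where the second coordinate is the power [2 * B] of the
    first, exponents bounded by [B] stay distinct, and the claim becomes one about polynomials in
    one variable with infinitely many roots. *)
Lemma laurent_eq0 (s : seq (int * int)) (c : int * int -> k) : uniq s ->
  (forall a b : k, a != 0 -> b != 0 -> \sum_(z <- s) c z * (a ^ z.1 * b ^ z.2) = 0) ->
  forall z, z \in s -> c z = 0.
Proof.
move=> us van z0 sz0.
have [B B0 BP] : exists2 B : int, 0 < B & forall z : int * int, z \in s -> `|z.1| < B /\ `|z.2| < B.
  have [B1 B10 B1P] := seq_bounded (fun z : int * int => z.1) s.
  have [B2 B20 B2P] := seq_bounded (fun z : int * int => z.2) s.
  exists (B1 + B2); first by lia.
  by move=> z sz; move: (B1P z sz) (B2P z sz) => /= h1 h2; split; lia.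
(* The constant shift makes all exponents nonnegative. *)
pose e (z : int * int) := absz (z.1 + (2 * B) * z.2 + (B + 2 * B * B)).
have eE (z : int * int) : z \in s -> (e z)%:Z = z.1 + (2 * B) * z.2 + (B + 2 * B * B).
  move=> /BP[z1 z2]; rewrite /e gez0_abs //.
  have : 0 <= (2 * B) * (z.2 + B) by rewrite mulr_ge0 //; lia.
  by lia.
have e_inj : {in s &, injective e}.
  move=> x y sx sy exy; have := eE _ sx; rewrite exy eE //.
  have [x1 x2] := BP _ sx; have [y1 y2] := BP _ sy.
  case: x y sx sy exy x1 x2 y1 y2 => a b [a' b'] /= _ _ _ x1 x2 y1 y2 eq.
  have bb : b = b'.
    have [lt|lt|//] := ltgtP b b'; [have : (2 * B) * (b' - b - 1) >= 0|have : (2 * B) * (b - b' - 1) >= 0].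
    - by rewrite mulr_ge0 //; lia.
    - by lia.
    - by rewrite mulr_ge0 //; lia.
    - by lia.
  by rewrite bb in eq *; congr pair; lia.
pose P : {poly k} := \sum_(z <- s) c z *: 'X^(e z).
have P0 : P = 0.
  apply: poly_eq0_on_nat => n; pose t : k := n.+1%:R.
  have t0 : t != 0 by rewrite /t ((pcharf0P k).1 char0).
  rewrite -/t /P horner_sum.
  have := van t (t ^ (2 * B)) t0 (expfz_neq0 _ t0) => h.
  transitivity ((\sum_(z <- s) c z * (t ^ z.1 * (t ^ (2 * B)) ^ z.2)) * t ^ (B + 2 * B * B));
    last by rewrite h mul0r.
  rewrite mulr_suml; apply: eq_big_seq => z sz; rewrite hornerZ hornerXn -[RHS]mulrA.
  transitivity (c z * t ^ (e z)%:Z); first by [].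
  by rewrite exprz_exp -!expfzDr // (eE z sz).
have := congr1 (fun Q : {poly k} => Q`_(e z0)) P0; rewrite coef0 coef_sum (bigD1_seq z0) //=.
rewrite coefZ coefXn eqxx mulr1 big_seq_cond big1 ?addr0 // => z /andP[sz ne].
rewrite coefZ coefXn; case: eqP => [/e_inj e0|]; last by rewrite mulr0.
by rewrite e0 ?eqxx in ne.
Qed.
End InfiniteField.

Section ToricIdeal.
Variables (k : fieldType) (R : realType) (D : set (R * R)).
Hypothesis char0 : [pchar k]%R =i pred0.
Hypothesis N0 : (0 < nb_points D)%N.
Local Notation n := (nb_points D).
Local Notation pi := (@lattice_pt R D).

(** On the torus a monomial depends only on its degree and weight, so the monomials of one fibre
    contribute their coefficient sum. *)
Lemma meval_torus (c a b : k) (v : 'I_n -> k) d (f : mpoly n k) : a != 0 -> b != 0 ->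
  (forall i, v i = c * (a ^ (pi i).1 * b ^ (pi i).2)) ->
  meval v (pihomog mdeg d f) =
  c ^+ d * \sum_(z <- undup [seq weight pi m | m <- msupp f]) fibre pi d z f * (a ^ z.1 * b ^ z.2).
Proof.
move=> a0 b0 vE; rewrite pihomogE raddf_sum /=.
have mE (m : multinom n) : mdeg m = d -> meval v (mpolyX k m) =
    c ^+ d * (a ^ (weight pi m).1 * b ^ (weight pi m).2).
  move=> <-; rewrite mevalX /weight mdegE.
  elim/big_rec3: _ => [|i x y w _]; first by rewrite expr0 !mul1r.
  move=> ->; rewrite vE exprMn exprD exprMn.
  have zE (u : k) (e : int) (j : nat) : (u ^ e) ^+ j = u ^ (e *+ j).
    by rewrite -[LHS]/((u ^ e) ^ j%:Z) exprz_exp -mulr_natr natz.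
  have -> : (pi i *+ m i + x).1 = (pi i).1 *+ m i + x.1.
    by rewrite /=; congr (_ + _); elim: (m i) => // j; rewrite !mulrS => <-.
  have -> : (pi i *+ m i + x).2 = (pi i).2 *+ m i + x.2.
    by rewrite /=; congr (_ + _); elim: (m i) => // j; rewrite !mulrS => <-.
  rewrite (expfzDr ((pi i).1 *+ m i) x.1 a0).
  rewrite (expfzDr ((pi i).2 *+ m i) x.2 b0).
  rewrite (zE a) (zE b).
  by rewrite mulrACA [a ^ _ * _ * _]mulrACA.
rewrite mulr_sumr.
under [RHS]eq_bigr => z _ do rewrite /fibre mulr_suml mulr_sumr.
rewrite (exchange_big_dep (fun m => mdeg m == d)) /= => [|z m _ /andP[]//].
rewrite big_seq_cond [RHS]big_seq_cond; apply: eq_bigr => m /andP[mf md].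
rewrite linearZ /= (mE _ (eqP md)) md /=.
rewrite -big_filter (_ : [seq i <- undup [seq weight pi m' | m' <- msupp f] | weight pi m == i] = [:: weight pi m]).
  by rewrite big_seq1 mulrCA.
rewrite (eq_filter (a2 := pred1 (weight pi m))) => [|z]; last by rewrite /= eq_sym.
by rewrite filter_pred1_uniq ?undup_uniq // mem_undup map_f.
Qed.

(** Torus points lie in the closure and decide it: a homogeneous polynomial vanishing on them
    vanishes on the closure. On the torus distinct weights give independent Laurent monomials. *)
Lemma toric_ideal_fibre (f : mpoly n k) :
  toric_ideal k D f <-> forall d z, fibre pi d z f = 0.
Proof.
split=> [If d z|f0 d y].
  have [zs|zs] := boolP (z \in undup [seq weight pi m | m <- msupp f]); last first.
    rewrite /fibre big_seq_cond big1 // => m /and3P[mf _ /eqP wz].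
    by case/negP: zs; rewrite mem_undup -wz map_f.
  apply: (laurent_eq0 char0 (c := fun z => fibre pi d z f) (undup_uniq _) _ zs) => a b a0 b0.
  pose v i := 1 * (a ^ (pi i).1 * b ^ (pi i).2).
  rewrite -[LHS]mul1r -(expr1n k d) -(@meval_torus 1 a b v) //; apply: If.
  have vt : torus_image v by exists a, b, 1; split=> //; apply: oner_neq0.
  split=> [|e g _ gv]; last exact: gv.
  by exists (Ordinal N0); rewrite /v mul1r mulf_neq0 ?expfz_neq0.
move=> [_]; apply; first exact: pihomogP.
move=> v [a [b [c [a0 b0 _ vE]]]]; rewrite (meval_torus _ _ a0 b0 vE).
by rewrite big1 ?mulr0 // => z _; rewrite f0 mul0r.
Qed.
End ToricIdeal.

(** * Dimensions of spaces of chains *)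

Section Supported.
Variables (k : fieldType) (X : finType).
Implicit Types (Q : pred X) (f : {ffun X -> k^o}).

Definition cut_fun Q f : {ffun X -> k^o} := [ffun x => if Q x then f x else 0].
Lemma cut_linear Q : linear (cut_fun Q).
Proof.
move=> a f g; apply/ffunP => x; rewrite !ffunE; case: ifP => // _.
by rewrite scaler0 addr0.
Qed.
Definition supported Q : {vspace {ffun X -> k^o}} := limg (lin (cut_linear Q)).

Lemma supportedP Q f : reflect (forall x, f x != 0 -> Q x) (f \in supported Q).
Proof.
apply: (iffP memv_imgP) => [[g _ ->] x|Qf].
  by rewrite linE ffunE; case: ifP; rewrite ?eqxx.
exists f; rewrite ?memvf //; apply/ffunP => x; rewrite linE ffunE.
by case: ifP => // /negbT; apply: contraNeq => /Qf.
Qed.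

Definition ext_fun Q (g : {ffun {x | Q x} -> k^o}) : {ffun X -> k^o} :=
  [ffun x => if insub x is Some y then g y else 0].
Lemma ext_linear Q : linear (@ext_fun Q).
Proof.
move=> a f g; apply/ffunP => x; rewrite !ffunE; case: insubP => [y _ _|_].
  by rewrite !ffunE.
by rewrite scaler0 addr0.
Qed.

Lemma dim_supported Q : \dim (supported Q) = #|Q|.
Proof.
have -> : supported Q = limg (lin (@ext_linear Q)).
  apply/vspaceP => f; apply/supportedP/memv_imgP => [Qf|[g _ ->] x].
    exists [ffun y : {x | Q x} => f (val y)]; rewrite ?memvf //.
    apply/ffunP => x; rewrite linE ffunE; case: insubP => [y _ <-|]; first by rewrite ffunE.
    by apply: contraNeq => /Qf.
  by rewrite linE ffunE; case: insubP => [//|]; rewrite eqxx.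
have := limg_ker_dim (lin (@ext_linear Q)) fullv.
have -> : (fullv :&: lker (lin (@ext_linear Q)) = 0)%VS.
  apply/vspaceP => g; rewrite memv0 memv_cap memvf memv_ker /=; apply/eqP/eqP => [e|->].
    apply/ffunP => y; have := congr1 (fun f : {ffun X -> k^o} => f (val y)) e.
    by rewrite linE !ffunE valK.
  by rewrite raddf0.
by rewrite dimv0 add0n => ->; rewrite dimvf /dim /= muln1 card_sig.
Qed.
End Supported.

Section ChainDim.
Variables (k : fieldType) (J : finType) (n : nat).
Implicit Types X : pred (J * {set 'I_n}).

Lemma chains_supported X p :
  chains k X p = supported k (fun x : J * {set 'I_n} => X x && (#|x.2| == p)).
Proof.
apply/vspaceP => f; apply/chainsP/supportedP => H x /H; first by case=> -> ->; rewrite eqxx.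
by case/andP=> -> /eqP.
Qed.

Lemma eq_chains X X' p : X =1 X' -> chains k X p = chains k X' p.
Proof.
by move=> e; apply/vspaceP => f; apply/chainsP/chainsP => H x /H; rewrite e.
Qed.
End ChainDim.

(** * Duality for cells over a polygon *)

Section PolygonDuality.
Variables (k : fieldType) (n m : nat) (pi : 'I_n -> int * int) (V : 'I_m -> int * int).
Variables (B : {set 'I_n}) (v : 'I_m -> 'I_n).
Hypothesis cvx : convex_cycle V.
Hypothesis pi_cone : forall t, t \in B -> in_cone V 1 (pi t).
Hypothesis vP : forall i, v i \in B /\ pi (v i) = V i.
Variables (J : finType) (w : J -> int * int) (q : int).
Local Notation cell := (J * {set 'I_n})%type.
Local Notation sg T := (\sum_(t in (T : {set 'I_n})) pi t).

Definition half_cell (i : 'I_m) : pred cell := fun x =>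
  (x.2 \subset B) && (0 <= edge V i (q - (#|x.2|)%:Z) (w x.1 - sg x.2)).
Definition cone_cell : pred cell := fun x =>
  (x.2 \subset B) && in_cone V (q - (#|x.2|)%:Z) (w x.1 - sg x.2).
(** A cell outside every half-plane has only negative edge values, so its negative is interior to
    the cone; this explains the reversed signs. *)
Definition icone_cell : pred cell := fun x =>
  (x.2 \subset B) && in_icone V ((#|x.2|)%:Z - q) (sg x.2 - w x.1).

Lemma edge_setU1 i j (t : 'I_n) (T : {set 'I_n}) : t \notin T ->
  edge V i (q - (#|t |: T|)%:Z) (w j - sg (t |: T)) =
  edge V i (q - (#|T|)%:Z) (w j - sg T) - edge V i 1 (pi t).
Proof.
move=> tT; rewrite cardsU1 tT (big_setU1 t) //= add1n -edgeN -edgeD.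
by congr (edge V i _ _); [rewrite -addn1 PoszD opprD addrA|rewrite opprD addrCA addrC].
Qed.

Lemma half_cell_down i : down_closed (half_cell i).
Proof.
move=> j t T; case: (boolP (t \in T)) => [tT|tT]; first by rewrite (setUidPr _) // sub1set.
rewrite /half_cell /= subUset sub1set edge_setU1 // => /andP[/andP[tB ->] le] /=.
apply: le_trans le _; rewrite gerBl.
by have := pi_cone tB => /forallP.
Qed.

Lemma cone_cellE (x : cell) : cone_cell x = [forall i, half_cell i x].
Proof.
have [m2 _] := cvx; apply/andP/forallP => [[xB /forallP H] i|H]; first by rewrite /half_cell xB H.
split; first by case/andP: (H (Ordinal (ltnW (ltnW m2)))).
by apply/forallP => i; case/andP: (H i).
Qed.

Lemma icone_cellE (x : cell) : icone_cell x = (x.2 \subset B) && [forall i, ~~ half_cell i x].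
Proof.
rewrite /icone_cell; case: (boolP (x.2 \subset B)) => //= xB; apply: eq_forallb => i.
rewrite /half_cell xB /= -ltNge -[X in edge _ _ X _]opprB -[X in edge _ _ _ X]opprB edgeN.
by rewrite oppr_gt0.
Qed.

Lemma half_cell_cone i j (T : {set 'I_n}) : edge V i 1 (pi (v j)) = 0 -> forall l,
  half_cell i (l, T) -> half_cell i (l, v j |: T).
Proof.
move=> e l; case: (boolP (v j \in T)) => [tT|tT]; first by rewrite (setUidPr _) // sub1set.
rewrite /half_cell /= subUset sub1set edge_setU1 // e subr0 (vP j).1.
by [].
Qed.

Local Notation dY := (bd_rel k half_cell).

(** The arc hypothesis of [cone_duality] is [unique_start], and the vertex [V i] cones both edges
    through it because it lies on them. *)
Lemma polygon_duality p : hdim dY (chains k icone_cell) p.+3 = hdim (bd k J n) (chains k cone_cell) p.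
Proof.
have [m2 _] := cvx.
rewrite (eq_hdim _ _ (fun r => eq_chains k r icone_cellE)).
rewrite (eq_hdim _ _ (fun r => eq_chains k r cone_cellE)).
apply: (@cone_duality k J n m B half_cell v).
- exact: (ltnW (ltnW m2)).
- exact: half_cell_down.
- by move=> i x /andP[].
- by move=> i; case: (vP i).
- by move=> i j T; apply: half_cell_cone; rewrite (vP i).2 edge_start.
- by move=> i j T; apply: half_cell_cone; rewrite (vP i).2 edge_pred_end.
move=> x i i' /andP[/andP[xB a] b] /andP[/andP[_ a'] b'].
rewrite /half_cell xB /= in b b'.
by apply: (unique_start cvx a _ a'); rewrite ltNge.
Qed.

Lemma dYE f (x : cell) : f \in chains k icone_cell #|x.2|.+1 ->
  dY f x = if icone_cell x then bd k J n f x else 0.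
Proof.
move=> /chainsP fY; rewrite /bd_rel comp_lfunE restrE icone_cellE.
case: (boolP (x.2 \subset B)) => //= xB.
case: ifP => // _; apply/eqP/negPn/negP => /bd_neq0[t _ /fY[/andP[+ _] _]].
by rewrite subUset => /andP[_ h]; rewrite h in xB.
Qed.

Lemma icone_cell_up j t (T : {set 'I_n}) : t \in B -> icone_cell (j, T) -> icone_cell (j, t |: T).
Proof.
case: (boolP (t \in T)) => [tT|tT] tB; first by rewrite (setUidPr _) // sub1set.
rewrite !icone_cellE /= subUset sub1set tB => /andP[-> /forallP H] /=.
by apply/forallP => i; apply: contra (H i) => /half_cell_down.
Qed.

Lemma dY_chains f r : f \in chains k icone_cell r.+1 -> dY f \in chains k icone_cell r.
Proof.
move=> fY; apply/chainsP => x nz; have fY' := fY; move/chainsP in fY'.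
have [t tx ft] : exists2 t, t \notin x.2 & f (x.1, t |: x.2) != 0.
  apply: bd_neq0; move: nz; rewrite /bd_rel comp_lfunE restrE.
  by case: ifP; rewrite ?eqxx.
have [/andP[ssub _]] := fY' _ ft; rewrite /= cardsU1 tx add1n => -[cx]; split=> //.
rewrite -cx in fY; move: nz; rewrite dYE //.
by case: ifP; rewrite ?eqxx.
Qed.

(** The ordinary boundary squares to zero, and adding a point of [B] to an interior cell keeps it
    interior, so the truncation in [dY] loses no intermediate term. *)
Lemma dY_dY f r : f \in chains k icone_cell r.+2 -> dY (dY f) = 0.
Proof.
move=> fY; have dfY := dY_chains fY; have ddY := dY_chains dfY.
apply/ffunP => x; rewrite ffunE; apply/eqP/negPn/negP => nz.
have /chainsP/(_ _ nz)[xY cx] := ddY; case/negP: nz.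
rewrite dYE ?cx // xY; apply/eqP.
have : bd k J n (bd k J n f) x = 0 by rewrite bd_bd ffunE.
rewrite !bdE /=; apply: etrans; apply: eq_bigr => t tx; congr (_ * _).
have [tB|tB] := boolP (t \in B).
  rewrite dYE /=; last by rewrite cardsU1 tx /= cx.
  by rewrite (icone_cell_up tB) //; case: (x) xY.
have -> : dY f (x.1, t |: x.2) = 0.
  apply/eqP/negPn/negP => nz; have /chainsP/(_ _ nz)[/andP[+ _] _] := dfY.
  by rewrite /= subUset sub1set (negPf tB).
apply/esym/eqP/negPn/negP => /bd_neq0[s /= _ nz].
have /chainsP/(_ _ nz)[/andP[+ _] _] := fY.
by rewrite /= !subUset !sub1set (negPf tB) andbF.
Qed.

(** Turns the truncated subtraction of [hdim] into an equation that can be added up along the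
    strand. *)
Lemma hdim_dY r : (hdim dY (chains k icone_cell) r + \dim (dY @: chains k icone_cell r.+1) =
  \dim (chains k icone_cell r :&: lker dY))%N.
Proof.
rewrite /hdim subnK //; apply: dimvS; apply/subvP => _ /memv_imgP[f fY ->].
rewrite memv_cap dY_chains // memv_ker; case: r fY => [|r] fY; last by rewrite (dY_dY fY) eqxx.
apply/eqP/ffunP => x; rewrite ffunE; apply/eqP/negPn/negP.
rewrite {1}/bd_rel comp_lfunE restrE; case: ifP; rewrite ?eqxx // => _.
by rewrite (bd_chains0 (dY_chains fY)) ffunE eqxx.
Qed.

Lemma dim_dY_img r : (\dim (dY @: chains k icone_cell r) +
  \dim (chains k icone_cell r :&: lker dY) = \dim (chains k icone_cell r))%N.
Proof. by rewrite addnC limg_ker_dim. Qed.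

(** There are no generators of positive degree: a point of the cone at positive height can lose some
    point of [B] and stay in the cone, which provides a preimage. *)
Lemma cone_hdim0 : 0 < q -> (forall h z, 0 < h -> in_cone V h z ->
    exists2 t, t \in B & in_cone V (h - 1) (z - pi t)) ->
  hdim (bd k J n) (chains k cone_cell) 0 = 0%N.
Proof.
move=> q0 normal; apply/eqP; rewrite subn_eq0; apply: dimvS; apply/subvP => f.
rewrite memv_cap => /andP[/chainsP fC _]; apply/memv_imgP.
pose c j := odflt (v (Ordinal (ltnW (ltnW cvx.1)))) [pick t in B | in_cone V (q - 1) (w j - pi t)].
have cP j : f (j, finset.set0) != 0 -> c j \in B /\ in_cone V (q - 1) (w j - pi (c j)).
  move=> /fC[/andP[_ zC] _]; rewrite /= cards0 big_set0 !subr0 in zC.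
  have [t tB tC] := normal _ _ q0 zC; rewrite /c; case: pickP => [? /andP[//]|/(_ t)].
  by rewrite tB tC.
exists [ffun x : cell => if x.2 == [set c x.1] then f (x.1, finset.set0) else 0].
  apply/chainsP => -[j T]; rewrite ffunE /=; case: (T =P [set c j]) => [->|]; last by rewrite eqxx.
  move=> /cP[cB cC]; rewrite /cone_cell /= sub1set cB cards1 big_set1; split=> //.
apply/ffunP => -[j T]; rewrite bdE /=.
have [->|T0] := eqVneq T finset.set0.
  rewrite (bigD1 (c j)) ?inE //= ffunE /= setU0 eqxx big1 ?addr0 => [|t /andP[_ tc]].
    by rewrite /sgn (_ : [set _ in finset.set0 | _] = finset.set0) ?cards0 ?expr0 ?mul1r //; apply/finset.setP => s; rewrite !inE.
  by rewrite ffunE /= setU0 (inj_eq set1_inj) (negPf tc) mulr0.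
have -> : f (j, T) = 0 by apply/eqP/negPn/negP => /fC[_ /eqP]; rewrite cards_eq0 (negPf T0).
rewrite big1 // => t tT; rewrite ffunE /=; case: eqP => [e|]; last by rewrite mulr0.
have := congr1 (fun A : {set 'I_n} => #|A|) e; rewrite cards1 cardsU1 tT => -[/eqP].
by rewrite cards_eq0 (negPf T0).
Qed.

(* The cells of degree [q] sit over a single point, which determines the element removed by [bd]. *)
Lemma cone_hdim_top (p : nat) : injective pi -> q = p.+1%:Z ->
  (chains k cone_cell p.+1 :&: lker (bd k J n) = 0)%VS.
Proof.
move=> pi_inj qp; apply/vspaceP => f; rewrite memv0 memv_cap memv_ker.
apply/andP/eqP => [[/chainsP fC /eqP df]|->]; last by rewrite mem0v raddf0.
apply/ffunP => -[j T]; rewrite ffunE; apply/eqP/negPn/negP => nz.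
have top (T' : {set 'I_n}) : f (j, T') != 0 -> w j = sg T'.
  move=> /fC[/andP[_]]; rewrite /= qp => + cT; rewrite cT subrr => zC.
  by apply/eqP; rewrite -subr_eq0; have [_ ->] := cone_height cvx zC.
have [_ /= cT] := fC _ nz; have [t tT] : exists t, t \in T.
  by apply/set0Pn; rewrite -cards_eq0 cT.
have : bd k J n f (j, T :\ t) = 0 by rewrite df ffunE.
rewrite bdE /= (bigD1 t) ?setD11 //= setD1K // big1 ?addr0 => [/eqP|s /andP[sT st]].
  by rewrite mulf_eq0 (negPf nz) orbF -sqrf_eq0 expr2 sgn_sqr oner_eq0.
suff -> : f (j, s |: T :\ t) = 0 by rewrite mulr0.
apply/eqP/negPn/negP => /top; rewrite (top _ nz) (big_setU1 s) //= (big_setD1 t) //=.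
by move=> /addIr/pi_inj e; rewrite e eqxx in st.
Qed.
End PolygonDuality.

(** * The strand of degree N - 3 and its Euler characteristic *)

Section FullPolygon.
Variables (k : fieldType) (n m : nat) (pi : 'I_n -> int * int) (V : 'I_m -> int * int).
Variable v : 'I_m -> 'I_n.
Hypothesis cvx : convex_cycle V.
Hypothesis pi_inj : injective pi.
Hypothesis pi_cone : forall t, in_cone V 1 (pi t).
Hypothesis vP : forall i, pi (v i) = V i.
Hypothesis n4 : (4 <= n)%N.
Variables (J : finType) (w : J -> int * int).
Hypothesis w_inj : injective w.
Local Notation q := ((n - 3)%N%:Z).
Local Notation cell := (J * {set 'I_n})%type.
Local Notation sg T := (\sum_(t in (T : {set 'I_n})) pi t).
Hypothesis w_cover : forall (T : {set 'I_n}) z,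
  in_icone V ((#|T|)%:Z - q) (sg T - z) -> exists j, w j = z.

Local Notation full := [set: 'I_n].
Local Notation Y := (icone_cell pi V full w q).
Local Notation C := (cone_cell pi V full w q).
Local Notation dY := (bd_rel k (half_cell pi V full w q)).
Local Notation dimK := (\dim (chains k Y n.-1 :&: lker dY)).

Let pi_cone' t : t \in full -> in_cone V 1 (pi t). Proof. by []. Qed.
Let vP' i : v i \in full /\ pi (v i) = V i. Proof. by rewrite inE. Qed.

(** For a fixed [T] the cells over [T] correspond to the interior points [sg T - w j], and [w_cover]
    guarantees that all of them occur. *)
Lemma dim_icone_chains r :
  \dim (chains k Y r) = ('C(n, r) * npts (in_icone V (r%:Z - q)))%N.
Proof.
rewrite chains_supported dim_supported -sum1_card.
rewrite (eq_bigl (fun x : cell => (#|x.2| == r) && in_icone V (r%:Z - q) (sg x.2 - w x.1))); last first.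
  by move=> x; rewrite unfold_in /icone_cell subsetT andbC /=; case: eqP => //= ->.
rewrite -(pair_big_dep xpredT (fun (j : J) (T : {set 'I_n}) =>
  (#|T| == r) && in_icone V (r%:Z - q) (sg T - w j)) (fun _ _ => 1%N)) /=.
rewrite (exchange_big_dep (fun T : {set 'I_n} => #|T| == r)) /=; last by move=> ? ? _ /andP[].
rewrite (eq_bigr (fun=> npts (in_icone V (r%:Z - q)))) => [|T /eqP cT].
  have -> : 'C(n, r) = #|[set T : {set 'I_n} | #|T| == r]| by rewrite card_draws card_ord.
  by rewrite sum_nat_const cardsE.
rewrite (@npts_count _ [seq sg T - w j | j <- enum J]).
- rewrite count_map sum1_card -size_filter cardE /enum_mem; congr size.
  rewrite -enumT -filter_predI; apply: eq_filter => j /=.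
  by rewrite unfold_in cT eqxx andbT.
- by rewrite map_inj_uniq ?enum_uniq // => i j /(addrI (sg T))/oppr_inj/w_inj.
move=> z zP; have [j wj] : exists j, w j = sg T - z by apply: (@w_cover T); rewrite cT opprB addrCA subrr addr0.
by apply/mapP; exists j; rewrite ?mem_enum // wj opprB addrCA subrr addr0.
Qed.

(** Dual to the cells of height 0, where [cone_hdim_top] applies; and there is no set of [n + 1]
    points to provide boundaries. *)
Lemma top_kernel : (chains k Y n :&: lker dY = 0)%VS.
Proof.
apply/eqP; rewrite -dimv_eq0.
rewrite [X in chains _ _ X](_ : n = (n - 3).+3); last by lia.
rewrite -hdim_dY // (polygon_duality k cvx pi_cone' vP') addn_eq0; apply/andP; split.
  rewrite /hdim subn_eq0 [X in (\dim (chains _ _ X :&: _) <= _)%N](_ : (n - 3)%N = (n - 4).+1); last by lia.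
  by rewrite (@cone_hdim_top k n m pi V full cvx J w q (n - 4) pi_inj) ?dimv0 //; congr Posz; lia.
have := limg_ker_dim dY (chains k Y (n - 3).+4).
by rewrite dim_icone_chains bin_small; lia.
Qed.

(** The chains on [n] points embed into the kernel on [n - 1] points, and the quotient is dual to
    the Betti number of index [(n - 4, n - 3)]. *)
Lemma first_equation :
  (hdim (bd k J n) (chains k C) (n - 4) + npts (in_icone V 3) = dimK)%N.
Proof.
have e : n.-1 = (n - 4).+3 by lia.
rewrite e -hdim_dY // -(polygon_duality k cvx pi_cone' vP'); congr (_ + _)%N.
have -> : (n - 4).+4 = n by lia.
have := dim_dY_img k pi V full w q n; rewrite top_kernel dimv0 addn0 => ->.
rewrite dim_icone_chains binn mul1n; congr npts; congr in_icone; lia.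
Qed.

(** All chains on [n - 2] points are cycles, since smaller sets would need interior points of height
    0; the boundaries among them have the dimension of the chains on [n - 1] points minus [dimK]. *)
Lemma second_equation : (5 <= n)%N ->
  (hdim (bd k J n) (chains k C) (n - 5) + n * npts (in_icone V 2) =
   'C(n, 2) * npts (in_icone V 1) + dimK)%N.
Proof.
move=> n5; have e : (n - 5).+3 = n.-2 by lia.
have := hdim_dY k pi_cone' w q (n - 5).+3.
rewrite (polygon_duality k cvx pi_cone' vP') => h1.
have h2 := dim_dY_img k pi V full w q n.-1.
have h3 : \dim (chains k Y n.-1) = (n * npts (in_icone V 2))%N.
  rewrite dim_icone_chains -subn1 bin_sub ?bin1; last by lia.
  by congr (_ * npts _)%N; congr in_icone; lia.
have h4 : (chains k Y (n - 5).+3 :&: lker dY = chains k Y (n - 5).+3)%VS.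
  apply/capv_idPl/subvP => f fY; rewrite memv_ker; have := dY_chains fY.
  suff -> : chains k Y (n - 5).+2 = 0%VS by rewrite memv0.
  apply/eqP; rewrite -dimv_eq0 dim_icone_chains npts0 ?muln0 //.
  by apply: icone_le0 => //; lia.
have h5 : \dim (chains k Y (n - 5).+3) = ('C(n, 2) * npts (in_icone V 1))%N.
  rewrite dim_icone_chains e -subn2 bin_sub; last by lia.
  by congr (_ * npts _)%N; congr in_icone; lia.
have e' : (n - 5).+4 = n.-1 by lia.
by rewrite h4 h5 e' in h1; rewrite h3 in h2; lia.
Qed.

(* In terms of [u j], the cells [~: [set a]] and [~: [set a; b]] over [j] are
   the points [a] with [u j - a] in the interior of [2 D], and the pairs with
   [u j - a - b] in that of [D]. *)
Definition dual_weight j : int * int := sg full - w j.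
Local Notation u := dual_weight.

Lemma sgC1 a : sg (~: [set a]) = sg full - pi a.
Proof.
rewrite [in RHS](big_setD1 a) ?inE //= addrC addrK; apply: eq_bigl => t.
by rewrite !inE andbT.
Qed.

Lemma sgC2 a b : a != b -> sg (~: [set a; b]) = sg full - pi a - pi b.
Proof.
move=> ab; rewrite -sgC1 [in RHS](big_setD1 b) /=; last by rewrite !inE eq_sym.
rewrite addrC addrK; apply: eq_bigl => t.
by rewrite !inE negb_or andbC.
Qed.

Lemma Y1 j a : Y (j, ~: [set a]) = in_icone V 2 (u j - pi a).
Proof.
rewrite /icone_cell subsetT /= sgC1 cardsC1 card_ord /dual_weight.
by congr in_icone; [lia|rewrite addrAC].
Qed.

Lemma Y2 j a b : a != b -> Y (j, ~: [set a; b]) = in_icone V 1 (u j - pi a - pi b).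
Proof.
move=> ab; rewrite /icone_cell subsetT /= sgC2 // cardsCs setCK cards2 ab card_ord /dual_weight.
congr in_icone; first by lia.
by rewrite addrAC; congr (_ - _); rewrite addrAC.
Qed.

Lemma setC2_up (a b : 'I_n) : a != b -> b |: ~: [set a; b] = ~: [set a].
Proof. by move=> ab; apply/finset.setP => t; rewrite !inE negb_or; case: (t =P b) => [->|_] /=; rewrite ?andbT // [b == a]eq_sym ab. Qed.

(** After multiplication by this sign the cycle condition becomes a plain equality of the values at
    [a] and [b]. *)
Definition eps (a : 'I_n) : k := sgn k a (~: [set a]).

Lemma eps_sqr a : eps a * eps a = 1. Proof. exact: sgn_sqr. Qed.

Lemma eps_neq0 a : eps a != 0.
Proof. by rewrite -sqrf_eq0 expr2 eps_sqr oner_eq0. Qed.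

Lemma sgnC2 (a b : 'I_n) : a != b -> sgn k a (~: [set a; b]) = eps a * (-1) ^+ (b < a)%N.
Proof.
move=> ab; rewrite /eps -(setC2_up ab) sgnU ?inE ?eqxx ?orbT //.
by rewrite -mulrA -expr2 sqrr_sign mulr1.
Qed.

Lemma dY_pair f j (a b : 'I_n) : f \in chains k Y n.-1 -> a != b -> Y (j, ~: [set a; b]) ->
  dY f (j, ~: [set a; b]) = eps a * eps b * ((-1) ^+ (b < a)%N) *
    (eps b * f (j, ~: [set b]) - eps a * f (j, ~: [set a])).
Proof.
move=> fY ab yab; rewrite dYE //; last by rewrite /= cardsCs setCK cards2 ab card_ord (_ : (n - 2).+1 = n.-1) //; lia.
rewrite yab bdE /= (bigD1 a) ?inE ?eqxx //= (bigD1 b) /=; last by rewrite !inE eqxx orbT eq_sym.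
rewrite big1 ?addr0; last by move=> t; rewrite !inE negbK => /andP[/andP[/orP[->|->]]].
have -> : a |: ~: [set a; b] = ~: [set b] by rewrite [in LHS]setUC -(setC2_up (_ : b != a)) 1?eq_sym // [in RHS]setUC; congr (~: _ :|: _); rewrite finset.setUC.
rewrite setC2_up // (sgnC2 ab) [~: [set a; b]](_ : _ = ~: [set b; a]); last by rewrite finset.setUC.
rewrite sgnC2 1?eq_sym //.
have -> : (-1) ^+ (a < b)%N = - ((-1) ^+ (b < a)%N) :> k.
  by move: ab; rewrite neq_ltn => /orP[] lt; rewrite lt ltnNge ltnW ?expr0 ?expr1 ?opprK.
have ea := eps_sqr a; have eb := eps_sqr b.
set s := (-1) ^+ _; set fb := f _; set fa := f _.
transitivity ((eps b * eps b) * (eps a * s * fb) - (eps a * eps a) * (eps b * s * fa)); last by ring.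
by rewrite ea eb; ring.
Qed.

(** Over each weight, join [a] and [b] when [u j - pi a - pi b] is interior: up to the signs [eps],
    the kernel consists of the functions constant on the components of this graph. *)
Lemma top_kerP f : f \in chains k Y n.-1 ->
  dY f = 0 <-> forall j a b, a != b -> in_icone V 1 (u j - pi a - pi b) ->
    eps a * f (j, ~: [set a]) = eps b * f (j, ~: [set b]).
Proof.
move=> fY; split=> [df j a b ab yab|H].
  have := congr1 (fun g : {ffun cell -> k^o} => g (j, ~: [set a; b])) df.
  rewrite dY_pair ?Y2 // ffunE => /eqP; rewrite mulf_eq0 subr_eq0 => /orP[|/eqP -> //].
  by rewrite !mulf_eq0 !(negPf (eps_neq0 _)) signr_eq0.
apply/ffunP => -[j T]; rewrite [RHS]ffunE; apply/eqP/negPn/negP => nz.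
have e : n.-1 = n.-2.+1 by lia.
have dfY : dY f \in chains k Y n.-2 by rewrite dY_chains // -e.
have /chainsP/(_ _ nz)[/= yT cT] := dfY.
have : #|~: T| = 2%N by rewrite cardsCs setCK card_ord cT; lia.
move=> /eqP/cards2P[a [b [ab eT]]].
have TE : T = ~: [set a; b] by rewrite -eT setCK.
move: nz; rewrite TE dY_pair // -?TE // (H _ _ _ ab) ?subrr ?mulr0 ?eqxx //.
by rewrite -Y2 // -TE.
Qed.

Lemma icone_up (h : int) z a : in_icone V h (z - pi a) -> in_icone V (h + 1) z.
Proof.
move=> /forallP H; apply/forallP => i; rewrite -[z](subrK (pi a)) edgeD.
by rewrite ltr_wpDr //; have /forallP := pi_cone a.
Qed.

Section Colouring.
Variable col : J -> 'I_n -> bool.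
Hypothesis col_edge : forall j a b, a != b -> in_icone V 1 (u j - pi a - pi b) -> col j a = col j b.
Hypothesis col_conn : forall j (h : 'I_n -> k),
  (forall a b, a != b -> in_icone V 1 (u j - pi a - pi b) -> h a = h b) ->
  forall a b, in_icone V 2 (u j - pi a) -> in_icone V 2 (u j - pi b) -> col j a = col j b -> h a = h b.

Definition colour_used : pred (J * bool) := fun x =>
  [exists a, in_icone V 2 (u x.1 - pi a) && (col x.1 a == x.2)].

Definition spread_fun (g : {ffun J * bool -> k^o}) : {ffun cell -> k^o} :=
  [ffun x : cell => (if [pick a | x.2 == ~: [set a]] is Some a then
     (if in_icone V 2 (u x.1 - pi a) then eps a * g (x.1, col x.1 a) else 0) else 0) : k^o].
Lemma spread_linear : linear spread_fun.
Proof.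
move=> c f g; apply/ffunP => x; rewrite !ffunE; case: pickP => [a _|_]; last by rewrite scaler0 addr0.
by case: ifP => _; [rewrite !ffunE /GRing.scale /=; ring|rewrite scaler0 addr0].
Qed.

Lemma spreadE g j a : spread_fun g (j, ~: [set a]) =
  if in_icone V 2 (u j - pi a) then eps a * g (j, col j a) else 0.
Proof.
rewrite ffunE /=; case: pickP => [b /eqP/setC_inj/set1_inj -> //|/(_ a)].
by rewrite eqxx.
Qed.

(** By [col_edge] and [col_conn] the colours are exactly the components of the graph among the
    points in use, so the kernel has one dimension for each colour that occurs over a weight. *)
Lemma dim_colours : dimK = #|colour_used|.
Proof.
have cardC1 a : #|~: [set a : 'I_n]| = n.-1 by rewrite cardsC1 card_ord.
rewrite -(dim_supported k colour_used).
have -> : (chains k Y n.-1 :&: lker dY = lin spread_linear @: supported k colour_used)%VS.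
  apply/vspaceP => f; rewrite memv_cap memv_ker; apply/andP/memv_imgP.
    move=> [fY /eqP/(top_kerP fY) H].
    pose g : {ffun J * bool -> k^o} := [ffun x : J * bool =>
      (if [pick a | in_icone V 2 (u x.1 - pi a) && (col x.1 a == x.2)] is Some a
      then eps a * f (x.1, ~: [set a]) else 0) : k^o].
    exists g.
      apply/supportedP => x; rewrite ffunE; case: pickP => [a xa _|]; last by rewrite eqxx.
      by apply/existsP; exists a.
    apply/ffunP => -[j T]; rewrite linE.
    have [a /eqP ->|no] := pickP (fun a => T == ~: [set a]).
      rewrite spreadE; case: ifP => [ya|]; last first.
        move/negbT; rewrite -Y1 => ny; apply/eqP/negPn/negP => nz.
        by have /chainsP/(_ _ nz)[] := fY; rewrite (negPf ny).
      rewrite ffunE /=; case: pickP => [b /andP[yb /eqP cb]|/(_ a)]; last by rewrite ya eqxx.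
      have -> := @col_conn j (fun a => eps a * f (j, ~: [set a])) (H j) b a yb ya cb.
      by rewrite mulrA eps_sqr mul1r.
    rewrite ffunE /=; case: pickP => [a|_]; first by rewrite no.
    apply/eqP/negPn/negP => nz; have /chainsP/(_ _ nz)[/= _ cT] := fY.
    have /cards1P[a ea] : #|~: T| == 1%N.
      have := cardsC T; rewrite cT card_ord; lia.
    by have := no a; rewrite -ea setCK eqxx.
  move=> [g /supportedP gQ ->].
  have sY : lin spread_linear g \in chains k Y n.-1.
    apply/chainsP => -[j T]; rewrite linE.
    have [a /eqP ->|no] := pickP (fun a => T == ~: [set a]).
      by rewrite spreadE; case: ifP; rewrite ?eqxx //= Y1 cardC1.
    by rewrite ffunE /=; case: pickP => [a|]; rewrite ?no ?eqxx.
  split=> //; apply/eqP/(top_kerP sY) => j a b ab yab.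
  have ya : in_icone V 2 (u j - pi a) := icone_up yab.
  have yb : in_icone V 2 (u j - pi b) by apply: (@icone_up _ _ a); rewrite addrAC.
  rewrite !linE !spreadE ya yb !mulrA !eps_sqr !mul1r.
  by rewrite (col_edge ab yab).
apply: limg_dim_eq; apply/vspaceP => g; rewrite memv0 memv_cap memv_ker.
apply/andP/eqP => [[/supportedP gQ /eqP e]|->]; last by rewrite mem0v raddf0.
apply/ffunP => -[j c]; rewrite ffunE; apply/eqP/negPn/negP => nz.
have /existsP[a /andP[/= ya /eqP ca]] := gQ _ nz.
have := congr1 (fun f : {ffun cell -> k^o} => f (j, ~: [set a])) e.
rewrite linE spreadE ya ca [RHS]ffunE => /eqP; rewrite mulf_eq0 (negPf nz) orbF.
by rewrite (negPf (eps_neq0 _)).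
Qed.
End Colouring.

(** If every point has at most one partner, the conditions of different pairs involve different
    points; placing the value of a pair on its larger element inverts the boundary. *)
Lemma matching_hdim : (5 <= n)%N ->
  (forall z a b b', b != a -> b' != a -> in_icone V 1 (z - pi a - pi b) ->
     in_icone V 1 (z - pi a - pi b') -> b = b') ->
  hdim (bd k J n) (chains k C) (n - 5) = 0%N.
Proof.
move=> n5 match1; rewrite -(polygon_duality k cvx pi_cone' vP').
apply/eqP; rewrite subn_eq0; apply: dimvS; apply/subvP => f; rewrite memv_cap => /andP[fY _].
have e : (n - 5).+3 = n.-2 by lia.
have e' : n.-2.+1 = n.-1 by lia.
rewrite e in fY *; apply/memv_imgP.
pose g : {ffun cell -> k^o} := [ffun x : cell => (if [pick b | x.2 == ~: [set b]] is Some b then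
   (if [pick a : 'I_n | (a < b)%N && in_icone V 1 (u x.1 - pi a - pi b)] is Some a then
     sgn k a (~: [set a; b]) * f (x.1, ~: [set a; b]) else 0) else 0) : k^o].
have gE j (b : 'I_n) : g (j, ~: [set b]) = if [pick a : 'I_n | (a < b)%N && in_icone V 1 (u j - pi a - pi b)] is Some a then
     sgn k a (~: [set a; b]) * f (j, ~: [set a; b]) else 0.
  rewrite ffunE /=; case: (pickP (fun b' => ~: [set b] == ~: [set b'])) => [b' /eqP/setC_inj/set1_inj <- //|/(_ b)].
  by rewrite eqxx.
have gY : g \in chains k Y n.-2.+1.
  apply/chainsP => -[j T].
  have [b /eqP -> |no] := pickP (fun b => T == ~: [set b]).
    rewrite gE; case: pickP => [a /andP[ab yab] _|]; last by rewrite eqxx.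
    rewrite Y1 /= cardsC1 card_ord -e'; split=> //.
    by rewrite -[2]/(1 + 1); apply: (@icone_up _ _ a); rewrite addrAC.
  by rewrite ffunE /=; case: pickP => [b|]; rewrite ?no ?eqxx.
exists g; first exact: gY.
apply/ffunP => -[j T].
have dgY := dY_chains gY.
have [[a [b [lt TE]]]|no] := pselect (exists a b : 'I_n, (a < b)%N /\ T = ~: [set a; b]); last first.
  have zero (h : {ffun cell -> k^o}) : h \in chains k Y n.-2 -> h (j, T) = 0.
    move=> /chainsP hY; apply/eqP/negPn/negP => /hY[_ /= cT].
    have : #|~: T| == 2%N by rewrite cardsCs setCK card_ord cT; lia.
    move=> /cards2P[a [b [ab eT]]]; apply: no; have TE : T = ~: [set a; b] by rewrite -eT setCK.
    move: ab; rewrite neq_ltn => /orP[] lt; first by exists a, b.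
    by exists b, a; rewrite TE finset.setUC.
  by rewrite !zero.
have ab : a != b by rewrite neq_ltn lt.
have [yT|nyT] := boolP (Y (j, T)); last first.
  have zero (h : {ffun cell -> k^o}) : h \in chains k Y n.-2 -> h (j, T) = 0.
    by move=> /chainsP hY; apply/eqP/negPn/negP => /hY[]; rewrite (negPf nyT).
  by rewrite !zero.
have yab : in_icone V 1 (u j - pi a - pi b) by rewrite -Y2 // -TE.
rewrite e' in gY; rewrite TE dY_pair ?Y2 // !gE.
case: (pickP (fun a' : 'I_n => (a' < b)%N && _)) => [a' /andP[lt' ya'b]|/(_ a)]; last by rewrite lt yab.
have aa : a' = a.
  have ne : a' != b by rewrite neq_ltn lt'.
  apply: (match1 (u j) b); rewrite // addrAC //.
case: (pickP (fun a' : 'I_n => (a' < a)%N && _)) => [c /andP[ltc yca]|_].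
  have cb : c = b.
    have ne : c != a by rewrite neq_ltn ltc.
    have ne' : b != a by rewrite eq_sym.
    by apply: (match1 (u j) a); rewrite // addrAC.
  by rewrite cb in ltc; have := ltn_trans lt ltc; rewrite ltnn.
rewrite mulr0 subr0 aa sgnC2 // ltnNge ltnW //= expr0 !mulr1.
have ea := eps_sqr a; have eb := eps_sqr b; set x := f _.
transitivity ((eps a * eps a) * (eps b * eps b) * x); last by ring.
by rewrite ea eb !mul1r.
Qed.
End FullPolygon.

(** * Exactness of linear strands by removing a vertex *)

Section LinearStrand.
Variables (k : fieldType) (n : nat) (pi : 'I_n -> int * int).
Hypothesis pi_inj : injective pi.
Implicit Types (f g h : {set 'I_n} -> k) (T B U W : {set 'I_n}) (w lam : int * int) (s t v a b : 'I_n).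
Local Notation sg T := (\sum_(t in (T : {set 'I_n})) pi t).

Definition dd f T : k := \sum_(t | t \notin T) sgn k t T * f (t |: T).

Lemma ddE f T : bd k unit n [ffun x : unit * {set 'I_n} => f x.2 : k^o] (tt, T) = dd f T.
Proof. by rewrite bdE; apply: eq_bigr => t _; rewrite ffunE. Qed.

Lemma dd_dd f T : dd (dd f) T = 0.
Proof.
rewrite -ddE; set F := [ffun x => _].
have -> : F = bd k unit n [ffun x : unit * {set 'I_n} => f x.2 : k^o].
  by apply/ffunP => -[[] T']; rewrite ffunE ddE.
by rewrite bd_bd ffunE.
Qed.

Lemma ddD f g T : dd (fun T => f T + g T) T = dd f T + dd g T.
Proof. by rewrite /dd -big_split; apply: eq_bigr => t _; rewrite mulrDr. Qed.
Lemma ddB f g T : dd (fun T => f T - g T) T = dd f T - dd g T.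
Proof. by rewrite /dd -sumrB; apply: eq_bigr => t _; rewrite mulrBr. Qed.

Lemma dd_neq0 f T : dd f T != 0 -> exists2 t, t \notin T & f (t |: T) != 0.
Proof.
move=> nz; case: (pickP (fun t => (t \notin T) && (f (t |: T) != 0))) => [t /andP[]|no]; first by exists t.
case/eqP: nz; apply: big1 => t tT; have := no t; rewrite tT /= => /negbFE/eqP ->.
by rewrite mulr0.
Qed.

Lemma dd_other f T t : dd f T = 0 -> t \notin T -> f (t |: T) != 0 ->
  exists s, [/\ s \notin T, s != t & f (s |: T) != 0].
Proof.
move=> d0 tT nz; case: (pickP (fun s => [&& s \notin T, s != t & f (s |: T) != 0])) => [s /and3P[]|no].
  by exists s.
move: d0; rewrite /dd (bigD1 t) //= big1 ?addr0 => [/eqP|s /andP[sT st]].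
  by rewrite mulf_eq0 (negPf nz) orbF -sqrf_eq0 expr2 sgn_sqr oner_eq0.
by have := no s; rewrite sT st /= => /negbFE/eqP ->; rewrite mulr0.
Qed.

(** The residual weight [w - sg T] is a single point of [B], that is, the coefficient is linear; in
    [top_chain] it is zero, a constant coefficient. *)
Definition strand_chain B p w f := forall T, f T != 0 ->
  [/\ T \subset B, #|T| = p & exists2 a, a \in B & w = sg T + pi a].
Definition top_chain B p w g := forall T, g T != 0 ->
  [/\ T \subset B, #|T| = p & w = sg T].

(* Exactness, at the spot K_(p,1), of the linear strand of the points of [B]. *)
Definition linear_exact B p := forall w f, strand_chain B p w f -> (forall T, dd f T = 0) ->
  exists2 g, top_chain B p.+1 w g & forall T, f T = dd g T.

Lemma sgU t T : t \notin T -> sg (t |: T) = pi t + sg T.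
Proof. by move=> tT; rewrite (big_setU1 t). Qed.

Lemma top_dd B p w g T : top_chain B p.+1 w g -> dd g T != 0 ->
  exists t, [/\ t \notin T, t \in B, T \subset B, #|T| = p & w = sg T + pi t].
Proof.
move=> gP /dd_neq0[t tT /gP[]]; rewrite subUset sub1set cardsU1 tT sgU // => /andP[tB TB] [cT] e.
by exists t; split=> //; rewrite e addrC.
Qed.

Lemma top_strand B p w g : top_chain B p.+1 w g -> strand_chain B p w (dd g).
Proof. by move=> gP T /(top_dd gP)[t [_ tB TB cT e]]; split=> //; exists t. Qed.

Lemma top_single B p w g T s : top_chain B p.+1 w g -> s \notin T -> w = sg T + pi s ->
  dd g T = sgn k s T * g (s |: T).
Proof.
move=> gP sT ws; rewrite /dd (bigD1 s) //= big1 ?addr0 // => t /andP[tT ts].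
suff -> : g (t |: T) = 0 by rewrite mulr0.
apply/eqP/negPn/negP => /gP[_ _]; rewrite sgU // ws addrC => /addIr/pi_inj e.
by rewrite e eqxx in ts.
Qed.

(** Interior product with the generator [s]; it anticommutes with [dd]. *)
Definition contract s f T : k := if s \in T then 0 else sgn k s T * f (s |: T).

Lemma dd_contract s f T : dd (contract s f) T = if s \in T then 0 else - (sgn k s T * dd f (s |: T)).
Proof.
rewrite /dd; case: ifP => [sT|/negbT sT].
  by apply: big1 => t tT; rewrite /contract inE sT orbT mulr0.
rewrite (bigD1 s) //= {1}/contract !inE eqxx mulr0 add0r mulr_sumr -sumrN.
rewrite (eq_bigl (fun t => t \notin s |: T)) => [|t]; last by rewrite !inE negb_or andbC.
apply: eq_bigr => t; rewrite !inE negb_or => /andP[ts tT].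
rewrite /contract !inE eq_sym (negPf ts) (negPf sT) /= !mulrA -mulNr setUCA; congr (_ * _).
by rewrite -sgn_swap // eq_sym.
Qed.

Lemma contract_neq0 s f T : contract s f T != 0 -> s \notin T /\ f (s |: T) != 0.
Proof.
rewrite /contract; case: ifP; rewrite ?eqxx // => _; rewrite mulf_eq0 negb_or => /andP[_ nz].
by split.
Qed.

Lemma contract_eq0 s f T : s \notin T -> contract s f T = 0 -> f (s |: T) = 0.
Proof.
move=> sT; rewrite /contract (negPf sT) => /eqP; rewrite mulf_eq0 => /orP[|/eqP //].
by rewrite -sqrf_eq0 expr2 sgn_sqr oner_eq0.
Qed.

Lemma argmin_set (F : 'I_n -> int) U : U != finset.set0 ->
  exists2 t, t \in U & forall s, s \in U -> F t <= F s.
Proof.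
case/set0Pn => x xU; have [|t] := @seq_argmin _ _ _ F (enum U) x; first by rewrite mem_enum.
by rewrite mem_enum => tU tP; exists t => // s sU; apply: tP; rewrite mem_enum.
Qed.

Lemma dotD lam x y : dot lam (x + y) = dot lam x + dot lam y.
Proof. by rewrite /dot /=; ring. Qed.

(** If [a] differs from [v], the functional is strictly larger on the right-hand side of the
    equation. *)
Lemma strict_min_double B v lam : v \in B ->
  (forall a, a \in B -> a != v -> dot lam (pi v) < dot lam (pi a)) ->
  forall s t a, s \in B -> t \in B -> a \in B -> dot lam (pi s) <= dot lam (pi t) ->
    pi s + pi v = pi t + pi a -> s = t.
Proof.
move=> vB vmin s t a sB tB aB st e; apply/pi_inj.
have [av|av] := eqVneq a v; first by move: e; rewrite av => /addIr.
by have := vmin _ aB av; have := congr1 (dot lam) e; rewrite !dotD; lia.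
Qed.

(** Exterior multiplication by [s]; on sets without [s] it is undone by [dd]. *)
Definition raise s G T : k := if s \in T then sgn k s (T :\ s) * G (T :\ s) else 0.

Lemma raiseU s G T : s \notin T -> raise s G (s |: T) = sgn k s T * G T.
Proof. by move=> sT; rewrite /raise setU11 setU1K. Qed.

Lemma raise_out s G T : s \notin T -> dd (raise s G) T = G T.
Proof.
move=> sT; rewrite /dd (bigD1 s) //= raiseU // mulrA sgn_sqr mul1r big1 ?addr0 // => t /andP[tT ts].
by rewrite /raise !inE eq_sym (negPf ts) (negPf sT) mulr0.
Qed.

Lemma raise_in s G T : s \notin T -> G (s |: T) = 0 ->
  dd (raise s G) (s |: T) = - (sgn k s T * dd G T).
Proof.
move=> sT G0; rewrite /dd [in RHS](bigD1 s) //= G0 mulr0 add0r mulr_sumr -sumrN.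
rewrite (eq_bigl (fun t => (t \notin T) && (t != s))) => [|t]; last by rewrite !inE negb_or andbC.
apply: eq_bigr => t /andP[tT ts]; rewrite setUCA raiseU; last by rewrite !inE negb_or eq_sym ts.
by rewrite !mulrA -mulNr; congr (_ * _); rewrite sgn_swap_mix // eq_sym.
Qed.

(** Induction on the set [U] of points that occur. Let [s] minimise the functional on [U]. By
    [strict_min_double] a set containing [s] never has residual point [v], so the contraction by [s]
    is a cycle on [B :\ v]; exactness there yields a correction that removes [s] from the
    support. *)
Theorem peel B v lam p : v \in B ->
  (forall a, a \in B -> a != v -> dot lam (pi v) < dot lam (pi a)) -> (1 < p)%N ->
  linear_exact (B :\ v) p.-1 -> linear_exact B p.
Proof.
move=> vB vmin p1 ex.
suff H m U : #|U| = m -> U \subset B -> forall w f, strand_chain B p w f ->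
    (forall T, f T != 0 -> T \subset U) -> (forall T, dd f T = 0) ->
    exists2 g, top_chain B p.+1 w g & forall T, f T = dd g T.
  by move=> w f fP; apply: (H _ B erefl (fintype.subxx _)) => // T /fP[].
elim: m U => [|m IH] U.
  move=> /eqP; rewrite cards_eq0 => /eqP -> _ w f fP f0 _; exists (fun=> 0); first by move=> T /eqP.
  move=> T; rewrite [RHS]big1 => [|t _]; last by rewrite mulr0.
  apply/eqP/negPn/negP => nz; have := f0 _ nz; rewrite subset0 => /eqP T0.
  by have [_ + _] := fP _ nz; rewrite T0 cards0 => p0; rewrite -p0 in p1.
move=> cU UB w f fP fU df.
have [|s sU smin] := @argmin_set (fun t => dot lam (pi t)) U; first by rewrite -cards_eq0 cU.
have sB := subsetP UB _ sU.
(* The minimum over [B] is attained only at [v], so once [v] occurs it is the point to be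
   contracted. *)
have vs : v \in U -> s = v.
  move=> vU; apply/eqP/negPn/negP => ne; have := vmin _ sB ne; have := smin _ vU; lia.
have zero T : s \notin T -> f (s |: T) != 0 -> w != sg (s |: T) + pi v.
  move=> sT nz; apply/eqP => we; have [t [tT ts ft]] := dd_other (df T) sT nz.
  have tU : t \in U by have := subsetP (fU _ ft) t; apply; rewrite setU11.
  have [_ _ [a aB]] := fP _ ft; rewrite we !sgU // -!addrA [sg T + _]addrC [sg T + pi a]addrC !addrA => /addIr e.
  have := strict_min_double vB vmin sB (subsetP UB _ tU) aB (smin _ tU) e.
  by move=> st; rewrite st eqxx in ts.
have cP : strand_chain (B :\ v) p.-1 (w - pi s) (contract s f).
  move=> T /contract_neq0[sT nz]; have [TB cT [a aB we]] := fP _ nz; have TU := fU _ nz.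
  have av : a != v by apply: contraNneq (zero _ sT nz) => <-; rewrite we.
  split; last by exists a; rewrite ?inE ?av // we sgU //; ring.
    apply/subsetP => t tT; have tU : t \in U by have := subsetP TU t; apply; rewrite inE tT orbT.
    rewrite !inE (subsetP UB _ tU) andbT; apply: contraNneq sT => tv; rewrite (vs _) -?tv //.
  by move: cT; rewrite cardsU1 sT => <-.
have [|G GP cG] := ex (w - pi s) (contract s f) cP.
  by move=> T; rewrite dd_contract df mulr0 oppr0 if_same.
have GP' := GP; rewrite (ltn_predK p1) in GP.
(* Since [p] exceeds 1, each point of a set in the support of [G] survives the removal of some other
   point, and the smaller set occurs in the contraction of [f]. *)
have GU T : G T != 0 -> T \subset U :\ s.
  move=> nz; have [TB cT wT] := GP _ nz; apply/subsetP => t tT.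
  have [t' [t'T tt']] : exists t', t' \in T /\ t' != t.
    have : (0 < #|T :\ t|)%N by move: cT; rewrite (cardsD1 t) tT; lia.
    by case/card_gt0P => t'; rewrite !inE => /andP[? ?]; exists t'.
  have : contract s f (T :\ t') != 0.
    rewrite cG (top_single (s := t') GP') ?setD11 ?setD1K //.
      by rewrite mulf_neq0 // -sqrf_eq0 expr2 sgn_sqr oner_eq0.
    by rewrite wT -{1}(setD1K t'T) sgU ?setD11 // addrC.
  case/contract_neq0 => sT /fU; rewrite subUset => /andP[_ /subsetP sub].
  have tT' : t \in T :\ t' by rewrite !inE eq_sym tt' tT.
  by rewrite !inE (sub _ tT') andbT; apply: contraNneq sT => <-.
have Gs T : s \in T -> G T = 0.
  by move=> sT; apply/eqP/negPn/negP => /GU/subsetP/(_ _ sT); rewrite !inE eqxx.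
have rP : top_chain B p.+1 w (raise s G).
  move=> T; rewrite /raise; case: ifP; rewrite ?eqxx // => sT; rewrite mulf_eq0 negb_or => /andP[_ /GP[TB cT we]].
  split; last by rewrite -(setD1K sT) sgU ?setD11 // -we addrC subrK.
    rewrite -(setD1K sT) subUset sub1set sB (fintype.subset_trans TB) //; exact: subsetDl.
  by rewrite (cardsD1 s) sT cT.
have [|||||g gP fg] := IH (U :\ s) _ _ w (fun T => f T + dd (raise s G) T).
- by move: cU; rewrite (cardsD1 s) sU => -[].
- by apply: fintype.subset_trans UB; exact: subsetDl.
- move=> T; have [->|nz] := eqVneq (f T) 0; first by rewrite add0r => /(top_strand rP).
  by move=> _; apply: fP.
- move=> T; have [sT|sT] := boolP (s \in T).
    have TE := setD1K sT; have sT' : s \notin T :\ s by rewrite setD11.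
    have -> : f T + dd (raise s G) T = 0; last by rewrite eqxx.
    rewrite -TE raise_in // ?Gs ?setU11 // -cG /contract (negPf sT') mulrA sgn_sqr mul1r subrr //.
  rewrite raise_out //; have [->|nz _] := eqVneq (f T) 0; first by rewrite add0r => /GU.
  apply/subsetP => t tT; rewrite !inE (subsetP (fU _ nz) _ tT) andbT.
  by apply: contraNneq sT => <-.
- by move=> T; rewrite ddD df dd_dd addr0.
exists (fun T => g T - raise s G T).
  move=> T; have [->|nz] := eqVneq (g T) 0; last by move=> _; apply: gP.
  by rewrite sub0r oppr_eq0 => /rP.
by move=> T; rewrite ddB -fg addrK.
Qed.

(** A nonzero linear syzygy on sets of size [q] needs more than [q] residual points. Take [s] in [U]
    and [b] in [W] with the largest values of [mu]: a term with [s] and residual point [b] must be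
    cancelled by another pair with the same sum, which maximality excludes. So contraction by [s]
    loses [b], and both sizes drop by one. *)
Lemma rank_vanish q W U mu w h : (forall a b, dot mu (pi a) = dot mu (pi b) -> a = b) ->
  (#|W| <= q)%N ->
  (forall T, h T != 0 -> [/\ T \subset U, #|T| = q & exists2 a, a \in W & w = sg T + pi a]) ->
  (forall T, dd h T = 0) -> forall T, h T = 0.
Proof.
move=> mu_inj; elim: q W U w h => [|q IHq] W U w h.
  rewrite leqn0 cards_eq0 => /eqP -> hP _ T; apply/eqP/negPn/negP => /hP[_ _ [a]].
  by rewrite inE.
move=> cW; have [m cU] : exists m, #|U| = m by exists #|U|.
elim: m U cU h => [|m IHm] U cU h hP dh T; apply/eqP/negPn/negP => nz.
  have [TU cT _] := hP _ nz; move/eqP: cU; rewrite cards_eq0 => /eqP U0.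
  by move: TU cT; rewrite U0 subset0 => /eqP ->; rewrite cards0.
have [_ _ [a0 a0W _]] := hP _ nz.
have [|s sU smax] := @argmin_set (fun t => - dot mu (pi t)) U; first by rewrite -cards_eq0 cU.
have [|b bW bmax] := @argmin_set (fun t => - dot mu (pi t)) W; first by apply/set0Pn; exists a0.
have c0 T' : contract s h T' = 0.
  apply: (IHq (W :\ b) (U :\ s) (w - pi s)) => [|T1 /contract_neq0[sT nz1]|T1].
  - by move: cW; rewrite (cardsD1 b) bW add1n ltnS.
  - have [TU cT [a aW we]] := hP _ nz1; split.
    + move: TU; rewrite subUset => /andP[_ /subsetP TU]; apply/subsetP => t tT.
      by rewrite !inE TU // andbT; apply: contraNneq sT => <-.
    + by move: cT; rewrite cardsU1 sT => -[].
    exists a; last by rewrite we sgU //; ring.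
    rewrite !inE aW andbT; apply/eqP => ab; rewrite ab {a aW ab} in we.
    have [t [tT ts ht]] := dd_other (dh T1) sT nz1.
    have [tU _ [a aW]] := hP _ ht; rewrite we !sgU // -!addrA [sg T1 + _]addrC [sg T1 + pi a]addrC !addrA => /addIr e.
    have {}tU : t \in U by move: tU; rewrite subUset sub1set => /andP[].
    have := smax _ tU; have := bmax _ aW; have := congr1 (dot mu) e; rewrite !dotD => e1 e2 e3.
    by case/eqP: ts; apply: mu_inj; lia.
  by rewrite dd_contract dh mulr0 oppr0 if_same.
have hs T' : s \in T' -> h T' = 0.
  by move=> sT; rewrite -(setD1K sT); apply: contract_eq0; rewrite ?setD11.
case/eqP: nz; apply: (IHm (U :\ s)) => // [|T' nz'].
  by move: cU; rewrite (cardsD1 s) sU => -[].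
have [TU cT aP] := hP _ nz'; split=> //; apply/subsetP => t tT.
rewrite !inE (subsetP TU _ tT) andbT; apply: contraTneq nz' => ts.
by rewrite hs ?eqxx // -ts.
Qed.

(** Terms with residual point [v] are first removed with [raise]. After that a set containing [v]
    only has residual points [a] with [pi v + pi a = pi b + pi c]; these lie in [W], which is too
    small by [rank_vanish]. What is left lives on [B :\ v]. *)
Theorem rank_exact B v lam mu p W : v \in B ->
  (forall a b, dot mu (pi a) = dot mu (pi b) -> a = b) ->
  (forall a, a \in B -> a != v -> dot lam (pi v) < dot lam (pi a)) ->
  (forall a b c, a \in B :\ v -> b \in B :\ v -> c \in B :\ v -> pi v + pi a = pi b + pi c -> a \in W) ->
  (#|W| < p)%N -> linear_exact (B :\ v) p -> linear_exact B p.
Proof.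
move=> vB mu_inj vmin Wmem cW ex w f fP df.
pose G T := if (v \notin T) && (w == sg T + pi v) then f T else 0.
have G0 T : v \in T -> G T = 0 by rewrite /G => ->.
have rP : top_chain B p.+1 w (raise v G).
  move=> T; rewrite /raise; case: ifP; rewrite ?eqxx // => vT; rewrite mulf_eq0 negb_or => /andP[_].
  rewrite /G; case: ifP; rewrite ?eqxx // => /andP[vT' /eqP we] /fP[TB cT _]; split.
  - by rewrite -(setD1K vT) subUset sub1set vB.
  - by rewrite (cardsD1 v) vT cT.
  - by rewrite we -{2}(setD1K vT) sgU ?setD11 // addrC.
pose f' T := f T - dd (raise v G) T.
have f'P : strand_chain B p w f'.
  move=> T; rewrite /f'; have [->|nz] := eqVneq (f T) 0; last by move=> _; apply: fP.
  by rewrite sub0r oppr_eq0 => /(top_strand rP).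
have df' T : dd f' T = 0 by rewrite ddB df dd_dd subr0.
have f'0 T : v \notin T -> w = sg T + pi v -> f' T = 0.
  by move=> vT we; rewrite /f' raise_out // /G vT -we eqxx subrr.
have zero T : v \notin T -> f' (v |: T) != 0 -> w != sg (v |: T) + pi v.
  move=> vT nz; apply/eqP => we; have [t [tT tv ft]] := dd_other (df' T) vT nz.
  have [tB _ [a aB]] := f'P _ ft; rewrite we !sgU // -!addrA [sg T + _]addrC [sg T + pi a]addrC !addrA => /addIr e.
  have {}tB : t \in B by move: tB; rewrite subUset sub1set => /andP[].
  have := strict_min_double vB vmin vB tB aB (ltW (vmin _ tB tv)) e.
  by move=> vt; rewrite vt eqxx in tv.
have c0 T : contract v f' T = 0.
  apply: (@rank_vanish p.-1 W (B :\ v) mu (w - pi v) _ mu_inj) => [|T1 /contract_neq0[vT nz]|T1].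
  - by rewrite -ltnS (ltn_predK cW).
  - have [TB cT [a aB we]] := f'P _ nz; have av : a != v by apply: contraNneq (zero _ vT nz) => av; rewrite we av.
    split.
    + move: TB; rewrite subUset => /andP[_ /subsetP TB]; apply/subsetP => t tT.
      by rewrite !inE TB // andbT; apply: contraNneq vT => <-.
    + by move: cT; rewrite cardsU1 vT => <-.
    exists a; last by rewrite we sgU //; ring.
    have [t [tT tv ft]] := dd_other (df' T1) vT nz.
    have [tB _ [c cB wc]] := f'P _ ft; have {}tB : t \in B by move: tB; rewrite subUset sub1set => /andP[].
    have cv : c != v.
      apply: contraTneq ft => cv; rewrite f'0 ?eqxx // -?cv //.
      by rewrite !inE negb_or eq_sym cv tv.
    move: wc; rewrite we !sgU // -!addrA [sg T1 + _]addrC [sg T1 + pi c]addrC !addrA => /addIr e.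
    by apply: (Wmem a t c); rewrite ?inE ?av ?tv ?cv.
  by rewrite dd_contract df' mulr0 oppr0 if_same.
have f'v T : v \in T -> f' T = 0.
  by move=> vT; rewrite -(setD1K vT); apply: contract_eq0; rewrite ?setD11.
have [|g gP fg] := ex w f' _ df'.
  move=> T nz; have [TB cT [a aB we]] := f'P _ nz.
  have vT : v \notin T by apply: contraNN nz => vT; rewrite f'v.
  split=> //.
    apply/subsetP => t tT; rewrite !inE (subsetP TB _ tT) andbT.
    by apply: contraNneq vT => <-.
  exists a => //; rewrite !inE aB andbT; apply: contraNneq nz => av.
  by rewrite f'0 // -av.
exists (fun T => g T + raise v G T); last by move=> T; rewrite ddD -fg subrK.
move=> T; have [->|nz _] := eqVneq (g T) 0; first by rewrite add0r => /rP.
have [TB cT we] := gP _ nz; split=> //; apply: fintype.subset_trans TB _; exact: subsetDl.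
Qed.
End LinearStrand.

(** * Linear exactness, Betti numbers and duality *)

Section StrandDuality.
Variables (k : fieldType) (n m : nat) (pi : 'I_n -> int * int) (V : 'I_m -> int * int).
Hypothesis pi_inj : injective pi.
Hypothesis cvx : convex_cycle V.
Variable B : {set 'I_n}.
Hypothesis pi_cone : forall t, t \in B -> in_cone V 1 (pi t).
Hypothesis pi_full : forall z, in_cone V 1 z -> exists2 t, t \in B & pi t = z.
Local Notation sg T := (\sum_(t in (T : {set 'I_n})) pi t).

Lemma cone0 : in_cone V 0 0.
Proof. by apply/forallP => i; rewrite edge0. Qed.

Lemma exact_hdim (J : finType) (w : J -> int * int) p : linear_exact k pi B p ->
  hdim (bd k J n) (chains k (cone_cell pi V B w p.+1%:Z)) p = 0%N.
Proof.
move=> ex; apply/eqP; rewrite subn_eq0; apply: dimvS; apply/subvP => F.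
rewrite memv_cap memv_ker => /andP[/chainsP FC /eqP dF].
have /choice[g gP] : forall j, exists g, top_chain pi B p.+1 (w j) g /\
    forall T, F (j, T) = dd g T :> k.
  move=> j; have [||g gP fg] := ex (w j) (fun T => F (j, T)).
  - move=> T nz; have [/andP[/= TB zC] /= cT] := FC _ nz; split=> //.
    have [|t tB te] := pi_full (z := w j - sg T).
      by move: zC; rewrite cT -addn1 PoszD addrAC subrr add0r.
    by exists t => //; rewrite te addrC subrK.
  - move=> T; have := congr1 (fun G : {ffun J * {set 'I_n} -> k^o} => G (j, T)) dF.
    by rewrite bdE ffunE.
  by exists g.
apply/memv_imgP; exists [ffun x : J * {set 'I_n} => g x.1 x.2 : k^o].
  apply/chainsP => -[j T]; rewrite ffunE /= => nz; have [gt _] := gP j.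
  have [TB cT we] := gt _ nz; split=> //; rewrite /cone_cell /= TB cT subrr we subrr.
  exact: cone0.
apply/ffunP => -[j T]; rewrite bdE /=; have [_ ->] := gP j.
by apply: eq_bigr => t _; rewrite ffunE.
Qed.

(** The dual homology sits on the full set [B] over interior points of height 2. By [icone2_sub] a
    point of [B] can be removed so that an interior point of height 1 is left, and there the
    boundary reads off the coefficient. *)
Lemma duality_exact i0 (v : 'I_m -> 'I_n) : (forall i, v i \in B /\ pi (v i) = V i) ->
  (3 <= #|B|)%N -> in_icone V 1 i0 -> linear_exact k pi B (#|B| - 3).
Proof.
(* Degree [p.+1] in exterior degree [p] is the linear strand, and the dual degree [p.+3] is the size
   of [B]. *)
move=> vP B3 i0P w f fP df; pose p := (#|B| - 3)%N; pose q : int := p.+1%:Z.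
pose w' (_ : unit) := w.
have hY : hdim (bd_rel k (half_cell pi V B w' q)) (chains k (icone_cell pi V B w' q)) p.+3 = 0%N.
  apply/eqP; rewrite /hdim subn_eq0 -[leqLHS]addn0.
  suff -> : (chains k (icone_cell pi V B w' q) p.+3 :&: lker (bd_rel k (half_cell pi V B w' q)))%VS = 0%VS.
    by rewrite dimv0.
  apply/vspaceP => F; rewrite memv0 memv_cap memv_ker; apply/andP/eqP => [[FY /eqP dF]|->]; last first.
    by rewrite mem0v raddf0.
  have /chainsP FY' := FY; apply/ffunP => -[[] T]; rewrite ffunE; apply/eqP/negPn/negP => nz.
  have [/andP[/= TB uP] /= cT] := FY' _ nz.
  have TE : T = B.
    by apply/eqP; rewrite eqEcard TB cT /p; lia.
  rewrite TE in nz uP; have [a aP ua] : exists2 a, in_cone V 1 a & in_icone V 1 (sg B - w - a).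
    have e2 : #|B|%:Z - q = 2 by rewrite /q /p; lia.
    by apply: (icone2_sub cvx i0P); rewrite e2 in uP; exact: uP.
  have [t tB te] := pi_full aP.
  have cB : #|B :\ t| = p.+2 by move: (cardsD1 t B); rewrite tB /p; lia.
  have YT : icone_cell pi V B w' q (tt, B :\ t).
    rewrite /icone_cell /= subsetDl /= cB (_ : _ - q = 1); last by rewrite /q; lia.
    move: ua; rewrite -te [in X in X -> _](big_setD1 t) //=; congr (is_true (in_icone V _ _)).
    by rewrite addrAC [pi t + _]addrC addrK.
  have := congr1 (fun G : {ffun unit * {set 'I_n} -> k^o} => G (tt, B :\ t)) dF.
  rewrite dYE /= ?cB // YT bdE ffunE /= (bigD1 t) ?setD11 //= setD1K // big1 ?addr0 => [/eqP|s /andP[sB st]].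
    by rewrite mulf_eq0 (negPf nz) orbF -sqrf_eq0 expr2 sgn_sqr oner_eq0.
  have -> : F (tt, s |: B :\ t) = 0; last by rewrite mulr0.
  apply/eqP/negPn/negP => /FY'[/andP[+ _] _]; rewrite /= subUset sub1set => /andP[sB' _].
  by move: sB; rewrite !inE sB' st.
rewrite (polygon_duality k cvx pi_cone vP) in hY.
pose F := [ffun x : unit * {set 'I_n} => f x.2 : k^o].
have FC : F \in chains k (cone_cell pi V B w' q) p.
  apply/chainsP => -[[] T]; rewrite ffunE /= => nz; have [TB cT [a aB we]] := fP _ nz; split=> //.
  rewrite /cone_cell /= TB cT (_ : q - _ = 1); last by rewrite /q; lia.
  by rewrite /w' we addrC addKr pi_cone.
have dF : bd k unit n F = 0 by apply/ffunP => -[[] T]; rewrite bdE ffunE -[RHS](df T); apply: eq_bigr => t _; rewrite ffunE.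
have sub : (bd k unit n @: chains k (cone_cell pi V B w' q) p.+1 <=
   chains k (cone_cell pi V B w' q) p :&: lker (bd k unit n))%VS.
  apply/subvP => y /memv_imgP[g gX ->]; rewrite memv_cap memv_ker bd_bd eqxx andbT.
  apply: (bd_chains _ gX) => j t T; rewrite !(cone_cellE _ _ cvx) => /forallP H.
  by apply/forallP => i; apply: (half_cell_down pi_cone (H i)).
have : F \in (bd k unit n @: chains k (cone_cell pi V B w' q) p.+1)%VS.
  have /eqP -> : (bd k unit n @: chains k (cone_cell pi V B w' q) p.+1 ==
    chains k (cone_cell pi V B w' q) p :&: lker (bd k unit n))%VS.
    by rewrite eqEdim sub /= -subn_eq0; apply/eqP.
  by rewrite memv_cap FC memv_ker dF eqxx.
case/memv_imgP => G /chainsP GC FG; exists (fun T => G (tt, T)).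
  move=> T /GC[/andP[/= TB zC] /= cT]; split=> //.
  move: zC; rewrite cT subrr => /(cone_height cvx)[_ /(_ erefl) /eqP].
  by rewrite subr_eq0 => /eqP.
move=> T; have := congr1 (fun G : {ffun unit * {set 'I_n} -> k^o} => G (tt, T)) FG.
by rewrite bdE ffunE.
Qed.
End StrandDuality.

(** * Convex sets of lattice points and their vertices *)

Section ConvexSets.
Variables (n : nat) (pi : 'I_n -> int * int).
Hypothesis pi_inj : injective pi.
Implicit Types (B : {set 'I_n}) (p z c : int * int) (m : int) (t v a b : 'I_n).

Definition below B p m := forall t, t \in B -> m <= dot p (pi t).
(** Hull and interior are described by all integral half-planes, so that they can be compared for a
    set and the set without a point, with no list of edges to update. *)
Definition in_hull B z := forall p m, below B p m -> m <= dot p z.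
Definition in_int B z := forall p m, p != 0 -> below B p m -> m < dot p z.
Definition lattice_convex B := forall z, in_hull B z -> exists2 t, t \in B & pi t = z.
Definition vertex_of B v := v \in B /\
  exists lam, forall a, a \in B -> a != v -> dot lam (pi v) < dot lam (pi a).

Lemma int_hull B z : in_int B z -> in_hull B z.
Proof.
move=> zI p m mB; have [p0|p0] := eqVneq p 0; last exact/ltW/zI.
have nz : ((1, 0) : int * int) != 0 by [].
case: (pickP (mem B)) => [t tB|no]; last first.
  by have := zI (1, 0) (dot (1, 0) z) nz; rewrite ltxx => H; suff: false by []; apply: H => t tB; have := no t; rewrite inE tB.
by have := mB _ tB; rewrite p0 /dot /= !mul0r.
Qed.

Lemma mem_hull B t : t \in B -> in_hull B (pi t).
Proof. by move=> tB p m; apply. Qed.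

Lemma sub_below B B' p m : B' \subset B -> below B p m -> below B' p m.
Proof. by move=> /subsetP sB mB t /sB/mB. Qed.

(** The functional isolating [v] is integral, so raising its bound by 1 cuts off [v] and no other
    point. *)
Lemma convex_del B v : lattice_convex B -> vertex_of B v -> lattice_convex (B :\ v).
Proof.
move=> cB [vB [lam lamP]] z zH; have sB : B :\ v \subset B by apply: subsetDl.
have [|t tB tz] := cB z; first by move=> p m /(sub_below sB); apply: zH.
exists t => //; rewrite !inE tB andbT; apply/eqP => tv.
have := zH lam (dot lam (pi v) + 1); rewrite -tz tv => H.
have : dot lam (pi v) + 1 <= dot lam (pi v); last by lia.
by apply: H => a; rewrite !inE => /andP[av aB]; have := lamP a aB av; lia.
Qed.

Lemma not_int B z : ~ in_int B z -> exists p m, [/\ p != 0, below B p m & dot p z <= m].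
Proof.
move=> nI; apply: contrapT => no; apply: nI => p m p0 mB; rewrite ltNge; apply/negP => le.
by apply: no; exists p, m.
Qed.

Lemma int_noncollinear B z : in_int B z -> noncollinear [seq pi t | t <- enum B].
Proof.
move=> zI; apply: contrapT => nc.
have [|a [d [_ d0 all _]]] := collinear_line nc.
  apply/negP => /eqP e; have nz : ((1, 0) : int * int) != 0 by [].
  have := zI (1, 0) (dot (1, 0) z) nz; rewrite ltxx => H; suff: false by [].
  apply: H => t tB; have : pi t \in [seq pi t | t <- enum B] by rewrite map_f // mem_enum.
  by rewrite e.
have h1 : dot d a < dot d z by apply: zI => // t tB; rewrite all // map_f // mem_enum.
have h2 : - dot d a < dot (- d) z.
  apply: zI; rewrite ?oppr_eq0 // => t tB.
  have -> : dot (- d) (pi t) = - dot d (pi t) by rewrite /dot /=; ring.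
  by rewrite all // map_f // mem_enum.
by have : dot (- d) z = - dot d z; [rewrite /dot /=; ring|lia].
Qed.

Lemma edge_normal_neq0 (r : nat) (V : 'I_r -> int * int) i : convex_cycle V -> edge_normal V i != 0.
Proof.
move=> cvx; apply/eqP => n0.
have := cvx.2 i (ord_pred i) (pred_neq cvx i).1 (pred_neq cvx i).2.
have := edge_start V i; rewrite !edgeE n0 /dot /= !mul0r !add0r; lia.
Qed.

Lemma cycle_ge (r : nat) (V : 'I_r -> int * int) p (c : int) z : convex_cycle V ->
  (forall j, 0 <= dot p (V j) + - c) -> in_cone V 1 z -> c <= dot p z.
Proof.
move=> cvx h zP; have H : 0 <= dot p z + - c * 1 by exact: (functional_ge0 cvx h zP).
lia.
Qed.

Lemma cycle_gt (r : nat) (V : 'I_r -> int * int) p (c : int) z : convex_cycle V -> p != 0 ->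
  (forall j, 0 <= dot p (V j) + - c) -> in_icone V 1 z -> c < dot p z.
Proof.
move=> cvx p0 h zP; have H : 0 < dot p z + - c * 1 by exact: (functional_gt0 cvx p0 h zP).
lia.
Qed.

Lemma edge_pt (r : nat) (V : 'I_r -> int * int) i z :
  edge V i 1 z = dot (edge_normal V i) z + edge_const V i.
Proof. by rewrite edgeE mulr1. Qed.

Lemma hull_cycle B : noncollinear [seq pi t | t <- enum B] ->
  exists (r : nat) (V : 'I_r -> int * int) (v : 'I_r -> 'I_n),
  [/\ convex_cycle V, forall i, v i \in B /\ pi (v i) = V i,
   forall z, in_cone V 1 z <-> in_hull B z & forall z, in_icone V 1 z <-> in_int B z].
Proof.
move=> /convex_cycle_exists [m [V [cvx Vs Vpos]]].
have /choice[v vP] : forall i, exists t, t \in B /\ pi t = V i.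
  by move=> i; have /mapP[t + ->] := Vs i; rewrite mem_enum => tB; exists t.
have belowV p (c : int) : below B p c -> forall j, 0 <= dot p (V j) + - c.
  by move=> cB j; have [vB <-] := vP j; rewrite subr_ge0 cB.
have edge_below i : below B (edge_normal V i) (- edge_const V i).
  move=> t tB; have := Vpos i (pi t); rewrite edge_pt map_f ?mem_enum // => /(_ isT); lia.
exists m, V, v; split=> // z; split=> zP.
- move=> p c /belowV cB; exact: (cycle_ge cvx cB zP).
- apply/forallP => i; have := zP _ _ (edge_below i); rewrite edge_pt; lia.
- move=> p c p0 /belowV cB; exact: (cycle_gt cvx p0 cB zP).
by apply/forallP => i; have := zP _ _ (edge_normal_neq0 i cvx) (edge_below i); rewrite edge_pt; lia.
Qed.

Lemma separating_functional : exists mu : int * int, forall a b, dot mu (pi a) = dot mu (pi b) -> a = b.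
Proof.
have [K K0 KP] := seq_bounded (fun z : int * int => z.2) [seq pi t | t <- enum 'I_n].
exists (2 * K, 1) => a b; have ha := KP (pi a) (map_f _ (mem_enum _ _)); have hb := KP (pi b) (map_f _ (mem_enum _ _)).
move=> e; apply: pi_inj; move: e ha hb; rewrite /dot /=; case: (pi a) => a1 a2; case: (pi b) => b1 b2 /= e ha hb.
have : a1 = b1; last by move=> ab; rewrite ab in e *; congr pair; lia.
by have [lt|lt|//] := ltgtP a1 b1; nia.
Qed.

Lemma vertex_edges B v : noncollinear [seq pi t | t <- enum B] -> vertex_of B v ->
  exists p1 p2 x1 x2, [/\ x1 \in B :\ v, x2 \in B :\ v, below B p1 (dot p1 (pi v)), below B p2 (dot p2 (pi v))
   & [/\ dot p1 (pi x1) = dot p1 (pi v), dot p2 (pi x2) = dot p2 (pi v), p1 != 0, p2 != 0 &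
      forall a, a \in B -> dot p1 (pi a) = dot p1 (pi v) -> dot p2 (pi a) = dot p2 (pi v) -> a = v]].
Proof.
move=> nc [vB [lam lamP]]; have [m [V [w [cvx wP coneE icE]]]] := hull_cycle nc.
have [i iv] : exists i, w i = v.
  case: (pickP (fun i => w i == v)) => [i /eqP|no]; first by exists i.
  have : in_cone V 1 (pi v) by apply/coneE/mem_hull.
  have pos j : 0 <= dot lam (V j) + - (dot lam (pi v) + 1).
    by have [wB <-] := wP j; have := lamP (w j) wB (negbT (no j)); lia.
  by move=> /(cycle_ge cvx pos) H; exfalso; lia.
have Vi : V i = pi v by rewrite -iv (wP i).2.
have dotE j z : edge V j 1 z = dot (edge_normal V j) z - dot (edge_normal V j) (V j).
  by have := edge_start V j; rewrite !edge_pt; lia.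
have dotP z : edge V (ord_pred i) 1 z = dot (edge_normal V (ord_pred i)) z - dot (edge_normal V (ord_pred i)) (V i).
  by have := edge_pred_end V i; rewrite !edge_pt; lia.
have pos j a : a \in B -> 0 <= edge V j 1 (pi a).
  by move=> aB; have /coneE/forallP := mem_hull aB.
exists (edge_normal V i), (edge_normal V (ord_pred i)), (w (ordS i)), (w (ord_pred i)).
have [wS wSE] := wP (ordS i); have [wPr wPE] := wP (ord_pred i).
have [pn1 pn2] := pred_neq cvx i; have sn := ordS_neq cvx i.
have neq j : j != i -> w j != v.
  by move=> ji; apply: contraNneq ji => e; apply/eqP/(vertex_inj cvx); rewrite Vi -e (wP j).2.
split.
- by rewrite !inE neq.
- by rewrite !inE neq.
- by move=> a /(pos i); rewrite dotE Vi; lia.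
- by move=> a /(pos (ord_pred i)); rewrite dotP Vi; lia.
split; rewrite ?edge_normal_neq0 //.
- by have := edge_end V i; rewrite dotE Vi wSE; lia.
- by have := edge_start V (ord_pred i); rewrite dotP Vi wPE; lia.
move=> a aB e1 e2; apply: pi_inj; rewrite -Vi.
have f1 : edge V i 1 (pi a) = 0 by rewrite dotE Vi e1 subrr.
have f2 : edge V (ord_pred i) 1 (pi a) = 0 by rewrite dotP Vi e2 subrr.
have N0 := cvx.2 i (ord_pred i) pn1 pn2.
have g1 : edge V i 1 (V (ord_pred i)) * ((pi a).1 - (V i).1) =
  ((V (ordS i)).1 - (V i).1) * edge V (ord_pred i) 1 (pi a) + ((V (ord_pred i)).1 - (V i).1) * edge V i 1 (pi a).
  by rewrite /edge ord_predK /det2 /=; ring.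
have g2 : edge V i 1 (V (ord_pred i)) * ((pi a).2 - (V i).2) =
  ((V (ordS i)).2 - (V i).2) * edge V (ord_pred i) 1 (pi a) + ((V (ord_pred i)).2 - (V i).2) * edge V i 1 (pi a).
  by rewrite /edge ord_predK /det2 /=; ring.
rewrite f1 f2 !mulr0 addr0 in g1 g2.
move/eqP: g1; move/eqP: g2; rewrite !mulf_eq0 (gt_eqF N0) /= !subr_eq0.
by case: (pi a) (V i) => ? ? [? ?] /= /eqP -> /eqP ->.
Qed.

Section Strand.
Variable k : fieldType.

Lemma interior_exact B z : lattice_convex B -> in_int B z -> (3 <= #|B|)%N ->
  linear_exact k pi B (#|B| - 3).
Proof.
move=> cB zI B3; have [m [V [v [cvx vP coneE icE]]]] := hull_cycle (int_noncollinear zI).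
apply: (duality_exact cvx _ _ vP B3 (i0 := z)); last exact/icE.
  by move=> t /mem_hull/coneE.
by move=> y /coneE/cB.
Qed.

(** Four points of [B :\ v] never occur as [a] in [pi v + pi a = pi b + pi c]: the point next to [v]
    on each of the two edges at [v], and [c1] and [c2], which become boundary points when [v] is
    removed. The other points number [#|B| - 5], within the bound of [rank_exact], while [B :\ v] is
    exact at the required spot by [interior_exact]. *)
Theorem removed_two_exact B v (c1 c2 : 'I_n) (q1 q2 : int * int) z : lattice_convex B -> vertex_of B v ->
  c1 \in B -> c2 \in B -> c1 != c2 -> in_int B (pi c1) -> in_int B (pi c2) ->
  q1 != 0 -> q2 != 0 ->
  below (B :\ v) q1 (dot q1 (pi c1)) -> below (B :\ v) q2 (dot q2 (pi c2)) ->
  in_int (B :\ v) z -> linear_exact k pi B (#|B| - 4).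
Proof.
move=> cB vV c1B c2B c12 i1 i2 q10 q20 b1 b2 zI; have [vB [lam lamP]] := vV.
have nc := int_noncollinear i1.
have [p1 [p2 [y1 [y2 [y1B y2B bp1 bp2 [e1 e2 p10 p20 only]]]]]] := vertex_edges nc vV.
have [mu muP] := separating_functional.
have near p y : y \in B :\ v -> below B p (dot p (pi v)) -> dot p (pi y) = dot p (pi v) ->
    exists x, [/\ x \in B :\ v, dot p (pi x) = dot p (pi v) & forall a b,
      a \in B :\ v -> b \in B :\ v -> pi v + pi x <> pi a + pi b].
  move=> yB bp ye; pose U := [set a in B :\ v | dot p (pi a) == dot p (pi v)].
  have [|x] := @argmin_set _ (fun a => dot lam (pi a)) U; first by apply/set0Pn; exists y; rewrite inE yB ye eqxx.
  rewrite inE => /andP[xB /eqP xe] xmin; exists x; split=> // a b aB bB e.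
  have ea := congr1 (dot p) e; have el := congr1 (dot lam) e; rewrite !dotD in ea el.
  have aB' : a \in B by move: aB; rewrite inE => /andP[].
  have bB' : b \in B by move: bB; rewrite inE => /andP[].
  have ha := bp _ aB'; have hb := bp _ bB'.
  have [pa pb] : dot p (pi a) = dot p (pi v) /\ dot p (pi b) = dot p (pi v) by clear - ea xe ha hb; lia.
  have xa : dot lam (pi x) <= dot lam (pi a) by apply: xmin; rewrite inE aB pa eqxx.
  have xb : dot lam (pi x) <= dot lam (pi b) by apply: xmin; rewrite inE bB pb eqxx.
  by move: xB; rewrite !inE => /andP[xv xB]; have lx := lamP _ xB xv; clear - lx xa xb el; lia.
have [x1 [x1B x1e x1P]] := near p1 y1 y1B bp1 e1.
have [x2 [x2B x2e x2P]] := near p2 y2 y2B bp2 e2.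
have cut (c : 'I_n) q : c \in B -> in_int B (pi c) -> q != 0 -> below (B :\ v) q (dot q (pi c)) ->
   dot q (pi v) < dot q (pi c) /\ forall a b, a \in B :\ v -> b \in B :\ v -> pi v + pi c <> pi a + pi b.
  move=> cB' ci q0 bq; have lt : dot q (pi v) < dot q (pi c).
    rewrite ltNge; apply/negP => le; have := ci q (dot q (pi c)) q0; rewrite ltxx => H.
    suff: false by []; apply: H => t tB; have [->|tv] := eqVneq t v; first by [].
    by apply: bq; rewrite !inE tv.
  split=> // a b aB bB e; have := congr1 (dot q) e; rewrite !dotD => e'.
  by have h1 := bq _ aB; have h2 := bq _ bB; clear - h1 h2 e' lt; lia.
have [l1 c1P] := cut _ _ c1B i1 q10 b1; have [l2 c2P] := cut _ _ c2B i2 q20 b2.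
have c1v : c1 != v by apply: contraTneq l1 => ->; rewrite ltxx.
have c2v : c2 != v by apply: contraTneq l2 => ->; rewrite ltxx.
have xint (x : 'I_n) p (c : 'I_n) : in_int B (pi c) -> p != 0 -> below B p (dot p (pi v)) -> dot p (pi x) = dot p (pi v) -> x != c.
  by move=> ci p0 bp xe; apply/eqP => xc; have := ci _ _ p0 bp; rewrite -xc xe ltxx.
have x12 : x1 != x2.
  apply/eqP => e; move: x1B; rewrite !inE => /andP[/eqP xv xB]; apply: xv.
  by apply: only; rewrite // e.
pose S := [set x1; x2; c1; c2]; pose W := (B :\ v) :\: S.
have cS : #|S| = 4%N.
  rewrite /S -!setUA !cardsU1 cards1 !inE !negb_or x12 c12 /=.
  by rewrite !(xint x1 p1) // !(xint x2 p2).
have SB : S \subset B :\ v.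
  by rewrite /S !subUset !sub1set x1B x2B !inE c1B c2B c1v c2v.
have cB1 : #|B| = #|B :\ v|.+1 by rewrite (cardsD1 v) vB.
have cW : #|W| = (#|B :\ v| - 4)%N by rewrite /W cardsD (setIidPr SB) cS.
have le4 : (4 <= #|B :\ v|)%N by rewrite -cS subset_leq_card.
apply: (@rank_exact k n pi pi_inj B v lam mu (#|B| - 4) W) => //.
- move=> a b c aB bB dB e; rewrite !inE; move: (aB); rewrite !inE => -> /=; rewrite andbT.
  apply/negP => /orP[/orP[/orP[]|]|] /eqP ea; subst a.
  + exact: x1P e.
  + exact: x2P e.
  + exact: c1P e.
  exact: c2P e.
- by clear - cW cB1 le4; rewrite cW cB1; lia.
have -> : (#|B| - 4)%N = (#|B :\ v| - 3)%N by clear - cB1; rewrite cB1; lia.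
by apply: (interior_exact (convex_del cB vV) zI); apply: leq_trans le4.
Qed.
End Strand.
End ConvexSets.

Ltac int_lia :=
  repeat match goal with
  | H : is_true (@Order.le _ _ _ _) |- _ => revert H
  | H : is_true (@Order.lt _ _ _ _) |- _ => revert H
  | H : @eq ?T _ _ |- _ => unify T int; revert H
  | H : not (@eq ?T _ _) |- _ => unify T int; revert H
  end; clear; intros; lia.

(** * Unimodular changes of coordinates *)

Section Unimodular.
Implicit Types (f g : int * int -> int * int) (p q z : int * int).

Definition unimod f := exists a b c d s t : int, (a * d - b * c) * (a * d - b * c) = 1 /\
  forall z, f z = (a * z.1 + b * z.2 + s, c * z.1 + d * z.2 + t).

Lemma unimod_pull f p : unimod f -> exists q (h : int),
  (p != 0 -> q != 0) /\ forall z, dot p (f z) = dot q z + h.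
Proof.
case=> a [b [c [d [s [t [e fE]]]]]].
exists (p.1 * a + p.2 * c, p.1 * b + p.2 * d), (p.1 * s + p.2 * t); split; last first.
  by move=> z; rewrite fE /dot /=; ring.
apply: contra_neq => /eqP; rewrite xpair_eqE => /andP[/eqP q1 /eqP q2].
have h1 : (a * d - b * c) * ((p.1 * a + p.2 * c) * d - (p.1 * b + p.2 * d) * c) = (a * d - b * c) * (a * d - b * c) * p.1 by ring.
have h2 : (a * d - b * c) * ((p.1 * b + p.2 * d) * a - (p.1 * a + p.2 * c) * b) = (a * d - b * c) * (a * d - b * c) * p.2 by ring.
rewrite q1 q2 e !mul0r subrr mulr0 mul1r in h1; rewrite q1 q2 e !mul0r subrr mulr0 mul1r in h2.
by rewrite [p]surjective_pairing -h1 -h2.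
Qed.

Lemma unimod_push f p : unimod f -> exists q (h : int),
  (p != 0 -> q != 0) /\ forall z, dot q (f z) = dot p z + h.
Proof.
case=> a [b [c [d [s [t [e fE]]]]]]; pose D := a * d - b * c.
pose q1 := D * (p.1 * d - p.2 * c); pose q2 := D * (p.2 * a - p.1 * b).
have h1 : q1 * a + q2 * c = p.1.
  by rewrite -[RHS]mul1r -e /q1 /q2 /D; ring.
have h2 : q1 * b + q2 * d = p.2.
  by rewrite -[RHS]mul1r -e /q1 /q2 /D; ring.
exists (q1, q2), (q1 * s + q2 * t); split; last first.
  by move=> z; rewrite fE /dot /= -h1 -h2; ring.
apply: contra_neq => -[e1 e2]; rewrite [p]surjective_pairing -h1 -h2 e1 e2.
by rewrite !mul0r addr0.
Qed.

Lemma unimod_inv f : unimod f -> exists g, [/\ unimod g, cancel f g & cancel g f].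
Proof.
case=> a [b [c [d [s [t [e fE]]]]]]; pose D := a * d - b * c.
exists (fun z => (D * d * z.1 + - (D * b) * z.2 + D * (b * t - d * s), - (D * c) * z.1 + D * a * z.2 + D * (c * s - a * t))).
split.
- exists (D * d), (- (D * b)), (- (D * c)), (D * a), (D * (b * t - d * s)), (D * (c * s - a * t)).
  split=> //; have -> : (D * d * (D * a) - - (D * b) * - (D * c)) = D * D * D by rewrite /D; ring.
  by rewrite /D e mul1r.
- move=> [x y]; rewrite fE /=; congr pair.
    by rewrite -[RHS]mul1r -e /D; ring.
  by rewrite -[RHS]mul1r -e /D; ring.
move=> [x y]; rewrite fE /=; congr pair.
  by transitivity (D * D * x + (1 - D * D) * s); [rewrite /D; ring|rewrite /D e; ring].
by transitivity (D * D * y + (1 - D * D) * t); [rewrite /D; ring|rewrite /D e; ring].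
Qed.

Lemma unimod_comp f g : unimod f -> unimod g -> unimod (fun z => f (g z)).
Proof.
case=> a [b [c [d [s [t [e fE]]]]]] [a' [b' [c' [d' [s' [t' [e' gE]]]]]]].
exists (a * a' + b * c'), (a * b' + b * d'), (c * a' + d * c'), (c * b' + d * d').
exists (a * s' + b * t' + s), (c * s' + d * t' + t); split.
  rewrite -[RHS]mul1r -{1}e -e'; ring.
by move=> z; rewrite fE gE /=; congr pair; ring.
Qed.

Lemma unimod_id : unimod (fun z => z).
Proof. by exists 1, 0, 0, 1, 0, 0; split=> // -[x y] /=; congr pair; ring. Qed.

(** This map and the next two are the symmetries of the triangle with vertices (0, 0), (1, 0), (0,
    1) that exchange two vertices. *)
Lemma unimod_refl : unimod (fun z => (1 - z.1 - z.2, z.2)).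
Proof. by exists (-1), (-1), 0, 1, 1, 0; split=> // -[x y] /=; congr pair; ring. Qed.

Lemma unimod_swap : unimod (fun z => (z.2, z.1)).
Proof. by exists 0, 1, 1, 0, 0, 0; split=> // -[x y] /=; congr pair; ring. Qed.

Lemma unimod_turn : unimod (fun z => (z.1, 1 - z.1 - z.2)).
Proof. by exists 1, 0, (-1), (-1), 0, 1; split=> // -[x y] /=; congr pair; ring. Qed.
End Unimodular.

Section Transfer.
Variables (n : nat) (pi : 'I_n -> int * int) (f : int * int -> int * int).
Hypothesis fU : unimod f.
Implicit Types (B : {set 'I_n}) (z : int * int).
Let pi' t := f (pi t).

Lemma unimod_inj : injective f.
Proof. by have [g [_ fg _]] := unimod_inv fU; apply: can_inj fg. Qed.

Lemma int_map B z : in_int pi' B (f z) <-> in_int pi B z.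
Proof.
split=> zI p m p0 mB.
  have [q [h [q0 qE]]] := unimod_push p fU.
  by have := zI q (m + h) (q0 p0); rewrite qE ltrD2r; apply => t tB; rewrite qE lerD2r mB.
have [q [h [q0 qE]]] := unimod_pull p fU.
have := zI q (m - h) (q0 p0); rewrite qE ltrBlDr; apply => t tB.
by rewrite lerBlDr -qE mB.
Qed.

Lemma hull_map B z : in_hull pi' B (f z) -> in_hull pi B z.
Proof.
move=> zI p m mB; have [q [h [q0 qE]]] := unimod_push p fU.
by have := zI q (m + h); rewrite qE lerD2r; apply => t tB; rewrite qE lerD2r mB.
Qed.

Lemma convex_map B : lattice_convex pi B -> lattice_convex pi' B.
Proof.
move=> cB z zH; have [g [_ fg gf]] := unimod_inv fU.
have [|t tB te] := cB (g z); first by apply: hull_map; rewrite gf.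
by exists t => //; rewrite /pi' te gf.
Qed.

(** A weight in the strand is a sum of [p.+1] points, so it moves by the linear part of [f] and
    [p.+1] times its translation part. *)
Lemma exact_map (k : fieldType) B p : linear_exact k pi' B p -> linear_exact k pi B p.
Proof.
case: (fU) => a [b [c [d [s [t [e fE]]]]]].
pose L z := (a * z.1 + b * z.2, c * z.1 + d * z.2).
have LD x y : L (x + y) = L x + L y by rewrite /L; congr pair => /=; ring.
have fL z : f z = L z + (s, t) by rewrite fE.
have Lsum (T : {set 'I_n}) : \sum_(i in T) pi' i = L (\sum_(i in T) pi i) + (s, t) *+ #|T|.
  have L0 : L 0 = 0 by rewrite /L /= !mulr0 addr0.
  rewrite (big_morph L LD L0) -sumr_const.
  by rewrite -big_split; apply: eq_bigr => i _; rewrite /pi' fL.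
have Linj x y : L x = L y -> x = y by move=> h; apply: unimod_inj; rewrite !fL h.
move=> ex w h hP dh; have [|//|G GP hG] := ex (L w + (s, t) *+ p.+1) h.
  move=> T /hP[TB cT [x xB we]]; split=> //; exists x => //.
  by rewrite Lsum cT we LD mulrSr /pi' fL !addrA; congr (_ + _); rewrite addrAC.
exists G => // T /GP[TB cT we]; split=> //; apply: Linj.
by move: we; rewrite Lsum cT => /addIr.
Qed.
End Transfer.

(** * Lattice points forced by convex combinations *)

Section Combinations.
Variables (n : nat) (pi : 'I_n -> int * int) (B : {set 'I_n}).
Implicit Types (a b c z p : int * int) (x y u h D : int).

Definition occ z := exists2 t, t \in B & pi t = z.

Lemma hull_comb (al be ga : int) a b c z : 0 <= al -> 0 <= be -> 0 <= ga -> 0 < al + be + ga ->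
  in_hull pi B a -> in_hull pi B b -> in_hull pi B c ->
  (al + be + ga) * z.1 = al * a.1 + be * b.1 + ga * c.1 ->
  (al + be + ga) * z.2 = al * a.2 + be * b.2 + ga * c.2 -> in_hull pi B z.
Proof.
move=> a0 b0 c0 D0 aH bH cH e1 e2 p m mB.
have := mulr_ge0 a0 (_ : 0 <= dot p a - m); have := mulr_ge0 b0 (_ : 0 <= dot p b - m).
have := mulr_ge0 c0 (_ : 0 <= dot p c - m); rewrite !subr_ge0 => /(_ (cH _ _ mB)) hc /(_ (bH _ _ mB)) hb /(_ (aH _ _ mB)) ha.
rewrite -subr_ge0 -(pmulr_rge0 _ D0).
have -> : (al + be + ga) * (dot p z - m) = al * (dot p a - m) + be * (dot p b - m) + ga * (dot p c - m).
  by rewrite mulrBr {1}/dot mulrDr ![(al + be + ga) * (_ * _)]mulrCA e1 e2 /dot; ring.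
by rewrite !addr_ge0.
Qed.

Lemma int_comb (al be ga : int) a b c z : 0 <= al -> 0 <= be -> 0 <= ga -> 0 < al + be ->
  in_int pi B a -> in_int pi B b -> in_hull pi B c ->
  (al + be + ga) * z.1 = al * a.1 + be * b.1 + ga * c.1 ->
  (al + be + ga) * z.2 = al * a.2 + be * b.2 + ga * c.2 -> in_int pi B z.
Proof.
move=> a0 b0 c0 D0 aH bH cH e1 e2 p m p0 mB.
have ha := aH _ _ p0 mB; have hb := bH _ _ p0 mB; have hc := cH _ _ mB.
have D1 : 0 < al + be + ga by rewrite ltr_wpDr.
have ha' : al <= al * (dot p a - m) by rewrite ler_peMr //; int_lia.
have hb' : be <= be * (dot p b - m) by rewrite ler_peMr //; int_lia.
have hc' : 0 <= ga * (dot p c - m) by rewrite mulr_ge0 //; int_lia.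
rewrite -subr_gt0 -(pmulr_rgt0 _ D1).
have -> : (al + be + ga) * (dot p z - m) = al * (dot p a - m) + be * (dot p b - m) + ga * (dot p c - m).
  by rewrite mulrBr {1}/dot mulrDr ![(al + be + ga) * (_ * _)]mulrCA e1 e2 /dot; ring.
int_lia.
Qed.

(* The triangle with apex at height [h] over two neighbours meets height [1] in a
   segment of length [(h - 1) / h], which always contains a lattice point. *)
Lemma slice x u h : 0 < h -> exists s c : int, [/\ 0 <= s, 0 <= h - 1 - s &
  (h - 1 - s + s + 1) * c = (h - 1 - s) * u + s * (u + 1) + 1 * x].
Proof.
move=> h0; have h0' : h != 0 by rewrite gt_eqF.
have e := divz_eq (u - x) h; have m0 := modz_ge0 (u - x) h0'; have m1 := ltz_pmod (u - x) h0.
move: e m0 m1; move: (modz _ _) (divz _ _) => m d e m0 m1.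
exists m, (u - d); split; [exact: m0|int_lia|].
by have -> : x = u - (d * h + m); [rewrite -e|]; ring.
Qed.

Lemma int_out z p : in_int pi B z -> p != 0 -> exists2 t, t \in B & dot p (pi t) < dot p z.
Proof.
move=> zI p0; apply: contrapT => no; have := zI p (dot p z) p0; rewrite ltxx => H.
suff: false by []; apply: H => t tB; rewrite leNgt; apply/negP => lt; apply: no.
by exists t.
Qed.

Definition wide := exists a b c, [/\ in_int pi B a, in_int pi B b, in_int pi B c & orient a b c != 0].

Lemma cert z : ~ in_int pi B z -> exists p, p != 0 /\ forall t, t \in B -> dot p z <= dot p (pi t).
Proof.
move=> /not_int[p [m [p0 mB le]]]; exists p; split=> // t tB.
exact: le_trans le (mB _ tB).
Qed.
End Combinations.

Definition upsilon_points : seq (int * int) :=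
  [:: (-1, -1); (0, 0); (1, 0); (2, 0); (0, 1); (1, 1); (0, 2)].

Definition is_upsilon n (pi : 'I_n -> int * int) (B : {set 'I_n}) :=
  exists f, unimod f /\ forall z, occ (fun t => f (pi t)) B z <-> z \in upsilon_points.

Lemma is_upsilon_map n (pi : 'I_n -> int * int) B g : unimod g ->
  is_upsilon (fun t => g (pi t)) B -> is_upsilon pi B.
Proof. by move=> gU [f [fU H]]; exists (fun z => f (g z)); split=> //; apply: unimod_comp. Qed.

(** * Recognising the exceptional triangle *)

Section Single.
Variables (n : nat) (pi : 'I_n -> int * int) (B : {set 'I_n}).
Hypothesis cB : lattice_convex pi B.
Hypothesis i00 : in_int pi B (0, 0).
Hypothesis i10 : in_int pi B (1, 0).
Hypothesis i01 : in_int pi B (0, 1).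
Variables (v : 'I_n) (c0 : int).
Hypothesis vB : v \in B.
Hypothesis ve : pi v = (c0, -1).
Hypothesis up : forall t, t \in B -> t != v -> 0 <= (pi t).2.
Hypothesis nI : forall z, ~ in_int pi (B :\ v) z.

(** Without [v] neither (0, 1) nor (1, 1) is interior. The functionals witnessing this squeeze the
    remaining points into the triangle given by [0 <= x], [0 <= y] and [x + y <= 2]; interiority of
    the three standard points then forces its vertices and the position of [v]. *)
Lemma upsilon_core (p : int * int) : 0 < p.1 ->
  (forall t, t \in B -> t != v -> dot p (0, 1) <= dot p (pi t)) -> is_upsilon pi B.
Proof.
move=> p1 pP; have [t0 t0B t0e] := cB (int_hull i00); have [t1 t1B t1e] := cB (int_hull i10).
have [t2 t2B t2e] := cB (int_hull i01).
have nv t (z : int * int) : pi t = z -> z.2 <> -1 -> t != v.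
  by move=> e ne; apply/eqP => tv; move: ne; rewrite -e tv ve.
have t0v : t0 != v by apply: (nv _ _ t0e).
have t1v : t1 != v by apply: (nv _ _ t1e).
have t2v : t2 != v by apply: (nv _ _ t2e).
have p2 : p.2 <= 0 by have := pP _ t0B t0v; rewrite t0e /dot /=; int_lia.
have pnz : p != 0 by apply/eqP => e; move: p1; rewrite e.
have c0n : c0 <= -1.
  have [t tB lt] := int_out i01 pnz; have [tv|tv] := eqVneq t v; last by have := le_lt_trans (pP _ tB tv) lt; rewrite ltxx.
  move: lt; rewrite tv ve /dot /= => lt; have [//|c0p] := lerP c0 (-1).
  have : 0 <= p.1 * c0 by rewrite mulr_ge0; int_lia.
  int_lia.
(* The coefficient 2 is chosen so that [v], which has [c0 <= -1], cannot be the point found. *)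
have [a aB] := int_out (p := (-1, 2)) i10 isT; rewrite /dot /= => alt.
have av : a != v by apply: contraTneq alt => ->; rewrite ve /=; int_lia.
have [b bB] := int_out (p := (0, -1)) i01 isT; rewrite /dot /= => blt.
have bv : b != v by apply: contraTneq blt => ->; rewrite ve /=; int_lia.
have ay := up aB av; have bx : 0 <= (pi b).1.
  have := pP _ bB bv; rewrite /dot /= => H; have : p.2 * ((pi b).2 - 1) <= 0 by rewrite mulr_le0_ge0; int_lia.
  move=> H2; have : 0 <= p.1 * (pi b).1 by int_lia.
  by rewrite pmulr_rge0.
have [q [q0 qP]] := cert (nI (z := (1, 1))).
have qP' t : t \in B -> t != v -> 0 <= q.1 * ((pi t).1 - 1) + q.2 * ((pi t).2 - 1).
  by move=> tB tv; have := qP t; rewrite !inE tv tB /dot /= => /(_ isT); int_lia.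
have q2 : q.2 <= 0 by have := qP' _ t1B t1v; rewrite t1e /=; int_lia.
have q1 : q.1 <= 0 by have := qP' _ t2B t2v; rewrite t2e /=; int_lia.
have ha := qP' _ aB av; have hb := qP' _ bB bv.
have qnz : q.1 = 0 -> q.2 = 0 -> False.
  by move=> e1 e2; move: q0; rewrite [q]surjective_pairing e1 e2 eqxx.
have la : q.1 * ((pi a).1 - 1) <= q.1 by have := mulr_le0_ge0 q1 (_ : 0 <= (pi a).1 - 2); int_lia.
have lb : q.2 * ((pi b).2 - 1) <= q.2 by have := mulr_le0_ge0 q2 (_ : 0 <= (pi b).2 - 2); int_lia.
have ay0 : (pi a).2 = 0.
  apply/eqP; rewrite eq_le ay andbT leNgt; apply/negP => gt.
  have H : q.2 * ((pi a).2 - 1) <= 0 by rewrite mulr_le0_ge0 //; int_lia.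
  have e1 : q.1 = 0 by int_lia.
  by apply: qnz => //; move: hb; rewrite e1 mul0r; int_lia.
have bx0 : (pi b).1 = 0.
  apply/eqP; rewrite eq_le bx andbT leNgt; apply/negP => gt.
  have H : q.1 * ((pi b).1 - 1) <= 0 by rewrite mulr_le0_ge0 //; int_lia.
  have e2 : q.2 = 0 by int_lia.
  by apply: qnz => //; move: ha; rewrite e2 mul0r; int_lia.
rewrite ay0 in ha; rewrite bx0 in hb.
have eq : q.1 = q.2 by int_lia.
have qn : q.1 < 0 by rewrite lt_neqAle q1 andbT; apply/eqP => e1; apply: qnz => //; rewrite -eq.
rewrite -eq in ha hb qP'.
have le2 (x : int) : q.1 * 2 <= q.1 * x -> x <= 2 by rewrite ler_nM2l.
have ax : (pi a).1 = 2 by have := le2 (pi a).1; int_lia.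
have by2 : (pi b).2 = 2 by have := le2 (pi b).2; int_lia.
have tri t : t \in B -> t != v -> (pi t).1 + (pi t).2 <= 2.
  by move=> tB tv; apply: le2; have := qP' _ tB tv; int_lia.
have p20 : p.2 = 0 by have := pP _ bB bv; rewrite /dot /= bx0 by2; int_lia.
have x0 t : t \in B -> t != v -> 0 <= (pi t).1.
  by move=> tB tv; have := pP _ tB tv; rewrite /dot /= p20 !mul0r !addr0 mulr0 pmulr_rge0.
have ae : pi a = (2, 0) by rewrite [LHS]surjective_pairing ax ay0.
have be : pi b = (0, 2) by rewrite [LHS]surjective_pairing bx0 by2.
have c01 : c0 = -1.
  apply/eqP; rewrite eq_le c0n leNgt; apply/negP => lt.
  (* With weights [2], [1] and [- 2 * c0 - 3] on [v], [(0, 2)] and the origin, the centre of mass is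
     [(-1, 0)]. *)
  have hm : in_hull pi B (-1, 0).
    apply: (hull_comb (al := 2) (be := 1) (ga := - 2 * c0 - 3) _ _ _ _ (@mem_hull _ pi _ _ vB)
      (@mem_hull _ pi _ _ bB) (int_hull i00)); rewrite ?ve ?be //=; int_lia.
  have [w wB we] := cB hm.
  have wv : w != v by apply: (nv _ _ we).
  by have := x0 w wB wv; rewrite we.
have [t3 t3B t3e] := cB (z := (1, 1)) (hull_comb (al := 1) (be := 1) (ga := 0) (a := pi a) (b := pi b) (c := pi b)
  (z := (1, 1)) isT isT isT isT (@mem_hull _ pi _ _ aB) (@mem_hull _ pi _ _ bB) (@mem_hull _ pi _ _ bB) ltac:(by rewrite ae be) ltac:(by rewrite ae be)).
exists (fun z => z); split; [exact: unimod_id|move=> z; split].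
  case=> t tB <-; rewrite /upsilon_points !inE; have [->|tv] := eqVneq t v; first by rewrite ve c01.
  have := x0 _ tB tv; have := up tB tv; have := tri _ tB tv; case: (pi t) => x y /=; rewrite !xpair_eqE; int_lia.
rewrite /upsilon_points !inE => /or4P[|||/or4P[]] /eqP ->.
- by exists v; rewrite // ve c01.
- by exists t0.
- by exists t1.
- by exists a.
- by exists t2.
- by exists t3.
- by exists b.
Qed.
End Single.

(** * Removing a point from the row below the interior *)

Section Bottom.
Variables (k : fieldType) (n : nat) (B : {set 'I_n}).
Hypothesis step : forall pi : 'I_n -> int * int, injective pi -> lattice_convex pi B ->
  forall v, vertex_of pi B v -> wide pi (B :\ v) -> linear_exact k pi B (#|B| - 4).

Section Coordinates.
Variable pi : 'I_n -> int * int.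
Hypothesis pi_inj : injective pi.
Hypothesis cB : lattice_convex pi B.
Hypothesis i00 : in_int pi B (0, 0).
Hypothesis i10 : in_int pi B (1, 0).
Hypothesis i01 : in_int pi B (0, 1).
Hypothesis Ipos : forall z, in_int pi B z -> 0 <= z.2.
Local Notation P x y := (occ pi B (x, y)).

(** A point further down would span with (0, 0) and (1, 0) an interior lattice point at height -1,
    by [slice]. *)
Lemma row_bound t : t \in B -> -1 <= (pi t).2.
Proof.
move=> tB; rewrite leNgt; apply/negP => lt; have [|s [c [s0 s1 e]]] := slice (pi t).1 0 (h := - (pi t).2); first int_lia.
have : in_int pi B (c, -1).
  apply: (int_comb (ga := 1) s1 s0 _ _ i00 i10 (@mem_hull _ pi _ _ tB)) => //=; int_lia.
by move=> /Ipos.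
Qed.

Lemma point_in z : in_int pi B z -> occ pi B z.
Proof. by move=> /int_hull/cB. Qed.

(** Removing the only point of the bottom row makes row 0 part of the boundary, in particular (0, 0)
    and (1, 0). If no interior point is left, a functional at (0, 1) leads to the exceptional
    triangle, after a reflection when it leans the other way. *)
Lemma single_row v c0 : v \in B -> pi v = (c0, -1) ->
  (forall t, t \in B -> t != v -> 0 <= (pi t).2) ->
  linear_exact k pi B (#|B| - 4) \/ is_upsilon pi B.
Proof.
move=> vB ve up; have [t0 t0B t0e] := point_in i00; have [t1 t1B t1e] := point_in i10.
have [[z zI]|no] := EM (exists z, in_int pi (B :\ v) z).
  left; have vV : vertex_of pi B v.
    split=> //; exists (0, 1) => a aB av; rewrite ve /dot /=; have := up _ aB av; int_lia.
  apply: (@removed_two_exact _ _ pi_inj k B v t0 t1 (0, 1) (0, 1) z) => //; rewrite ?t0e ?t1e //.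
  - by apply: contra_eqN t1e => /eqP <-; rewrite t0e.
  - by move=> t; rewrite !inE => /andP[tv tB]; rewrite /dot /=; have := up _ tB tv; int_lia.
  by move=> t; rewrite !inE => /andP[tv tB]; rewrite /dot /=; have := up _ tB tv; int_lia.
right; have nI z : ~ in_int pi (B :\ v) z by move=> zI; apply: no; exists z.
have [p [p0 pP]] := cert (nI (0, 1)).
have pP' t : t \in B -> t != v -> dot p (0, 1) <= dot p (pi t) by move=> tB tv; apply: pP; rewrite !inE tv.
have [p1|p1|p1] := ltgtP 0 p.1; first by have HH := @upsilon_core _ pi B cB i00 i10 i01 v c0 vB ve up nI p p1 pP'; exact: HH.
  have RU := unimod_refl; set f := (fun z : int * int => _) in RU.
  apply: (is_upsilon_map RU); apply: (@upsilon_core _ (fun t => f (pi t)) B _ _ _ _ v (2 - c0) vB _ _ _ (- p.1, p.2 - p.1)).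
  - exact: convex_map.
  - by apply/(int_map pi RU B (1, 0)).
  - by apply/(int_map pi RU B (0, 0)).
  - by apply/(int_map pi RU B (0, 1)).
  - by rewrite ve /f /=; congr pair; ring.
  - exact: up.
  - move=> z; have [g [_ fg gf]] := unimod_inv RU; rewrite -(gf z) => /(int_map pi RU (B :\ v) (g z)).
    exact: nI.
  - by rewrite /=; int_lia.
  by move=> t tB tv; have := pP' _ tB tv; rewrite /f /dot /=; int_lia.
have p2 : p.2 < 0.
  rewrite ltNge; apply/negP => p2; have [z zB] := int_out (p := p) i01 p0.
  have := pP' _ t0B; rewrite t0e /dot /= -p1 => /(_ _) H.
  have tv : t0 != v by apply/eqP => e; have := congr1 snd t0e; rewrite e ve.
  have := H tv => H'; have e : p.2 = 0 by int_lia.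
  by move: p0; rewrite [p]surjective_pairing e -p1 eqxx.
have [b bB] := int_out (p := (0, -1)) i01 isT; rewrite /dot /= => blt.
have bv : b != v by apply: contraTneq blt => ->; rewrite ve /=; int_lia.
have H := pP' _ bB bv; rewrite /dot /= -p1 in H.
have h2 : p.2 * ((pi b).2 - 1) < 0 by rewrite nmulr_rlt0 //; int_lia.
int_lia.
Qed.

(** Let (l, 0) be the leftmost point of row 0; it is the natural candidate to become a boundary
    point. If another interior point does so too, [removed_two_exact] applies; if three noncollinear
    interior points survive, the induction hypothesis [step] does; the alternative describes what
    remains. *)
Lemma left_end v c0 u : v \in B -> pi v = (c0, -1) -> u \in B -> pi u = (c0 + 1, -1) ->
  (forall t, t \in B -> (pi t).2 = -1 -> t != v -> c0 < (pi t).1) ->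
  linear_exact k pi B (#|B| - 4) \/
  (forall z, in_int pi B z -> z != (0, 0) -> z.1 + z.2 = 1) /\ ~ P (-1) 0.
Proof.
move=> vB ve uB ue c0min.
have [t0 t0B t0e] := point_in i00; have [t1 t1B t1e] := point_in i10; have [t2 t2B t2e] := point_in i01.
have vV : vertex_of pi B v.
  have [K K0 KP] := seq_bounded (fun z : int * int => z.1) [seq pi t | t <- enum 'I_n].
  split=> //; exists (1, 2 * K) => a aB av; rewrite ve /dot /=.
  have ha := KP (pi a) (map_f _ (mem_enum _ _)); have hv := KP (pi v) (map_f _ (mem_enum _ _)); rewrite ve /= in hv.
  have [ay|ay] := eqVneq (pi a).2 (-1); first by have := c0min _ aB ay av; rewrite ay; int_lia.
  move/eqP: ay => ay; have rb := row_bound aB; have : 0 <= 2 * K * (pi a).2 by rewrite mulr_ge0; int_lia.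
  int_lia.
have vu : u != v by apply: contra_eqN ue => /eqP ->; rewrite ve xpair_eqE; int_lia.
pose U := [set t in B | (pi t).2 == 0].
have [|tl] := @argmin_set _ (fun t => (pi t).1) U; first by apply/set0Pn; exists t0; rewrite inE t0B t0e.
rewrite inE => /andP[lB /eqP ly] lmin; set l := (pi tl).1 in lmin.
have le : pi tl = (l, 0) by rewrite [LHS]surjective_pairing ly.
have lP t : t \in B -> (pi t).2 = 0 -> l <= (pi t).1 by move=> tB ty; apply: lmin; rewrite inE tB ty.
have l0 : l <= 0 by have := lP _ t0B; rewrite t0e; apply.
have nv t (z : int * int) : pi t = z -> z.2 <> -1 -> t != v.
  by move=> e ne; apply/eqP => tv; move: ne; rewrite -e tv ve.
(* The line through [u] and [(l, 0)]: all points other than [v] lie on it or to its right. *)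
pose g : int * int := (1, c0 + 1 - l).
have gP t : t \in B -> t != v -> l <= dot g (pi t).
  move=> tB tv; rewrite leNgt; apply/negP; rewrite /g /dot /= => lt; have rb := row_bound tB.
  have [ty|ty] := eqVneq (pi t).2 (-1); first by move: lt (c0min _ tB ty tv); rewrite ty; int_lia.
  move/eqP: ty => ty; have [|s [c [s0 s1 e]]] := slice (pi t).1 c0 (h := (pi t).2 + 1); first by int_lia.
  have [|w wB we] := cB (z := (c, 0)).
    by apply: (hull_comb (ga := 1) s1 s0 _ _ (@mem_hull _ pi _ _ vB) (@mem_hull _ pi _ _ uB) (@mem_hull _ pi _ _ tB)); rewrite ?ve ?ue //=; int_lia.
  have := lP w wB; rewrite we /= => /(_ erefl) lc.
  have : 0 <= ((pi t).2 + 1) * (c - l) by rewrite mulr_ge0; int_lia.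
  int_lia.
have out t q : t \in B -> in_int pi B (pi t) -> q != 0 ->
    (forall a, a \in B -> a != v -> dot q (pi t) <= dot q (pi a)) -> dot q (pi v) < dot q (pi t).
  move=> tB tI q0 qP; have [a aB lt] := int_out tI q0; have [<- //|av] := eqVneq a v.
  by have := qP _ aB av; int_lia.
have inner x : in_int pi B (x, 0) -> P (x - 1) 0 -> in_int pi (B :\ v) (x, 0).
  move=> xI [w wB we]; apply: contrapT => /cert[q [q0 qP]].
  have qP' a : a \in B -> a != v -> dot q (x, 0) <= dot q (pi a) by move=> aB av; apply: qP; rewrite !inE av.
  have [tx txB txe] := point_in xI; rewrite -txe in qP' xI.
  have := out _ _ txB xI q0 qP'; have := qP' _ uB vu; have := qP' _ wB (nv _ _ we _).
  by rewrite we ue ve txe /dot /=; int_lia.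
have in10 : in_int pi (B :\ v) (1, 0) by apply: inner => //; exists t0.
have widen a b c : in_int pi (B :\ v) a -> in_int pi (B :\ v) b -> in_int pi (B :\ v) c ->
  orient a b c != 0 -> linear_exact k pi B (#|B| - 4).
  by move=> ? ? ? ?; apply: (step pi_inj cB vV); exists a, b, c.
(* If [(l, 0)] is already a boundary point, every interior point stays interior. *)
have [lI|lI] := EM (in_int pi B (l, 0)); last first.
  left; have [p [p0 pP]] := cert lI.
  have p1 : 0 < p.1 * - l.
    have := i00 p0 pP; rewrite /dot /=; int_lia.
  have pp : 0 < p.1 by rewrite -(pmulr_lgt0 (x := - l)) //; rewrite lt_neqAle; case: eqP p1 => [<-|]; rewrite ?mulr0 //; int_lia.
  have pv := pP _ vB; rewrite ve /dot /= in pv.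
  have keep z : in_int pi B z -> in_int pi (B :\ v) z.
    move=> zI; apply: contrapT => /cert[q [q0 qP]]; have [t tB te] := point_in zI.
    have qP' a : a \in B -> a != v -> dot q (pi t) <= dot q (pi a) by move=> aB av; rewrite te; apply: qP; rewrite !inE av.
    rewrite -te in zI; have h1 := out _ _ tB zI q0 qP'; have h2 := qP' _ uB vu.
    have h3 := qP' _ lB (nv _ _ le _); have h4 := zI _ _ p0 pP; have h5 := Ipos zI.
    rewrite ve in h1; rewrite ue in h2; rewrite le in h3.
    move: h1 h2 (h3 ltac:(by [])) h4 h5; rewrite /dot /=; case: (pi t) => x y /= h1 h2 h3' h4 h5.
    have q1 : 0 < q.1 by int_lia.
    have h6 : p.2 * y <= p.1 * (c0 - l) * y by rewrite ler_wpM2r //; int_lia.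
    have h7 : 0 < p.1 * (x - l + (c0 - l) * y) by int_lia.
    have h8 : 0 < x - l + (c0 - l) * y by rewrite -(pmulr_rgt0 _ pp).
    have h9 : 0 < q.1 * (x - l + (c0 - l) * y) by rewrite mulr_gt0.
    have h10 : 0 <= (q.2 + q.1 * (l - c0)) * y by rewrite mulr_ge0 //; int_lia.
    int_lia.
  by apply: (widen (0, 0) (1, 0) (0, 1)); try exact: keep.
have gV : below pi (B :\ v) g (dot g (pi tl)).
  by move=> t; rewrite !inE => /andP[tv tB]; rewrite le {1}/g /dot /= mulr0 addr0 mul1r gP.
rewrite -le in lI.
have [[z [zI zl nz]]|all] := EM (exists z, [/\ in_int pi B z, z <> (l, 0) & ~ in_int pi (B :\ v) z]).
  left; have [q [q0 qP]] := cert nz; have [t tB te] := point_in zI; rewrite -te in zI.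
  apply: (@removed_two_exact _ _ pi_inj k B v tl t g q (1, 0)) => //.
  - by apply/eqP => e; apply: zl; rewrite -te -e le.
  - by move=> a aB; rewrite te; apply: qP.
have rest z : in_int pi B z -> z <> (l, 0) -> in_int pi (B :\ v) z.
  by move=> zI zl; apply: contrapT => nz; apply: all; exists z.
have in01 : in_int pi (B :\ v) (0, 1) by apply: rest.
(* The three standard interior points all survive unless one of them is [(l, 0)]. *)
have [l00|ln] := eqVneq l 0; last first.
  left; apply: (widen (0, 0) (1, 0) (0, 1)) => //; apply: rest => // -[e].
  by rewrite -e eqxx in ln.
rewrite l00 in rest.
have [[z [zI z0 zs]]|no] := EM (exists z, [/\ in_int pi B z, z <> (0, 0) & z.1 + z.2 <> 1]).
  left; apply: (widen (1, 0) (0, 1) z) => //; first exact: rest.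
  by case: z zs {zI z0} => x y /= zs; rewrite /orient /det2 /=; int_lia.
right; split.
  by move=> z zI /eqP z0; apply: contrapT => zs; apply: no; exists z.
by case=> w wB we; have := lP w wB; rewrite we l00 /= => /(_ erefl).
Qed.
End Coordinates.

(** If row -1 has several points, [left_end] applies at its left end and, after a reflection, at its
    right end; the two conditions together leave only the three standard interior points. *)
Lemma bottom_row (pi : 'I_n -> int * int) : injective pi -> lattice_convex pi B ->
  in_int pi B (0, 0) -> in_int pi B (1, 0) -> in_int pi B (0, 1) ->
  (forall z, in_int pi B z -> 0 <= z.2) ->
  linear_exact k pi B (#|B| - 4) \/ is_upsilon pi B \/
  [/\ forall z, in_int pi B z -> z \in [:: (0, 0); (1, 0); (0, 1)], ~ occ pi B (-1, 0), ~ occ pi B (2, 0)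
    & exists c, occ pi B (c, -1) /\ occ pi B (c + 1, -1)].
Proof.
move=> pi_inj cB i00 i10 i01 Ipos; have rb := row_bound i00 i10 Ipos.
pose U := [set t in B | (pi t).2 == -1].
have [b bB] := int_out (p := (0, 1)) i00 isT; rewrite /dot /= => blt.
have Ub : U != finset.set0 by apply/set0Pn; exists b; rewrite inE bB; have := rb _ bB; int_lia.
have [v] := @argmin_set _ (fun t => (pi t).1) U Ub; rewrite inE => /andP[vB /eqP vy] vmin.
have [w] := @argmin_set _ (fun t => - (pi t).1) U Ub; rewrite inE => /andP[wB /eqP wy] wmin.
have inU t : t \in B -> (pi t).2 = -1 -> t \in U by move=> tB ty; rewrite inE tB ty.
have ve : pi v = ((pi v).1, -1) by rewrite -vy -surjective_pairing.
have we : pi w = ((pi w).1, -1) by rewrite -wy -surjective_pairing.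
have [vw|vw] := eqVneq (pi v).1 (pi w).1.
  have [|H|H] := single_row pi_inj cB i00 i10 i01 vB ve; [|by left|by right; left].
  move=> t tB tv; have := rb _ tB; rewrite le_eqVlt => /orP[/eqP ty|]; last by int_lia.
  have tU := inU _ tB (esym ty); have := vmin _ tU; have := wmin _ tU => h1 h2.
  by case/eqP: tv; apply: pi_inj; rewrite ve [LHS]surjective_pairing -ty; congr pair; int_lia.
move/eqP: vw => vw; have wU := inU _ wB wy; have vU := inU _ vB vy; have lt : (pi v).1 < (pi w).1.
  by have := vmin _ wU; int_lia.
have mid (x : int) : (pi v).1 <= x -> x <= (pi w).1 -> occ pi B (x, -1).
  move=> x1 x2; have a1 : 0 <= (pi w).1 - x by rewrite subr_ge0.
  have a2 : 0 <= x - (pi v).1 by rewrite subr_ge0.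
  have a3 : 0 < (pi w).1 - x + (x - (pi v).1) + 0 by rewrite addr0 addrA subrK subr_gt0.
  apply: cB; apply: (hull_comb a1 a2 (lexx 0) a3 (@mem_hull _ pi _ _ vB) (@mem_hull _ pi _ _ wB) (@mem_hull _ pi _ _ wB));
    rewrite ?vy ?wy /=; ring.
have [||u uB ue] := mid ((pi v).1 + 1); try int_lia.
have [||u' uB' ue'] := mid ((pi w).1 - 1); try int_lia.
have [|H|[Hl nl]] := left_end pi_inj cB i00 i10 i01 Ipos vB ve uB ue; [|by left|].
  move=> t tB ty tv; rewrite lt_neqAle vmin ?inU // andbT; apply: contra_neq tv => e.
  by apply: pi_inj; rewrite ve e [LHS]surjective_pairing ty.
have RU := unimod_refl; set f := (fun z : int * int => _) in RU.
have [|||||||||H|[Hr nr]] := @left_end (fun t => f (pi t)) _ _ _ _ _ _ w (2 - (pi w).1) u' wB _ uB' _.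
- by move=> x y /(unimod_inj RU)/pi_inj.
- exact: convex_map.
- by apply/(int_map pi RU B (1, 0)).
- by apply/(int_map pi RU B (0, 0)).
- by apply/(int_map pi RU B (0, 1)).
- move=> z; have [g [_ fg gf]] := unimod_inv RU; rewrite -(gf z) => /(int_map pi RU B (g z)).
  exact: Ipos.
- by rewrite we /f /=; congr pair; ring.
- by rewrite ue' /f /=; congr pair; ring.
- move=> t tB ty tw; have tU := inU _ tB ty; rewrite /f /= in ty *; have := wmin _ tU; rewrite ty => h.
  have ne : (pi t).1 != (pi w).1 by apply: contra_neq tw => e; apply: pi_inj; rewrite we [LHS]surjective_pairing ty e.
  move/eqP: ne => ne; int_lia.
- by left; apply: (exact_map RU).
right; right; split=> //.
- move=> z zI; have := Hl _ zI; have := Hr (f z) ((int_map pi RU B z).2 zI); rewrite /f /= !inE.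
  case: z {zI} => x y /=; rewrite !xpair_eqE; int_lia.
- by case=> t tB te; apply: nr; exists t; rewrite // te.
by exists (pi v).1; split; apply: mid; int_lia.
Qed.

(** If all three sides of the interior triangle fall into the last case of [bottom_row], the
    constraints from the other two sides leave no room for two adjacent points in row -1. *)
Lemma corner_case (pi : 'I_n -> int * int) : injective pi -> lattice_convex pi B ->
  in_int pi B (0, 0) -> in_int pi B (1, 0) -> in_int pi B (0, 1) ->
  (forall z, in_int pi B z -> 0 <= z.2) ->
  linear_exact k pi B (#|B| - 4) \/ is_upsilon pi B.
Proof.
move=> pi_inj cB i00 i10 i01 Ipos.
have [|[|[IT _ _ [c [[a aB ae] [b bB be]]]]]] := bottom_row pi_inj cB i00 i10 i01 Ipos; [by left|by right|].
have turn f : unimod f -> in_int (fun t => f (pi t)) B (0, 0) -> in_int (fun t => f (pi t)) B (1, 0) ->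
    in_int (fun t => f (pi t)) B (0, 1) ->
    (forall z, z \in [:: (0, 0); (1, 0); (0, 1)] -> 0 <= (f z).2) ->
    (linear_exact k pi B (#|B| - 4) \/ is_upsilon pi B) \/
    (forall t, t \in B -> [/\ -1 <= (f (pi t)).2, f (pi t) <> (-1, 0) & f (pi t) <> (2, 0)]).
  move=> fU j00 j10 j01 jpos; have inj : injective (fun t => f (pi t)) by move=> x y /(unimod_inj fU)/pi_inj.
  have pos z : in_int (fun t => f (pi t)) B z -> 0 <= z.2.
    have [g [_ fg gf]] := unimod_inv fU; rewrite -(gf z) => /(int_map pi fU B (g z))/IT; exact: jpos.
  have [H|[H|[_ n1 n2 _]]] := bottom_row inj (convex_map fU cB) j00 j10 j01 pos.
  - by left; left; apply: (exact_map fU).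
  - by left; right; apply: (is_upsilon_map fU).
  right=> t tB; split; first exact: (row_bound j00 j10 pos tB).
    by move=> e; apply: n1; exists t.
  by move=> e; apply: n2; exists t.
have [||||//|S] := turn _ unimod_swap.
- by apply/(int_map pi unimod_swap B (0, 0)).
- by apply/(int_map pi unimod_swap B (0, 1)).
- by apply/(int_map pi unimod_swap B (1, 0)).
- by move=> z; rewrite !inE => /or3P[] /eqP ->.
have [||||//|S'] := turn _ unimod_turn.
- by apply/(int_map pi unimod_turn B (0, 1)).
- by apply/(int_map pi unimod_turn B (1, 0)).
- by apply/(int_map pi unimod_turn B (0, 0)).
- by move=> z; rewrite !inE => /or3P[] /eqP ->.
have [+ + +] := S _ aB; have [+ + +] := S _ bB; have [+ + +] := S' _ aB; have [+ + +] := S' _ bB.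
rewrite ae be /= => h1 h2 h3 h4 h5 h6 h7 h8 h9 h10 h11 h12.
have E (x y x' y' : int) : x = x' -> y = y' -> (x, y) = (x', y') by move=> -> ->.
have : c <> 0 by move=> c0; apply: h11; rewrite c0.
have : c + 1 <> 0 by move=> c0; apply: h8; rewrite c0.
have : c <> 2 by move=> c0; apply: h6; rewrite c0.
have : c + 1 <> 2 by move=> c0; apply: h3; rewrite c0.
int_lia.
Qed.
End Bottom.

Lemma pair_neq0 (p : int * int) : p != 0 -> p.1 = 0 -> p.2 <> 0.
Proof. by case: p => x y /= + x0 y0; rewrite x0 y0. Qed.

(** * One-point extensions of the exceptional triangle *)

Section UpsilonStep.
Variables (k : fieldType) (n : nat) (B : {set 'I_n}) (v : 'I_n).
Hypothesis vB : v \in B.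

Lemma upsilon_int (pi : 'I_n -> int * int) z : (forall z, occ pi (B :\ v) z <-> z \in upsilon_points) ->
  z \in [:: (0, 0); (1, 0); (0, 1)] -> in_int pi B z.
Proof.
move=> H zT p m p0 mB; have low y : y \in upsilon_points -> m <= dot p y.
  by move=> /H[t + <-]; rewrite !inE => /andP[_ tB]; apply: mB.
have := low (-1, -1) isT; have := low (2, 0) isT; have := low (0, 2) isT; have := @pair_neq0 p p0.
by move: zT; rewrite !inE => /or3P[] /eqP ->; rewrite /dot /=; clear; lia.
Qed.

Lemma upsilon_gain (pi : 'I_n -> int * int) : injective pi -> lattice_convex pi B ->
  (forall z, occ pi (B :\ v) z <-> z \in upsilon_points) ->
  0 <= (pi v).1 -> -3 < 2 * (pi v).1 + (pi v).2 ->
  (exists z, forall w, pi w = (-1, -1) -> in_int pi (B :\ w) z) ->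
  linear_exact k pi B (#|B| - 4).
Proof.
move=> pi_inj cB H x0 xy [z zP].
have get y : y \in upsilon_points -> exists2 t, t \in B & pi t = y.
  by move=> /H[t + <-]; rewrite !inE => /andP[_ tB]; exists t.
have [w wB we] := get (-1, -1) isT; have [c1 c1B c1e] := get (0, 0) isT; have [c2 c2B c2e] := get (0, 1) isT.
have all t : t \in B -> t != w -> 0 <= (pi t).1 /\ -3 < 2 * (pi t).1 + (pi t).2.
  move=> tB tw; have [->|tv] := eqVneq t v; first by [].
  have : pi t \in upsilon_points by apply/H; exists t; rewrite ?inE ?tv.
  have : pi t != (-1, -1) by rewrite -we (inj_eq pi_inj).
  by rewrite /upsilon_points !inE; case: (pi t) => x y /=; rewrite !xpair_eqE; clear; lia.
apply: (@removed_two_exact _ _ pi_inj k B w c1 c2 (1, 0) (1, 0) z) => //.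
- split=> //; exists (2, 1) => a aB aw; have [_ +] := all _ aB aw; rewrite we /dot /=; clear; lia.
- by apply: contra_eqN c1e => /eqP ->; rewrite c2e.
- by rewrite c1e; apply: upsilon_int.
- by rewrite c2e; apply: upsilon_int.
- move=> t; rewrite !inE => /andP[tw tB]; have [+ _] := all _ tB tw; rewrite c1e /dot /=; clear; lia.
- move=> t; rewrite !inE => /andP[tw tB]; have [+ _] := all _ tB tw; rewrite c2e /dot /=; clear; lia.
exact: zP.
Qed.

(** Either [v] lies beyond the edge from (2, 0) to (0, 2), which makes (1, 1) interior, or beyond
    the edge from (-1, -1) to (2, 0). In the second case [slice] finds a new lattice point at
    distance 1 from that edge, which can only be [v] itself. *)
Lemma upsilon_half (pi : 'I_n -> int * int) : injective pi -> lattice_convex pi B ->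
  (forall z, occ pi (B :\ v) z <-> z \in upsilon_points) ->
  (3 <= (pi v).1 + (pi v).2 /\ 0 <= (pi v).1) \/
  ((pi v).1 + (pi v).2 <= 2 /\ 3 * (pi v).2 - (pi v).1 + 2 < 0) -> linear_exact k pi B (#|B| - 4).
Proof.
move=> pi_inj cB H cases.
have get y : y \in upsilon_points -> exists2 t, t \in B & pi t = y.
  by move=> /H[t + <-]; rewrite !inE => /andP[_ tB]; exists t.
have low w p m : pi w = (-1, -1) -> below pi (B :\ w) p m -> forall y, y \in upsilon_points -> y != (-1, -1) -> m <= dot p y.
  move=> we mB y yU yw; have [t tB te] := get _ yU; rewrite -te; apply: mB; rewrite !inE tB andbT.
  by apply: contra_neq yw => tw; rewrite -te tw.
have vU : pi v \notin upsilon_points.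
  by apply/negP => /H[t]; rewrite !inE => /andP[tv _] /pi_inj e; rewrite e eqxx in tv.
have vw w : pi w = (-1, -1) -> v \in B :\ w.
  by move=> we; rewrite !inE vB andbT; apply: contraNneq vU => ->; rewrite we.
case: cases => [[sv xv]|[sv lv]].
  apply: upsilon_gain => //; first by move: sv xv; clear; lia.
  exists (1, 1) => w we p m p0 mB; have L := low w p m we mB; have Lv := mB _ (vw _ we).
  have := L (0, 0) isT isT; have := L (2, 0) isT isT; have := L (0, 2) isT isT; have := @pair_neq0 p p0.
  move: Lv; rewrite /dot /=; case: (pi v) sv => x y /= sv Lv p12 l1 l2 l3.
  rewrite ltNge; apply/negP => le; have e : p.1 = p.2 by move: l1 l2 l3 le; clear; lia.
  rewrite -e in p12 Lv l1 l2 l3 le; have pn : p.1 < 0 by move: p12 l1 l2 l3 le; clear; lia.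
  have : p.1 * 2 <= p.1 * (x + y) by move: l1 l2 l3 le Lv; clear; lia.
  by rewrite ler_nM2l //; move: sv; clear; lia.
have memB y : in_hull pi B y -> y \in upsilon_points \/ y = pi v.
  move=> /cB[t tB <-]; have [->|tv] := eqVneq t v; first by right.
  by left; apply/H; exists t; rewrite ?inE ?tv.
have hv := @mem_hull _ pi _ _ vB.
have hU y : y \in upsilon_points -> in_hull pi B y by move=> /get[t tB <-]; apply: mem_hull.
have [h3 x3] : 3 * (pi v).2 - (pi v).1 + 2 = -1 /\ (pi v).2 <= -1.
  (* [h] is the lattice distance of [v] from the edge through (-1, -1) and (2, 0); the points at
     distance 1 are those of the form [(3 * c + 3, c)]. *)
  have [h hE] : exists h : int, h = (pi v).1 - 3 * (pi v).2 - 2 by exists ((pi v).1 - 3 * (pi v).2 - 2).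
  have [|s [c [s0 s1 e]]] := @slice (pi v).2 (-1) h; first by move: lv hE; clear; lia.
  have hc : in_hull pi B (3 * c + 3, c).
    have A : 0 < h - 1 - s + s + 1 by move: lv hE; clear; lia.
    have E2 : (h - 1 - s + s + 1) * c = (h - 1 - s) * -1 + s * 0 + 1 * (pi v).2 by rewrite e; ring.
    have E1 : (h - 1 - s + s + 1) * (3 * c + 3) = (h - 1 - s) * -1 + s * 2 + 1 * (pi v).1.
      have -> : (h - 1 - s + s + 1) * (3 * c + 3) = 3 * ((h - 1 - s + s + 1) * c) + 3 * h by ring.
      by rewrite e hE; ring.
    exact: (@hull_comb _ pi B (h - 1 - s) s 1 (-1, -1) (2, 0) (pi v) (3 * c + 3, c) s1 s0 isT A (hU (-1, -1) isT) (hU (2, 0) isT) hv E1 E2).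
  case: (memB _ hc) => [|e2].
    by rewrite /upsilon_points !inE !xpair_eqE; clear; lia.
  by move: sv; rewrite -e2 /=; clear; lia.
(* Further along that line [v] would also lie far beyond the edge through (-1, -1) and (0, 2), and
   [slice] would produce a second new point. *)
have ve : pi v = (0, -1).
  have x1 : (pi v).1 = 3 * (pi v).2 + 3 by move: h3; clear; lia.
  have [y1|y1] := eqVneq (pi v).2 (-1); first by rewrite [LHS]surjective_pairing x1 y1.
  move/eqP: y1 => y1.
  have [h hE] : exists h : int, h = (pi v).2 - 3 * (pi v).1 - 2 by exists ((pi v).2 - 3 * (pi v).1 - 2).
  have [|s [c [s0 s1 e]]] := @slice (pi v).1 (-1) h; first by move: x1 y1 x3 hE; clear; lia.
  have hc : in_hull pi B (c, 3 * c + 3).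
    have A : 0 < h - 1 - s + s + 1 by move: x1 y1 x3 hE; clear; lia.
    have E2 : (h - 1 - s + s + 1) * c = (h - 1 - s) * -1 + s * 0 + 1 * (pi v).1 by rewrite e; ring.
    have E1 : (h - 1 - s + s + 1) * (3 * c + 3) = (h - 1 - s) * -1 + s * 2 + 1 * (pi v).2.
      have -> : (h - 1 - s + s + 1) * (3 * c + 3) = 3 * ((h - 1 - s + s + 1) * c) + 3 * h by ring.
      by rewrite e hE; ring.
    exact: (@hull_comb _ pi B (h - 1 - s) s 1 (-1, -1) (0, 2) (pi v) (c, 3 * c + 3) s1 s0 isT A (hU (-1, -1) isT) (hU (0, 2) isT) hv E2 E1).
  case: (memB _ hc) => [|e2].
    by rewrite /upsilon_points !inE !xpair_eqE; clear; lia.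
  by move: x1; rewrite -e2 /=; clear; lia.
apply: upsilon_gain; rewrite ?ve //.
exists (1, 0) => w we p m p0 mB; have L := low w p m we mB; have Lv := mB _ (vw _ we).
have := L (0, 0) isT isT; have := L (2, 0) isT isT; have := L (0, 2) isT isT; have := @pair_neq0 p p0.
by move: Lv; rewrite ve /dot /=; clear; lia.
Qed.

Lemma upsilon_step (pi : 'I_n -> int * int) : injective pi -> lattice_convex pi B ->
  is_upsilon pi (B :\ v) -> linear_exact k pi B (#|B| - 4).
Proof.
move=> pi_inj cB [f [fU H]]; apply: (exact_map fU); set pi' := fun t => f (pi t).
have inj' : injective pi' by move=> x y /(unimod_inj fU)/pi_inj.
have cB' := convex_map fU cB.
have vU : pi' v \notin upsilon_points.
  by apply/negP => /H[t]; rewrite !inE => /andP[tv _] /inj' e; rewrite e eqxx in tv.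
pose swap (z : int * int) := (z.2, z.1).
have H' z : occ (fun t => swap (pi' t)) (B :\ v) z <-> z \in upsilon_points.
  have -> : (z \in upsilon_points) = (swap z \in upsilon_points).
    by case: z => x y; rewrite /swap /upsilon_points !inE !xpair_eqE /=; clear; lia.
  rewrite -H; split=> -[t tB te]; exists t => //.
    by rewrite -te /swap /pi' /=; case: (f _).
  by rewrite -[f (pi t)]/(pi' t) in te; rewrite te /swap; case: (z).
have inj2 : injective (fun t => swap (pi' t)).
  by move=> x y /(unimod_inj unimod_swap)/inj'.
have cB2 := convex_map unimod_swap cB'.
have : ((3 <= (pi' v).1 + (pi' v).2 /\ 0 <= (pi' v).1) \/
  ((pi' v).1 + (pi' v).2 <= 2 /\ 3 * (pi' v).2 - (pi' v).1 + 2 < 0)) \/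
  ((3 <= (pi' v).1 + (pi' v).2 /\ 0 <= (pi' v).2) \/
  ((pi' v).1 + (pi' v).2 <= 2 /\ 3 * (pi' v).1 - (pi' v).2 + 2 < 0)).
  by move: vU; rewrite /upsilon_points !inE; case: (pi' v) => x y /=; rewrite !xpair_eqE; clear; lia.
case=> C; first exact: upsilon_half.
apply: (exact_map unimod_swap); apply: (upsilon_half inj2 cB2 H').
by rewrite /swap /= addrC.
Qed.
End UpsilonStep.

(** [g] is the lattice length of the segment; Bezout's identity completes its primitive direction to
    a basis of the lattice. *)
Lemma edge_coordinates (a b : int * int) : a != b -> exists f (g : int),
  [/\ unimod f, 0 < g, f a = (0, 0), f b = (g, 0) & forall z, det2 (b - a) (z - a) = g * (f z).2].
Proof.
move=> ab; pose E := b - a; pose g : int := gcdz E.1 E.2.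
have E0 : E != 0 by rewrite subr_eq0 eq_sym.
have g0 : 0 < g.
  have gn : g != 0.
    rewrite gcdz_eq0; apply: contraNN E0 => /andP[/eqP e1 /eqP e2].
    by rewrite [E]surjective_pairing e1 e2.
  by rewrite lt_neqAle eq_sym gn /g /gcdz le0z_nat.
have /dvdzP[e1 E1] : (g %| E.1)%Z by apply: dvdz_gcdl.
have /dvdzP[e2 E2] : (g %| E.2)%Z by apply: dvdz_gcdr.
have [u [w uw]] := Bezoutz E.1 E.2; rewrite -/g in uw.
have det : u * e1 + w * e2 = 1.
  have : (u * e1 + w * e2) * g = 1 * g by rewrite mul1r -[RHS]uw E1 E2; ring.
  by move/(mulIf (lt0r_neq0 g0)).
exists (fun z : int * int => (u * (z.1 - a.1) + w * (z.2 - a.2), - e2 * (z.1 - a.1) + e1 * (z.2 - a.2))), g; split=> //.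
- exists u, w, (- e2), e1, (- (u * a.1 + w * a.2)), (e2 * a.1 - e1 * a.2); split.
    by have -> : u * e1 - w * - e2 = 1 by rewrite -[RHS]det; ring.
  by move=> z; congr pair; ring.
- by congr pair; ring.
- have -> : b.1 = a.1 + e1 * g by rewrite -E1 /E /=; ring.
  have -> : b.2 = a.2 + e2 * g by rewrite -E2 /E /=; ring.
  congr pair; last by ring.
  by transitivity ((u * e1 + w * e2) * g); [ring|rewrite det mul1r].
by move=> z; rewrite -/E /det2 E1 E2 /=; ring.
Qed.

(** * Standard coordinates and the induction on the number of points *)

Section Coordinates.
Variables (n : nat) (pi : 'I_n -> int * int) (B : {set 'I_n}).

(** An edge of the hull of the interior points is placed on the axis; [slice] supplies an interior
    point at height 1, which a shear moves to (0, 1). *)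
Lemma standard_coordinates : lattice_convex pi B -> wide pi B ->
  exists f, [/\ unimod f, in_int (fun t => f (pi t)) B (0, 0), in_int (fun t => f (pi t)) B (1, 0),
    in_int (fun t => f (pi t)) B (0, 1) & forall z, in_int (fun t => f (pi t)) B z -> 0 <= z.2].
Proof.
move=> cB [a0 [b0 [c0 [a0I b0I c0I orn]]]].
pose s := [seq pi t | t <- enum B & `[< in_int pi B (pi t) >]].
have sP z : z \in s <-> in_int pi B z.
  split=> [/mapP[t]|zI]; first by rewrite mem_filter => /andP[/asboolP + _] ->.
  have [t tB te] := cB _ (int_hull zI); apply/mapP; exists t => //.
  by rewrite mem_filter mem_enum tB andbT; apply/asboolP; rewrite te.
have [|m [V [cvx Vs Vpos]]] := @convex_cycle_exists s.
  by exists a0, b0, c0; split=> //; apply/sP.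
pose i := Ordinal (ltn_trans (isT : (0 < 2)%N) cvx.1).
have [|f [g [fU g0 fa fe height0]]] := @edge_coordinates (V i) (V (ordS i)).
  by apply/negP => /eqP/(vertex_inj cvx)/eqP; rewrite eq_sym (negPf (ordS_neq cvx i)).
have height z : edge V i 1 z = g * (f z).2 by rewrite -height0 /edge !mul1r.
have pos z : in_int pi B z -> 0 <= (f z).2.
  by move=> /sP/(Vpos i); rewrite height pmulr_rge0.
have VI j : in_int pi B (V j) by apply/sP/Vs.
have fI z : in_int pi B z -> in_int (fun t => f (pi t)) B (f z) by move=> ?; apply/(int_map pi fU).
have f0 : in_int (fun t => f (pi t)) B (0, 0).
  by rewrite -fa; apply: fI.
have fg : in_int (fun t => f (pi t)) B (g, 0).
  by rewrite -fe; apply: fI.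
have f1 : in_int (fun t => f (pi t)) B (1, 0).
  apply: (int_comb (al := g - 1) (be := 1) (ga := 0) _ _ _ _ f0 fg (int_hull f0)) => //=; move: (g) g0; clear; lia.
pose b := V (ordS (ordS i)).
have hb : 0 < (f b).2.
  rewrite -(pmulr_rgt0 _ g0) -height; apply: cvx.2; [exact: (ordSS_neq cvx i)|exact: (ordS_neq cvx (ordS i))].
have fb : in_int (fun t => f (pi t)) B (f b) by apply: fI; apply: VI.
move: (f b) hb fb => [xb yb] /= hb fb.
have [s1 [c [s10 s11 ce]]] := slice xb 0 hb.
have fc : in_int (fun t => f (pi t)) B (c, 1).
  have a3 : 0 < 1 + (yb - 1 - s1) :> int by move: s11; clear; lia.
  have E1 : (1 + (yb - 1 - s1) + s1) * c = 1 * xb + (yb - 1 - s1) * 0 + s1 * 1 :> int.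
    transitivity ((yb - 1 - s1 + s1 + 1) * c); first by ring.
    by rewrite ce; ring.
  have E2 : (1 + (yb - 1 - s1) + s1) * 1 = 1 * yb + (yb - 1 - s1) * 0 + s1 * 0 :> int by ring.
  exact: (@int_comb _ _ B 1 (yb - 1 - s1) s1 (xb, yb) (0, 0) (1, 0) (c, 1) isT s11 s10 a3 fb f0 (int_hull f1) E1 E2).
pose sh (z : int * int) := (z.1 - c * z.2, z.2).
have shU : unimod sh by exists 1, (- c), 0, 1, 0, 0; split; [ring|move=> z; rewrite /sh; congr pair; ring].
have shI z : in_int (fun t => f (pi t)) B z -> in_int (fun t => sh (f (pi t))) B (sh z).
  by move=> zI; apply/(int_map (fun t => f (pi t)) shU).
exists (fun z => sh (f z)); split.
- exact: unimod_comp.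
- by have := shI _ f0; rewrite /sh /= mulr0 subrr.
- by have := shI _ f1; rewrite /sh /= mulr0 subr0.
- by have := shI _ fc; rewrite /sh /= mulr1 subrr.
have [g' [_ fg' gf']] := unimod_inv (unimod_comp shU fU) => z.
by rewrite -(gf' z) => /(int_map pi (unimod_comp shU fU) B (g' z))/pos.
Qed.

(** Three vertices and three noncollinear interior points. *)
Lemma wide_card : injective pi -> lattice_convex pi B -> wide pi B -> (6 <= #|B|)%N.
Proof.
move=> pi_inj cB [a [b [c [aI bI cI orn]]]].
have [m [V [v [cvx vP coneE icE]]]] := hull_cycle (int_noncollinear aI).
have vinj : injective v by move=> i j e; apply: (vertex_inj cvx); rewrite -(vP i).2 -(vP j).2 e.
pose S := v @: [set: 'I_m]; have cS : (3 <= #|S|)%N by rewrite card_imset // cardsT card_ord cvx.1.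
have [ta taB tae] := cB _ (int_hull aI); have [tb tbB tbe] := cB _ (int_hull bI); have [tc tcB tce] := cB _ (int_hull cI).
have ab : ta != tb by apply: contraNneq orn => e; rewrite -tae -tbe e /orient /det2 /=; apply/eqP; ring.
have ac : ta != tc by apply: contraNneq orn => e; rewrite -tae -tce e /orient /det2 /=; apply/eqP; ring.
have bc : tb != tc by apply: contraNneq orn => e; rewrite -tbe -tce e /orient /det2 /=; apply/eqP; ring.
have out z t : in_int pi B z -> pi t = z -> t \notin S.
  move=> zI te; apply/negP => /imsetP[i _ e]; have /icE/forallP/(_ i) := zI.
  by rewrite -te e (vP i).2 edge_start ltxx.
pose T := [set ta; tb; tc]; have cT : #|T| = 3%N by rewrite /T -setUA cardsU1 cards2 !inE negb_or ab ac bc.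
have dis : [disjoint S & T].
  rewrite disjoint_sym; apply/pred0P => t /=; apply/negP => /andP[]; rewrite !inE => /orP[/orP[]|] /eqP -> h.
  - by move: (out _ _ aI tae); rewrite h.
  - by move: (out _ _ bI tbe); rewrite h.
  by move: (out _ _ cI tce); rewrite h.
have sub : S :|: T \subset B.
  by rewrite subUset /T !subUset !sub1set taB tbB tcB !andbT; apply/subsetP => t /imsetP[i _ ->]; case: (vP i).
have := subset_leq_card sub; rewrite cardsU (eqP (_ : S :&: T == finset.set0)) ?setI_eq0 // cards0 subn0 cT.
by apply: leq_trans; rewrite -[6%N]/(3 + 3)%N leq_add2r.
Qed.
End Coordinates.

(** Induction on the number of points. When removing a vertex keeps a two-dimensional interior,
    [peel] lifts exactness from the smaller set, and [upsilon_step] covers the case where the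
    smaller set is the exceptional triangle; [corner_case] reduces everything to such removals. *)
Theorem exact_or_upsilon (k : fieldType) n (pi : 'I_n -> int * int) (B : {set 'I_n}) :
  injective pi -> lattice_convex pi B -> wide pi B ->
  linear_exact k pi B (#|B| - 4) \/ is_upsilon pi B.
Proof.
have [m] := ubnP #|B|; elim: m B pi => // m IH B pi Bm pi_inj cB wB.
have step (pi' : 'I_n -> int * int) : injective pi' -> lattice_convex pi' B -> forall v, vertex_of pi' B v ->
    wide pi' (B :\ v) -> linear_exact k pi' B (#|B| - 4).
  move=> inj' cB' v vV wv; have [vB [lam lamP]] := vV; have cv := convex_del cB' vV.
  have cBv : #|B| = #|B :\ v|.+1 by rewrite (cardsD1 v) vB.
  have lt : (#|B :\ v| < m)%N by rewrite -ltnS -cBv.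
  have c6 := wide_card inj' cv wv.
  case: (IH _ _ lt inj' cv wv) => [ex|]; last exact: upsilon_step.
  apply: (peel inj' vB lamP); first by rewrite cBv; move: c6; clear; lia.
  have -> : (#|B| - 4).-1 = (#|B :\ v| - 4)%N by rewrite cBv; move: c6; clear; lia.
  exact: ex.
have [f [fU f0 f1 f2 fpos]] := standard_coordinates cB wB.
have inj' : injective (fun t => f (pi t)) by move=> x y /(unimod_inj fU)/pi_inj.
case: (corner_case step inj' (convex_map fU cB) f0 f1 f2 fpos) => H.
  by left; apply: (exact_map fU).
by right; apply: (is_upsilon_map fU).
Qed.

(** * Segments and the finite table for the exceptional triangle *)

Definition segment (y lo hi : int) : seq (int * int) :=
  [seq (lo + i%:Z, y) | i <- iota 0 (absz (hi - lo + 1))].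

Lemma mem_segment y lo hi (z : int * int) : lo <= hi + 1 ->
  (z \in segment y lo hi) = [&& lo <= z.1, z.1 <= hi & z.2 == y].
Proof.
move=> le; apply/mapP/and3P => [[i + ->]|[h1 h2 /eqP h3]] /=.
  by rewrite mem_iota eqxx => /andP[_ ii]; split=> //; move: ii le; clear; lia.
exists (absz (z.1 - lo)); first by rewrite mem_iota; move: h1 h2; clear; lia.
by rewrite [LHS]surjective_pairing h3; congr pair; move: h1; clear; lia.
Qed.

Lemma segment_uniq y lo hi : uniq (segment y lo hi).
Proof. by rewrite map_inj_uniq ?iota_uniq // => i j [] /addrI []. Qed.

Lemma size_segment y lo hi : lo <= hi + 1 -> (size (segment y lo hi))%:Z = hi - lo + 1.
Proof. by move=> le; rewrite size_map size_iota; move: le; clear; lia. Qed.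

Lemma unimod_sub f x y : unimod f -> f (x - y) = f x - f y + f 0.
Proof.
case=> a [b [c [d [s [t [_ fE]]]]]]; rewrite !fE /=; congr pair => /=; ring.
Qed.

Definition upsilon_interior : seq (int * int) := [:: (0, 0); (1, 0); (0, 1)].
Definition psub (a b : int * int) : int * int := (a.1 - b.1, a.2 - b.2).
Definition u_edge (U a b : int * int) := psub (psub U a) b \in upsilon_interior.
Definition u_used (U a : int * int) := has (u_edge U a) upsilon_points.
(** At the three weights where the graph splits, [true] marks the smaller component; elsewhere there
    is one colour. *)
Definition u_col (U a : int * int) := if U == (0, 0) then a == (0, 0)
  else if U == (0, 1) then a \in [:: (0, 0); (0, 1)]
  else if U == (1, 0) then a \in [:: (0, 0); (1, 0)] else false.
Definition u_grow U s := undup (s ++ [seq b <- upsilon_points | has (fun c => (c != b) && u_edge U c b) s]).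
(** The interior of three times the triangle, where the weights of height 3 live; it is contained in
    [box 6]. *)
Definition u_region (U : int * int) := [&& U.1 + U.2 <= 5, U.1 - 3 * U.2 <= 5 & U.2 - 3 * U.1 <= 5].
(** The hypotheses of [two_colours] at one weight as a decidable test; 7 rounds of growth reach a
    whole component because there are 7 points. *)
Definition u_check U := if u_region U then
  [&& has (u_used U) upsilon_points,
    all (fun a => all (fun b => if u_edge U a b && (a != b) then u_col U a == u_col U b else true)
      upsilon_points) upsilon_points,
    all (fun a => all (fun b => if [&& u_used U a, u_used U b & u_col U a == u_col U b]
      then b \in iter 7 (u_grow U) [:: a] else true) upsilon_points) upsilon_points &
    (U \in upsilon_interior) == has (fun a => u_used U a && u_col U a &&
      has (fun b => u_used U b && ~~ u_col U b) upsilon_points) upsilon_points] else true.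

Lemma psubE a b : psub a b = a - b.
Proof. by []. Qed.

Lemma u_checked : all u_check (box 6).
Proof. by vm_compute. Qed.

(** * Betti numbers as numbers of weights with two colours *)

Section DualCounting.
Variables (k : fieldType) (n m : nat) (pi : 'I_n -> int * int) (V : 'I_m -> int * int).
Variable v : 'I_m -> 'I_n.
Hypothesis cvx : convex_cycle V.
Hypothesis pi_inj : injective pi.
Hypothesis pi_cone : forall t, in_cone V 1 (pi t).
Hypothesis pi_full : forall z, in_cone V 1 z -> exists t, pi t = z.
Hypothesis vP : forall i, pi (v i) = V i.
Hypothesis n4 : (4 <= n)%N.
Variables (J : finType) (w : J -> int * int).
Hypothesis w_inj : injective w.
Local Notation q := ((n - 3)%N%:Z).
Hypothesis w_cover : forall (T : {set 'I_n}) z,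
  in_icone V ((#|T|)%:Z - q) ((\sum_(t in T) pi t) - z) -> exists j, w j = z.
Local Notation u := (dual_weight pi w).
Local Notation C := (cone_cell pi V [set: 'I_n] w q).

Lemma dual_inj : injective u.
Proof. by move=> i j /addrI/oppr_inj/w_inj. Qed.

Lemma dual_cover z : in_icone V 3 z -> exists j, u j = z.
Proof.
move=> zI; have [|j wj] := @w_cover [set: 'I_n] ((\sum_(t in [set: 'I_n]) pi t) - z).
  rewrite subKr cardsT card_ord; have -> // : n%:Z - q = 3 by move: n4; clear; lia.
by exists j; rewrite /dual_weight wj subKr.
Qed.

Lemma card_dual (P : pred (int * int)) : (forall z, P z -> in_icone V 3 z) ->
  #|[pred j | P (u j)]| = npts P.
Proof.
move=> P3; rewrite (@npts_count P [seq u j | j <- enum J]); first last.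
- by move=> z /P3/dual_cover[j <-]; rewrite map_f ?mem_enum.
- by rewrite map_inj_uniq ?enum_uniq //; apply: dual_inj.
by rewrite count_map cardE -size_filter; congr size; rewrite enumT /enum_mem; apply: eq_filter.
Qed.

Lemma icone_add h z a : in_cone V 1 a -> in_icone V h z -> in_icone V (h + 1) (z + a).
Proof.
move=> /forallP aC /forallP zI; apply/forallP => i; rewrite edgeD.
by apply: ltr_pwDl; [apply: zI|apply: aC].
Qed.

Section TwoColours.
Variable col : J -> 'I_n -> bool.
Hypothesis col_edge : forall j a b, a != b -> in_icone V 1 (u j - pi a - pi b) -> col j a = col j b.
Hypothesis col_conn : forall j (h : 'I_n -> k),
  (forall a b, a != b -> in_icone V 1 (u j - pi a - pi b) -> h a = h b) ->
  forall a b, in_icone V 2 (u j - pi a) -> in_icone V 2 (u j - pi b) -> col j a = col j b -> h a = h b.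
Variable band : pred (int * int).
Hypothesis all_used : forall j, in_icone V 3 (u j) -> exists a, in_icone V 2 (u j - pi a).
Hypothesis bandP : forall j, band (u j) <->
  exists a b, [/\ in_icone V 2 (u j - pi a), in_icone V 2 (u j - pi b), col j a & ~~ col j b].
Hypothesis band3 : forall z, band z -> in_icone V 3 z.

(** [dimK] counts the pairs of a weight and an occurring colour, and every interior weight of height
    3 has at least one colour; by [first_equation] the Betti number is the number of weights with a
    second one. *)
Lemma two_colours : hdim (bd k J n) (chains k C) (n - 4) = npts band.
Proof.
pose Q (x : J * bool) := colour_used pi V w col x.
have QE x : Q x = [exists a, in_icone V 2 (u x.1 - pi a) && (col x.1 a == x.2)] by [].
have E := first_equation k cvx pi_inj pi_cone vP n4 w_inj w_cover.
rewrite (dim_colours pi_cone n4 col_edge col_conn) in E.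
have : #|colour_used pi V w col| = (npts band + npts (in_icone V 3))%N; last by move=> e; rewrite e in E; move/eqP: E; rewrite eqn_add2r => /eqP.
rewrite -(card_dual band3) -(@card_dual (in_icone V 3)) //.
rewrite -sum1_card [LHS]big_mkcond.
rewrite [LHS](eq_bigr (fun x : J * bool => if Q (x.1, x.2) then 1%N else 0%N)) => [|[]//].
rewrite -(pair_bigA _ (fun j b => if Q (j, b) then 1%N else 0%N)) /=.
rewrite -!sum1_card [X in (X + _)%N]big_mkcond [X in (_ + X)%N]big_mkcond -big_split /=.
apply: eq_bigr => j _; rewrite big_bool /= !inE.
have -> : band (u j) = Q (j, true) && Q (j, false).
  apply/idP/andP => [/bandP[a [b [ua ub ca cb]]]|[/existsP[a /andP[ua /eqP ca]] /existsP[b /andP[ub /eqP cb]]]].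
    by split; apply/existsP; [exists a; rewrite ua ca|exists b; rewrite ub (negPf cb)].
  by apply/bandP; exists a, b; split; rewrite //= ?ca ?cb.
have -> : in_icone V 3 (u j) = Q (j, true) || Q (j, false).
  apply/idP/orP => [/all_used[a ua]|[]/existsP[a /andP[/= ua _]]].
  - by case ca: (col j a); [left|right]; apply/existsP; exists a; rewrite ua ca.
  - by have := icone_add (pi_cone a) ua; rewrite subrK.
  - by have := icone_add (pi_cone a) ua; rewrite subrK.
by case: (Q (j, true)); case: (Q (j, false)).
Qed.
End TwoColours.

Variable f : int * int -> int * int.
Hypothesis fU : unimod f.
(** The affine map [f] extended to height 3 of the cone: its linear part plus three times its
    translation part. *)
Definition height3 z := f z + f 0 + f 0.
Arguments height3 z : simpl never.

Lemma height3_sub z a b : f (z - a - b) = height3 z - f a - f b.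
Proof. by rewrite !(unimod_sub _ _ fU) /height3; congr pair => /=; ring. Qed.

Lemma height3_gt p (c : int) z : p != 0 -> (forall a, in_cone V 1 a -> c <= dot p (f a)) ->
  in_icone V 3 z -> 3 * c < dot p (height3 z).
Proof.
move=> p0 low zI; have [r [h [r0 rE]]] := unimod_pull p fU.
have pos j : 0 <= dot r (V j) + (h - c).
  by have := low (V j); rewrite rE -vP => /(_ (pi_cone _)); rewrite vP; clear; lia.
have H : 0 < dot r z + (h - c) * 3 by exact: (functional_gt0 cvx (r0 p0) pos zI).
have -> : dot p (height3 z) = dot r z + 3 * h.
  rewrite /height3; have -> : dot p (f z + f 0 + f 0) = dot p (f z) + dot p (f 0) + dot p (f 0) by rewrite /dot /=; ring.
  by rewrite !rE /dot /=; ring.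
by move: H; clear; lia.
Qed.

Lemma unimod_surj z : exists y, f y = z.
Proof. by have [g [_ _ gf]] := unimod_inv fU; exists (g z). Qed.

Lemma npts_height3 (s : seq (int * int)) : uniq s -> npts (fun z => height3 z \in s) = size s.
Proof.
move=> us; have [g [gU fg gf]] := unimod_inv fU; pose h z := g (z - f 0 - f 0).
have hK z : height3 (h z) = z by rewrite /height3 /h gf !subrK.
have Kh z : h (height3 z) = z.
  by rewrite /height3 /h !addrK fg.
rewrite (@npts_count _ [seq h z | z <- s]); first last.
- by move=> z zs; rewrite -(Kh z) map_f.
- by rewrite map_inj_uniq //; apply: can_inj hK.
rewrite count_map; apply/eqP; rewrite -all_count; apply/allP => z zs /=.
by rewrite hK.
Qed.

#[local] Opaque height3.
Variable zi : int * int.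
Hypothesis ziP : in_icone V 1 zi.

Lemma int2P z a : in_icone V 2 (z - pi a) <-> exists c, in_icone V 1 (z - pi a - pi c).
Proof.
split=> [zI|[c cI]]; last by have := icone_add (pi_cone c) cI; rewrite subrK.
have [y /pi_full[c <-] yI] := icone2_sub cvx ziP zI.
by exists c.
Qed.

Lemma int3_intro z a c : in_icone V 1 (z - pi a - pi c) -> in_icone V 3 z.
Proof.
by move=> /(icone_add (pi_cone c)); rewrite subrK => /(icone_add (pi_cone a)); rewrite subrK.
Qed.

(** * Polygons whose interior points form a segment *)

Section Strip.
Variables p1 q1 p2 q2 l r i0 i1 : int.
Definition row_lo (y : int) := if y == 1 then p1 else if y == -1 then p2 else l.
Definition row_hi (y : int) := if y == 1 then q1 else if y == -1 then q2 else r.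
Hypothesis coneE : forall z, in_cone V 1 z <->
  [/\ -1 <= (f z).2, (f z).2 <= 1, row_lo (f z).2 <= (f z).1 & (f z).1 <= row_hi (f z).2].
Hypothesis iconeE : forall z, in_icone V 1 z <->
  [/\ (f z).2 = 0, i0 <= (f z).1 & (f z).1 <= i1].
Hypothesis i01 : i0 < i1.
Hypothesis pq1 : p1 <= q1.
Hypothesis pq2 : p2 <= q2.
Hypothesis left_side : (i0 = l + 1 /\ 2 * l <= p1 + p2) \/ (i0 = l /\ p1 + p2 = 2 * l - 1).
Hypothesis right_side : (i1 = r - 1 /\ q1 + q2 <= 2 * r) \/ (i1 = r /\ q1 + q2 = 2 * r + 1).
Local Notation x t := (f (pi t)).1.
Local Notation y t := (f (pi t)).2.
Local Notation X z := (height3 z).1.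
Local Notation Y z := (height3 z).2.

Lemma row_cases (h : int) : -1 <= h -> h <= 1 -> [\/ h = -1, h = 0 | h = 1].
Proof.
move=> h1 h2; have [e|e] := eqVneq h (-1); first by constructor 1.
have [e'|e'] := eqVneq h 0; [by constructor 2|constructor 3].
by move/eqP: e; move/eqP: e'; move: h1 h2; clear; lia.
Qed.

Lemma lr : l <= r.
Proof. by move: i01 left_side right_side; clear; lia. Qed.

Lemma row_values : ((row_lo 1 = p1) * (row_lo 0 = l) * (row_lo (-1) = p2)) *
  ((row_hi 1 = q1) * (row_hi 0 = r) * (row_hi (-1) = q2)).
Proof. by []. Qed.

Lemma row_le h : row_lo h <= row_hi h.
Proof. by have := lr; move: pq1 pq2; rewrite /row_lo /row_hi; do 2?case: ifP => _. Qed.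

Lemma pt_row t : [/\ -1 <= y t, y t <= 1, row_lo (y t) <= x t & x t <= row_hi (y t)].
Proof. exact/coneE/pi_cone. Qed.

Lemma row_pt (x0 y0 : int) : -1 <= y0 -> y0 <= 1 -> row_lo y0 <= x0 -> x0 <= row_hi y0 ->
  exists t, f (pi t) = (x0, y0).
Proof.
move=> h1 h2 h3 h4; have [z zE] := unimod_surj (x0, y0).
by have /pi_full[t tE] : in_cone V 1 z; [apply/coneE; rewrite zE|exists t; rewrite tE].
Qed.

(** Integer intervals add up without gaps. *)
Lemma pick_sum (lo hi e0 e1 s : int) : lo <= hi -> e0 <= e1 -> lo + e0 <= s -> s <= hi + e1 ->
  exists c : int, [/\ lo <= c, c <= hi, e0 <= s - c & s - c <= e1].
Proof.
move=> h1 h2 h3 h4; have [h|h] := lerP (s - e1) lo; [exists lo|exists (s - e1)]; split; move: h h1 h2 h3 h4; clear; lia.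
Qed.

Lemma strip_edge z a b : in_icone V 1 (z - pi a - pi b) <->
  [/\ Y z = y a + y b, i0 <= X z - x a - x b & X z - x a - x b <= i1].
Proof.
rewrite iconeE height3_sub /=; split=> -[h1 h2 h3]; split=> //; move: h1; clear; lia.
Qed.

Lemma strip_used z a : in_icone V 2 (z - pi a) <->
  [/\ -1 <= Y z - y a, Y z - y a <= 1, row_lo (Y z - y a) + i0 <= X z - x a & X z - x a <= row_hi (Y z - y a) + i1].
Proof.
rewrite int2P; split=> [[c /strip_edge[e h1 h2]]|[h1 h2 h3 h4]].
  have [c1 c2 c3 c4] := pt_row c; have -> : Y z - y a = y c by move: e; clear; lia.
  by split=> //; move: h1 h2 c3 c4; clear; lia.
have [c [c1 c2 c3 c4]] := pick_sum (row_le _) (ltW i01) h3 h4.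
have [t tE] := row_pt h1 h2 c1 c2; exists t; apply/strip_edge; rewrite tE /=; split=> //.
by clear; lia.
Qed.

(** Each bound is a supporting functional of the polygon, tripled and made strict by interiority. *)
Lemma strip_bounds z : in_icone V 3 z ->
  [/\ -2 <= Y z, Y z <= 2,
    [/\ Y z = 2 -> 2 * p1 + i0 <= X z <= 2 * q1 + i1, Y z = 1 -> p1 + l + i0 <= X z <= q1 + r + i1,
       Y z = -1 -> p2 + l + i0 <= X z <= q2 + r + i1 & Y z = -2 -> 2 * p2 + i0 <= X z <= 2 * q2 + i1] &
    Y z = 0 -> (2 * l + i0 <= X z \/ p1 + p2 + i0 <= X z) /\ (X z <= 2 * r + i1 \/ X z <= q1 + q2 + i1)].
Proof.
move=> zI; have low (a b c : int) : ((a, b) : int * int) != 0 ->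
    (forall h g : int, -1 <= h -> h <= 1 -> row_lo h <= g -> g <= row_hi h -> c <= a * g + b * h) ->
    3 * c < a * X z + b * Y z.
  move=> ab H; have := @height3_gt (a, b) c z ab; rewrite /dot /=; apply=> // t /coneE[? ? ? ?].
  exact: H.
have rows (Pr : int -> int -> Prop) : (forall g, p2 <= g -> g <= q2 -> Pr (-1) g) ->
   (forall g, l <= g -> g <= r -> Pr 0 g) -> (forall g, p1 <= g -> g <= q1 -> Pr 1 g) ->
   forall h g, -1 <= h -> h <= 1 -> row_lo h <= g -> g <= row_hi h -> Pr h g.
  by move=> H1 H2 H3 h g h1 h2; case: (row_cases h1 h2) => ->; rewrite !row_values; [apply: H1|apply: H2|apply: H3].
have b1 : 3 * -1 < 0 * X z + 1 * Y z.
  by apply: low => // h g h1 _ _ _; move: h1; clear; lia.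
have b2 : 3 * -1 < 0 * X z + -1 * Y z.
  by apply: low => // h g _ h2 _ _; move: h2; clear; lia.
have L : (i0 = l + 1 /\ 3 * l < 1 * X z + (l - p1) * Y z /\ 3 * l < 1 * X z + (p2 - l) * Y z) \/
   (i0 = l /\ p1 + p2 = 2 * l - 1 /\ 3 * (2 * l - 1) < 2 * X z + (p2 - p1) * Y z).
  case: left_side => -[e1 e2]; [left|right]; split=> //; split=> //; apply: low => //;
    apply: rows => g; move: e2; clear; lia.
have U : (i1 = r - 1 /\ 3 * - r < -1 * X z + (q1 - r) * Y z /\ 3 * - r < -1 * X z + (r - q2) * Y z) \/
   (i1 = r /\ q1 + q2 = 2 * r + 1 /\ 3 * (- (2 * r + 1)) < -2 * X z + (q1 - q2) * Y z).
  case: right_side => -[e1 e2]; [left|right]; split=> //; split=> //; apply: low => //;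
    apply: rows => g; move: e2; clear; lia.
split; [by move: b1; clear; lia|by move: b2; clear; lia|split|]; move=> e; move: L U; rewrite e; clear; lia.
Qed.

Lemma strip_size : n%:Z = (q1 - p1 + 1) + (r - l + 1) + (q2 - p2 + 1).
Proof.
have lr' := lr; pose s := segment 1 p1 q1 ++ segment 0 l r ++ segment (-1) p2 q2.
have le (a b : int) : a <= b -> a <= b + 1 by clear; lia.
have ms z : (z \in s) = [|| [&& p1 <= z.1, z.1 <= q1 & z.2 == 1], [&& l <= z.1, z.1 <= r & z.2 == 0] |
    [&& p2 <= z.1, z.1 <= q2 & z.2 == -1]].
  by rewrite !mem_cat !mem_segment ?le.
have us : uniq s.
  rewrite /s !cat_uniq !segment_uniq /= andbT; apply/andP; split; apply/hasPn => z;
    rewrite ?mem_cat !mem_segment ?le //; case: z => ? ? /=; clear; lia.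
have -> : n = size s.
  have <- : size [seq f (pi t) | t <- enum 'I_n] = n by rewrite size_map size_enum_ord.
  apply/perm_size/uniq_perm => //.
    by rewrite map_inj_uniq ?enum_uniq // => a b /(unimod_inj fU)/pi_inj.
  move=> z; rewrite ms; apply/mapP/idP => [[t _ ->]|].
    have [h1 h2 h3 h4] := pt_row t; case: (row_cases h1 h2) h3 h4 => ->; rewrite !row_values => -> ->;
      by rewrite ?eqxx ?orbT.
  move=> Hz; suff [t tE] : exists t, f (pi t) = z by exists t; rewrite ?mem_enum.
  rewrite [z]surjective_pairing; case/or3P: Hz => /and3P[h1 h2 /eqP h3]; rewrite h3; apply: row_pt; rewrite ?row_values //.
by rewrite !size_cat !PoszD !size_segment ?le // addrA.
Qed.

(** Neighbouring points of a row are partners or share a partner, so the used part of a row is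
    connected. A partner of a point in row [y] lies in row [Y z - y], which links the rows in use,
    except that for [Y z = 0] row 0 is its own partner. *)
Lemma strip_conn z (h : 'I_n -> k) :
  (forall a b, a != b -> in_icone V 1 (z - pi a - pi b) -> h a = h b) ->
  forall a b, in_icone V 2 (z - pi a) -> in_icone V 2 (z - pi b) ->
  (Y z == 0) && (y a == 0) = (Y z == 0) && (y b == 0) -> h a = h b.
Proof.
move=> E.
have step a b : y a = y b -> x b = x a + 1 -> in_icone V 2 (z - pi a) -> in_icone V 2 (z - pi b) -> h a = h b.
  move=> yab xab /strip_used[a1 a2 a3 a4] /strip_used[_ _ b3 b4]; rewrite -yab xab in b3 b4.
  have [|||c [c1 c2 c3 c4]] := pick_sum (e0 := i0 + 1) (e1 := i1) (s := X z - x a) (row_le (Y z - y a)).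
  - by move: i01; clear; lia.
  - by move: b3; clear; lia.
  - by move: a4; clear; lia.
  have [t tE] := row_pt a1 a2 c1 c2.
  have ab : a != b by apply: contra_eqN xab => /eqP ->; clear; lia.
  have [ta|ta] := eqVneq a t.
    apply: E => //; apply/strip_edge; rewrite -yab xab; rewrite -ta in tE.
    have e1 : y a = Y z - y a by rewrite {1}tE.
    have e2 : x a = c by rewrite tE.
    by split; move: e1 e2 c3 c4; clear; lia.
  have [tb|tb] := eqVneq b t.
    apply: E => //; apply/strip_edge; rewrite -tb in tE.
    have e1 : y b = Y z - y a by rewrite tE.
    have e2 : x b = c by rewrite tE.
    by split; move: e1 e2 c3 c4; clear; lia.
  have -> : h a = h t.
    apply: E => //; apply/strip_edge; have e1 : x t = c by rewrite tE.
    have e2 : y t = Y z - y a by rewrite tE.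
    by split; move: e1 e2 c3 c4; clear; lia.
  apply/esym/E => //; apply/strip_edge; have e1 : x t = c by rewrite tE.
  have e2 : y t = Y z - y a by rewrite tE.
  by rewrite -yab xab; split; move: e1 e2 c3 c4; clear; lia.
have row a b : y a = y b -> x a <= x b -> in_icone V 2 (z - pi a) -> in_icone V 2 (z - pi b) -> h a = h b.
  have [e0] := ubnP (absz (x b - x a)); elim: e0 b => // e0 IHm b lt yab le ua ub.
  have [e|ne] := eqVneq (x a) (x b).
    by congr h; apply/pi_inj/(unimod_inj fU); rewrite [LHS]surjective_pairing e yab -surjective_pairing.
  move/eqP: ne => ne; have [y1 y2 b3 b4] := pt_row b; have [_ _ a3 a4] := pt_row a; rewrite yab in a3 a4.
  have [||c cE] := @row_pt (x b - 1) (y b) y1 y2; try by move: a3 b4 le ne; clear; lia.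
  have uc : in_icone V 2 (z - pi c).
    move/strip_used: ua => [u1 u2 u3 u4]; move/strip_used: ub => [v1 v2 v3 v4]; rewrite yab in u1 u2 u3 u4.
    have c1 : x c = x b - 1 by rewrite cE.
    have c2 : y c = y b by rewrite cE.
    by apply/strip_used; rewrite c1 c2; split=> //; move: u4 v3 le ne; clear; lia.
  rewrite (IHm c) ?cE //=; try by move: lt le ne; clear; lia.
  by apply: step; rewrite ?cE //=; clear; lia.
have row' a b : y a = y b -> in_icone V 2 (z - pi a) -> in_icone V 2 (z - pi b) -> h a = h b.
  move=> yab ua ub; have [le|lt] := lerP (x a) (x b); first exact: row.
  by apply/esym/row => //; apply: ltW.
have cross a : Y z != y a + y a -> in_icone V 2 (z - pi a) -> exists c, [/\ h a = h c, y c = Y z - y a & in_icone V 2 (z - pi c)].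
  move=> yn /strip_used[a1 a2 a3 a4]; have [c [c1 c2 c3 c4]] := pick_sum (row_le _) (ltW i01) a3 a4.
  have [t tE] := row_pt a1 a2 c1 c2; have ed : in_icone V 1 (z - pi a - pi t).
    by apply/strip_edge; rewrite tE /=; split=> //; clear; lia.
  exists t; split; first apply: E => //.
  - by apply: contraNneq yn => e; rewrite {2}e tE /=; apply/eqP; clear; lia.
  - by rewrite tE.
  apply/int2P; exists a; have -> : z - pi t - pi a = z - pi a - pi t by rewrite addrAC.
  exact: ed.
move=> a b ua ub cab; have [yab|yab] := eqVneq (y a) (y b); first exact: row'.
have [a1 a2 _ _] := pt_row a; have [b1 b2 _ _] := pt_row b.
have [a3 a4 _ _] := (strip_used z a).1 ua; have [b3 b4 _ _] := (strip_used z b).1 ub.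
have ys : Y z = y a + y b.
  by move: cab yab a1 a2 b1 b2 a3 a4 b3 b4; clear; lia.
have [|c [hc yc uc]] := cross a _ ua.
  by rewrite ys; apply: contra_neq yab => /addrI.
by rewrite hc; apply: row' => //; rewrite yc ys; clear; lia.
Qed.

Definition strip_band z := height3 z \in segment 0 (p1 + p2 + l + 1) (q1 + q2 + r - 1).

(** For [Y z = 0] row 0 and the outer rows are separate components. Both are in use exactly at the
    positions of [strip_band], a segment whose number of points is that of the polygon minus 4. *)
Theorem strip_hdim : hdim (bd k J n) (chains k C) (n - 4) = (n - 4)%N.
Proof.
have le0 : p1 + p2 + l + 1 <= q1 + q2 + r - 1 + 1.
  by have := strip_size; move: n4 left_side right_side i01; clear; lia.
have bandE z : strip_band z = [&& p1 + p2 + l + 1 <= X z, X z <= q1 + q2 + r - 1 & Y z == 0].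
  exact: mem_segment.
have lr' := lr; have i01' := ltW i01.
have at_row (h s e0 e1 : int) : -1 <= h -> h <= 1 -> e0 <= e1 -> row_lo h + e0 <= s -> s <= row_hi h + e1 ->
    exists t, [/\ y t = h, e0 <= s - x t & s - x t <= e1].
  move=> h1 h2 h3 h4 h5; have [c [c1 c2 c3 c4]] := pick_sum (row_le h) h3 h4 h5.
  by have [t tE] := row_pt h1 h2 c1 c2; exists t; rewrite tE.
have S : forall h, i0 + row_lo h <= i1 + row_hi h.
  by move=> h; have := row_le h; move: i01; clear; lia.
have S1 := S 1; have S0 := S 0; have S2 := S (-1); rewrite !row_values in S1 S0 S2.
rewrite (@two_colours (fun j a => (Y (u j) == 0) && (y a == 0)) _ _ strip_band).
- rewrite npts_height3 ?segment_uniq //.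
  by have := size_segment 0 le0; have := strip_size; move: n4; clear; lia.
- move=> j a b _ /strip_edge[e _ _]; move: e; clear; lia.
- by move=> j h E a b; apply: strip_conn.
- move=> j /strip_bounds[y1 y2 [Y2 Y1 Ym1 Ym2] Y0].
  have used (h h' : int) : Y (u j) = h + h' -> -1 <= h -> h <= 1 -> -1 <= h' -> h' <= 1 ->
     row_lo h + (row_lo h' + i0) <= X (u j) -> X (u j) <= row_hi h + (row_hi h' + i1) ->
     exists a, in_icone V 2 (u j - pi a).
    move=> e h1 h2 h3 h4 h5 h6; have [|t [t1 t2 t3]] := at_row h (X (u j)) _ _ h1 h2 _ h5 h6.
      by have := S h'; clear; lia.
    exists t; apply/strip_used; rewrite t1 (_ : Y (u j) - h = h') //.
    by move: e; clear; lia.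
  have [e2|n2] := eqVneq (Y (u j)) 2.
    have /andP[h1 h2] := Y2 e2; apply: (used 1 1) => //; rewrite ?row_values; move: h1 h2; clear; lia.
  have [e1|n1] := eqVneq (Y (u j)) 1.
    have /andP[h1 h2] := Y1 e1; apply: (used 1 0) => //; rewrite ?row_values; move: h1 h2; clear; lia.
  have [e0|n0] := eqVneq (Y (u j)) 0.
    have [H1 H2] := Y0 e0; have [c|c] : (2 * l + i0 <= X (u j) /\ X (u j) <= 2 * r + i1) \/
       (p1 + p2 + i0 <= X (u j) /\ X (u j) <= q1 + q2 + i1).
      by have := strip_size; move: H1 H2 left_side right_side n4 pq1 pq2 i01; clear; lia.
      by apply: (used 0 0) => //; rewrite ?row_values; move: c; clear; lia.
    by apply: (used 1 (-1)) => //; rewrite ?row_values; move: c; clear; lia.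
  have [e3|n3] := eqVneq (Y (u j)) (-1).
    have /andP[h1 h2] := Ym1 e3; apply: (used (-1) 0) => //; rewrite ?row_values; move: h1 h2; clear; lia.
  have e4 : Y (u j) = -2 by move: n0 n1 n2 n3 y1 y2; clear; lia.
  have /andP[h1 h2] := Ym2 e4; apply: (used (-1) (-1)) => //; rewrite ?row_values; move: h1 h2; clear; lia.
- move=> j; rewrite bandE; split=> [/and3P[h1 h2 /eqP h3]|[a [b [ua ub /andP[/eqP Y0 /eqP ya]]]]].
    have [t [t1 t2 t3]] : exists t, [/\ y t = 0, l + i0 <= X (u j) - x t & X (u j) - x t <= r + i1].
      by apply: at_row => //; rewrite ?row_values; move: h1 h2 S0 left_side right_side; clear; lia.
    have [s [s1 s2 s3]] : exists t, [/\ y t = 1, p2 + i0 <= X (u j) - x t & X (u j) - x t <= q2 + i1].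
      by apply: at_row => //; rewrite ?row_values; move: h1 h2 S2 left_side right_side; clear; lia.
    exists t, s; rewrite h3 t1 s1 /=; split=> //; apply/strip_used; rewrite h3 ?t1 ?s1 ?subr0 ?sub0r ?row_values; split=> //.
  have [b1 b2 b3 b4] := pt_row b; have [a1 a2 a3 a4] := pt_row a.
  rewrite Y0 eqxx andTb => yb; move/strip_used: ua => [_ _ ua1 ua2]; move/strip_used: ub => [_ _ ub1 ub2].
  rewrite ya Y0 ?subr0 !row_values in a3 a4 ua1 ua2; rewrite Y0 sub0r in ub1 ub2.
  case: (row_cases b1 b2) => e; rewrite e ?opprK in b3 b4 ub1 ub2 yb; rewrite ?row_values in b3 b4 ub1 ub2; rewrite ?Y0.
  - by move: a3 a4 ua1 ua2 b3 b4 ub1 ub2 left_side right_side; clear; lia.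
  - by rewrite ?eqxx in yb.
  by move: a3 a4 ua1 ua2 b3 b4 ub1 ub2 left_side right_side; clear; lia.
move=> z; rewrite bandE => /and3P[h1 h2 /eqP h3].
have [t [t1 t2 t3]] : exists t, [/\ y t = 0, l + i0 <= X z - x t & X z - x t <= r + i1].
  by apply: at_row => //; rewrite ?row_values; move: h1 h2 S0 left_side right_side; clear; lia.
have /int2P[c cI] : in_icone V 2 (z - pi t) by apply/strip_used; rewrite h3 t1 subr0 !row_values; split.
exact: int3_intro cI.
Qed.
End Strip.

(** * The exceptional triangle *)

Section Upsilon.
Hypothesis ucone : forall z, in_cone V 1 z <-> f z \in upsilon_points.
Hypothesis uicone : forall z, in_icone V 1 z <-> f z \in upsilon_interior.

Lemma upsilon_edge z a b : in_icone V 1 (z - pi a - pi b) <-> u_edge (height3 z) (f (pi a)) (f (pi b)).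
Proof. by rewrite uicone height3_sub /u_edge !psubE. Qed.

Lemma upsilon_pt c : c \in upsilon_points -> exists t, f (pi t) = c.
Proof.
have [z <-] := unimod_surj c; move=> /ucone/pi_full[t <-].
by exists t.
Qed.

Lemma pt_upsilon t : f (pi t) \in upsilon_points.
Proof. exact/ucone/pi_cone. Qed.

Lemma upsilon_used z a : in_icone V 2 (z - pi a) <-> u_used (height3 z) (f (pi a)).
Proof.
rewrite int2P; split=> [[c /upsilon_edge e]|/hasP[c /upsilon_pt[t <-] e]].
  by apply/hasP; exists (f (pi c)) => //; apply: pt_upsilon.
by exists t; apply/upsilon_edge.
Qed.

Lemma upsilon_check z : in_icone V 3 z -> u_region (height3 z) /\ u_check (height3 z).
Proof.
move=> zI; have low (p : int * int) (c : int) : p != 0 -> all (fun a => c <= dot p a) upsilon_points ->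
    3 * c < dot p (height3 z).
  by move=> p0 /allP H; apply: height3_gt => // a /ucone; apply: H.
have reg : u_region (height3 z).
  have := low (-1, -1) (-2) isT isT; have := low (-1, 3) (-2) isT isT; have := low (3, -1) (-2) isT isT.
  rewrite /u_region /dot /=; clear; lia.
split=> //; apply: (allP u_checked); apply: mem_box; move: reg; rewrite /u_region /in_box; clear; lia.
Qed.

Lemma upsilon_conn z (h : 'I_n -> k) :
  (forall a b, a != b -> in_icone V 1 (z - pi a - pi b) -> h a = h b) ->
  forall r a b, b \in iter r (u_grow (height3 z)) [:: f (pi a)] -> exists2 t, f (pi t) = b & h a = h t.
Proof.
move=> E r a; elim: r => [|r IHr] b /=; first by rewrite mem_seq1 => /eqP ->; exists a.
rewrite /u_grow mem_undup mem_cat => /orP[/IHr //|]; rewrite mem_filter => /andP[/hasP[c /IHr[t <- hat] /andP[cb e]] /upsilon_pt[s sb]].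
exists s => //; rewrite hat; apply: E; last by apply/upsilon_edge; rewrite sb.
by apply: contraNneq cb => ->; rewrite sb.
Qed.

Theorem upsilon_hdim : hdim (bd k J n) (chains k C) (n - 4) = 3%N.
Proof.
rewrite (@two_colours (fun j a => u_col (height3 (u j)) (f (pi a))) _ _ (fun z => height3 z \in upsilon_interior)).
- exact: (@npts_height3 upsilon_interior).
- move=> j a b ab e; have /upsilon_check[reg] : in_icone V 3 (u j) by apply: int3_intro e.
  rewrite /u_check reg => /and4P[_ H _ _]; have := allP (allP H _ (pt_upsilon a)) _ (pt_upsilon b).
  move/upsilon_edge: e => ->; rewrite (inj_eq (unimod_inj fU)) (inj_eq pi_inj) ab /=.
  by move/eqP.
- move=> j h E a b ua ub cab.
  have /int2P[c cI] := ua; have /upsilon_check[reg] : in_icone V 3 (u j) by apply: int3_intro cI.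
  rewrite /u_check reg => /and4P[_ _ H _]; have := allP (allP H _ (pt_upsilon a)) _ (pt_upsilon b).
  move/upsilon_used: ua => ->; move/upsilon_used: ub => ->; rewrite cab eqxx => H'.
  have [t te ->] : exists2 t, f (pi t) = f (pi b) & h a = h t by exact: (upsilon_conn (r := 7) E H').
  by congr h; apply/pi_inj/(unimod_inj fU).
- move=> j /upsilon_check[reg]; rewrite /u_check reg => /and4P[/hasP[c /upsilon_pt[t <-] ut] _ _ _].
  by exists t; apply/upsilon_used.
- move=> j; split=> [uT|[a [b [ua ub ca cb]]]].
    have /upsilon_check[reg] : in_icone V 3 (u j).
      have [t te] := upsilon_pt (c := (0, 0)) isT; apply: (@int3_intro _ t t); apply/upsilon_edge.
      by rewrite te /u_edge !psubE !subr0.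
    rewrite /u_check reg => /and4P[_ _ _ /eqP]; rewrite uT => /esym/hasP[a /upsilon_pt[s <-] /andP[/andP[us cs]]].
    move=> /hasP[b /upsilon_pt[t <-] /andP[ut ct]]; exists s, t; split=> //; exact/upsilon_used.
  have /int2P[c cI] := ua; have /upsilon_check[reg] : in_icone V 3 (u j) by apply: int3_intro cI.
  rewrite /u_check reg => /and4P[_ _ _ /eqP ->]; apply/hasP; exists (f (pi a)); first exact: pt_upsilon.
  move/upsilon_used: ua => ->; rewrite ca !andTb; apply/hasP; exists (f (pi b)); first exact: pt_upsilon.
  by move/upsilon_used: ub => ->; rewrite cb.
move=> z uT; have [t te] := upsilon_pt (c := (0, 0)) isT; apply: (@int3_intro _ t t); apply/upsilon_edge.
by rewrite te /u_edge !psubE !subr0.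
Qed.
End Upsilon.
End DualCounting.

(** * Equivalence of polygons through their lattice points *)

Section Equivalence.
Local Open Scope classical_set_scope.
Local Open Scope ring_scope.
Variable R : realType.
Implicit Types (D : set (R * R)) (z : R * R) (p : int * int) (W : seq (int * int)).

Definition extension (a b c d s t : int) z : R * R :=
  (z.1 * a%:~R + z.2 * b%:~R + s%:~R, z.1 * c%:~R + z.2 * d%:~R + t%:~R).

Lemma extension_pt a b c d s t p :
  extension a b c d s t (real_pt R p) = real_pt R (a * p.1 + b * p.2 + s, c * p.1 + d * p.2 + t).
Proof. by rewrite /extension /real_pt /=; congr pair; rewrite !intrD !intrM; ring. Qed.

Lemma extension_inj a b c d s t : (a * d - b * c) * (a * d - b * c) = 1 -> injective (extension a b c d s t).
Proof.
move=> e [x y] [x' y'] [h1 h2].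
have e' : (a%:~R * d%:~R - b%:~R * c%:~R) * (a%:~R * d%:~R - b%:~R * c%:~R) = 1 :> R.
  by rewrite -!intrM -!intrB -!intrM e.
have D0 : (a%:~R * d%:~R - b%:~R * c%:~R) != 0 :> R.
  by apply/eqP => D0; move/eqP: e'; rewrite D0 mul0r eq_sym oner_eq0.
have k1 : (a%:~R * d%:~R - b%:~R * c%:~R) * (x - x') = 0 :> R.
  have -> : (a%:~R * d%:~R - b%:~R * c%:~R) * (x - x') =
    d%:~R * ((x * a%:~R + y * b%:~R + s%:~R) - (x' * a%:~R + y' * b%:~R + s%:~R)) -
    b%:~R * ((x * c%:~R + y * d%:~R + t%:~R) - (x' * c%:~R + y' * d%:~R + t%:~R)) :> R by ring.
  by rewrite h1 h2 !subrr !mulr0 subrr.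
have k2 : (a%:~R * d%:~R - b%:~R * c%:~R) * (y - y') = 0 :> R.
  have -> : (a%:~R * d%:~R - b%:~R * c%:~R) * (y - y') =
    a%:~R * ((x * c%:~R + y * d%:~R + t%:~R) - (x' * c%:~R + y' * d%:~R + t%:~R)) -
    c%:~R * ((x * a%:~R + y * b%:~R + s%:~R) - (x' * a%:~R + y' * b%:~R + s%:~R)) :> R by ring.
  by rewrite h1 h2 !subrr !mulr0 subrr.
move/eqP: k1; move/eqP: k2; rewrite !mulf_eq0 (negPf D0) /= !subr_eq0 => /eqP -> /eqP ->.
by [].
Qed.

Lemma int_unit_sqr (x y : int) : x * y = 1 -> x * x = 1.
Proof.
move=> e; have : (absz x * absz y)%N = 1%N by rewrite -abszM e.
move/eqP; rewrite muln_eq1 => /andP[/eqP h _].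
by have [->|->] : x = 1 \/ x = -1 by move: h; clear; lia.
Qed.

Lemma polygon_equivE D D' : polygon_equiv D D' <-> exists a b c d s t : int,
  (a * d - b * c) * (a * d - b * c) = 1 /\ D' = extension a b c d s t @` D.
Proof.
split=> [[A [t [Au ->]]]|[a [b [c [d [s [t [e ->]]]]]]]].
  exists (A 0 0), (A 1 0), (A 0 1), (A 1 1), t.1, t.2; split=> //.
  have ent i j : (A *m invmx A) i j = (i == j)%:R by rewrite mulmxV // mxE.
  pose B := invmx A; apply: (@int_unit_sqr _ (B 0 0 * B 1 1 - B 1 0 * B 0 1)).
  have := ent 0 0; have := ent 0 1; have := ent 1 0; have := ent 1 1.
  rewrite !mxE !big_ord_recl !big_ord0 -/B /= !addr0.
  have -> : lift ord0 ord0 = 1 :> 'I_2 by apply/val_inj.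
  have -> : ord0 = 0 :> 'I_2 by apply/val_inj.
  move=> h11 h10 h01 h00.
  transitivity ((A 0 0 * B 0 0 + A 0 1 * B 1 0) * (A 1 0 * B 0 1 + A 1 1 * B 1 1) -
    (A 0 0 * B 0 1 + A 0 1 * B 1 1) * (A 1 0 * B 0 0 + A 1 1 * B 1 0)); first by ring.
  by rewrite h00 h11 h01 h10.
pose M (x y z w : int) : 'M[int]_2 := \matrix_(i, j) if i == 0 then (if j == 0 then x else y) else (if j == 0 then z else w).
exists (M a c b d), (s, t); split; last first.
  have -> : extension a b c d s t = affine_map (M a c b d) (s, t); last by [].
  by apply/funext => z; rewrite /affine_map /extension !mxE.
have D0 : a * d - b * c = 1 \/ a * d - b * c = -1.
  have := congr1 absz e; rewrite abszM => /eqP; rewrite muln_eq1 andbb => /eqP h; move: h; clear; lia.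
pose q := a * d - b * c.
have [] // := @mulmx1_unit _ 2 (M a c b d) (M (q * d) (- q * c) (- q * b) (q * a)).
apply/matrixP => i j; rewrite !mxE !big_ord_recl !big_ord0 !mxE /= addr0.
have e1 : q * q = 1 by exact: e.
case: i => [[|[|//]] ?] /=; case: j => [[|[|//]] ?] /=.
- by rewrite -[RHS]e1 /q; ring.
- by rewrite /q; ring.
- by rewrite /q; ring.
by rewrite -[RHS]e1 /q; ring.
Qed.

Lemma sub_lattice_hull W p : p \in W -> lattice_hull W (real_pt R p).
Proof. by move=> pW; apply: sub_hull; exists p. Qed.

(** A lattice polygon is the hull of its lattice points, so an affine map that matches the lattice
    points matches the polygons. *)
Lemma equiv_points W W' : polygon_equiv (@lattice_hull R W) (@lattice_hull R W') <->
  exists f, unimod f /\ forall p, lattice_points (@lattice_hull R W') (f p) <-> lattice_points (@lattice_hull R W) p.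
Proof.
rewrite polygon_equivE; split=> [[a [b [c [d [s [t [e E]]]]]]]|[f [fU fP]]].
  exists (fun p => (a * p.1 + b * p.2 + s, c * p.1 + d * p.2 + t)); split.
    by exists a, b, c, d, s, t.
  move=> p; rewrite /lattice_points /= -extension_pt E; split=> [[z Dz /(extension_inj e) <-] //|Dp].
  by exists (real_pt R p).
have [g [gU fg gf]] := unimod_inv fU.
case: (fU) => a [b [c [d [s [t [e fE]]]]]]; exists a, b, c, d, s, t; split=> //.
have fpt p : extension a b c d s t (real_pt R p) = real_pt R (f p) by rewrite extension_pt fE.
apply/seteqP; split.
  apply: hull_sub.
    move=> _ [p /= pW' <-]; exists (real_pt R (g p)); last by rewrite fpt gf.
    by apply/(fP (g p)); rewrite gf; apply: sub_lattice_hull.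
  apply/convex_setP => _ _ u [x Dx <-] [y Dy <-] u0 u1.
  exists (u * x.1 + (1 - u) * y.1, u * x.2 + (1 - u) * y.2); first exact: hull_convex.
  by rewrite /extension /=; congr pair; ring.
move=> _ [z Dz <-]; move: z Dz; apply: hull_sub.
  by move=> _ [p /= pW <-] /=; rewrite fpt; apply/(fP p); apply: sub_lattice_hull.
apply/convex_setP => x y u Dx Dy u0 u1 /=.
have -> : extension a b c d s t (u * x.1 + (1 - u) * y.1, u * x.2 + (1 - u) * y.2) =
  (u * (extension a b c d s t x).1 + (1 - u) * (extension a b c d s t y).1,
   u * (extension a b c d s t x).2 + (1 - u) * (extension a b c d s t y).2).
  by rewrite /extension /=; congr pair; ring.
exact: hull_convex.
Qed.

Lemma hull_halfplane W p q (c : int) : all (fun a => 0 <= dot p a + c) W ->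
  lattice_hull W (real_pt R q) -> 0 <= dot p q + c.
Proof.
move=> /allP H Wq.
have : [set z | 0 <= dot (real_pt R p) z + c%:~R] (real_pt R q).
  move: Wq; apply: hull_sub; last exact: halfplane_convex.
  by move=> _ [a /= aW <-] /=; rewrite real_pt_dot -intrD ler0z H.
by rewrite /= real_pt_dot -intrD ler0z.
Qed.

Lemma hull_tri W a b c (x y w : nat) p : a \in W -> b \in W -> c \in W -> (0 < x + y + w)%N ->
  (x + y + w)%:Z * p.1 = x%:Z * a.1 + y%:Z * b.1 + w%:Z * c.1 ->
  (x + y + w)%:Z * p.2 = x%:Z * a.2 + y%:Z * b.2 + w%:Z * c.2 -> lattice_hull W (real_pt R p).
Proof.
move=> aW bW cW s0 e1 e2.
apply: (@hull3 _ _ (real_pt R a) (real_pt R b) (real_pt R c) x%:R y%:R w%:R); rewrite ?ler0n //.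
- exact: sub_lattice_hull.
- exact: sub_lattice_hull.
- exact: sub_lattice_hull.
- by rewrite -!natrD ltr0n.
- by have := congr1 (fun i : int => i%:~R : R) e1; rewrite /real_pt /= !intrD !intrM !PoszD !intrD.
by have := congr1 (fun i : int => i%:~R : R) e2; rewrite /real_pt /= !intrD !intrM !PoszD !intrD.
Qed.

Lemma upsilon_lattice p : lattice_points (Upsilon2 R) p <-> p \in upsilon_points.
Proof.
split=> [H|].
  have := hull_halfplane (W := [:: (-1, -1); (2, 0); (0, 2)]) (p := (-1, -1)) (c := 2) isT H.
  have := hull_halfplane (W := [:: (-1, -1); (2, 0); (0, 2)]) (p := (-1, 3)) (c := 2) isT H.
  have := hull_halfplane (W := [:: (-1, -1); (2, 0); (0, 2)]) (p := (3, -1)) (c := 2) isT H.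
  by case: p {H} => x y; rewrite /upsilon_points !inE !xpair_eqE /dot /=; clear; lia.
rewrite /upsilon_points !inE => /or4P[|||/or4P[]] /eqP ->.
- by apply: (@hull_tri _ (-1, -1) (2, 0) (0, 2) 1 0 0).
- by apply: (@hull_tri _ (-1, -1) (2, 0) (0, 2) 2 1 1).
- by apply: (@hull_tri _ (-1, -1) (2, 0) (0, 2) 2 5 1).
- by apply: (@hull_tri _ (-1, -1) (2, 0) (0, 2) 0 1 0).
- by apply: (@hull_tri _ (-1, -1) (2, 0) (0, 2) 2 1 5).
- by apply: (@hull_tri _ (-1, -1) (2, 0) (0, 2) 0 1 1).
by apply: (@hull_tri _ (-1, -1) (2, 0) (0, 2) 0 0 1).
Qed.

Lemma sigma_lattice p : lattice_points (Sigma R) p <-> p \in upsilon_interior.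
Proof.
split=> [H|].
  have := hull_halfplane (W := [:: (0, 0); (1, 0); (0, 1)]) (p := (1, 0)) (c := 0) isT H.
  have := hull_halfplane (W := [:: (0, 0); (1, 0); (0, 1)]) (p := (0, 1)) (c := 0) isT H.
  have := hull_halfplane (W := [:: (0, 0); (1, 0); (0, 1)]) (p := (-1, -1)) (c := 1) isT H.
  by case: p {H} => x y; rewrite /upsilon_interior !inE !xpair_eqE /dot /=; clear; lia.
by move=> pT; apply: sub_lattice_hull.
Qed.
End Equivalence.

(** * The full set of lattice points of a polygon *)

Section FullPolygon.
Variables (n m : nat) (pi : 'I_n -> int * int) (V : 'I_m -> int * int).
Variable v : 'I_m -> 'I_n.
Hypothesis cvx : convex_cycle V.
Hypothesis pi_inj : injective pi.
Hypothesis pi_cone : forall t, in_cone V 1 (pi t).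
Hypothesis pi_full : forall z, in_cone V 1 z -> exists t, pi t = z.
Hypothesis vP : forall i, pi (v i) = V i.
Local Notation full := [set: 'I_n].

Lemma edge_below i : below pi full (edge_normal V i) (- edge_const V i).
Proof. by move=> t _; have /forallP/(_ i) := pi_cone t; rewrite edge_pt; clear; lia. Qed.

Lemma full_hull z : in_hull pi full z -> in_cone V 1 z.
Proof. by move=> H; apply/forallP => i; have := H _ _ (@edge_below i); rewrite edge_pt; clear; lia. Qed.

Lemma full_convex : lattice_convex pi full.
Proof. by move=> z /full_hull/pi_full[t <-]; exists t; rewrite ?inE. Qed.

Lemma full_int z : in_int pi full z <-> in_icone V 1 z.
Proof.
split=> [H|H p c p0 cB].
  apply/forallP => i; have := H _ _ (edge_normal_neq0 i cvx) (@edge_below i).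
  by rewrite edge_pt; clear; lia.
by apply: (cycle_gt cvx p0 _ H) => j; rewrite subr_ge0 -vP; apply: cB; rewrite inE.
Qed.

(** Every polygon contains a unimodular triangle: a piece of lattice length 1 of an edge, and a
    point at height 1 over it found by [slice]. With at most three points there is nothing else. *)
Lemma small_polygon : (n <= 3)%N -> exists f, unimod f /\
  forall p, f p \in upsilon_interior <-> in_cone V 1 p.
Proof.
move=> n3; pose i := Ordinal (ltn_trans (isT : (0 < 2)%N) cvx.1).
have [|f [g [fU g0 fa fb height0]]] := @edge_coordinates (V i) (V (ordS i)).
  by apply/negP => /eqP/(vertex_inj cvx)/eqP; rewrite eq_sym (negPf (ordS_neq cvx i)).
have height z : edge V i 1 z = g * (f z).2 by rewrite -height0 /edge !mul1r.
have [h [hU fh hf]] := unimod_inv fU.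
have VC j : in_hull pi full (V j) by rewrite -vP; apply: mem_hull; rewrite inE.
have VF j : in_hull (fun t => f (pi t)) full (f (V j)) by rewrite -vP; apply: (@mem_hull _ (fun t => f (pi t))); rewrite inE.
have cF := convex_map fU full_convex.
have f0 : in_hull (fun t => f (pi t)) full (0, 0) by rewrite -fa; apply: VF.
have fg : in_hull (fun t => f (pi t)) full (g, 0) by rewrite -fb; apply: VF.
have f1 : in_hull (fun t => f (pi t)) full (1, 0).
  apply: (hull_comb (al := g - 1) (be := 1) (ga := 0) _ _ _ _ f0 fg f0) => //=; move: (g) g0; clear; lia.
pose b := V (ordS (ordS i)).
have hb : 0 < (f b).2.
  rewrite -(pmulr_rgt0 _ g0) -height; apply: cvx.2; [exact: (ordSS_neq cvx i)|exact: (ordS_neq cvx (ordS i))].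
have fb' : in_hull (fun t => f (pi t)) full (f b) by apply: VF.
move: (f b) hb fb' => [xb yb] /= hb fb'.
have [s1 [c [s10 s11 ce]]] := slice xb 0 hb.
have fc : in_hull (fun t => f (pi t)) full (c, 1).
  have a3 : 0 < 1 + (yb - 1 - s1) + s1 :> int by move: s11 s10; clear; lia.
  have E1 : (1 + (yb - 1 - s1) + s1) * c = 1 * xb + (yb - 1 - s1) * 0 + s1 * 1 :> int.
    transitivity ((yb - 1 - s1 + s1 + 1) * c); first by ring.
    by rewrite ce; ring.
  have E2 : (1 + (yb - 1 - s1) + s1) * 1 = 1 * yb + (yb - 1 - s1) * 0 + s1 * 0 :> int by ring.
  exact: (@hull_comb _ _ full 1 (yb - 1 - s1) s1 (xb, yb) (0, 0) (1, 0) (c, 1) isT s11 s10 a3 fb' f0 f1 E1 E2).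
pose sh (z : int * int) := (z.1 - c * z.2, z.2).
have shU : unimod sh by exists 1, (- c), 0, 1, 0, 0; split; [ring|move=> z; rewrite /sh; congr pair; ring].
have [t0 _ t0e] := cF _ f0; have [t1 _ t1e] := cF _ f1; have [t2 _ t2e] := cF _ fc.
exists (fun z => sh (f z)); split; first exact: unimod_comp.
have n01 : t0 != t1 by apply/eqP => e; have := congr1 fst t1e; rewrite -e t0e /=; clear; lia.
have n02 : t0 != t2 by apply/eqP => e; have := congr1 snd t2e; rewrite -e t0e /=; clear; lia.
have n12 : t1 != t2 by apply/eqP => e; have := congr1 snd t2e; rewrite -e t1e /=; clear; lia.
have uT : uniq [:: t0; t1; t2] by rewrite /= !inE !negb_or n01 n02 n12.
have all t : t \in [:: t0; t1; t2].
  have sz : (size (enum 'I_n) <= size [:: t0; t1; t2])%N by rewrite size_enum_ord.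
  have sub : {subset [:: t0; t1; t2] <= enum 'I_n} by move=> x _; rewrite mem_enum.
  by have [_ ->] := uniq_min_size uT sub sz; rewrite mem_enum.
have shK p : sh (f p) = sh (f (pi t0)) \/ sh (f p) = sh (f (pi t1)) \/ sh (f p) = sh (f (pi t2)) -> in_cone V 1 p.
  by case=> [|[]] /(unimod_inj shU)/(unimod_inj fU) ->; apply: pi_cone.
have v0 : sh (f (pi t0)) = (0, 0) by rewrite t0e /sh /=; congr pair; ring.
have v1 : sh (f (pi t1)) = (1, 0) by rewrite t1e /sh /=; congr pair; ring.
have v2 : sh (f (pi t2)) = (0, 1) by rewrite t2e /sh /=; congr pair; ring.
move=> p; split.
  rewrite !inE => /or3P[] /eqP e; apply: shK; rewrite v0 v1 v2; tauto.
by move=> /pi_full[t <-]; have := all t; rewrite !inE => /or3P[] /eqP ->; rewrite ?v0 ?v1 ?v2.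
Qed.
End FullPolygon.

(** * Rows of a polygon with collinear interior points *)

Section Rows.
Variables (n : nat) (F : 'I_n -> int * int).
Local Notation full := [set: 'I_n].
Local Notation inC := (in_hull F full).
Local Notation inI := (in_int F full).
Hypothesis cF : lattice_convex F full.

Lemma row_ends (h : int) : (exists x, inC (x, h)) -> exists lo hi : int, lo <= hi /\
  forall x, inC (x, h) <-> lo <= x /\ x <= hi.
Proof.
move=> [x0 /cF[t0 _ t0e]]; pose U := [set t | (F t).2 == h].
have U0 : U != finset.set0 by apply/set0Pn; exists t0; rewrite inE t0e.
have [a] := @argmin_set _ (fun t => (F t).1) U U0; rewrite inE => /eqP ah amin.
have [b] := @argmin_set _ (fun t => - (F t).1) U U0; rewrite inE => /eqP bh bmin.
have bU : b \in U by rewrite inE bh.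
exists (F a).1, (F b).1; split; first exact: amin.
move=> x; split=> [/cF[t _ te]|[h1 h2]].
  have tU : t \in U by rewrite inE te.
  by have := amin _ tU; have := bmin _ tU; rewrite te /= lerN2.
have aC : inC (F a) by apply: mem_hull; rewrite inE.
have bC : inC (F b) by apply: mem_hull; rewrite inE.
have [e|ne] := eqVneq (F a).1 (F b).1.
  have -> : x = (F a).1 by move: e h1 h2; clear; lia.
  by rewrite -ah -surjective_pairing.
have lt : (F a).1 < (F b).1 by rewrite lt_neqAle ne amin.
have a1 : 0 <= (F b).1 - x by rewrite subr_ge0.
have a2 : 0 <= x - (F a).1 by rewrite subr_ge0.
have a3 : 0 < (F b).1 - x + (x - (F a).1) + 0 by rewrite addr0 addrA subrK subr_gt0.
by apply: (hull_comb a1 a2 (lexx 0) a3 aC bC bC); rewrite /= ?ah ?bh; ring.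
Qed.

Variables p1 q1 p2 q2 l r i0 i1 : int.
Hypothesis rows : forall p, inC p -> -1 <= p.2 /\ p.2 <= 1.
Hypothesis row1 : forall x, inC (x, 1) <-> p1 <= x /\ x <= q1.
Hypothesis row0 : forall x, inC (x, 0) <-> l <= x /\ x <= r.
Hypothesis row2 : forall x, inC (x, -1) <-> p2 <= x /\ x <= q2.
Hypothesis ints : forall x, inI (x, 0) <-> i0 <= x /\ x <= i1.
Hypothesis i01 : i0 < i1.
Hypothesis pq1 : p1 <= q1.
Hypothesis pq2 : p2 <= q2.

(** The segment joining the left ends of the outer rows crosses row 0 at [(p1 + p2) / 2]. If this is
    left of [l], it is so by exactly half a unit, as no lattice point lies between, and [(l, 0)] is
    interior; otherwise [(l, 0)] is a boundary point. *)
Lemma left_dichotomy : (i0 = l + 1 /\ 2 * l <= p1 + p2) \/ (i0 = l /\ p1 + p2 = 2 * l - 1).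
Proof.
have I0 : inI (i0, 0) by apply/ints; split; [exact: lexx|exact: ltW].
have /row0[l0 r0] := int_hull I0.
have C0 : inC (l, 0) by apply/row0; split; [exact: lexx|exact: le_trans r0].
have C1 : inC (p1, 1) by apply/row1; split.
have C2 : inC (p2, -1) by apply/row2; split.
have le1 : i0 <= l + 1.
  rewrite leNgt; apply/negP => lt; have a1 : 0 <= i0 - l - 1 by move: lt; clear; lia.
  have a3 : 0 < (1 : int) + 0 by [].
  have /ints[h _] : inI (l + 1, 0).
    by apply: (int_comb (al := 1) (be := 0) (ga := i0 - l - 1) _ _ a1 a3 I0 I0 C0) => //=; ring.
  by move: h lt; clear; lia.
have ge1 : 2 * l - 1 <= p1 + p2.
  rewrite leNgt; apply/negP => lt; have a1 : 0 <= 2 * l - 2 - (p1 + p2) by move: lt; clear; lia.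
  have a3 : 0 < 1 + 1 + (2 * l - 2 - (p1 + p2)) by move: a1; clear; lia.
  have /row0[h _] : inC (l - 1, 0).
    by apply: (hull_comb (al := 1) (be := 1) (ga := 2 * l - 2 - (p1 + p2)) _ _ a1 a3 C1 C2 C0) => //=; ring.
  by move: h; clear; lia.
have [e|ne] := eqVneq (p1 + p2) (2 * l - 1); [right|left].
  split=> //; suff /ints[h _] : inI (l, 0) by move: h l0; clear; lia.
  move=> p m p0 mB; have h0 := I0 _ _ p0 mB; have h1 := C1 _ _ mB; have h2 := C2 _ _ mB; have h3 := C0 _ _ mB.
  have [e0|e0] : i0 = l \/ i0 = l + 1 by move: l0 le1; clear; lia.
    by rewrite -e0.
  have e1 : p1 = 2 * l - 1 - p2 by move: e; clear; lia.
  by move: h0 h1 h2; rewrite e0 e1 /dot /=; clear; lia.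
have ge2 : 2 * l <= p1 + p2 by move/eqP: ne => ne; move: ne ge1; clear; lia.
split=> //; have [e0|//] : i0 = l \/ i0 = l + 1 by move: l0 le1; clear; lia.
have := I0 (1, l - p1) l isT; rewrite e0 /dot /= => H; exfalso.
suff : l < 1 * l + (l - p1) * 0 by clear; lia.
apply: H => t _; have tC : inC (F t) by apply: mem_hull; rewrite inE.
have [h1 h2] := rows tC; move: tC h1 h2; case: (F t) => x y /= tC h1 h2.
case: (row_cases h1 h2) => ye; rewrite ye in tC *.
- by have /row2[] := tC; rewrite /dot /=; move: ge2; clear; lia.
- by have /row0[] := tC; rewrite /dot /=; clear; lia.
by have /row1[] := tC; rewrite /dot /=; clear; lia.
Qed.
End Rows.

Section StripCase.
Variables (k : fieldType) (n m : nat) (pi : 'I_n -> int * int) (V : 'I_m -> int * int).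
Variable v : 'I_m -> 'I_n.
Hypothesis cvx : convex_cycle V.
Hypothesis pi_inj : injective pi.
Hypothesis pi_cone : forall t, in_cone V 1 (pi t).
Hypothesis pi_full : forall z, in_cone V 1 z -> exists t, pi t = z.
Hypothesis vP : forall i, pi (v i) = V i.
Hypothesis n4 : (4 <= n)%N.
Variables (J : finType) (w : J -> int * int).
Hypothesis w_inj : injective w.
Local Notation q := ((n - 3)%N%:Z).
Hypothesis w_cover : forall (T : {set 'I_n}) z,
  in_icone V ((#|T|)%:Z - q) ((\sum_(t in T) pi t) - z) -> exists j, w j = z.
Local Notation C := (cone_cell pi V [set: 'I_n] w q).
Local Notation full := [set: 'I_n].

Variables a b : int * int.
Hypothesis aI : in_icone V 1 a.
Hypothesis bI : in_icone V 1 b.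
Hypothesis ab : a != b.
Hypothesis coll : forall c, in_icone V 1 c -> det2 (b - a) (c - a) = 0.

(** The line of interior points becomes row 0; points beyond rows -1 and 1 would, by [slice], create
    interior points off that line. The right side is the left side of the reflected polygon. *)
Theorem strip_case : hdim (bd k J n) (chains k C) (n - 4) = (n - 4)%N.
Proof.
have [f [g [fU g0 fa fb height0]]] := edge_coordinates ab.
have [h [hU fh hf]] := unimod_inv fU.
pose F t := f (pi t); have cF : lattice_convex F full := convex_map fU (full_convex pi_cone pi_full).
have FI z : in_int F full (f z) <-> in_icone V 1 z.
  by rewrite /F (int_map pi fU) (full_int cvx pi_cone vP).
have FC z : in_hull F full (f z) <-> in_cone V 1 z.
  split=> [/(hull_map fU)/(full_hull pi_cone) //|/pi_full[t <-]].
  by apply: (@mem_hull _ F); rewrite inE.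
have flat p : in_int F full p -> p.2 = 0.
  rewrite -(hf p) => /FI/coll; rewrite height0 => /eqP; rewrite mulf_eq0 (gt_eqF g0) /= => /eqP.
  by [].
have I0 : in_int F full (0, 0) by rewrite -fa; apply/FI.
have Ig : in_int F full (g, 0) by rewrite -fb; apply/FI.
have I1 : in_int F full (1, 0).
  have a1 : 0 <= g - 1 by move: (g) g0; clear; lia.
  have a3 : 0 < g - 1 + 1 by rewrite subrK.
  by apply: (int_comb (al := g - 1) (be := 1) (ga := 0) a1 _ _ a3 I0 Ig (int_hull I0)) => //=; ring.
have rows p : in_hull F full p -> -1 <= p.2 /\ p.2 <= 1.
  move=> pC; have key e (y : int) : p.2 = e * y -> e * e = 1 -> 1 < y -> False.
    move=> pe ee y1; have [s [c [s0 s1 ce]]] := slice p.1 0 (lt_trans ltr01 y1).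
    have a3 : 0 < y - 1 - s + s by move: y1; clear; lia.
    have /flat : in_int F full (c, e).
      apply: (int_comb (al := y - 1 - s) (be := s) (ga := 1) s1 s0 _ a3 I0 I1 pC) => //=.
      by rewrite pe; ring.
    by move=> /= e0; move: ee; rewrite e0 mul0r.
  split; rewrite leNgt; apply/negP => lt.
    by apply: (key (-1) (- p.2)); [ring| |move: lt; clear; lia].
  by apply: (key 1 p.2); [ring| |].
have [t1 _ t1y] := int_out (p := (0, -1)) I0 isT; have [t2 _ t2y] := int_out (p := (0, 1)) I0 isT.
have tC t : in_hull F full (F t) by apply: mem_hull; rewrite inE.
have [p1 [q1 [pq1 row1]]] : exists lo hi : int, lo <= hi /\ forall x, in_hull F full (x, 1) <-> lo <= x /\ x <= hi.
  apply: row_ends => //; exists (F t1).1; have := tC t1; have [_] := rows _ (tC t1).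
  by move: t1y; rewrite /dot /=; case: (F t1) => x y /= y1 y2; have -> : y = 1 by move: y1 y2; clear; lia.
have [p2 [q2 [pq2 row2]]] : exists lo hi : int, lo <= hi /\ forall x, in_hull F full (x, -1) <-> lo <= x /\ x <= hi.
  apply: row_ends => //; exists (F t2).1; have := tC t2; have [] := rows _ (tC t2).
  by move: t2y; rewrite /dot /=; case: (F t2) => x y /= y1 y2; have -> : y = -1 by move: y1 y2; clear; lia.
have [l [r [lr0 row0]]] : exists lo hi : int, lo <= hi /\ forall x, in_hull F full (x, 0) <-> lo <= x /\ x <= hi.
  by apply: row_ends => //; exists 0; apply: int_hull.
pose U := [set t | in_icone V 1 (pi t)].
have UP t : t \in U <-> in_int F full (F t) by rewrite inE -FI.
have [ta _ tae] := cF _ (int_hull I0); have [tb _ tbe] := cF _ (int_hull I1).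
have taU : ta \in U by apply/UP; rewrite tae.
have tbU : tb \in U by apply/UP; rewrite tbe.
have U0 : U != finset.set0 by apply/set0Pn; exists ta.
have [c cU cmin] := @argmin_set _ (fun t => (F t).1) U U0.
have [d dU dmin] := @argmin_set _ (fun t => - (F t).1) U U0.
have /UP cI := cU; have /UP dI := dU.
have i01 : (F c).1 < (F d).1.
  by have := cmin _ taU; have := dmin _ tbU; rewrite tae tbe /=; clear; lia.
have ints x : in_int F full (x, 0) <-> (F c).1 <= x /\ x <= (F d).1.
  split=> [xI|[h1 h2]].
    have [t _ te] := cF _ (int_hull xI); have tU : t \in U by apply/UP; rewrite te.
    by have := cmin _ tU; have := dmin _ tU; rewrite te /= lerN2.
  have a1 : 0 <= (F d).1 - x by rewrite subr_ge0.
  have a2 : 0 <= x - (F c).1 by rewrite subr_ge0.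
  have a3 : 0 < (F d).1 - x + (x - (F c).1) by rewrite addrA subrK subr_gt0.
  by apply: (int_comb (ga := 0) a1 a2 _ a3 cI dI (int_hull I0)) => //=; rewrite ?(flat _ cI) ?(flat _ dI); ring.
have L := left_dichotomy rows row1 row0 row2 ints i01 pq1 pq2.
pose sg (z : int * int) := (- z.1, z.2).
have sgU : unimod sg by exists (-1), 0, 0, 1, 0, 0; split=> // -[x y]; rewrite /sg; congr pair => /=; ring.
have sgK z : sg (sg z) = z by case: z => x y; rewrite /sg /= opprK.
have cG := convex_map sgU cF.
have GC z : in_hull (fun t => sg (F t)) full z <-> in_hull F full (sg z).
  split=> [H|/cF[t _ te]]; first by apply: (hull_map sgU); rewrite sgK.
  by rewrite -(sgK z) -te; apply: (@mem_hull _ (fun t => sg (F t))); rewrite inE.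
have GI z : in_int (fun t => sg (F t)) full z <-> in_int F full (sg z) by rewrite -{1}(sgK z) (int_map F sgU).
have neg (x y : int) (P : int -> Prop) : (P (- x) <-> y <= - x /\ - x <= y) -> True by [].
have Rr : (- (F d).1 = - r + 1 /\ 2 * - r <= - q1 + - q2) \/ (- (F d).1 = - r /\ - q1 + - q2 = 2 * - r - 1).
  apply: (@left_dichotomy _ (fun t => sg (F t)) (- q1) (- p1) (- q2) (- p2) (- r) (- l) (- (F d).1) (- (F c).1)).
  - by move=> p /GC/rows.
  - by move=> x; rewrite GC /sg /= row1; split=> -[h1 h2]; split; move: h1 h2; clear; lia.
  - by move=> x; rewrite GC /sg /= row0; split=> -[h1 h2]; split; move: h1 h2; clear; lia.
  - by move=> x; rewrite GC /sg /= row2; split=> -[h1 h2]; split; move: h1 h2; clear; lia.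
  - by move=> x; rewrite GI /sg /= ints; split=> -[h1 h2]; split; move: h1 h2; clear; lia.
  - by rewrite ltrN2.
  - by rewrite lerN2.
  by rewrite lerN2.
apply: (@strip_hdim k n m pi V v cvx pi_inj pi_cone pi_full vP n4 J w w_inj w_cover f fU a aI
  p1 q1 p2 q2 l r (F c).1 (F d).1) => //.
- move=> z; rewrite -FC [f z]surjective_pairing; split=> [H|[h1 h2]].
    have [h1 h2] := rows _ H; rewrite /= in h1 h2 *; split=> //; move: H;
      by case: (row_cases h1 h2) => ->; rewrite ?(row0, row1, row2) /row_lo /row_hi /= => -[].
  rewrite /= in h1 h2 *; case: (row_cases h1 h2) => ->; rewrite /row_lo /row_hi /= => h3 h4.
  - exact/row2.
  - exact/row0.
  exact/row1.
- move=> z; rewrite -FI; split=> [H|[h1 h2 h3]].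
    have f2 := flat _ H; move: H; rewrite [f z]surjective_pairing f2 => /ints[h1 h2].
    by split.
  by rewrite [f z]surjective_pairing h1; apply/ints.
by case: Rr => -[e1 e2]; [left|right]; split; move: e1 e2; clear; lia.
Qed.
End StripCase.

(** * Betti numbers and lattice point counts *)

Section Numerics.
Variables (k : fieldType) (n m : nat) (pi : 'I_n -> int * int) (V : 'I_m -> int * int).
Variable v : 'I_m -> 'I_n.
Hypothesis char0 : [pchar k]%R =i pred0.
Hypothesis cvx : convex_cycle V.
Hypothesis pi_inj : injective pi.
Hypothesis pi_cone : forall t, in_cone V 1 (pi t).
Hypothesis pi_full : forall z, in_cone V 1 z -> exists t, pi t = z.
Hypothesis vP : forall i, pi (v i) = V i.
Hypothesis n4 : (4 <= n)%N.
Local Notation full := [set: 'I_n].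
Local Notation q := ((n - 3)%N%:Z).

Lemma cone_add h h' z z' : in_cone V h z -> in_cone V h' z' -> in_cone V (h + h') (z + z').
Proof.
by move=> /forallP H /forallP H'; apply/forallP => i; rewrite edgeD addr_ge0.
Qed.

Lemma cone_zero : in_cone V 0 0.
Proof. by apply/forallP => i; rewrite edge0. Qed.

(** Normality of the polygon in terms of monomials: [cone_sub_point] splits off one variable at a
    time. *)
Lemma cone_weight (d : nat) z : in_cone V d%:Z z <-> exists mm : multinom n, mdeg mm = d /\ weight pi mm = z.
Proof.
split=> [|[mm [<- <-]]]; last first.
  rewrite mdegE /weight; apply: (big_ind2 (fun (h : nat) (y : int * int) => in_cone V h%:Z y)).
  - exact: cone_zero.
  - by move=> h y h' y' H H'; rewrite PoszD; apply: cone_add.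
  move=> t _; elim: (mm t) => [|e IHe]; first by rewrite mulr0n; apply: cone_zero.
  by rewrite mulrS -add1n PoszD; apply: cone_add.
elim: d z => [|d IHd] z zC.
  have [_ /(_ erefl) ->] := cone_height cvx zC; exists mnm0; rewrite mdeg0; split=> //.
  by rewrite /weight big1 // => i _; rewrite mnm0E.
have [|a /pi_full[t <-]] := cone_sub_point cvx _ zC; first by [].
have -> : d.+1%:Z - 1 = d%:Z by clear; lia.
move=> /IHd[mm [md mw]]; exists (mnm_add (mnm1 t) mm); rewrite mdegD mdeg1 md weightD weight1 mw; split=> //.
by rewrite addrC subrK.
Qed.

(** A box for all weights that occur: such a weight is a sum of at most [n] points minus a cone
    point of height at most [n], whence the factor 2. *)
Let K : int := Vbound V * (2 * n)%N%:Z.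
Let J : finType := seq_sub (box K).
Let w : J -> int * int := @ssval _ (box K).
Local Notation C := (cone_cell pi V full w q).

Lemma J_inj : injective w.
Proof. exact: val_inj. Qed.

Lemma Vbound_ge0 : 0 <= Vbound V.
Proof. by rewrite /Vbound sumr_ge0 // => i _; rewrite addr_ge0. Qed.

Lemma J_cover z : in_box K z -> exists j, w j = z.
Proof. by move=> /mem_box zK; exists (SeqSub zK). Qed.

Lemma cone_box (h : int) z : `|h| <= (2 * n)%N%:Z -> in_cone V h z -> in_box K z.
Proof.
move=> hn /(cone_in_box cvx)/andP[h1 h2]; have H := ler_wpM2l Vbound_ge0 hn.
by apply/andP; split; [apply: le_trans h1 H|apply: le_trans h2 H].
Qed.

Lemma sum_cone (T : {set 'I_n}) : in_cone V (#|T|)%:Z (\sum_(t in T) pi t).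
Proof.
rewrite -sum1_card; apply: (big_ind2 (fun (h : nat) (y : int * int) => in_cone V h%:Z y)) => //.
- exact: cone_zero.
- by move=> h y h' y' H H'; rewrite PoszD; apply: cone_add.
Qed.

Lemma w_cover (T : {set 'I_n}) z :
  in_icone V ((#|T|)%:Z - q) ((\sum_(t in T) pi t) - z) -> exists j, w j = z.
Proof.
move=> /icone_cone zC; apply: J_cover; have Tn : (#|T| <= n)%N by rewrite -[X in (_ <= X)%N]card_ord max_card.
have h1 : `|(#|T|)%:Z| <= n%:Z by move: Tn; clear; lia.
have h2 : `|(#|T|)%:Z - q| <= n%:Z by move: Tn; clear; lia.
have /andP[a1 a2] := cone_in_box cvx (sum_cone T); have /andP[b1 b2] := cone_in_box cvx zC.
have H1 := ler_wpM2l Vbound_ge0 h1; have H2 := ler_wpM2l Vbound_ge0 h2.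
have KE : K = Vbound V * n%:Z + Vbound V * n%:Z by rewrite /K PoszM; ring.
rewrite /in_box KE; move: a1 a2 b1 b2 H1 H2 => /=; move: (Vbound V * `|(#|T|)%:Z|) (Vbound V * `|_ - q|) (Vbound V * n%:Z) => A B D.
by case: (\sum_(t in T) pi t) z {zC} => x y [x' y'] /=; clear; lia.
Qed.

Section Betti.
Variables (I : set (mpoly n k)) (F : min_graded_free_resolution I).
Hypothesis I_fibre : forall x : mpoly n k, I x <-> forall d z, fibre pi d z x = 0.

Lemma betti_cells p : betti F p (n - 3)%N = hdim (bd k J n) (chains k C) p.
Proof.
apply: (betti_hdim char0 F I_fibre J_inj) => [mm md|j T].
  have mC : in_cone V (n - 3)%N%:Z (weight pi mm) by apply/cone_weight; exists mm.
  by apply/J_cover/(cone_box _ mC); clear; lia.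
rewrite /cone_cell /= finset.subsetT /=; have [Tq|Tq] := leqP #|T| (n - 3)%N.
  have -> : q - (#|T|)%:Z = ((n - 3)%N - #|T|)%N%:Z by move: Tq; clear; lia.
  rewrite cone_weight; split=> -[mm [md mw]]; exists mm; split=> //.
    by rewrite md subnK.
  by rewrite -md addnK.
rewrite (cone_neg cvx); last by rewrite subr_lt0 ltz_nat.
by split=> // -[mm [md _]]; move: Tq; rewrite -md ltnNge leq_addl.
Qed.

(** For five points the index [(n - 5, n - 3)] has homological degree 0, where the only generator
    has degree 0; this matches the convention for [c_3] outside its range. *)
Lemma betti_zero : n = 5%N -> betti F (n - 5) (n - 3)%N = 0%N.
Proof.
move=> n5; rewrite betti_cells (_ : (n - 5)%N = 0%N); last by rewrite n5.
apply: (@cone_hdim0 k n m pi V full v cvx J w q); first by rewrite n5.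
move=> h z h0 zC; have [a /pi_full[t <-] aC] := cone_sub_point cvx h0 zC.
by exists t; rewrite ?inE.
Qed.

Lemma betti_equation : (5 <= n)%N ->
  (betti F (n - 5) (n - 3) + n * npts (in_icone V 2) =
   'C(n, 2) * npts (in_icone V 1) + (betti F (n - 4) (n - 3) + npts (in_icone V 3)))%N.
Proof.
move=> n5; rewrite !betti_cells (first_equation k cvx pi_inj pi_cone vP n4 J_inj w_cover).
exact: (second_equation k cvx pi_cone vP n4 J_inj w_cover n5).
Qed.

Lemma betti_wide : (5 <= n)%N -> wide pi full -> ~ is_upsilon pi full -> betti F (n - 4) (n - 3) = 0%N.
Proof.
move=> n5 wd nu; rewrite betti_cells.
case: (exact_or_upsilon k pi_inj (full_convex pi_cone pi_full) wd) => [ex|/nu //].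
rewrite cardsT card_ord in ex; have -> : q = (n - 4).+1%N%:Z by move: n5; clear; lia.
by apply: (exact_hdim _ w ex) => z /pi_full[t <-]; exists t; rewrite ?inE.
Qed.

(** With a single interior point [i], the only possible partner of [a] over the weight [z] is
    [z - pi a - i]. *)
Lemma betti_matching : (5 <= n)%N -> (forall x y, in_icone V 1 x -> in_icone V 1 y -> x = y) ->
  betti F (n - 5) (n - 3) = 0%N.
Proof.
move=> n5 one; rewrite betti_cells; apply: (matching_hdim k cvx pi_cone vP n4 w n5).
by move=> z a b b' _ _ h h'; apply: pi_inj; have /addrI/oppr_inj := one _ _ h h'.
Qed.

Lemma betti_strip a b : in_icone V 1 a -> in_icone V 1 b -> a != b ->
  (forall c, in_icone V 1 c -> det2 (b - a) (c - a) = 0) -> betti F (n - 4) (n - 3) = (n - 4)%N.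
Proof.
move=> aI bI ab coll; rewrite betti_cells.
exact: (strip_case k cvx pi_inj pi_cone pi_full vP n4 J_inj w_cover aI bI ab coll).
Qed.

Lemma upsilon_data f : unimod f -> (forall z, occ (fun t => f (pi t)) full z <-> z \in upsilon_points) ->
  [/\ n = 7%N, forall z, in_cone V 1 z <-> f z \in upsilon_points &
      forall z, in_icone V 1 z <-> f z \in upsilon_interior].
Proof.
move=> fU H; split.
- transitivity (size [seq f (pi t) | t <- enum 'I_n]); first by rewrite size_map size_enum_ord.
  apply: (@perm_size _ _ upsilon_points); apply: uniq_perm => //.
    by rewrite map_inj_uniq ?enum_uniq // => x y /(unimod_inj fU)/pi_inj.
  move=> z; apply/mapP/idP => [[t _ ->]|/H[t _ <-]]; first by apply/H; exists t; rewrite ?inE.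
  by exists t; rewrite ?mem_enum.
- move=> z; split=> [/pi_full[t <-]|/H[t _ /(unimod_inj fU) <-]]; last exact: pi_cone.
  by apply/H; exists t; rewrite ?inE.
move=> z; rewrite -(full_int cvx pi_cone vP) -(int_map pi fU).
have low (p : int * int) (c : int) : all (fun a => c <= dot p a) upsilon_points -> below (fun t => f (pi t)) full p c.
  by move=> /allP A t _; apply: A; apply/H; exists t; rewrite ?inE.
split=> [zI|zT].
  have := zI (-1, -1) (-2) isT (low (-1, -1) (-2) isT); have := zI (-1, 3) (-2) isT (low (-1, 3) (-2) isT).
  have := zI (3, -1) (-2) isT (low (3, -1) (-2) isT).
  by case: (f z) => x y; rewrite /upsilon_interior !inE !xpair_eqE /dot /=; clear; lia.
move=> p c p0 cB; have lw y : y \in upsilon_points -> c <= dot p y.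
  by move=> /H[t _ <-]; apply: cB; rewrite inE.
have := lw (-1, -1) isT; have := lw (2, 0) isT; have := lw (0, 2) isT; have := @pair_neq0 p p0.
by move: zT; rewrite /upsilon_interior !inE => /or3P[] /eqP ->; rewrite /dot /=; clear; lia.
Qed.

Lemma upsilon_wide : is_upsilon pi full -> wide pi full.
Proof.
case=> f [fU H]; have [_ _ uI] := upsilon_data fU H; have [g [gU fg gf]] := unimod_inv fU.
have gI z : z \in upsilon_interior -> in_int pi full (g z).
  by move=> zT; apply/(full_int cvx pi_cone vP)/uI; rewrite gf.
exists (g (0, 0)), (g (1, 0)), (g (0, 1)); split; try exact: gI.
case: gU => a [b [c [d [s [t [e gE]]]]]]; rewrite !gE /orient /det2 /=; apply/eqP => o.
have : a * d - b * c = 0 by rewrite -[RHS]o; ring.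
by move=> D0; move: e; rewrite D0 mul0r.
Qed.

Lemma betti_upsilon : is_upsilon pi full -> betti F (n - 4) (n - 3) = 3%N /\ n = 7%N.
Proof.
move=> U; have [a [_ [_ [aI _ _ _]]]] := upsilon_wide U; move/(full_int cvx pi_cone vP): aI => aI.
case: U => f [fU H]; have [n7 uC uI] := upsilon_data fU H; split=> //.
rewrite betti_cells.
exact: (@upsilon_hdim k n m pi V v cvx pi_inj pi_cone pi_full vP n4 J w J_inj w_cover f fU a aI uC uI).
Qed.
End Betti.

Lemma count_points : n = npts (in_cone V 1).
Proof.
have us : uniq [seq pi t | t <- enum 'I_n] by rewrite map_inj_uniq ?enum_uniq.
have cov z : in_cone V 1 z -> z \in [seq pi t | t <- enum 'I_n].
  by move=> /pi_full[t <-]; rewrite map_f ?mem_enum.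
rewrite [RHS](npts_count us cov) count_map; transitivity (count predT (enum 'I_n)).
  by rewrite count_predT size_enum_ord.
by apply: eq_count => t /=; rewrite pi_cone.
Qed.

(** The value at 1 is the number of points, which determines the linear coefficient; the values at
    -1, -2 and -3 are the interior counts. *)
Lemma ehrhart_values (R : realType) (A := area (@polygon_set R m V)) :
  [/\ (npts (in_icone V 1))%:R = 2 * A - n%:R + 2 :> R, (npts (in_icone V 2))%:R = 6 * A - 2 * n%:R + 3 :> R
    & (npts (in_icone V 3))%:R = 12 * A - 3 * n%:R + 4 :> R].
Proof.
have [b eh] := @ehrhart_quadratic R m V cvx; rewrite -/A in eh.
have e1 : ehrhart V 1 = n%:Z by rewrite /ehrhart -count_points (npts0 (icone_le0 cvx _)) // addr0.
have pos : (n%:R : R) = A + b + 1.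
  have -> : (n%:R : R) = (ehrhart V 1)%:~R by rewrite e1.
  by rewrite eh (_ : 1%:~R = 1 :> R) // expr1n !mulr1.
have neg (h : nat) : (0 < h)%N -> ((npts (in_icone V h%:Z))%:R : R) = A * h%:R ^+ 2 - b * h%:R + 1.
  move=> h0; have e : ehrhart V (- h%:Z) = (npts (in_icone V h%:Z))%:Z.
    by rewrite /ehrhart opprK (npts0 (cone_neg cvx _)) ?add0r // oppr_lt0.
  have -> : ((npts (in_icone V h%:Z))%:R : R) = (ehrhart V (- h%:Z))%:~R by rewrite e.
  by rewrite eh mulrNz sqrrN mulrN.
have N1 := neg 1%N isT; have N2 := neg 2%N isT; have N3 := neg 3%N isT.
by split; [apply: (etrans N1)|apply: (etrans N2)|apply: (etrans N3)]; rewrite pos; ring.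
Qed.

End Numerics.

(** * Lattice points of the given polygon *)

Section LatticeSequence.
Variables (R : realType) (m : nat) (V : 'I_m -> int * int).
Hypothesis cvx : convex_cycle V.
Variable D : set (R * R).
Hypothesis DV : D = @polygon_set R m V.

Lemma polygon_pts p : lattice_points D p <-> in_cone V 1 p.
Proof. by rewrite /lattice_points /= DV; apply: (cone_pt R V 1 p). Qed.

Lemma mem_lattice_seq p : (p \in lattice_seq D) = in_cone V 1 p.
Proof.
have fin : finite_set (lattice_points D).
  apply: (@sub_finite_set _ _ [set` box (Vbound V)]%classic) => //.
  by move=> z /polygon_pts zC; have := cone_in_box cvx zC; rewrite normr1 mulr1; apply: mem_box.
have -> : (p \in lattice_seq D) = (p \in fset_set (lattice_points D)) by [].
rewrite in_fset_set //; apply/idP/idP => [/set_mem/polygon_pts //|pC].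
exact/mem_set/polygon_pts.
Qed.

Lemma lattice_pt_inj : injective (@lattice_pt R D).
Proof.
move=> i j; rewrite /lattice_pt !(tnth_nth (0, 0)) /= => /eqP.
by rewrite nth_uniq ?fset_uniq // => /eqP/val_inj.
Qed.

Lemma lattice_pt_cone t : in_cone V 1 (@lattice_pt R D t).
Proof. by rewrite -mem_lattice_seq /lattice_pt; apply: (mem_tnth t (in_tuple (lattice_seq D))). Qed.

Lemma lattice_pt_full z : in_cone V 1 z -> exists t, @lattice_pt R D t = z.
Proof.
rewrite -mem_lattice_seq => zs; have /tnthP[t te] : z \in in_tuple (lattice_seq D) by [].
by exists t; rewrite te.
Qed.

Definition interior_seq := [seq @lattice_pt R D t | t <- enum 'I_(nb_points D) & in_icone V 1 (@lattice_pt R D t)].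

Lemma mem_interior_seq z : (z \in interior_seq) = in_icone V 1 z.
Proof.
apply/mapP/idP => [[t + ->]|zI]; first by rewrite mem_filter => /andP[].
have [t te] := lattice_pt_full (icone_cone zI); exists t => //.
by rewrite mem_filter te zI mem_enum.
Qed.

Lemma interior_hullE : interior_hull D = @lattice_hull R interior_seq.
Proof.
rewrite /interior_hull /lattice_hull; congr (convex_hull (_ @` _)%classic).
apply/funext => p; apply/propext; rewrite /= mem_interior_seq.
by rewrite -(interior_pt R cvx) -DV.
Qed.
End LatticeSequence.

(** * Solving the strand equation *)

Section Formulas.
Variable R : realType.

Lemma strand_formula (x A B C b c w1 w2 w3 : R) : C * 2 = x * (x - 1) ->
  w1 = 2 * A - x + 2 -> w2 = 6 * A - 2 * x + 3 -> w3 = 12 * A - 3 * x + 4 ->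
  c + x * w2 = C * w1 + (b + w3) -> b = (x - 4) * B ->
  c = (x - 4) * ((x - 3) * A - (x - 1) * (x - 2) / 2 + B).
Proof.
move=> hC e1 e2 e3 e hb; have C2 : C = x * (x - 1) / 2 by rewrite -hC mulfK // pnatr_eq0.
have -> : c = C * w1 + (b + w3) - x * w2 by rewrite -e addrK.
by rewrite C2 e1 e2 e3 hb; field.
Qed.

(** With vanishing [c] the strand equation determines [b]; the area is eliminated through Pick's
    formula for the number [w1] of interior points. *)
Lemma matching_formula (x A C b w1 w2 w3 : R) : C * 2 = x * (x - 1) ->
  w1 = 2 * A - x + 2 -> w2 = 6 * A - 2 * x + 3 -> w3 = 12 * A - 3 * x + 4 ->
  x * w2 = C * w1 + (b + w3) ->
  (w1 = 0 -> b = (x - 4) * (x - 2)) /\ (w1 = 1 -> b = (x - 4) * ((x - 1) / 2)).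
Proof.
move=> hC e1 e2 e3 e; have C2 : C = x * (x - 1) / 2 by rewrite -hC mulfK // pnatr_eq0.
have -> : b = x * w2 - C * w1 - w3 by rewrite e; ring.
have A2 : A = (w1 + x - 2) / 2 by rewrite e1; field.
by split=> w; rewrite e2 e3 C2 A2 w; field.
Qed.

Lemma bin2_real (n : nat) : (0 < n)%N -> ('C(n, 2))%:R * 2 = n%:R * (n%:R - 1) :> R.
Proof.
move=> n0; rewrite -(natrB _ n0) -!natrM; congr (_%:R).
by have := bin_ffact n 2; rewrite ffactnS ffactn1 subn1 => <-.
Qed.
End Formulas.

Theorem theorem3p5 (k : fieldType) (k_char0 : [pchar k]%R =i pred0)
    (R : realType) (D : set (R * R)) (D_polygon : lattice_polygon D)
    (D_dim2 : affine_dim D 2) :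
  let N := nb_points D in
  ((4 <= N)%N <-> ~ polygon_equiv D (Sigma R)) /\
  ((4 <= N)%N ->
   forall F : min_graded_free_resolution (toric_ideal k D),
     (betti_b F (N - 4))%:R = (N%:R - 4) * Bconst D /\
     (betti_c F 3)%:R =
       (N%:R - 4) * ((N%:R - 3) * area D
                     - (N%:R - 1) * (N%:R - 2) / 2 + Bconst D)).
Proof.
move=> N; have [W DW] := D_polygon; have [m [V [cvx DV]]] := polygon_data D_polygon D_dim2.
pose pi := @lattice_pt R D; have pi_inj : injective pi := @lattice_pt_inj R D.
have pi_cone : forall t, in_cone V 1 (pi t) := (lattice_pt_cone cvx DV).
have pi_full : forall z, in_cone V 1 z -> exists t, pi t = z := (lattice_pt_full cvx DV).
have Vc j : in_cone V 1 (V j) by apply/forallP => i; apply: edge_vertex.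
have /choice[v vP] : forall i, exists t, pi t = V i by move=> i; apply: pi_full.
have equivP W' : polygon_equiv D (@lattice_hull R W') <->
    exists f, unimod f /\ forall p, lattice_points (@lattice_hull R W') (f p) <-> in_cone V 1 p.
  have E := @equiv_points R W W'; rewrite -DW in E; rewrite E.
  by split=> -[f [fU fP]]; exists f; split=> // p; rewrite fP (polygon_pts DV).
split.
  split=> [N4 /equivP[f [fU fP]]|nS].
    have sub : {subset [seq f (pi t) | t <- enum 'I_N] <= upsilon_interior}.
      by move=> _ /mapP[t _ ->]; apply/(sigma_lattice R)/fP.
    have us : uniq [seq f (pi t) | t <- enum 'I_N].
      by rewrite map_inj_uniq ?enum_uniq // => x y /(unimod_inj fU)/pi_inj.
    by have := uniq_leq_size us sub; rewrite size_map size_enum_ord leqNgt N4.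
  rewrite ltnNge; apply/negP => N3; apply: nS; apply/equivP.
  have [f [fU fP]] := (small_polygon cvx pi_cone pi_full vP N3).
  by exists f; split=> // p; rewrite -fP; apply: (sigma_lattice R).
move=> N4 F; have N0 : (0 < N)%N by apply: leq_trans N4.
(* For four points the factor [N - 4] vanishes and both indices fall outside their range, so all
   sides are zero. *)
have [N5|N5] := leqP 5 N; last first.
  have N44 : N = 4%N by apply/eqP; rewrite eqn_leq N4 -ltnS N5.
  have N40 : (N%:R - 4 : R) = 0 by rewrite N44 subrr.
  have [e1 e2] : (1 <= N - 4 <= N - 3)%N = false /\ (1 <= 3 <= N - 3)%N = false by rewrite N44.
  by rewrite N40 !mul0r /betti_b /betti_c e1 e2.
have fib := toric_ideal_fibre k_char0 N0.
pose b := betti F (N - 4) (N - 3); pose c := betti F (N - 5) (N - 3).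
have bE : betti_b F (N - 4) = b.
  rewrite /betti_b -/N ifT; last by move: (N) N5; clear; lia.
  by rewrite /b; congr betti; move: (N) N5; clear; lia.
have cE : betti_c F 3 = c.
  rewrite /betti_c -/N; case: ifP => [_|N6]; first by rewrite /c; congr betti; move: (N) N5; clear; lia.
  have n5 : N = 5%N by move: (N) N5 N6; clear; lia.
  exact: (esym ((betti_zero v k_char0 cvx pi_cone pi_full F fib n5))).
have [w1E w2E w3E] := (ehrhart_values cvx pi_inj pi_cone pi_full R).
rewrite -DV in w1E w2E w3E.
have eq := (betti_equation k_char0 cvx pi_inj pi_cone pi_full vP N4 F fib N5).
rewrite -/b -/c in eq.
have eqR := congr1 (fun i : nat => i%:R : R) eq; rewrite /= !natrD !natrM in eqR.
have binR := bin2_real R N0.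
suff bB : b%:R = (N%:R - 4) * Bconst D.
  by rewrite bE cE; split=> //; apply: (strand_formula binR w1E w2E w3E eqR bB).
have upsE : polygon_equiv D (Upsilon2 R) <-> is_upsilon pi [set: 'I_N].
  rewrite [X in X <-> _](equivP [:: (-1, -1); (2, 0); (0, 2)]); split=> -[f [fU fP]]; exists f; split=> // p.
    split=> [[t _ <-]|pU]; first by apply/(upsilon_lattice R)/fP.
    have [g [_ fg gf]] := unimod_inv fU; have /fP/pi_full[t te] : lattice_points (Upsilon2 R) (f (g p)).
      by rewrite gf; apply/(upsilon_lattice R).
    by exists t; rewrite ?inE // te gf.
  rewrite (upsilon_lattice R) -fP; split=> [[t _ /(unimod_inj fU) <-] //|/pi_full[t <-]].
  by exists t; rewrite ?inE.
have upsW := (upsilon_wide cvx pi_inj pi_cone pi_full vP).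
pose s := @interior_seq R m V D; have sP z : (z \in s) = in_icone V 1 z := (mem_interior_seq cvx DV z).
have hullE : interior_hull D = @lattice_hull R s := (interior_hullE cvx DV).
have wideE : wide pi [set: 'I_N] <-> noncollinear s.
  split=> -[x [y [z [h1 h2 h3 h4]]]]; exists x, y, z; split=> //;
    by rewrite ?sP; apply/(full_int cvx pi_cone vP); rewrite -?sP.
rewrite /Bconst hullE -/N.
(* The exceptional triangle comes first: its interior is two-dimensional, yet its constant is 1. *)
have [U|nU] := EM (polygon_equiv D (Upsilon2 R)).
  rewrite asboolF; last by case.
  rewrite asboolT; last by right.
  have [b3 N7] := (betti_upsilon k_char0 cvx pi_inj pi_cone pi_full vP N4 F fib (upsE.1 U)).
  rewrite /b b3 mulr1 -/N; have -> : (N%:R : R) = 7 by rewrite [N]N7.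
  by ring.
have [nc|col] := EM (noncollinear s).
  rewrite asboolT; last by split=> //; apply: affine_dim_plane.
  rewrite mulr0 /b (betti_wide k_char0 cvx pi_inj pi_cone pi_full F fib N5) //.
    exact/wideE.
  by move=> /upsE.
have only d (dP : affine_dim (@lattice_hull R s) d) d' : d != d' -> ~ affine_dim (@lattice_hull R s) d'.
  by move=> dd /(affine_dim_unique dP) e; rewrite e eqxx in dd.
have mat : (forall x y, in_icone V 1 x -> in_icone V 1 y -> x = y) ->
    N%:R * (npts (in_icone V 2))%:R = 'C(N, 2)%:R * (npts (in_icone V 1))%:R + (b%:R + (npts (in_icone V 3))%:R) :> R.
  move=> one; have c0 : c = 0%N := (betti_matching k_char0 cvx pi_inj pi_cone pi_full vP N4 F fib N5 one).
  by rewrite -eqR c0 add0r.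
have [s0|sne] := eqVneq s [::].
  rewrite s0 !asboolF; try by [case=> [/affine_dim_empty|] | move=> /affine_dim_empty | case=> /affine_dim_empty].
  have none z : in_icone V 1 z = false by rewrite -sP s0.
  have one' x y : in_icone V 1 x -> in_icone V 1 y -> x = y by rewrite none.
  have [H _] := matching_formula binR w1E w2E w3E (mat one').
  by apply: H; rewrite (npts0 (P := in_icone V 1)).
have [a [d [aS d0 all [one|[y yS ya]]]]] := collinear_line col sne.
  have dim0 := affine_dim_point R aS one.
  rewrite asboolF; last by case=> h _; apply: (only _ dim0 2%N isT).
  rewrite asboolF; last by case=> [|//]; apply: (only _ dim0 1%N isT).
  rewrite asboolT //.
  have one' x y : in_icone V 1 x -> in_icone V 1 y -> x = y.
    by rewrite -!sP => /one -> /one ->.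
  have [_ H] := matching_formula binR w1E w2E w3E (mat one').
  apply: H; rewrite (@npts_count _ [:: a]) //=; last by move=> z; rewrite -sP => /one ->; rewrite inE.
  by move: aS; rewrite sP => ->.
have dim1 := affine_dim_line R aS yS ya d0 all.
rewrite asboolF; last by case=> h _; apply: (only _ dim1 2%N isT).
rewrite asboolT; last by left.
have aI : in_icone V 1 a by rewrite -sP.
have yI : in_icone V 1 y by rewrite -sP.
rewrite /b (betti_strip k_char0 cvx pi_inj pi_cone pi_full vP N4 F fib aI yI).
- by rewrite mulr1 natrB.
- by rewrite eq_sym.
move=> z; rewrite -sP => zS; have e1 := all _ zS; have e2 := all _ yS.
(* Both difference vectors are orthogonal to [d], so each coordinate of [d] annihilates their
   determinant. *)
have h1 : d.1 * det2 (y - a) (z - a) = 0.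
  transitivity ((dot d y - dot d a) * (z.2 - a.2) - (dot d z - dot d a) * (y.2 - a.2)); first by rewrite /det2 /dot /=; ring.
  by rewrite e1 e2 !subrr !mul0r subrr.
have h2 : d.2 * det2 (y - a) (z - a) = 0.
  transitivity ((dot d z - dot d a) * (y.1 - a.1) - (dot d y - dot d a) * (z.1 - a.1)); first by rewrite /det2 /dot /=; ring.
  by rewrite e1 e2 !subrr !mul0r subrr.
move/eqP: h1; move/eqP: h2; rewrite !mulf_eq0; case/orP=> [/eqP d2|/eqP //]; case/orP=> [/eqP d1|/eqP //].
by move: d0; rewrite [d]surjective_pairing d1 d2 eqxx.
Qed.
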